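(* Let $n \geq 2$ and let $\Omega \subset \mathbf{R}^n$ be a connected bounded open set with smooth boundary. Let $\Gamma \subsetneq \partial\Omega$ be a closed proper subset of the boundary. Let $\mathcal{H}_\Gamma$ denote the set of functions $u \in C^{\infty}(\overline{\Omega})$ which are harmonic in $\Omega$ and satisfy $u|_{\Gamma} = 0$. Then the set of products $\{uv : u, v \in \mathcal{H}_\Gamma\}$ is dense in $L^1(\Omega)$, in the sense that its linear span is dense in $L^1(\Omega)$; equivalently, if $f \in L^\infty(\Omega)$ satisfies $\int_\Omega f\,u\,v\,dx = 0$ for all $u,v \in \mathcal{H}_\Gamma$, then $f = 0$ almost everywhere in $\Omega$.
   Context: Harmonic functions are allowed to be complex-valued. *)

(* Defs.v *)
From HB Require Import structures.
From mathcomp Require Import all_boot all_order all_algebra.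
From mathcomp Require Import all_classical all_reals all_analysis.
From mathcomp Require Import complex.

Set Implicit Arguments.
Unset Strict Implicit.
Unset Printing Implicit Defensive.

Import Order.TTheory GRing.Theory Num.Theory.
Import numFieldNormedType.Exports.
Local Open Scope classical_set_scope.
Local Open Scope ring_scope.

(* Points of R^n are row vectors 'rV[R]_n (max-norm topology = usual topology). *)
Section Defs.
Variable R : realType.

Definition basis_vec (n : nat) (j : 'I_n) : 'rV[R]_n := delta_mx 0 j.

Definition pd (n : nat) (j : 'I_n) (f : 'rV[R]_n -> R) : 'rV[R]_n -> R :=
  fun x => derive f x (basis_vec j).

Definition iter_pd (n : nat) (js : seq 'I_n) (f : 'rV[R]_n -> R) :
  'rV[R]_n -> R := foldr (@pd n) f js.

Definition smooth_on (n : nat) (U : set 'rV[R]_n) (f : 'rV[R]_n -> R) : Prop :=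
  forall js : seq 'I_n, forall x, U x ->
    (forall j, derivable (iter_pd js f) x (basis_vec j)) /\
    {for x, continuous (iter_pd js f)}.

Definition bdry (n : nat) (O : set 'rV[R]_n) : set 'rV[R]_n :=
  closure O `\` O.

Definition smooth_up_to_bdry (n : nat) (O : set 'rV[R]_n)
    (u : 'rV[R]_n -> R) : Prop :=
  smooth_on O u /\ {within closure O, continuous u} /\
  forall js : seq 'I_n, exists g : 'rV[R]_n -> R,
    {within closure O, continuous g} /\ (forall x, O x -> g x = iter_pd js u x).

Definition harmonic_on (n : nat) (O : set 'rV[R]_n) (u : 'rV[R]_n -> R) : Prop :=
  smooth_on O u /\ forall x, O x -> \sum_(j < n) iter_pd [:: j; j] u x = 0.

Definition smooth_boundary (n : nat) (O : set 'rV[R]_n) : Prop :=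
  forall p, bdry O p ->
    exists (U : set 'rV[R]_n) (rho : 'rV[R]_n -> R),
      [/\ open U, U p, smooth_on U rho,
          U `&` O = [set x | U x /\ rho x < 0] &
          forall x, U x -> exists j : 'I_n, pd j rho x != 0].

Definition ReF (n : nat) (u : 'rV[R]_n -> R[i]) : 'rV[R]_n -> R :=
  fun x => complex.Re (u x).
Definition ImF (n : nat) (u : 'rV[R]_n -> R[i]) : 'rV[R]_n -> R :=
  fun x => complex.Im (u x).

Definition H_Gamma (n : nat) (O Gamma : set 'rV[R]_n)
    (u : 'rV[R]_n -> R[i]) : Prop :=
  smooth_up_to_bdry O (ReF u) /\ smooth_up_to_bdry O (ImF u) /\
  harmonic_on O (ReF u) /\ harmonic_on O (ImF u) /\
  (forall x, Gamma x -> u x = 0).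

Definition vcons (k : nat) (a : R) (y : 'rV[R]_k) : 'rV[R]_k.+1 :=
  \row_(i < k.+1) match unlift ord0 i with Some j => y 0 j | None => a end.

(* Lebesgue integral on R^n, computed as an iterated integral of
   one-dimensional Lebesgue integrals (Fubini/Tonelli) -- real-valued
   version for integrable functions *)
Fixpoint iint (n : nat) : ('rV[R]_n -> R) -> R :=
  match n return ('rV[R]_n -> R) -> R with
  | 0 => fun g => g 0
  | k.+1 => fun g =>
      Rintegral (@lebesgue_measure R) setT (fun a => iint (fun y => g (vcons a y)))
  end.

(* extended-real version, used for nonnegative functions (Tonelli) *)
Fixpoint eint (n : nat) : ('rV[R]_n -> \bar R) -> \bar R :=
  match n return ('rV[R]_n -> \bar R) -> \bar R with
  | 0 => fun g => g 0
  | k.+1 => fun g =>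
      (\int[@lebesgue_measure R]_(a in setT) eint (fun y => g (vcons a y)))%E
  end.

Definition leb_n (n : nat) (A : set 'rV[R]_n) : \bar R :=
  eint (fun x => (\1_A x)%:E).

Definition cint (n : nat) (O : set 'rV[R]_n) (h : 'rV[R]_n -> R[i]) : R[i] :=
  (iint (fun x => if `[< O x >] then complex.Re (h x) else 0) +i*
   iint (fun x => if `[< O x >] then complex.Im (h x) else 0))%C.

Definition borel_n (n : nat) : set (set 'rV[R]_n) :=
  <<s [set U : set 'rV[R]_n | open U] >>.

Definition borel_fun (n : nat) (f : 'rV[R]_n -> R) : Prop :=
  forall B : set R, open B -> borel_n (f @^-1` B).

(* f is (a Borel representative of) an element of L^infty(O), complex-valued *)
Definition Linfty (n : nat) (O : set 'rV[R]_n) (f : 'rV[R]_n -> R[i]) : Prop :=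
  borel_fun (ReF f) /\ borel_fun (ImF f) /\
  exists M : R, forall x, O x -> `|complex.Re (f x)| <= M /\ `|complex.Im (f x)| <= M.

End Defs.

(* Main.v *)
(** The domain [Omega] is enlarged across a boundary point outside [Gamma] to a domain [O].
For a pole [y] in [O] and a function [P] harmonic off [y], let [u = P - w], where [w] is harmonic in [O]
with the boundary values of [P]; if [y] lies outside the closure of [Omega], then [u] restricts to an
element of [H_Gamma]. Suppose that [f], extended by zero, is orthogonal to all products of two such
functions with pole [y] and vanishes near [y]. Take for [P] the Kelvin transforms about [y] of
exp(a.x) cos(b.x) and exp(a.x) sin(b.x), where [a] and [b] are orthogonal vectors of the same length: the
squares of these two add up to a power of |x - y| times a real exponential, while the products
with [w] are of lower exponential order. This bounds a Laplace transform of the inverted [f], and the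
bound forces [f] to vanish on the whole ball about [y] contained in [O]. Expanding the singular part in
the position of the pole then gives the orthogonality for all poles near [y]. So the pole moves from
outside [Omega] through the boundary point into [Omega], and everywhere by connectedness.

The Dirichlet problem in [O] is solved as a limit of discrete Perron solutions on grids of step
1/(j+1). Smoothness up to the boundary follows from the maximum principle with explicit barriers, by
induction on the order of the derivatives, estimating tangential derivatives first and recovering
the normal one from the equation. *)

Require Import Defs.
From HB Require Import structures.
From mathcomp Require Import all_boot all_order all_algebra.
From mathcomp Require Import all_classical all_reals all_analysis.
From mathcomp Require Import measurable_realfun.
From mathcomp Require Import complex.
From mathcomp Require Import ring lra zify.
Import Order.TTheory GRing.Theory Num.Theory.
Import numFieldNormedType.Exports.
Set Implicit Arguments.
Unset Strict Implicit.
Unset Printing Implicit Defensive.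
Local Open Scope classical_set_scope.
Local Open Scope ring_scope.

(** * Partial derivatives and smooth functions *)

Section Calculus.
Variables (R : realType) (n : nat).
Local Notation V := 'rV[R]_n.
Implicit Types (f g : V -> R) (x v : V) (U : set V).

(** Two exponents drive the argument. If [f] vanishes within distance [d] of the pole and the
    boundary of [O] is at distance at least [delta > d], then, up to powers of the distance, the
    Kelvin transform is at most exp(|a|/d) on the support of [f], while [w], bounded by its boundary
    values, is at most exp(|a|/delta). The squares carry the real exponential of xi = 2a, so the
    Laplace transform at xi of the inverted [f] is at most a constant times exp(r1 |xi|) with r1 =
    (1/d + 1/delta)/2 < 1/d. Hence [d] can be replaced by the larger harmonic mean of [d] and
    [delta], and the supremum of the radii is [delta]. For a pole inside Omega the products are
    singular, and their integrals make sense only because [f] already vanishes near the pole; so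
    vanishing and orthogonality have to be propagated together. Orthogonality is asked for every
    function harmonic off the pole, not only for Kelvin transforms, because the expansion in the
    position of the pole produces derivatives of the singular part. *)

Lemma is_derive_comp1 f (phi : R -> R) x v df dphi :
  is_derive x v f df -> is_derive (f x) 1 phi dphi ->
  is_derive x v (phi \o f) (dphi * df).
Proof.
move=> [dfx <-] [dp <-].
have /derivable1P/derivable1_diffP h1 := dfx.
have h1' := h1; rewrite /= in h1'.
have e0 : (fun h : R => f (h *: v + x)) 0 = f x by rewrite scale0r add0r.
have dp' : differentiable phi ((fun h : R => f (h *: v + x)) 0).
  by rewrite e0; exact/derivable1_diffP.
have dc : differentiable (phi \o (fun h : R => f (h *: v + x))) 0.
  exact: differentiable_comp.
have E (h : V -> R) : 'D_v h x = 'D_1 (fun t : R => h (t *: v + x)) 0.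
  rewrite /derive; set a := (fun t => t^-1 *: _); set b := (fun t => t^-1 *: _).
  suff -> : a = b by [].
  by apply/funext => t; rewrite /a /b /= scale0r add0r addr0 [_%:A]mulr1.
apply: DeriveDef; first by apply/derivable1P/derivable1_diffP.
rewrite E [in RHS]E -!derive1E -e0.
rewrite (_ : (fun t => _) = phi \o (fun h : R => f (h *: v + x))) //.
exact: (@derive1_comp R (fun h : R => f (h *: v + x)) phi 0
  (iffRL (derivable1_diffP _ _) h1) (iffRL (derivable1_diffP _ _) dp')).
Qed.

Lemma is_derive_line f x v (t : R) df :
  is_derive (x + t *: v) v f df -> is_derive t 1 (fun s => f (x + s *: v)) df.
Proof.
move=> [dfx <-]; rewrite /derivable /derive in dfx *.
have E : (fun h : R => h^-1 *: ((fun s => f (x + s *: v)) (h *: 1 + t) - f (x + t *: v))) =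
  (fun h : R => h^-1 *: (f (h *: v + (x + t *: v)) - f (x + t *: v))).
  apply/funext => h /=; congr (_ *: (f _ - _)).
  by rewrite [_%:A]mulr1 scalerDl addrCA.
by apply: DeriveDef; rewrite /derivable /derive E.
Qed.

Lemma line_is_derive f x v df :
  is_derive (0 : R) 1 (fun s => f (x + s *: v)) df -> is_derive x v f df.
Proof.
move=> [dfx <-]; rewrite /derivable /derive in dfx *.
have E : (fun h : R => h^-1 *: ((fun s => f (x + s *: v)) (h *: 1 + 0) - f (x + 0 *: v))) =
  (fun h : R => h^-1 *: (f (h *: v + x) - f x)).
  apply/funext => h /=; rewrite scale0r !addr0.
  by rewrite [_%:A]mulr1 [x + _]addrC.
by apply: DeriveDef; rewrite /derivable /derive -E.
Qed.

Lemma open_near U x : open U -> U x -> \forall y \near x, U y.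
Proof. by move=> oU Ux; apply: open_nbhs_nbhs. Qed.

Lemma derivable_congr U f g x v : open U -> (forall y, U y -> f y = g y) -> U x ->
  derivable f x v -> derivable g x v.
Proof.
move=> oU fg Ux; apply: near_eq_derivable.
by apply: filterS (open_near oU Ux) => y /fg.
Qed.

Lemma derive_congr U f g x v : open U -> (forall y, U y -> f y = g y) -> U x ->
  'D_v f x = 'D_v g x.
Proof.
move=> oU fg Ux; apply: near_eq_derive.
by apply: filterS (open_near oU Ux) => y /fg.
Qed.

Lemma continuous_congr U f g x : open U -> (forall y, U y -> f y = g y) -> U x ->
  {for x, continuous f} -> {for x, continuous g}.
Proof.
move=> oU fg Ux cf; rewrite /prop_for /continuous_at -(fg _ Ux).
have H : \forall y \near x, f y = g y.
  by apply: filterS (open_near oU Ux) => y /fg.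
exact: cvg_trans (near_eq_cvg H) cf.
Qed.

Lemma iter_pd_rcons js j f : iter_pd (rcons js j) f = iter_pd js (pd j f).
Proof. by rewrite /iter_pd foldr_rcons. Qed.

Lemma iter_pd_congr U f g : open U -> (forall y, U y -> f y = g y) ->
  forall js x, U x -> iter_pd js f x = iter_pd js g x.
Proof.
move=> oU fg; elim => [|j js IH] x Ux /=; first exact: fg.
by apply: derive_congr oU _ Ux => y; exact: IH.
Qed.

Lemma smooth_congr U f g : open U -> (forall y, U y -> f y = g y) ->
  smooth_on U f -> smooth_on U g.
Proof.
move=> oU fg sf js x Ux; have [d c] := sf js x Ux; have E := iter_pd_congr oU fg js.
by split=> [j|]; [apply: derivable_congr oU E Ux (d j)|apply: continuous_congr oU E Ux c].
Qed.

Lemma smooth_sub U W f : W `<=` U -> smooth_on U f -> smooth_on W f.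
Proof. by move=> WU sf js x /WU; exact: sf. Qed.

Lemma smooth_pd U f j : smooth_on U f -> smooth_on U (pd j f).
Proof. by move=> sf js x Ux; rewrite -iter_pd_rcons; exact: sf. Qed.

Lemma smooth_iter U f js : smooth_on U f -> smooth_on U (iter_pd js f).
Proof. by elim: js => //= j js IH sf; apply: smooth_pd; exact: IH. Qed.

Lemma smooth_cont U f x : smooth_on U f -> U x -> {for x, continuous f}.
Proof. by move=> sf Ux; have [] := sf [::] x Ux. Qed.

Lemma smooth_derive U f x j : smooth_on U f -> U x ->
  is_derive x (basis_vec R j) f (pd j f x).
Proof. by move=> sf Ux; have [d _] := sf [::] x Ux; apply: DeriveDef => //; exact: d. Qed.

(** The induction peels the list of derivatives from its last entry, which is the one applied first
    to [f], so the class [P] only has to contain the first derivatives of its members. Composite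
    functions and, later, the limits of discrete solutions get their smoothness in this way. *)
Lemma smooth_coind U (P : (V -> R) -> Prop) : open U ->
  (forall f, P f -> forall x, U x -> {for x, continuous f}) ->
  (forall f, P f -> forall j, exists2 g, P g &
     forall x, U x -> is_derive x (basis_vec R j) f (g x)) ->
  forall f, P f -> smooth_on U f.
Proof.
move=> oU Pc Pd f Pf js; elim/last_ind: js f Pf => [|js j IH] f Pf x Ux.
  split; last exact: Pc.
  by move=> j; have [g _ /(_ x Ux) []] := Pd f Pf j.
have [g Pg dg] := Pd f Pf j; rewrite iter_pd_rcons.
have E y : U y -> g y = pd j f y by move=> /dg [_ <-].
have E' := iter_pd_congr oU E js.
have [d c] := IH g Pg x Ux; split=> [i|].
  exact: derivable_congr oU E' Ux (d i).
exact: continuous_congr oU E' Ux c.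
Qed.

(** Expressions closed under partial derivatives, to be fed to [smooth_coind]. In a composition the
    one-variable functions of the class [C] need only be differentiable at the values of the inner
    function over [U], which covers inverses, square roots and logarithms away from their
    singularities. *)
Inductive smgen U : (V -> R) -> Prop :=
| smgen_base f : smooth_on U f -> smgen U f
| smgen_cst (c : R) : smgen U (fun=> c)
| smgen_coord i : smgen U (fun x => x 0 i)
| smgen_add f g : smgen U f -> smgen U g -> smgen U (f \+ g)
| smgen_mul f g : smgen U f -> smgen U g -> smgen U (f \* g)
| smgen_comp (C : (R -> R) -> Prop) phi f : smgen U f -> C phi ->
   (forall psi, C psi -> exists2 psi', C psi' &
      forall x, U x -> is_derive (f x) 1 psi (psi' (f x))) -> smgen U (phi \o f).

Lemma coord_is_derive i j x : is_derive x (basis_vec R j) (fun y : V => y 0 i) (i == j)%:R.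
Proof.
apply: line_is_derive.
rewrite (_ : (fun s => _) = (fun s : R => x 0 i + s * (i == j)%:R)); last first.
  by apply/funext => s; rewrite !mxE eqxx.
apply: (@is_derive_eq _ _ _ (fun s : R => x 0 i + s * (i == j)%:R) 0 1 _ (0 + (1 * (i == j)%:R))).
  apply: is_deriveD.
  rewrite (_ : (fun s => _) = (fun s : R => (i == j)%:R *: s)); last first.
    by apply/funext => s; rewrite mulrC.
  by apply: is_derive_eq; rewrite /GRing.scale /= mulrC.
by rewrite add0r mul1r.
Qed.

Lemma coord_cont i x : {for x, continuous (fun y : V => y 0 i)}.
Proof. exact: coord_continuous. Qed.

Lemma is_derive1_cont (phi : R -> R) (t l : R) : is_derive t 1 phi l -> {for t, continuous phi}.
Proof. by move=> [d _]; apply: differentiable_continuous; exact/derivable1_diffP. Qed.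

Lemma smgen_smooth U f : open U -> smgen U f -> smooth_on U f.
Proof.
move=> oU; apply: (smooth_coind oU) => {}f.
  elim => {f} [f sf|c|i|f g _ cf _ cg|f g _ cf _ cg|C phi f _ cf Cphi Cd] x Ux.
  - exact: smooth_cont sf Ux.
  - exact: cst_continuous.
  - exact: coord_cont.
  - by apply: continuousD; [exact: cf|exact: cg].
  - by apply: continuousM; [exact: cf|exact: cg].
  - apply: continuous_comp; first exact: cf.
    by have [psi' _ /(_ x Ux)] := Cd phi Cphi; exact: is_derive1_cont.
elim => {f} [f sf|c|i|f g sf cf sg cg|f g sf cf sg cg|C phi f sf cf Cphi Cd] j.
- exists (pd j f); first by apply: smgen_base; exact: smooth_pd.
  by move=> x Ux; exact: smooth_derive sf Ux.
- exists (fun=> 0); first exact: smgen_cst.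
  by move=> x _; exact: is_derive_cst.
- exists (fun=> (i == j)%:R); first exact: smgen_cst.
  by move=> x _; exact: coord_is_derive.
- have [f' sf' df] := cf j; have [g' sg' dg] := cg j.
  exists (f' \+ g'); first exact: smgen_add.
  by move=> x Ux; apply: is_deriveD; [exact: df|exact: dg].
- have [f' sf' df] := cf j; have [g' sg' dg] := cg j.
  exists ((f \* g') \+ (g \* f')).
    by apply: smgen_add; apply: smgen_mul.
  by move=> x Ux; have := is_deriveM (df x Ux) (dg x Ux).
- have [f' sf' df] := cf j; have [psi' Cp dp] := Cd phi Cphi.
  exists ((psi' \o f) \* f').
    by apply: smgen_mul => //; apply: (smgen_comp sf Cp Cd).
  by move=> x Ux; apply: is_derive_comp1; [exact: df|exact: dp].
Qed.
End Calculus.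

(** * Closure properties of smooth functions and rules for partial derivatives *)

Section SmoothClosure.
Variables (R : realType) (n : nat).
Local Notation V := 'rV[R]_n.
Implicit Types (f g : V -> R) (x v : V) (U : set V).

Lemma coord_le_norm x i : `|x 0 i| <= `|x|.
Proof.
rewrite [leRHS]/Num.Def.normr /= mx_normrE; apply/bigmax_geP; right => /=.
by exists (0, i).
Qed.

Lemma norm_le_coord x (c : R) : 0 <= c -> (forall i, `|x 0 i| <= c) -> `|x| <= c.
Proof.
move=> c0 xc; rewrite [leLHS]/Num.Def.normr /= mx_normrE; apply/bigmax_leP; split=> //=.
by move=> [i j] _ /=; rewrite ord1.
Qed.

Lemma norm_basis (t : R) i : `|t *: (basis_vec R i : V)| <= `|t|.
Proof.
apply: norm_le_coord => // j; rewrite !mxE eqxx /=.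
by case: (j == i); rewrite ?mulr1 ?mulr0 ?normr0.
Qed.

Lemma open_ballP U x : open U -> U x -> exists2 r : R, 0 < r & forall y, `|y - x| < r -> U y.
Proof.
move=> oU Ux; have /nbhs_normP[r r0 rU] := open_near oU Ux.
by exists r => // y yr; apply: rU; rewrite /= distrC.
Qed.

Lemma ballP_open U : (forall x, U x -> exists2 r : R, 0 < r & forall y, `|y - x| < r -> U y) -> open U.
Proof.
move=> H; rewrite openE => x /H[r r0 rU]; change (nbhs x U); apply/nbhs_ballP; exists r => //= y; rewrite -ball_normE /= distrC.
exact: rU.
Qed.

Lemma smoothD U f g : open U -> smooth_on U f -> smooth_on U g ->
  smooth_on U (fun x => f x + g x).
Proof. by move=> oU sf sg; apply: (smgen_smooth oU); apply: (@smgen_add _ _ U f g); exact: smgen_base. Qed.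

Lemma smoothM U f g : open U -> smooth_on U f -> smooth_on U g ->
  smooth_on U (fun x => f x * g x).
Proof. by move=> oU sf sg; apply: (smgen_smooth oU); apply: (@smgen_mul _ _ U f g); exact: smgen_base. Qed.

Lemma smooth_cst U c : open U -> smooth_on U (fun _ : V => c).
Proof. by move=> oU; apply: (smgen_smooth oU); exact: smgen_cst. Qed.

Lemma smooth_coord U i : open U -> smooth_on U (fun x : V => x 0 i).
Proof. by move=> oU; apply: (smgen_smooth oU); exact: smgen_coord. Qed.

Lemma smoothZ U c f : open U -> smooth_on U f -> smooth_on U (fun x => c * f x).
Proof. by move=> oU sf; apply: smoothM => //; exact: smooth_cst. Qed.

Lemma smoothN U f : open U -> smooth_on U f -> smooth_on U (fun x => - f x).
Proof.
move=> oU sf; apply: (smooth_congr oU _ (smoothZ (-1) oU sf)) => y _.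
by rewrite mulN1r.
Qed.

Lemma smoothB U f g : open U -> smooth_on U f -> smooth_on U g ->
  smooth_on U (fun x => f x - g x).
Proof. by move=> oU sf sg; apply: smoothD => //; exact: smoothN. Qed.

Lemma smooth_sum U (I : Type) (r : seq I) (P : pred I) (F : I -> V -> R) : open U ->
  (forall i, smooth_on U (F i)) -> smooth_on U (fun x => \sum_(i <- r | P i) F i x).
Proof.
move=> oU sF; elim: r => [|i r IH].
  by apply: (smooth_congr oU _ (smooth_cst 0 oU)) => y _; rewrite big_nil.
apply: (@smooth_congr _ _ U (fun x => (if P i then F i x else 0) + \sum_(i <- r | P i) F i x)) => //.
  by move=> y _; rewrite big_cons; case: (P i); rewrite ?add0r.
apply: smoothD => //; case: (P i) => //; exact: smooth_cst.
Qed.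

Lemma smooth_comp U (C : (R -> R) -> Prop) phi f : open U -> smooth_on U f -> C phi ->
   (forall psi, C psi -> exists2 psi', C psi' &
      forall x, U x -> is_derive (f x) 1 psi (psi' (f x))) -> smooth_on U (fun x => phi (f x)).
Proof. by move=> oU sf Cp CC; apply: (smgen_smooth oU); apply: (smgen_comp (smgen_base sf) Cp CC). Qed.

Lemma smooth_exp U f : open U -> smooth_on U f -> smooth_on U (fun x => expR (f x)).
Proof.
move=> oU sf; apply: (@smooth_comp U (eq expR)) => // psi <-.
by exists expR => // x _; exact: is_derive_expR.
Qed.

Lemma is_derive_ext (phi psi : R -> R) (t l m : R) : phi =1 psi -> l = m ->
  is_derive t 1 phi l -> is_derive t 1 psi m.
Proof. by move=> /funext -> ->. Qed.

Lemma is_deriveZ1 (phi : R -> R) (c t l : R) : is_derive t 1 phi l ->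
  is_derive t 1 (fun s => c * phi s) (c * l).
Proof. by move=> h; exact: (is_deriveZ c h). Qed.

Lemma smooth_cos_sin U (b : bool) f : open U -> smooth_on U f ->
  smooth_on U (fun x => if b then cos (f x) else sin (f x)).
Proof.
move=> oU sf; apply: (@smooth_comp U (fun psi => exists (c : R) b, psi = fun t => c * (if b then cos t else sin t)) (fun t => if b then cos t else sin t)) => //.
  by exists 1, b; apply/funext => t; rewrite mul1r; case: b.
move=> _ [c [d ->]]; exists (fun t => (if d then - c else c) * (if ~~ d then cos t else sin t)).
  by exists (if d then - c else c), (~~ d).
move=> x _; case: d => /=; last by apply: is_deriveZ1; exact: is_derive_sin.
by rewrite mulNr -mulrN; apply: is_deriveZ1; exact: is_derive_cos.
Qed.

Lemma smooth_cos U f : open U -> smooth_on U f -> smooth_on U (fun x => cos (f x)).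
Proof. exact: (@smooth_cos_sin U true). Qed.

Lemma smooth_sin U f : open U -> smooth_on U f -> smooth_on U (fun x => sin (f x)).
Proof. exact: (@smooth_cos_sin U false). Qed.

Lemma is_derive_invX (t : R) k : t != 0 ->
  is_derive t 1 (fun s => s^-1 ^+ k) (- k%:R * t^-1 ^+ k.+1).
Proof.
move=> t0; have dV : is_derive t 1 (fun s : R => s^-1) (- t ^- 2).
  have dI := @is_derive_id R R^o t 1.
  have h := @deriveV R R^o (@id R) t 1 t0 (@derivable_id R R^o t 1).
  apply: DeriveDef; first exact: (@derivableV R R^o (@id R) t 1 t0 (@derivable_id R R^o t 1)).
  by rewrite [LHS]h derive_id /GRing.scale /= mulr1.
apply: is_derive_ext (@is_deriveX R R^o (fun s : R => s^-1) k t 1 _ dV) => /=.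
  by move=> s; rewrite fctE.
rewrite /GRing.scale /=.
case: k => [|k]; first by rewrite mulr0n !mul0r oppr0 mul0r.
rewrite /= -mulr_natl -exprVn mulrN mulNr; congr (- _).
by rewrite mulr1 -mulrA -exprD addn2.
Qed.

Lemma smooth_inv U f : open U -> smooth_on U f -> (forall x, U x -> f x != 0) ->
  smooth_on U (fun x => (f x)^-1).
Proof.
move=> oU sf f0; apply: (@smooth_comp U (fun psi => exists (c : R) k, psi = fun t => c * t^-1 ^+ k) (fun t => t^-1)) => //.
  by exists 1, 1%N; apply/funext => t; rewrite mul1r.
move=> _ [c [k ->]]; exists (fun t => (c * - k%:R) * t^-1 ^+ k.+1).
  by exists (c * - k%:R), k.+1.
by move=> x Ux; rewrite -mulrA; apply: is_deriveZ1; apply: is_derive_invX; exact: f0.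
Qed.

(** The multiples of [Num.sqrt t * t^-1 ^+ k] contain the square root and are closed under
    differentiation on the positive half-line. *)
Lemma smooth_sqrt U f : open U -> smooth_on U f -> (forall x, U x -> 0 < f x) ->
  smooth_on U (fun x => Num.sqrt (f x)).
Proof.
move=> oU sf f0; apply: (@smooth_comp U (fun psi => exists (c : R) k, psi = fun t => c * (Num.sqrt t * t^-1 ^+ k)) Num.sqrt) => //.
  by exists 1, 0%N; apply/funext => t; rewrite mul1r expr0 mulr1.
move=> _ [c [k ->]]; exists (fun t => (c * (2^-1 - k%:R)) * (Num.sqrt t * t^-1 ^+ k.+1)).
  by exists (c * (2^-1 - k%:R)), k.+1.
move=> x Ux; rewrite -mulrA; apply: is_deriveZ1.
have fx := f0 x Ux; have d1 := @is_derive1_sqrt R _ fx.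
apply: is_derive_ext (is_deriveM d1 (is_derive_invX k (lt0r_neq0 fx))) => //.
rewrite /GRing.scale /=.
have s0 : Num.sqrt (f x) != 0 by rewrite sqrtr_eq0 -ltNge.
rewrite -[in RHS](sqr_sqrtr (ltW fx)) -[in LHS](sqr_sqrtr (ltW fx)) sqrtr_sqr ger0_norm ?sqrtr_ge0 //.
by rewrite !exprS; field.
Qed.

Lemma smooth_ln U f : open U -> smooth_on U f -> (forall x, U x -> 0 < f x) ->
  smooth_on U (fun x => ln (f x)).
Proof.
move=> oU sf f0; apply: (@smooth_comp U (fun psi => psi = @ln R \/ exists (c : R) k, psi = fun t => c * t^-1 ^+ k) (@ln R)) => //.
  by left.
move=> _ [->|[c [k ->]]].
  exists (fun t => 1 * t^-1 ^+ 1); first by right; exists 1, 1%N.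
  by move=> x Ux; rewrite mul1r expr1; apply: is_derive1_ln; exact: f0.
exists (fun t => (c * - k%:R) * t^-1 ^+ k.+1).
  by right; exists (c * - k%:R), k.+1.
move=> x Ux; rewrite -mulrA; apply: is_deriveZ1; apply: is_derive_invX.
by rewrite lt0r_neq0 // f0.
Qed.

Lemma pdD U f g j x : smooth_on U f -> smooth_on U g -> U x ->
  pd j (fun x => f x + g x) x = pd j f x + pd j g x.
Proof.
by move=> sf sg Ux; case: (is_deriveD (smooth_derive j sf Ux) (smooth_derive j sg Ux)).
Qed.

Lemma pdM U f g j x : smooth_on U f -> smooth_on U g -> U x ->
  pd j (fun x => f x * g x) x = f x * pd j g x + g x * pd j f x.
Proof.
by move=> sf sg Ux; case: (is_deriveM (smooth_derive j sf Ux) (smooth_derive j sg Ux)).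
Qed.

Lemma pd_comp U f (phi : R -> R) l j x : smooth_on U f -> U x ->
  is_derive (f x) 1 phi l -> pd j (fun x => phi (f x)) x = l * pd j f x.
Proof.
by move=> sf Ux dp; case: (is_derive_comp1 (smooth_derive j sf Ux) dp).
Qed.

Lemma pd_cst (c : R) j x : pd j (fun _ : V => c) x = 0.
Proof. by case: (is_derive_cst c x (basis_vec R j)). Qed.

Lemma pd_coord i j x : pd j (fun x : V => x 0 i) x = (i == j)%:R.
Proof. by case: (coord_is_derive i j x). Qed.

Lemma pdZ U c f j x : smooth_on U f -> U x -> pd j (fun x => c * f x) x = c * pd j f x.
Proof. by move=> sf Ux; case: (is_deriveZ c (smooth_derive j sf Ux)). Qed.

Lemma pdN U f j x : smooth_on U f -> U x -> pd j (fun x => - f x) x = - pd j f x.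
Proof. by move=> sf Ux; case: (is_deriveN (smooth_derive j sf Ux)). Qed.

Lemma pdB U f g j x : smooth_on U f -> smooth_on U g -> U x ->
  pd j (fun x => f x - g x) x = pd j f x - pd j g x.
Proof.
by move=> sf sg Ux; case: (is_deriveB (smooth_derive j sf Ux) (smooth_derive j sg Ux)).
Qed.

Lemma pd_sum U (I : Type) (r : seq I) (P : pred I) (F : I -> V -> R) j x : open U ->
  (forall i, smooth_on U (F i)) -> U x ->
  pd j (fun x => \sum_(i <- r | P i) F i x) x = \sum_(i <- r | P i) pd j (F i) x.
Proof.
move=> oU sF Ux; elim: r => [|i r IH].
  rewrite big_nil -[RHS](pd_cst 0 j x); congr (pd j _ x).
  by apply/funext => y; rewrite big_nil.
rewrite big_cons -IH; case: ifP => Pi.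
  rewrite -(@pdD U (F i)) //; last exact: smooth_sum.
  by congr (pd j _ x); apply/funext => y; rewrite big_cons Pi.
by congr (pd j _ x); apply/funext => y; rewrite big_cons Pi.
Qed.

Lemma pd_congr U f g j x : open U -> (forall y, U y -> f y = g y) -> U x -> pd j f x = pd j g x.
Proof. exact: derive_congr. Qed.

End SmoothClosure.

(** * Mean value estimates, directional derivatives, symmetry of second derivatives *)

Section MeanValue.
Variables (R : realType) (n : nat).
Local Notation V := 'rV[R]_n.
Implicit Types (f g : V -> R) (x v : V) (U : set V).

Lemma ball_near x (P : V -> Prop) : (\forall y \near x, P y) ->
  exists2 r : R, 0 < r & forall y, `|y - x| < r -> P y.
Proof. by move=> /nbhs_normP[r r0 h]; exists r => // y yr; apply: h; rewrite /= distrC. Qed.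

Lemma cont_norm f x : (forall e : R, 0 < e -> exists2 d : R, 0 < d &
  forall y, `|y - x| < d -> `|f y - f x| <= e) -> {for x, continuous f}.
Proof.
move=> H; rewrite /prop_for /continuous_at; apply/(@cvgrPdist_le _ _ _ (nbhs x)) => e e0.
have [d d0 h] := H e e0; apply/nbhs_ballP; exists d => //= y; rewrite -ball_normE /= => yd.
by rewrite distrC; apply: h; rewrite distrC.
Qed.

Lemma cont_normP f x (e : R) : {for x, continuous f} -> 0 < e -> exists2 d : R, 0 < d &
  forall y, `|y - x| < d -> `|f y - f x| <= e.
Proof.
move=> cf e0; have /cvgrPdist_le /(_ _ e0) /ball_near [d d0 h] := cf.
by exists d => // y /h; rewrite distrC.
Qed.

Lemma mvt_point (g dg : R -> R) (a b : R) : a <= b ->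
  (forall t, a <= t <= b -> is_derive t 1 g (dg t)) ->
  exists2 t, a <= t <= b & g b - g a = dg t * (b - a).
Proof.
move=> ab dgt; have [|t|] := @MVT_segment R g dg a b ab.
- by move=> t; rewrite in_itv /= => /andP[at_ tb]; apply: dgt; rewrite !ltW.
- apply: continuous_in_subspaceT => u; rewrite inE /= in_itv /= => /dgt.
  exact: is_derive1_cont.
by move=> t; rewrite in_itv /= => tab E; exists t.
Qed.

Lemma mvt_bound (g dg : R -> R) (a b l e : R) :
  (forall t, Num.min a b <= t <= Num.max a b -> is_derive t 1 g (dg t)) ->
  (forall t, Num.min a b <= t <= Num.max a b -> `|dg t - l| <= e) ->
  `|g b - g a - l * (b - a)| <= e * `|b - a|.
Proof.
wlog ab : a b / a <= b => [W|].
  case/orP: (le_total a b) => [ab|ba]; first exact: W.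
  rewrite minC maxC => h1 h2; have := W b a ba h1 h2.
  by rewrite (_ : g a - g b - l * (a - b) = - (g b - g a - l * (b - a))) ?normrN 1?[`|a - b|]distrC //; ring.
rewrite min_l // max_r // => dgt hl; have [t tab ->] := mvt_point ab dgt.
by rewrite -mulrBl normrM ler_wpM2r // hl.
Qed.

Lemma addxK2 x v (w : V) : x + v + w - x = v + w.
Proof. by rewrite -(addrA x) (addrC x) addrK. Qed.

(** The points [x + trunc k v] are the corners of a path from [x] to [x + v] with edges parallel to
    the axes. *)
Definition trunc k v : V := \row_i (if (i < k)%N then v 0 i else 0).

Lemma trunc0 v : trunc 0 v = 0.
Proof. by apply/rowP => i; rewrite !mxE. Qed.

Lemma truncn v : trunc n v = v.
Proof. by apply/rowP => i; rewrite !mxE ltn_ord. Qed.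

Lemma truncS (k : 'I_n) v : trunc k.+1 v = trunc k v + v 0 k *: basis_vec R k.
Proof.
apply/rowP => i; rewrite !mxE eqxx /= ltnS.
have [->|ik] := eqVneq i k; first by rewrite leqnn ltnn mulr1 add0r.
by rewrite mulr0 addr0 leq_eqVlt (inj_eq val_inj) (negbTE ik).
Qed.

Lemma trunc_norm k v t (i : 'I_n) : i = k :> nat -> `|t| <= `|v 0 i| ->
  `|trunc k v + t *: basis_vec R i| <= `|v|.
Proof.
move=> ik tv; apply: norm_le_coord => // j; rewrite !mxE eqxx /=.
have [->|ji] := eqVneq j i.
  by rewrite ik ltnn mulr1 add0r (le_trans tv) // coord_le_norm.
rewrite mulr0 addr0; case: ifP => _; last by rewrite normr0.
exact: coord_le_norm.
Qed.

(* Moving one coordinate at a time reduces the estimate to the one-variable mean value theorem *)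
Lemma box_diff f (df : 'I_n -> V -> R) (l : 'I_n -> R) x v (e : R) :
  (forall i y, `|y - x| <= `|v| -> is_derive y (basis_vec R i) f (df i y)) ->
  (forall i y, `|y - x| <= `|v| -> `|df i y - l i| <= e) ->
  `|f (x + v) - f x - \sum_i v 0 i * l i| <= e * \sum_i `|v 0 i|.
Proof.
move=> dfy dl.
have -> : f (x + v) - f x = \sum_(i < n) (f (x + trunc i.+1 v) - f (x + trunc i v)).
  rewrite -(big_mkord xpredT (fun i => f (x + trunc i.+1 v) - f (x + trunc i v))).
  by rewrite telescope_sumr // truncn trunc0 addr0.
rewrite -sumrB mulr_sumr; apply: (le_trans (ler_norm_sum _ _ _)).
apply: ler_sum => i _; rewrite truncS addrA.
have hb t : Num.min 0 (v 0 i) <= t <= Num.max 0 (v 0 i) -> `|t| <= `|v 0 i|.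
  by case: (leP 0 (v 0 i)) => h /andP[h1 h2]; rewrite ler_norml; case: (ger0P (v 0 i)) => //; lra.
have hball t : `|t| <= `|v 0 i| -> `|x + trunc i v + t *: basis_vec R i - x| <= `|v|.
  by move=> h; rewrite addxK2; exact: trunc_norm.
have := @mvt_bound (fun t => f (x + trunc i v + t *: basis_vec R i))
  (fun t => df i (x + trunc i v + t *: basis_vec R i)) 0 (v 0 i) (l i) e.
rewrite scale0r addr0 subr0 [l i * _]mulrC; apply.
- by move=> t /hb ht; apply: is_derive_line; apply: dfy; exact: hball.
- by move=> t /hb ht; apply: dl; exact: hball.
Qed.

Lemma sum_abs_le v : \sum_i `|v 0 i| <= n%:R * `|v|.
Proof.
rewrite mulr_natl -[n in _ *+ n]card_ord -sumr_const; apply: ler_sum => i _.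
exact: coord_le_norm.
Qed.

Lemma box_lip f (df : 'I_n -> V -> R) x v (C : R) : 0 <= C ->
  (forall i y, `|y - x| <= `|v| -> is_derive y (basis_vec R i) f (df i y)) ->
  (forall i y, `|y - x| <= `|v| -> `|df i y| <= C) ->
  `|f (x + v) - f x| <= C * n%:R * `|v|.
Proof.
move=> C0 d b; have b' i y : `|y - x| <= `|v| -> `|df i y - 0| <= C by rewrite subr0; exact: b.
have := @box_diff f df (fun=> 0) x v C d b'; rewrite big1 => [|i _]; last by rewrite mulr0.
by rewrite subr0 => /le_trans; apply; rewrite -mulrA ler_wpM2l // sum_abs_le.
Qed.

(** [smooth_on] speaks of partial derivatives only; their continuity makes them almost constant on a
    small cube, and [box_diff] then gives the derivative in an arbitrary direction. *)
Lemma smooth_dir U f x v : open U -> smooth_on U f -> U x ->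
  is_derive x v f (\sum_i v 0 i * pd i f x).
Proof.
move=> oU sf Ux.
suff H : h^-1 *: (f (h *: v + x) - f x) @[h --> (0 : R)^'] --> \sum_i v 0 i * pd i f x.
  by apply: DeriveDef; [apply/cvg_ex; exists (\sum_i v 0 i * pd i f x)|apply/cvg_lim].
apply/cvgrPdist_le => e e0.
have e1 : 0 < e / (n%:R * `|v| + 1) by rewrite divr_gt0 // ltr_pwDr // mulr_ge0.
have /ball_near[r r_gt0 hr] : \forall y \near x, U y /\ forall i,
    `|pd i f x - pd i f y| <= e / (n%:R * `|v| + 1).
  near=> y; split; first by near: y; exact: open_near.
  near: y; apply: filter_forall => i.
  by have /cvgrPdist_le /(_ _ e1) := smooth_cont (smooth_pd i sf) Ux.
near=> h.
have h0 : h != 0 by near: h; exact: nbhs_dnbhs_neq.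
have hv : `|h *: v| < r.
  have v1 : 0 < `|v| + 1 by rewrite ltr_pwDr.
  have : `|h| < r / (`|v| + 1) by near: h; apply: dnbhs0_lt; rewrite divr_gt0 // ltr_pwDr.
  rewrite ltr_pdivlMr // normrZ; apply: le_lt_trans.
  by rewrite ler_wpM2l // lerDl.
have hr2 i y : `|y - x| < r -> `|pd i f y - pd i f x| <= e / (n%:R * `|v| + 1).
  by move=> /hr[_ /(_ i)]; rewrite distrC.
have hb y : `|y - x| <= `|h *: v| -> `|y - x| < r by move/le_lt_trans; apply.
have := @box_diff f (fun i => pd i f) (fun i => pd i f x) x (h *: v) (e / (n%:R * `|v| + 1))
  (fun i y yh => smooth_derive i sf (hr y (hb y yh)).1) (fun i y yh => hr2 i y (hb y yh)).
rewrite [x + _]addrC => hD; rewrite distrC.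
have -> : h^-1 *: (f (h *: v + x) - f x) - \sum_i v 0 i * pd i f x =
  h^-1 * (f (h *: v + x) - f x - \sum_i (h *: v) 0 i * pd i f x).
  rewrite mulrBr mulr_sumr; congr (_ - _); apply: eq_bigr => i _.
  by rewrite mxE -mulrA mulKf.
rewrite normrM normfV mulrC ler_pdivrMr ?normr_gt0 //; apply: (le_trans hD).
rewrite mulrAC ler_pdivrMr ?ltr_pwDr ?mulr_ge0 // -mulrA ler_wpM2l ?(ltW e0) //.
apply: (le_trans (sum_abs_le _)); rewrite normrZ mulrCA ler_wpM2l //.
by rewrite lerDl.
Unshelve. all: by end_near. Qed.

(* The double difference of [f] is within [e * h ^ 2] of [h ^ 2] times either mixed derivative *)
Lemma pd_swap U f i j x : open U -> smooth_on U f -> U x ->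
  pd i (pd j f) x = pd j (pd i f) x.
Proof.
move=> oU sf Ux; apply/eqP; rewrite -subr_eq0 -normr_le0; apply/ler_addgt0Pl => e e0.
rewrite addr0.
have e2 : 0 < e / 2 by rewrite divr_gt0.
have /ball_near[r r0 hr] : \forall y \near x, U y /\ forall k l,
    `|pd k (pd l f) x - pd k (pd l f) y| <= e / 2.
  near=> y; split; first by near: y; exact: open_near.
  near: y; apply: filter_forall => k; apply: filter_forall => l.
  by have /cvgrPdist_le /(_ _ e2) := smooth_cont (smooth_pd k (smooth_pd l sf)) Ux.
pose h := r / 3; have h0 : 0 < h by rewrite divr_gt0.
have hball k l s t : 0 <= s <= h -> 0 <= t <= h ->
    `|x + s *: basis_vec R k + t *: basis_vec R l - x| < r.
  move=> /andP[s0 sh] /andP[t0 th]; rewrite addxK2.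
  apply: (le_lt_trans (ler_normD _ _)).
  have := norm_basis s k; have := norm_basis t l.
  by rewrite !ger0_norm //; rewrite /h in sh th; lra.
have key k l : `|f (x + h *: basis_vec R k + h *: basis_vec R l) - f (x + h *: basis_vec R k)
     - (f (x + h *: basis_vec R l) - f x) - h * (h * pd l (pd k f) x)| <= h * (h * (e / 2)).
  have M1 s : 0 <= s <= h ->
    `|pd k f (x + s *: basis_vec R k + h *: basis_vec R l) - pd k f (x + s *: basis_vec R k)
       - h * pd l (pd k f) x| <= h * (e / 2).
    move=> sh.
    have := @mvt_bound (fun t => pd k f (x + s *: basis_vec R k + t *: basis_vec R l))
      (fun t => pd l (pd k f) (x + s *: basis_vec R k + t *: basis_vec R l)) 0 h
      (pd l (pd k f) x) (e / 2).
    rewrite scale0r addr0 subr0 [`|h|]ger0_norm ?(ltW h0) // min_l ?max_r ?(ltW h0) //.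
    rewrite [_ * h]mulrC [e / 2 * h]mulrC; apply => t th.
      apply: is_derive_line; apply: smooth_derive; first exact: smooth_pd sf.
      by have [] := hr _ (hball k l s t sh th).
    by rewrite distrC; have [_] := hr _ (hball k l s t sh th); apply.
  have := @mvt_bound (fun s => f (x + h *: basis_vec R l + s *: basis_vec R k) - f (x + s *: basis_vec R k))
    (fun s => pd k f (x + h *: basis_vec R l + s *: basis_vec R k) - pd k f (x + s *: basis_vec R k)) 0 h
    (h * pd l (pd k f) x) (h * (e / 2)).
  rewrite !scale0r !addr0 subr0 [`|h|]ger0_norm ?(ltW h0) // min_l ?max_r ?(ltW h0) //.
  rewrite [_ * h]mulrC [h * (e / 2) * h]mulrC [x + h *: basis_vec R l + _]addrAC.
  have hh : 0 <= h <= h by rewrite (ltW h0) lexx.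
  have z0 : 0 <= (0 : R) <= h by apply/andP; split => //; exact: ltW.
  apply => t th; last by rewrite [x + h *: basis_vec R l + _]addrAC; exact: M1.
  apply: is_deriveB; apply: is_derive_line; apply: (smooth_derive k sf).
    by have [] := hr _ (hball l k h t hh th).
  by have [] := hr _ (hball k l t 0 th z0); rewrite scale0r addr0.
have := key i j; have := key j i.
rewrite [x + h *: basis_vec R i + _]addrAC.
set A := f (_ + _ + _); set B := f (x + h *: basis_vec R i); set C := f (x + h *: basis_vec R j).
set p := pd i _ x; set q := pd j _ x => k1 k2.
have : h * h * `|p - q| <= h * h * e.
  rewrite -{1}(ger0_norm (ltW (mulr_gt0 h0 h0))) -normrM.
  have -> : h * h * (p - q) = (A - B - (C - f x) - h * (h * q)) - (A - C - (B - f x) - h * (h * p)).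
    by ring.
  apply: (le_trans (ler_normB _ _)); apply: (le_trans (lerD k2 k1)).
  by rewrite le_eqVlt; apply/orP; left; apply/eqP; field.
by rewrite ler_pM2l // mulr_gt0.
Unshelve. all: by end_near. Qed.
End MeanValue.

(** * Discrete harmonic functions *)

Section DiscreteHarmonic.
Variables (R : realType) (n : nat).
Local Notation V := 'rV[R]_n.
Local Notation e_ := (@basis_vec R n).
Implicit Types (u v Psi : V -> R) (x z : V) (D O : set V) (h : R).

(** The mean over the [2 * n] neighbours is taken at every point of the space, not only on one grid:
    the cosets of the grid of step [h] simply do not interact. *)
Definition avg h u x : R :=
  (2 * n%:R)^-1 * \sum_(i < n) (u (x + h *: e_ i) + u (x - h *: e_ i)).

Lemma avgD h u v x : avg h (fun z => u z + v z) x = avg h u x + avg h v x.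
Proof. by rewrite /avg -mulrDr -big_split /=; congr (_ * _); apply: eq_bigr => i _; ring. Qed.

Lemma avgZ h c u x : avg h (fun z => c * u z) x = c * avg h u x.
Proof. by rewrite /avg mulrCA; congr (_ * _); rewrite mulr_sumr; apply: eq_bigr => i _; ring. Qed.

Lemma avg_shift h u x w : avg h (fun z => u (z + w)) x = avg h u (x + w).
Proof. by rewrite /avg; congr (_ * _); apply: eq_bigr => i _; rewrite ![x + _ + w]addrAC. Qed.

Hypothesis n0 : (0 < n)%N.

Let twon_gt0 : 0 < 2 * n%:R :> R.
Proof. by rewrite mulr_gt0 // ltr0n. Qed.

Lemma avg_le h u x B : (forall i, u (x + h *: e_ i) <= B) -> (forall i, u (x - h *: e_ i) <= B) ->
  avg h u x <= B.
Proof.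
move=> h1 h2; rewrite /avg mulrC ler_pdivrMr //.
apply: (@le_trans _ _ (\sum_(i < n) (B + B))).
  by apply: ler_sum => i _; apply: lerD.
by rewrite sumr_const card_ord -mulr_natr le_eqVlt; apply/orP; left; apply/eqP; ring.
Qed.

Lemma avg_mono h u v x : (forall z, u z <= v z) -> avg h u x <= avg h v x.
Proof.
move=> uv; rewrite /avg ler_wpM2l ?invr_ge0 ?(ltW twon_gt0) //.
by apply: ler_sum => i _; apply: lerD.
Qed.

Lemma avg_cst h c x : avg h (fun=> c) x = c.
Proof.
rewrite /avg sumr_const card_ord -mulr_natr.
by have := lt0r_neq0 twon_gt0; rewrite mulf_eq0 negb_or => /andP[_ a]; field.
Qed.

(** [D] may be infinite, so the supremum of [Psi] need not be attained. The gain [k] of the mean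
    replaces this: at a point within [Num.min k S] of a positive supremum [S] the mean would exceed
    [S], although the neighbours have values at most [S]. *)
Lemma disc_comparison h (k B : R) D Psi : 0 < k -> (forall z, D z -> Psi z <= B) ->
  (forall z, D z -> 0 < Psi z -> Psi z + k <= avg h Psi z) ->
  (forall z i, D z -> 0 < Psi z ->
    (D (z + h *: e_ i) \/ Psi (z + h *: e_ i) <= 0) /\
    (D (z - h *: e_ i) \/ Psi (z - h *: e_ i) <= 0)) ->
  forall z, D z -> Psi z <= 0.
Proof.
move=> k0 DB Dk Dn z0 Dz0; rewrite leNgt; apply/negP => P0.
pose E := [set Psi z | z in D]; pose S := sup E.
have hE : has_sup E.
  by split; [exists (Psi z0), z0|exists B => _ [z Dz <-]; exact: DB].
have ubS z : D z -> Psi z <= S by move=> Dz; apply: sup_upper_bound => //; exists z.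
have S0 : 0 < S by apply: lt_le_trans P0 (ubS _ Dz0).
have e0 : 0 < Num.min k S by rewrite lt_min k0.
have [_ [z Dz <-]] := sup_adherent e0 hE; rewrite -/S => hz.
have Pz : 0 < Psi z by apply: le_lt_trans hz; rewrite subr_ge0 ge_min lexx orbT.
have : avg h Psi z <= S.
  by apply: avg_le => i; have [[] a [] b] := Dn z i Dz Pz; rewrite ?(ubS _ a) ?(ubS _ b) //;
     rewrite ?(le_trans a (ltW S0)) ?(le_trans b (ltW S0)).
move=> /(le_trans (Dk z Dz Pz)); apply/negP; rewrite -ltNge.
rewrite -ltrBlDr; apply: le_lt_trans hz; rewrite lerD2l lerN2.
by rewrite ge_min lexx.
Qed.

(** Perron's method: the pointwise supremum of the discrete subsolutions is a solution, because one
    step of averaging cannot increase it. *)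
Lemma perron_solution h (M : R) O (g : V -> R) : (forall x, `|g x| <= M) ->
  exists u, [/\ forall x, `|u x| <= M, forall x, O x -> u x = avg h u x &
                forall x, ~ O x -> u x = g x].
Proof.
move=> gM.
pose S := [set v : V -> R | [/\ forall x, v x <= M, forall x, O x -> v x <= avg h v x &
                forall x, ~ O x -> v x <= g x]].
have Sm : S (fun=> - M).
  split=> x; first by have := gM x; rewrite ler_norml => /andP[]; exact: le_trans.
    by rewrite avg_cst.
  by have := gM x; rewrite ler_norml => /andP[].
pose E x := [set v x | v in S]; pose u x := sup (E x).
have hE x : has_sup (E x).
  by split; [exists (- M), (fun=> - M)|exists M => _ [v [vM _ _] <-]].
have vu v x : S v -> v x <= u x by move=> Sv; apply: sup_upper_bound => //; exists v.
have uB x B : (forall v, S v -> v x <= B) -> u x <= B.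
  by move=> H; apply: ge_sup; [case: (hE x)|move=> _ [v Sv <-]; exact: H].
have uM x : u x <= M by apply: uB => v [].
have ug x : ~ O x -> u x <= g x by move=> Ox; apply: uB => v [_ _ /(_ x Ox)].
have ua x : O x -> u x <= avg h u x.
  move=> Ox; apply: uB => v Sv; have [_ /(_ x Ox) va _] := Sv.
  by apply: le_trans va _; apply: avg_mono => z; exact: vu.
(* [Tu] is again a subsolution and at least [u]; by maximality it equals [u], which is the discrete
   equation together with the boundary condition. *)
pose Tu x := if `[< O x >] then avg h u x else g x.
have uT x : u x <= Tu x.
  by rewrite /Tu; case: asboolP; [exact: ua|exact: ug].
have ST : S Tu.
  split=> x; rewrite /Tu.
  - case: asboolP => _; first by apply: avg_le => i; exact: uM.
    by have := gM x; rewrite ler_norml => /andP[].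
  - by move=> Ox; rewrite asboolT //; apply: avg_mono.
  - by move=> Ox; rewrite asboolF.
have Tu' x : Tu x = u x by apply/le_anti; rewrite uT vu.
exists u; split=> x.
- by rewrite ler_norml uM andbT; exact: (vu (fun=> - M)).
- by move=> Ox; rewrite -[LHS]Tu' /Tu asboolT.
- by move=> Ox; rewrite -[LHS]Tu' /Tu asboolF.
Qed.

(** The mean of a quadratic polynomial is known exactly. With weights [- n] in one direction and 1
    in the others the sum of the weights is -1, so the polynomial is strictly superharmonic, both
    for the discrete and for the continuous Laplacian. *)
Definition wq (w : 'I_n -> R) (p z : V) : R := \sum_k w k * (z 0 k - p 0 k) ^+ 2.

Lemma wq_shift w p z (t : R) j :
  wq w p (z + t *: e_ j) = wq w p z + w j * (2 * t * (z 0 j - p 0 j) + t ^+ 2).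
Proof.
rewrite /wq (bigD1 j) //= [in RHS](bigD1 j) //= -addrA [_ + w j * (_ + _)]addrC addrA.
congr (_ + _); last first.
  by apply: eq_bigr => k kj; rewrite !mxE eqxx (negbTE kj) /= mulr0 addr0.
by rewrite !mxE !eqxx mulr1; ring.
Qed.

Lemma wq_avg h w p z (c a : R) (l : V -> R) (b : 'I_n -> R) : (forall j t, l (z + t *: e_ j) = l z + t * b j) ->
  avg h (fun z => c * (wq w p z + l z + a)) z = c * (wq w p z + l z + a) + c * (\sum_j w j) * h ^+ 2 / n%:R.
Proof.
move=> hl; rewrite avgZ -!mulrA -mulrDr; congr (_ * _).
have n1 : n%:R != 0 :> R by rewrite pnatr_eq0 -lt0n.
rewrite /avg; under eq_bigr => i _.
  rewrite -scaleNr !wq_shift !hl.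
  have -> : wq w p z + w i * (2 * h * (z 0 i - p 0 i) + h ^+ 2) + (l z + h * b i) + a +
   (wq w p z + w i * (2 * - h * (z 0 i - p 0 i) + (- h) ^+ 2) + (l z + - h * b i) + a) =
   2 * (wq w p z + l z + a) + 2 * h ^+ 2 * w i by ring.
  over.
rewrite big_split /= sumr_const card_ord -mulr_sumr -mulr_natr; by field.
Qed.

(* The comparison function for the reflected difference [u z - u (z - 2 * eta z)], where
   [eta z = z_i - x0_i - h / 2] takes values in [h * (N + 1/2)] on the comparison region *)
Lemma disc_gradient h (d M : R) u x0 i : 0 < h -> h <= d -> 0 < M ->
  (forall z, `|z - x0| < 2 * d -> u z = avg h u z) ->
  (forall z, `|z - x0| <= 4 * d -> `|u z| <= M) ->
  u (x0 + h *: e_ i) - u x0 <= 3 * n%:R * M * h / d.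
Proof.
move=> h0 hd M0 uh uM.
have d0 : 0 < d by apply: lt_le_trans hd.
pose p := x0 + (h / 2) *: e_ i.
pose eta z := z 0 i - p 0 i.
have pE k : p 0 k = x0 0 k + (if k == i then h / 2 else 0).
  by rewrite /p !mxE eqxx /=; case: eqP => _; rewrite ?mulr1 ?mulr0.
pose Rz z := z - (2 * eta z) *: e_ i.
pose w (k : 'I_n) : R := if k == i then - n%:R else 1.
(* [c * d ^+ 2 = 2 * M] bounds [phi], so [psi] dominates [phi] wherever its polynomial part is at
   least [d ^+ 2]; this happens just beyond the outer faces of [D]. As the weights have sum -1, the
   mean of [psi] drops by [c * h ^+ 2 / n]. *)
pose c := 2 * M / d ^+ 2.
pose psi z := c * (wq w p z + 3 * n%:R * d * eta z + n%:R * h ^+ 2 / 4).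
pose phi z := u z - u (Rz z).
pose D := [set z : V | (forall j, j != i -> `|z 0 j - x0 0 j| < d) /\
   exists2 k : nat, eta z = h * (k%:R + 2^-1) & eta z < d].
have c0 : 0 < c by rewrite /c !mulr_gt0 // invr_gt0 exprn_gt0.
have n1 : 1 <= n%:R :> R by rewrite ler1n.
have etaS z t j : eta (z + t *: e_ j) = eta z + (if j == i then t else 0).
  by rewrite /eta !mxE eqxx eq_sym /=; case: eqP => _; rewrite ?mulr1 ?mulr0; ring.
have sw : \sum_j w j = - 1.
  rewrite (bigD1 i) //= /w eqxx (eq_bigr (fun=> 1)); last by move=> j /negbTE ->.
  rewrite sumr_const cardC1 card_ord -subn1 natrB // ; ring.
have wqge z : - n%:R * eta z ^+ 2 <= wq w p z.
  rewrite /wq (bigD1 i) //= /w eqxx -/(eta z) lerDl; apply: sumr_ge0 => j /negbTE ->.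
  by rewrite mul1r sqr_ge0.
have wqge2 z j : j != i -> (z 0 j - x0 0 j) ^+ 2 - n%:R * eta z ^+ 2 <= wq w p z.
  move=> ji; rewrite /wq (bigD1 i) //= (bigD1 j) //= /w eqxx (negbTE ji) mul1r -/(eta z).
  rewrite pE (negbTE ji) addr0 mulNr addrCA lerD2l lerDl; apply: sumr_ge0 => k /andP[/negbTE -> _].
  by rewrite mul1r sqr_ge0.
have Dball z : D z -> `|z - x0| < 2 * d /\ `|Rz z - x0| < 2 * d.
  move=> [Dj [k ek ed]].
  have e0 : 0 < eta z by rewrite ek mulr_gt0 // ltr_wpDl.
  have zi : z 0 i - x0 0 i = eta z + h / 2 by rewrite /eta pE eqxx; ring.
  have aux z' : (forall j, `|(z' - x0) 0 j| <= Num.max (d + h/2) d) -> `|z' - x0| < 2 * d.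
    move=> /norm_le_coord hh; apply: (@le_lt_trans _ _ (Num.max (d + h/2) d)).
      by apply: hh; rewrite le_max (ltW d0) orbT.
    by rewrite gt_max; apply/andP; split; lra.
  split; apply: aux => j; rewrite !mxE ?eqxx le_max /=; have [->|ji] := eqVneq j i.
  - by apply/orP; left; rewrite zi ler_norml; apply/andP; split; lra.
  - by rewrite (ltW (Dj j ji)) orbT.
  - have -> : z 0 i - 2 * eta z * true%:R - x0 0 i = h / 2 - eta z.
      by rewrite addrAC zi mulr1; ring.
    by apply/orP; left; rewrite ler_norml; apply/andP; split; lra.
  - by rewrite mulr0 subr0 (ltW (Dj j ji)) orbT.
have nball z t j : `|z - x0| < 2 * d -> `|t| <= h -> `|z + t *: e_ j - x0| <= 4 * d.
  move=> zd th; rewrite addrAC; apply: (le_trans (ler_normD _ _)).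
  have := le_trans (norm_basis t j) th; lra.
have RzS z t j : Rz (z + t *: e_ j) = Rz z + (if j == i then - t else t) *: e_ j.
  rewrite /Rz etaS; case: eqP => [->|_]; last by rewrite addr0 addrAC.
  by apply/rowP => k; rewrite !mxE; ring.
have phiS z : D z -> avg h phi z = phi z.
  move=> Dz; have [zd Rd] := Dball z Dz; rewrite /phi (uh _ zd) (uh _ Rd) /avg -mulrBr -sumrB.
  congr (_ * _); apply: eq_bigr => j _; rewrite -!scaleNr !RzS.
  by case: eqP => _; rewrite ?opprK; ring.
have phiB z j t : D z -> `|t| <= h -> phi (z + t *: e_ j) <= 2 * M.
  move=> Dz th; have [zd Rd] := Dball z Dz; rewrite /phi RzS.
  have th' : `|if j == i then - t else t| <= h by case: ifP; rewrite ?normrN.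
  have := uM _ (nball z t j zd th); have := uM _ (nball _ _ j Rd th').
  by rewrite !ler_norml => /andP[a _] /andP[_ b]; lra.
have psiS z : avg h psi z = psi z - c * h ^+ 2 / n%:R.
  rewrite /psi (@wq_avg h w p z c _ (fun z => 3 * n%:R * d * eta z)
    (fun j => 3 * n%:R * d * (j == i)%:R)); last first.
    by move=> j t; rewrite etaS; case: (j == i) => /=; rewrite ?mulr1n ?mulr0n; ring.
  by rewrite sw; ring.
have psi0 z : 0 <= eta z -> eta z <= 3 * d -> 0 <= psi z.
  move=> a b; rewrite /psi mulr_ge0 ?(ltW c0) //; have := wqge z; rewrite mulNr => hw.
  have : 0 <= n%:R * (3 * d * eta z - eta z ^+ 2).
    by rewrite mulr_ge0 // expr2 -mulrBl mulr_ge0 // subr_ge0.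
  have : 0 <= n%:R * h ^+ 2 / 4 by rewrite !mulr_ge0 // ltW.
  lra.
have psi2M z : d ^+ 2 <= wq w p z + 3 * n%:R * d * eta z -> 2 * M <= psi z.
  move=> H; have -> : 2 * M = c * d ^+ 2 by rewrite /c divfK // expf_neq0 // lt0r_neq0.
  rewrite /psi ler_pM2l //; apply: (le_trans H); rewrite lerDl.
  by rewrite !mulr_ge0 // ltW.
pose Psi z := phi z - psi z.
suff H : Psi (x0 + h *: e_ i) <= 0.
  have E1 : eta (x0 + h *: e_ i) = h / 2 by rewrite etaS eqxx /eta pE eqxx; lra.
  have E2 : Rz (x0 + h *: e_ i) = x0.
    by rewrite /Rz E1 mulrCA divff // mulr1 addrK.
  move: H; rewrite /Psi /phi E2 subr_le0 => /le_trans; apply.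
  rewrite /psi E1.
  have -> : wq w p (x0 + h *: e_ i) = - n%:R * h ^+ 2 / 4.
    rewrite wq_shift pE eqxx /w eqxx /wq (bigD1 i) //= big1 ?addr0; last first.
      by move=> j ji; rewrite pE (negbTE ji) addr0 subrr expr0n mulr0.
    by rewrite eqxx pE eqxx; field.
  rewrite /c le_eqVlt; apply/orP; left; apply/eqP; field; exact: lt0r_neq0.
apply: (@disc_comparison h (c * h ^+ 2 / n%:R) (2 * M) D Psi).
- by rewrite divr_gt0 ?ltr0n // mulr_gt0 // exprn_gt0.
- move=> z Dz; rewrite /Psi; have := phiB z i 0 Dz; rewrite normr0 scale0r addr0 => /(_ (ltW h0)).
  have [_ [k ek ed]] := Dz.
  have e0 : 0 <= eta z by rewrite ek mulr_ge0 ?(ltW h0) // addr_ge0.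
  have := psi0 z e0; lra.
- move=> z Dz _; rewrite /Psi.
  have -> : avg h (fun z => phi z - psi z) z = avg h phi z - avg h psi z.
    by rewrite (_ : (fun z => _) = (fun z => phi z + (-1) * psi z)) ?avgD ?avgZ ?mulN1r //; apply/funext => y; rewrite mulN1r.
  by rewrite psiS phiS //; lra.
- move=> z j Dz Pz; have [Dj [k ek ed]] := Dz.
  have e0 : 0 < eta z by rewrite ek mulr_gt0 // ltr_wpDl.
  have [->|ji] := eqVneq j i.
    split.
      have ekh : eta (z + h *: e_ i) = h * (k.+1%:R + 2^-1) by rewrite etaS eqxx ek -natr1; ring.
      have [lt|ge] := ltP (eta (z + h *: e_ i)) d.
        left; split; last by exists k.+1.
        by move=> j' j'i; rewrite !mxE eqxx (negbTE j'i) /= mulr0 addr0; exact: Dj.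
      right; rewrite /Psi subr_le0; apply: (@le_trans _ _ (2 * M)).
        by apply: phiB => //; rewrite ger0_norm // ltW.
      set z' := z + _ in ge *; have le2 : eta z' <= 2 * d by rewrite /z' etaS eqxx; lra.
      have q1 : d ^+ 2 <= 3 * d * eta z' - eta z' ^+ 2.
        by rewrite -subr_ge0; have : 0 <= (eta z' - d) * (2 * d - eta z'); [apply: mulr_ge0; lra|nra].
      by apply: psi2M; have := wqge z'; rewrite mulNr; nra.
    rewrite -scaleNr; case: k ek => [|k] ek; last first.
      left; split; last exists k.
      - by move=> j' j'i; rewrite !mxE eqxx (negbTE j'i) /= mulr0 addr0; exact: Dj.
      - by rewrite etaS eqxx ek -natr1; ring.
      - by rewrite etaS eqxx; lra.
    (* For [k = 0] the neighbour across the mirror plane is the mirror image of [z], where [phi] has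
       the value [- phi z]. Since [Psi z > 0] means [phi z > psi z], it suffices that
       [psi z + psi (Rz z)] is nonnegative. *)
    right.
    have Rzz : z + (- h) *: e_ i = Rz z by rewrite /Rz ek add0r mulrCA divff // mulr1 scaleNr.
    have RR : Rz (Rz z) = z by rewrite -Rzz RzS eqxx opprK -Rzz -addrA -scalerDl addNr scale0r addr0.
    have Pz' := Pz; move: Pz'; rewrite /Psi /phi Rzz RR.
    have : 0 <= psi z + psi (Rz z).
      rewrite -Rzz /psi -mulrDr mulr_ge0 ?(ltW c0) //.
      have := wqge z; have := wqge (z + (- h) *: e_ i).
      rewrite !etaS !eqxx ek; nra.
    lra.
  have etz t : eta (z + t *: e_ j) = eta z by rewrite etaS (negbTE ji) addr0.
  have step t : `|t| <= h -> D (z + t *: e_ j) \/ Psi (z + t *: e_ j) <= 0.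
    move=> th; have [lt|ge] := ltP `|(z + t *: e_ j) 0 j - x0 0 j| d.
      left; split; last by rewrite etz; exists k.
      move=> j' j'i; have [->//|j'j] := eqVneq j' j.
      by rewrite !mxE eqxx (negbTE j'j) /= mulr0 addr0; exact: Dj.
    right; rewrite /Psi subr_le0; apply: (@le_trans _ _ (2 * M)); first exact: phiB.
    apply: psi2M; have := wqge2 (z + t *: e_ j) j ji; rewrite etz.
    have : d ^+ 2 <= ((z + t *: e_ j) 0 j - x0 0 j) ^+ 2.
      by rewrite -[leRHS]real_normK ?num_real // ler_sqr ?nnegrE ?(ltW d0).
    have : 0 <= n%:R * (eta z * (d - eta z)) by rewrite !mulr_ge0 //; lra.
    have : 0 <= n%:R * (d * eta z) by rewrite !mulr_ge0 //; lra.
    nra.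
  split; first by apply: step; rewrite ger0_norm // ltW.
  by rewrite -scaleNr; apply: step; rewrite normrN ger0_norm // ltW.
- split.
    by move=> j ji; rewrite !mxE eqxx (negbTE ji) /= mulr0 addr0 subrr normr0.
  have E1 : eta (x0 + h *: e_ i) = h / 2 by rewrite etaS eqxx /eta pE eqxx; lra.
  by exists 0%N; rewrite E1 ?add0r //; lra.
Qed.
End DiscreteHarmonic.

(** * Limits of discrete harmonic functions *)

Lemma fin_bound (R : realType) (I : finType) (P : I -> R -> R -> Prop) :
  (forall i d M d' M', P i d M -> d' <= d -> M <= M' -> P i d' M') ->
  (forall i, exists d M, 0 < d /\ P i d M) -> exists d M, [/\ 0 < d, 0 <= M & forall i, P i d M].
Proof.
move=> Pm PE; suff [d [M [d0 M0 H]]] : exists d M, [/\ 0 < d, 0 <= M & forall i, i \in enum I -> P i d M].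
  by exists d, M; split=> // i; apply: H; rewrite mem_enum.
elim: (enum I) => [|i s [d [M [d0 M0 H]]]]; first by exists 1, 0.
have [d' [M' [d'0 Pi]]] := PE i.
exists (Num.min d d'), (Num.max M M'); split; rewrite ?lt_min ?d0 // ?le_max ?M0 //.
move=> k; rewrite inE => /orP[/eqP ->|/H h].
  by apply: Pm Pi _ _; rewrite ?ge_min ?le_max lexx orbT.
by apply: Pm h _ _; rewrite ?ge_min ?le_max lexx.
Qed.

Lemma cvg_sum_ord (R : realType) (T : Type) (F : set_system T) (FF : Filter F) (m : nat)
    (a : 'I_m -> T -> R) (l : 'I_m -> R) :
  (forall i, a i @ F --> l i) -> (fun t => \sum_i a i t) @ F --> \sum_i l i.
Proof.
move=> al; elim: (index_enum 'I_m) => [|i s IH].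
  rewrite big_nil (_ : (fun t => _) = cst 0); first exact: cvg_cst.
  by apply/funext => t; rewrite big_nil.
rewrite big_cons (_ : (fun t => _) = (fun t => a i t + \sum_(j <- s) a j t)); first exact: cvgD.
by apply/funext => t; rewrite big_cons.
Qed.

Section DiscreteLimit.
Variables (R : realType) (n : nat).
Local Notation V := 'rV[R]_n.
Local Notation e_ := (@basis_vec R n).
Implicit Types (x z : V) (O : set V).
Hypothesis n0 : (0 < n)%N.
Variable G : set_system nat.
Hypothesis GU : UltraFilter G.
Hypothesis Goo : \oo `<=` G.

(** One ultrafilter serves for all points and all difference quotients at once, in place of diagonal
    subsequences. *)
Lemma ultra_bounded_cvg (a : nat -> R) (M : R) : (\forall j \near G, `|a j| <= M) -> cvg (a @ G).
Proof.
move=> aM.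
pose S := [set t | G [set j | t <= a j]].
have SM : ubound S M.
  move=> t /= Gt; have [j] := @filter_ex _ G _ _ (filterI Gt aM).
  by rewrite /= ler_norml => -[tj /andP[_ jM]]; exact: le_trans jM.
have hS : has_sup S.
  split; last by exists M.
  by exists (- M); apply: filterS aM => j; rewrite /= ler_norml => /andP[].
apply/cvg_ex; exists (sup S); apply/cvgrPdist_lt => e e0.
have [t St te] := sup_adherent e0 hS.
have G2 : G [set j | a j < sup S + e].
  have [h|] := in_ultra_setVsetC [set j | a j < sup S + e] GU; first by [].
  move=> h; exfalso; have : S (sup S + e) by apply: filterS h => j /= /negP; rewrite -leNgt.
  move=> /(sup_upper_bound hS); rewrite gerDl; lra.
near=> j.
have h1 : a j < sup S + e by near: j.
have h2 : t <= a j by near: j.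
by rewrite ltr_norml; apply/andP; split; lra.
Unshelve. all: by end_near. Qed.

Definition ulim (a : nat -> R) : R := lim (a @ G).

Lemma ulim_cvg (a : nat -> R) (M : R) : (\forall j \near \oo, `|a j| <= M) -> a @ G --> ulim a.
Proof. by move=> /Goo; exact: ultra_bounded_cvg. Qed.

Lemma ulim_le (a : nat -> R) l (B : R) : a @ G --> l -> (\forall j \near \oo, a j <= B) -> l <= B.
Proof.
move=> al /Goo aB; have E : lim (a @ G) = l by apply: cvg_lim.
by rewrite -E; apply: limr_le => //; apply/cvg_ex; exists l.
Qed.

Definition hs (j : nat) : R := j.+1%:R^-1.

Lemma hs_gt0 j : 0 < hs j. Proof. by rewrite invr_gt0. Qed.

Lemma hs_cvg : hs @ \oo --> 0. Proof. exact: cvg_harmonic. Qed.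

Lemma hs_small (d : R) : 0 < d -> \forall j \near \oo, hs j <= d.
Proof.
move=> d0; have /cvgrPdist_le /(_ _ d0) := hs_cvg.
by apply: filterS => j; rewrite sub0r normrN ger0_norm // ltW // hs_gt0.
Qed.

(** Locally bounded and discretely harmonic for all small steps. The class is made for being stable
    under difference quotients, which turns [smooth_coind] into a smoothness proof for the
    limits. *)
Definition disc_family O (u : nat -> V -> R) := forall x, O x -> exists d M : R,
  [/\ 0 < d, 0 < M & \forall j \near \oo, forall z, `|z - x| < d ->
     `|u j z| <= M /\ u j z = avg (hs j) (u j) z].

Definition dq i (u : nat -> V -> R) (j : nat) z := (u j (z + hs j *: e_ i) - u j z) / hs j.

(** [disc_gradient] bounds the quotient, and it is discretely harmonic because [avg] is linear and
    commutes with translations. The radius shrinks to [d / 8] to leave room for the cubes of radius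
    [4 * (d / 8)] that the gradient estimate uses. *)
Lemma disc_family_dq O u i : disc_family O u -> disc_family O (dq i u).
Proof.
move=> fu x Ox; have [d [M [d0 M0 H]]] := fu x Ox.
exists (d / 8), (3 * n%:R * M / (d / 8)); split; first lra.
  by rewrite !mulr_gt0 ?ltr0n // invr_gt0; lra.
have d8 : 0 < d / 8 by lra.
near=> j.
have hd : hs j <= d / 8 by near: j; exact: hs_small.
have Hj : forall z, `|z - x| < d -> `|u j z| <= M /\ u j z = avg (hs j) (u j) z by near: j.
move=> z zx.
have tri w : `|w - z| <= 4 * (d / 8) -> `|w - x| < d.
  move=> wz; have -> : w - x = (w - z) + (z - x) by rewrite addrA subrK.
  by apply: (le_lt_trans (ler_normD _ _)); lra.
have h0 := hs_gt0 j.
split.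
  rewrite normrM normfV (ger0_norm (ltW h0)) ler_pdivrMr //.
  have g1 := @disc_gradient R n n0 (hs j) (d / 8) M (u j) z i h0 hd M0.
  have g2 := @disc_gradient R n n0 (hs j) (d / 8) M (fun z => - u j z) z i h0 hd M0.
  have E : 3 * n%:R * M / (d / 8) * hs j = 3 * n%:R * M * hs j / (d / 8) by ring.
  rewrite ler_norml E; apply/andP; split.
    have : - u j (z + hs j *: e_ i) - - u j z <= 3 * n%:R * M * hs j / (d / 8).
      apply: g2 => w wz; last by rewrite normrN; have [] := Hj w (tri w wz).
      have -> : (fun z0 => - u j z0) = (fun z0 => -1 * u j z0) by apply/funext => y; rewrite mulN1r.
      by rewrite avgZ mulN1r; congr (- _); have [] := Hj w (tri w ltac:(lra)).
    lra.
  by apply: g1 => w wz; have [] := Hj w (tri w ltac:(lra)).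
have -> : dq i u j = (fun w => (hs j)^-1 * (u j (w + hs j *: e_ i) + -1 * u j w)).
  by apply/funext => w; rewrite /dq mulN1r mulrC.
rewrite avgZ avgD avgZ avg_shift; congr (_ * (_ + _ * _)).
  have [] // := Hj (z + hs j *: e_ i) _; apply: tri; rewrite addrC addKr.
  by apply: (le_trans (norm_basis _ _)); rewrite ger0_norm ?(ltW h0) //; lra.
by have [] // := Hj z _; apply: tri; rewrite subrr normr0; lra.
Unshelve. all: by end_near. Qed.

(** The discrete equation does not relate the values of [u j] on different cosets of the grid, so
    limits are taken along the points of one grid. *)
Definition fl (j : nat) x : V := \row_i (hs j * (Num.floor (x 0 i / hs j))%:~R).

Lemma fl_close j x : `|fl j x - x| <= hs j.
Proof.
have h0 := hs_gt0 j.
apply: norm_le_coord; first exact: ltW.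
move=> i; rewrite !mxE; have /andP[a b] := floor_itv (x 0 i / hs j).
set k := (Num.floor _)%:~R in a b *.
rewrite intrD in b; rewrite distrC ger0_norm.
  by rewrite lerBlDl -[X in _ <= _ + X]mulr1 -mulrDr mulrC -ler_pdivrMr // ltW.
by rewrite subr_ge0 mulrC -ler_pdivlMr.
Qed.

Definition dlim (u : nat -> V -> R) x : R := ulim (fun j => u j (fl j x)).

Lemma dlim_cvg O u x : disc_family O u -> O x -> (fun j => u j (fl j x)) @ G --> dlim u x.
Proof.
move=> fu Ox; have [d [M [d0 M0 H]]] := fu x Ox; apply: (@ulim_cvg _ M).
near=> j; have Hj : forall z, `|z - x| < d -> `|u j z| <= M /\ u j z = avg (hs j) (u j) z by near: j.
have [] // := Hj (fl j x) _; apply: le_lt_trans (fl_close j x) _.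
by apply: (@le_lt_trans _ _ (d / 2)); [near: j; apply: hs_small; lra|lra].
Unshelve. all: by end_near. Qed.

Lemma fl_step j x i (t : R) : exists m : int, fl j (x + t *: e_ i) = fl j x + (m%:~R * hs j) *: e_ i.
Proof.
exists (Num.floor ((x 0 i + t) / hs j) - Num.floor (x 0 i / hs j)).
apply/rowP => k; rewrite !mxE eqxx /=; have [->|ki] := eqVneq k i.
  by rewrite !mulr1 rmorphB /=; ring.
by rewrite !mulr0 !addr0.
Qed.

(** The first difference is off from [p] by at most [K] at the start and by at most [K] more at each
    step; summing once more gives quadratic growth. *)
Lemma second_difference_sum (c : nat -> R) (p K : R) m : 0 <= K -> `|c 1%N - c 0%N - p| <= K ->
  (forall k, (k.+1 < m)%N -> `|c k.+2 - c k.+1 - (c k.+1 - c k)| <= K) ->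
  `|c m - c 0%N - m%:R * p| <= K * m%:R ^+ 2.
Proof.
move=> K0 h1 h2.
have inc k : (k < m)%N -> `|c k.+1 - c k - p| <= K * k.+1%:R.
  elim: k => [_|k IH km]; first by rewrite mulr1.
  have -> : c k.+2 - c k.+1 - p = (c k.+2 - c k.+1 - (c k.+1 - c k)) + (c k.+1 - c k - p) by ring.
  apply: (le_trans (ler_normD _ _)); have := IH (ltnW km); have := h2 k km.
  rewrite -[k.+2%:R]natr1 mulrDr mulr1; lra.
have : forall l, (l <= m)%N -> `|c l - c 0%N - l%:R * p| <= K * l%:R ^+ 2.
  elim=> [_|l IH lm]; first by rewrite subrr mul0r subrr normr0 expr0n mulr0.
  have -> : c l.+1 - c 0%N - l.+1%:R * p = (c l.+1 - c l - p) + (c l - c 0%N - l%:R * p).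
    by rewrite -natr1; ring.
  apply: (le_trans (ler_normD _ _)); have := IH (ltnW lm); have := inc l lm.
  have l0 : 0 <= l%:R :> R by [].
  have : 0 <= K * l%:R by rewrite mulr_ge0.
  rewrite -[l.+1%:R]natr1; nra.
by apply.
Qed.

Lemma lattice_taylor (u : nat -> V -> R) j a i (C : R) (m : int) : 0 <= C ->
  (forall z, `|z - a| <= `|m%:~R * hs j| -> `|dq i (dq i u) j z| <= C) ->
  `|u j (a + (m%:~R * hs j) *: e_ i) - u j a - m%:~R * hs j * dq i u j a| <= C * (m%:~R * hs j) ^+ 2.
Proof.
move=> C0 hC; have h0 := hs_gt0 j.
have E z : u j (z + hs j *: e_ i + hs j *: e_ i) - u j (z + hs j *: e_ i) - (u j (z + hs j *: e_ i) - u j z)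
    = hs j ^+ 2 * dq i (dq i u) j z.
  by rewrite /dq; field; exact: lt0r_neq0.
have Ed : hs j * dq i u j a = u j (a + hs j *: e_ i) - u j a.
  by rewrite /dq; field; exact: lt0r_neq0.
have small k : (k <= `|m|)%N -> k%:R * hs j <= `|m%:~R * hs j|.
  move=> km; rewrite normrM (ger0_norm (ltW h0)) ler_wpM2r ?(ltW h0) //.
  by rewrite -intr_norm -abszE ler_nat.
have bd z : `|z - a| <= `|m%:~R * hs j| ->
    `|u j (z + hs j *: e_ i + hs j *: e_ i) - u j (z + hs j *: e_ i) - (u j (z + hs j *: e_ i) - u j z)|
     <= C * hs j ^+ 2.
  by move=> /hC hz; rewrite E normrM ger0_norm ?exprn_ge0 ?(ltW h0) // mulrC ler_wpM2r // exprn_ge0 // ltW.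
rewrite exprMn -[m%:~R * hs j * _]mulrA Ed mulrA mulrAC.
have K0 : 0 <= C * hs j ^+ 2 by rewrite mulr_ge0 // exprn_ge0 // ltW.
case: m small bd {hC} => m; rewrite ?NegzE /= => small bd.
  have := @second_difference_sum (fun k => u j (a + (k%:R * hs j) *: e_ i)) (u j (a + hs j *: e_ i) - u j a)
    (C * hs j ^+ 2) m K0.
  rewrite mul0r scale0r addr0 mul1r subrr normr0; apply=> // k km.
  have := bd (a + (k%:R * hs j) *: e_ i); rewrite -!addrA -!scalerDl !addrA.
  rewrite -[k.+2%:R]natr1 -[k.+1%:R]natr1 !mulrDl !mul1r; apply.
  rewrite addrC addKr; apply: (le_trans (norm_basis _ _)).
  by rewrite ger0_norm ?mulr_ge0 ?(ltW h0) //; apply: small; lia.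
(* For negative [m] the walk goes backwards from [a]; the first backward difference misses the
   negative of the forward one by a single second difference, centred at [a]. *)
have := @second_difference_sum (fun k => u j (a - (k%:R * hs j) *: e_ i)) (- (u j (a + hs j *: e_ i) - u j a))
    (C * hs j ^+ 2) m.+1 K0.
rewrite mul0r scale0r subr0 mul1r mulNr scaleNr sqrrN mulrN mulNr !opprK; apply=> [|k km].
  have := bd (a - hs j *: e_ i); rewrite !subrK.
  rewrite (_ : u j _ - _ - _ = u j (a - hs j *: e_ i) - u j a + (u j (a + hs j *: e_ i) - u j a)); last by ring.
  apply; rewrite addrC addKr normrN; apply: (le_trans (norm_basis _ _)).
  by rewrite ger0_norm ?(ltW h0) //; have := small 1%N; rewrite mul1r; apply.
have := bd (a - (k.+2%:R * hs j) *: e_ i).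
have Ek l : a - (l.+1%:R * hs j) *: e_ i + hs j *: e_ i = a - (l%:R * hs j) *: e_ i.
  by rewrite -[l.+1%:R]natr1 mulrDl mul1r scalerDl opprD addrA subrK.
rewrite !Ek (_ : u j _ - _ - _ = u j (a - (k.+2%:R * hs j) *: e_ i) - u j (a - (k.+1%:R * hs j) *: e_ i) -
  (u j (a - (k.+1%:R * hs j) *: e_ i) - u j (a - (k%:R * hs j) *: e_ i))); last by ring.
apply; rewrite addrC addKr normrN; apply: (le_trans (norm_basis _ _)).
by rewrite ger0_norm ?mulr_ge0 ?(ltW h0) //; apply: small.
Qed.

Lemma is_derive_quad (f : V -> R) x i (L C r : R) : 0 < r -> 0 <= C ->
  (forall t, t != 0 -> `|t| < r -> `|f (x + t *: e_ i) - f x - t * L| <= C * t ^+ 2) ->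
  is_derive x (e_ i) f L.
Proof.
move=> r0 C0 H.
suff D : h^-1 *: (f (h *: e_ i + x) - f x) @[h --> (0 : R)^'] --> L.
  by apply: DeriveDef; [apply/cvg_ex; exists L|apply/cvg_lim].
apply/cvgrPdist_le => e e0; near=> h.
have h0 : h != 0 by near: h; exact: nbhs_dnbhs_neq.
have hr : `|h| < r by near: h; exact: dnbhs0_lt.
have he : `|h| < e / (C + 1) by near: h; apply: dnbhs0_lt; rewrite divr_gt0 // ltr_pwDr.
have -> : L - h^-1 *: (f (h *: e_ i + x) - f x) = - (h^-1 * (f (x + h *: e_ i) - f x - h * L)).
  by rewrite [x + _]addrC /GRing.scale /=; field.
rewrite normrN normrM normfV mulrC ler_pdivrMr ?normr_gt0 //.
apply: (le_trans (H h h0 hr)); rewrite -[h ^+ 2]real_normK ?num_real // expr2 mulrA ler_wpM2r //.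
move: he; rewrite ltr_pdivlMr ?ltr_pwDr // => he.
have : 0 <= `|h| by [].
lra.
Unshelve. all: by end_near. Qed.

Lemma dlim_bound O u x (M d : R) : disc_family O u -> 
  (\forall j \near \oo, forall z, `|z - x| < d -> `|u j z| <= M) ->
  forall y, O y -> `|y - x| < d -> `|dlim u y| <= M.
Proof.
move=> fu H y Oy yx.
apply: (@ulim_le (fun j => `|u j (fl j y)|) `|dlim u y| M).
  by apply: cvg_norm; exact: dlim_cvg fu Oy.
near=> j; have Hj : forall z, `|z - x| < d -> `|u j z| <= M by near: j.
apply: Hj; have -> : fl j y - x = (fl j y - y) + (y - x) by rewrite addrA subrK.
apply: (le_lt_trans (ler_normD _ _)); have := fl_close j y.
have : hs j <= (d - `|y - x|) / 2 by near: j; apply: hs_small; lra.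
lra.
Unshelve. all: by end_near. Qed.

(** The second difference quotients are bounded independently of the step, so the discrete Taylor
    formula has a remainder [C * t ^+ 2] that survives in the limit. *)
Lemma dlim_derive O u x i : open O -> disc_family O u -> O x ->
  is_derive x (e_ i) (dlim u) (dlim (dq i u) x).
Proof.
move=> oO fu Ox; have fd := disc_family_dq i fu; have fdd := disc_family_dq i fd.
have [d1 [M1 [d10 M10 H1]]] := fd x Ox; have [d2 [M2 [d20 M20 H2]]] := fdd x Ox.
have [r0 r00 rO] := open_ballP oO Ox.
pose r := Num.min r0 (d2 / 4).
have rp : 0 < r by rewrite lt_min r00; lra.
apply: (@is_derive_quad _ _ _ _ (4 * M2 + 1) r rp); first lra.
move=> t t0; rewrite lt_min => /andP[tr td].
have Oxt : O (x + t *: e_ i).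
  by apply: rO; rewrite addrC addKr; apply: le_lt_trans (norm_basis _ _) tr.
have t1 : 0 < `|t| by rewrite normr_gt0.
apply: (@ulim_le (fun j => `|u j (fl j (x + t *: e_ i)) - u j (fl j x) - t * dq i u j (fl j x)|)).
  apply: cvg_norm; apply: cvgB; first by apply: cvgB; [exact: dlim_cvg fu Oxt|exact: dlim_cvg fu Ox].
  by apply: cvgMr; exact: dlim_cvg fd Ox.
near=> j.
have h0 := hs_gt0 j.
have [m Em] := fl_step j x i t.
have hb : `|m%:~R * hs j - t| <= 2 * hs j.
  have := fl_close j (x + t *: e_ i); rewrite Em => c1.
  have c2 := fl_close j x.
  have -> : m%:~R * hs j - t = ((fl j x + (m%:~R * hs j) *: e_ i - (x + t *: e_ i)) - (fl j x - x)) 0 i.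
    by rewrite !mxE !eqxx /= !mulr1; ring.
  by apply: (le_trans (coord_le_norm _ _)); apply: (le_trans (ler_normB _ _)); lra.
have hm : `|m%:~R * hs j| <= `|t| + 2 * hs j.
  have -> : m%:~R * hs j = t + (m%:~R * hs j - t) by ring.
  by apply: (le_trans (ler_normD _ _)); lra.
have h1 : hs j <= d2 / 16 by near: j; apply: hs_small; lra.
have h2 : hs j <= d1 / 2 by near: j; apply: hs_small; lra.
have h3 : hs j <= `|t| / 2 by near: j; apply: hs_small; lra.
(* Rounding replaces [t] by a multiple of the step at distance at most [2 * hs j]. With [t] fixed
   and [j] large, the effect on the linear term is absorbed into [t ^+ 2]. *)
have h4 : hs j <= t ^+ 2 / (2 * M1).
  by near: j; apply: hs_small; rewrite divr_gt0 ?exprn_even_gt0 // mulr_gt0.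
have Hj1 : forall z, `|z - x| < d1 -> `|dq i u j z| <= M1 /\ dq i u j z = avg (hs j) (dq i u j) z by near: j.
have Hj2 : forall z, `|z - x| < d2 -> `|dq i (dq i u) j z| <= M2 /\ dq i (dq i u) j z = avg (hs j) (dq i (dq i u) j) z by near: j.
have b1 : `|dq i u j (fl j x)| <= M1.
  by have [] // := Hj1 (fl j x) _; apply: le_lt_trans (fl_close j x) _; lra.
rewrite Em; have := @lattice_taylor u j (fl j x) i M2 m (ltW M20).
have hz z : `|z - fl j x| <= `|m%:~R * hs j| -> `|dq i (dq i u) j z| <= M2.
  move=> hz; have [] // := Hj2 z _; have -> : z - x = (z - fl j x) + (fl j x - x) by rewrite addrA subrK.
  by apply: (le_lt_trans (ler_normD _ _)); have := fl_close j x; lra.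
move=> /(_ hz); set A := u j _; set B := u j _; set D := dq i u j _ in b1 *; set mh := m%:~R * hs j in hb hm *.
move=> T; have -> : A - B - t * D = (A - B - mh * D) + (mh - t) * D by ring.
apply: (le_trans (ler_normD _ _)); rewrite normrM.
have p1 : `|mh - t| * `|D| <= 2 * hs j * M1 by apply: ler_pM.
have p2 : 2 * hs j * M1 <= t ^+ 2 by move: h4; rewrite ler_pdivlMr ?mulr_gt0 //; lra.
have p3 : mh ^+ 2 <= 4 * t ^+ 2.
  rewrite -[mh ^+ 2]real_normK ?num_real // -[t ^+ 2]real_normK ?num_real //.
  have : `|mh| <= 2 * `|t| by lra.
  have : 0 <= `|mh| by [].
  nra.
have p4 : M2 * mh ^+ 2 <= M2 * (4 * t ^+ 2) by rewrite ler_wpM2l // ltW.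
lra.
Unshelve. all: by end_near. Qed.

Lemma dlim_cont O u x : open O -> disc_family O u -> O x -> {for x, continuous (dlim u)}.
Proof.
move=> oO fu Ox.
have [r0 r00 rO] := open_ballP oO Ox.
have [d [M [d0 M0 H]]] : exists d M : R, [/\ 0 < d, 0 <= M & forall i, forall y, O y -> `|y - x| < d ->
    `|dlim (dq i u) y| <= M].
  apply: (@fin_bound R _ (fun i d M => forall y, O y -> `|y - x| < d -> `|dlim (dq i u) y| <= M)).
    by move=> i d M d' M' h dd MM y Oy yd; apply: le_trans (h y Oy (lt_le_trans yd dd)) MM.
  move=> i; have fd := disc_family_dq i fu; have [d [M [d0 M0 H]]] := fd x Ox.
  exists d, M; split=> //; apply: dlim_bound fd _.
  by apply: filterS H => j Hj z /Hj [].
apply: cont_norm => e e0.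
exists (Num.min (Num.min r0 d) (e / (M * n%:R + 1))) => /=.
  by rewrite !lt_min r00 d0 /= divr_gt0 // ltr_pwDr // mulr_ge0.
move=> y /=; rewrite !lt_min -!andbA => /and3P[y1 y2 y3].
rewrite -{1}(subrK x y) [y - x + x]addrC.
apply: (le_trans (@box_lip R n (dlim u) (fun i => dlim (dq i u)) x (y - x) M M0 _ _)).
- move=> i z zx; apply: dlim_derive fu _ => //; apply: rO; exact: le_lt_trans zx _.
- by move=> i z zx; apply: H; [apply: rO|]; exact: le_lt_trans zx _.
move: y3; rewrite ltr_pdivlMr ?ltr_pwDr ?mulr_ge0 //.
have : 0 <= `|y - x| by [].
lra.
Qed.

Lemma dlim_smooth O u : open O -> disc_family O u -> smooth_on O (dlim u).
Proof.
move=> oO fu; apply: (@smooth_coind R n O (fun f => exists2 u, disc_family O u & f = dlim u)) => //.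
- by move=> f [v fv ->] x Ox; exact: dlim_cont fv Ox.
- move=> f [v fv ->] i; exists (dlim (dq i v)); first by exists (dq i v) => //; exact: disc_family_dq.
  by move=> x Ox; exact: dlim_derive fv Ox.
- by exists u.
Qed.

Lemma dlim_harmonic O u : open O -> disc_family O u -> harmonic_on O (dlim u).
Proof.
move=> oO fu; split; first exact: dlim_smooth.
move=> x Ox.
have E i : iter_pd [:: i; i] (dlim u) x = dlim (dq i (dq i u)) x.
  have P v y : disc_family O v -> O y -> pd i (dlim v) y = dlim (dq i v) y.
    by move=> fv Oy; case: (dlim_derive i oO fv Oy).
  rewrite /= (@pd_congr R n O _ _ i x oO (fun y => P u y fu) Ox) //; exact: P (disc_family_dq i fu) Ox.
under eq_bigr => i _ do rewrite E.
pose s i := dq i (dq i u).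
have fs i : disc_family O (s i) by do 2 apply: disc_family_dq.
have [d [M [d0 M0 H]]] : exists d M : R, [/\ 0 < d, 0 <= M & forall i, 
    \forall j \near \oo, forall z, `|z - x| < d -> `|dq i (s i) j z| <= M].
  apply: (@fin_bound R _ (fun i d M => \forall j \near \oo, forall z, `|z - x| < d -> `|dq i (s i) j z| <= M)).
    move=> i d M d' M' h dd MM; apply: filterS h => j h z zd.
    by apply: le_trans (h z (lt_le_trans zd dd)) MM.
  move=> i; have [d [M [d0 M0 H]]] := disc_family_dq i (fs i) Ox.
  by exists d, M; split=> //; apply: filterS H => j Hj z /Hj [].
have [d1 [M1 [d10 M10 H1]]] := fu x Ox.
apply/eqP; rewrite -normr_le0; apply/ler_addgt0Pl => e e0; rewrite addr0.
apply: (@ulim_le (fun j => `|\sum_i s i j (fl j x)|)).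
  by apply: cvg_norm; apply: cvg_sum_ord => i; exact: dlim_cvg (fs i) Ox.
have Hall : \forall j \near \oo, forall i z, `|z - x| < d -> `|dq i (s i) j z| <= M.
  exact: filter_forall.
near=> j.
have h0 := hs_gt0 j.
have {}Hall' : forall i z, `|z - x| < d -> `|dq i (s i) j z| <= M by near: j.
have Hj1 : forall z, `|z - x| < d1 -> `|u j z| <= M1 /\ u j z = avg (hs j) (u j) z by near: j.
have hd : hs j <= d / 4 by near: j; apply: hs_small; lra.
have hd1 : hs j <= d1 / 4 by near: j; apply: hs_small; lra.
have he : hs j <= e / (n%:R * M + 1) by near: j; apply: hs_small; rewrite divr_gt0 // ltr_pwDr // mulr_ge0.
have hfl := fl_close j x.
(* Shifted back by one step, the forward second quotient becomes the central one, and the central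
   ones add up to zero by discrete harmonicity. Undoing the shift costs [hs j] times a third
   quotient, which is bounded. *)
have sE i z : s i j (z - hs j *: e_ i) = (u j (z + hs j *: e_ i) + u j (z - hs j *: e_ i) - 2 * u j z) / hs j ^+ 2.
  by rewrite /s /dq subrK; field; exact: lt0r_neq0.
have S0 : \sum_i s i j (fl j x - hs j *: e_ i) = 0.
  under eq_bigr => i _ do rewrite sE.
  rewrite -mulr_suml sumrB sumr_const card_ord.
  have [|_ ->] := Hj1 (fl j x); first lra.
  have n1 : n%:R != 0 :> R by rewrite pnatr_eq0 -lt0n.
  by rewrite /avg -mulr_natr; set A := \sum_(i < n) _; field; rewrite lt0r_neq0.
rewrite -[X in `|X|]subr0 -[X in _ - X]S0 -sumrB.
apply: (le_trans (ler_norm_sum _ _ _)).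
apply: (@le_trans _ _ (\sum_(i < n) hs j * M)).
  apply: ler_sum => i _.
  have -> : s i j (fl j x) - s i j (fl j x - hs j *: e_ i) = hs j * dq i (s i) j (fl j x - hs j *: e_ i).
    by rewrite /dq subrK; field; exact: lt0r_neq0.
  rewrite normrM ger0_norm ?(ltW h0) // ler_wpM2l ?(ltW h0) //; apply: Hall'.
  rewrite addrAC; apply: (le_lt_trans (ler_normB _ _)); have := norm_basis (hs j) i.
  by rewrite (ger0_norm (ltW h0)); lra.
rewrite sumr_const card_ord -mulr_natr; move: he; rewrite ler_pdivlMr ?ltr_pwDr ?mulr_ge0 //; lra.
Unshelve. all: by end_near. Qed.
End DiscreteLimit.

(** * The Dirichlet problem *)

Section Dirichlet.
Variables (R : realType) (n : nat).
Local Notation V := 'rV[R]_n.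
Local Notation e_ := (@basis_vec R n).
Implicit Types (x z p nu : V) (O U : set V).

Definition sqd p x : R := \sum_i (x 0 i - p 0 i) ^+ 2.
Definition lin nu p x : R := \sum_i nu 0 i * (x 0 i - p 0 i).

Lemma sqd_ge0 p x : 0 <= sqd p x.
Proof. by apply: sumr_ge0 => i _; rewrite sqr_ge0. Qed.

Lemma sqd_ge_norm p x : `|x - p| ^+ 2 <= sqd p x.
Proof.
rewrite -[leRHS]sqr_sqrtr ?sqd_ge0 // ler_sqr ?nnegrE ?sqrtr_ge0 //.
apply: norm_le_coord => [|i]; first exact: sqrtr_ge0.
rewrite -[leLHS]ger0_norm // -sqrtr_sqr ler_wsqrtr // real_normK ?num_real // !mxE /sqd (bigD1 i) //= lerDl.
by apply: sumr_ge0 => j _; rewrite sqr_ge0.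
Qed.

Lemma sqd_le_norm p x : sqd p x <= n%:R * `|x - p| ^+ 2.
Proof.
rewrite mulr_natl -[n in _ *+ n]card_ord -sumr_const; apply: ler_sum => i _.
have := coord_le_norm (x - p) i; rewrite !mxE => h.
by rewrite -[leLHS]real_normK ?num_real // ler_sqr ?nnegrE.
Qed.

Lemma sqd_shift p x i (t : R) : sqd p (x + t *: e_ i) = sqd p x + (2 * t * (x 0 i - p 0 i) + t ^+ 2).
Proof.
have E y : sqd p y = wq (fun=> 1) p y by apply: eq_bigr => k _; rewrite mul1r.
by rewrite !E wq_shift mul1r.
Qed.

Lemma lin_shift nu p x i (t : R) : lin nu p (x + t *: e_ i) = lin nu p x + t * nu 0 i.
Proof.
rewrite /lin (bigD1 i) //= [in RHS](bigD1 i) //= !mxE !eqxx mulr1.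
rewrite (eq_bigr (fun j => nu 0 j * (x 0 j - p 0 j))); first by ring.
by move=> j ji; rewrite !mxE eqxx (negbTE ji) /= mulr0 addr0.
Qed.

Lemma lin_le nu p x : (forall i, `|nu 0 i| <= 1) -> `|lin nu p x| <= n%:R * `|x - p|.
Proof.
move=> nu1; apply: (le_trans (ler_norm_sum _ _ _)).
rewrite mulr_natl -[n in _ *+ n]card_ord -sumr_const; apply: ler_sum => i _.
rewrite normrM -[leRHS]mul1r ler_pM //.
by have := coord_le_norm (x - p) i; rewrite !mxE.
Qed.

(** A quadratic form of the exterior ball condition at [p], with unit inward normal [nu]. *)
Definition touches_from_outside O p := exists nu (K r : R), [/\ \sum_i nu 0 i ^+ 2 = 1, 0 <= K, 0 < r &
  forall x, O x -> `|x - p| < r -> - (K * sqd p x) <= lin nu p x].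

Hypothesis n0 : (0 < n)%N.

Lemma barrier_ge_arith (A K l q : R) : 0 <= K -> 0 <= q -> - (K * q) <= l -> A * `|l| <= 1 ->
  q <= l - A * l ^+ 2 + (2 * K + 1) * q.
Proof.
move=> K0 q0 lK Al1.
have Al2 : A * l ^+ 2 <= `|l|.
  by rewrite -[l ^+ 2]real_normK ?num_real // expr2 mulrA -[leRHS]mul1r ler_wpM2r.
have : 0 <= K * q by rewrite mulr_ge0.
by case: (ger0P l) Al2 => _; nra.
Qed.

Lemma barrier_shift_arith (A B l m q t y : R) : 0 <= A -> 0 <= B -> `|m| <= 1 -> `|y| <= 1 -> `|t| <= 1 ->
  A * `|l| <= 1 -> 0 <= l - A * l ^+ 2 + B * q ->
  - ((3 + A + 2 * B) * `|t|) <= l + t * m - A * (l + t * m) ^+ 2 + B * (q + (2 * t * y + t ^+ 2)).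
Proof.
move=> A0 B0 m1 y1 t1 Al1 hp.
have b1 : `|t * m| <= `|t| by rewrite normrM ler_piMr.
have b2 : `|A * l * (t * m)| <= `|t|.
  by rewrite normrM -[leRHS]mul1r ler_pM // normrM (ger0_norm A0).
have b3 : (t * m) ^+ 2 <= `|t|.
  by rewrite -real_normK ?num_real // expr2 -[leRHS]mul1r ler_pM // (le_trans b1).
have b4 : `|t * y| <= `|t| by rewrite normrM ler_piMr.
have b5 : A * (t * m) ^+ 2 <= A * `|t| by rewrite ler_wpM2l.
have b6 : B * - `|t| <= B * (t * y).
  by rewrite ler_wpM2l // lerNl; apply: le_trans b4; rewrite -normrN ler_norm.
have b7 : 0 <= B * t ^+ 2 by rewrite mulr_ge0 ?sqr_ge0.
move: b1 b2; rewrite !ler_norml => /andP[b1 _] /andP[_ b2].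
have -> : l + t * m - A * (l + t * m) ^+ 2 + B * (q + (2 * t * y + t ^+ 2)) =
  (l - A * l ^+ 2 + B * q) + t * m - 2 * (A * l * (t * m)) - A * (t * m) ^+ 2 + 2 * (B * (t * y)) + B * t ^+ 2 by ring.
lra.
Qed.

(* Barrier [l - A l^2 + B q]: a quadratic polynomial, so its discrete Laplacian is exact *)
Lemma perron_bdry O p (g : V -> R) (M e : R) (u : nat -> V -> R) : touches_from_outside O p ->
  0 < e -> {for p, continuous g} -> (forall x, `|g x| <= M) -> (forall j x, `|u j x| <= M) ->
  (forall j x, O x -> u j x = avg (hs R j) (u j) x) -> (forall j x, ~ O x -> u j x = g x) ->
  exists2 d : R, 0 < d & \forall j \near \oo, forall x, `|x - p| < d -> u j x <= g p + e.
Proof.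
move=> [nu [K [r [nu1 K0 r0 hO]]]] e0 gc gM uM ua ug.
have nui i : `|nu 0 i| <= 1.
  rewrite -(@ler_sqr _ `|nu 0 i| 1) ?nnegrE // real_normK ?num_real // expr1n -nu1 (bigD1 i) //= lerDl.
  by apply: sumr_ge0 => j _; rewrite sqr_ge0.
have n1 : 1 <= n%:R :> R by rewrite ler1n.
have nn0 : n%:R != 0 :> R by rewrite pnatr_eq0 -lt0n.
have M0 : 0 <= M := le_trans (normr_ge0 _) (gM p).
have e3 : 0 < e / 4 by lra.
have [r1 r10 hg] := cont_normP gc e3.
(* [B] compensates the curvature loss [K], so that the barrier is at least [sqd p] on [O] near [p];
   [A] is chosen so that the mean of the barrier drops by exactly [h ^+ 2 / n]. *)
pose B := 2 * K + 1; pose A := n%:R * B + 1.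
have B1 : 1 <= B by rewrite /B lerDr mulr_ge0.
have A1 : 1 <= A by rewrite /A lerDr mulr_ge0 // (le_trans ler01).
pose r2 := Num.min (Num.min (r / 2) (r1 / 2)) (Num.min (1 / 2) ((A * n%:R)^-1 / 2)).
have An : 0 < (A * n%:R)^-1 by rewrite invr_gt0 mulr_gt0 //; lra.
have r20 : 0 < r2 by rewrite !lt_min; lra.
have [r2r [r2r1 [r2h r2A]]] : r2 <= r / 2 /\ r2 <= r1 / 2 /\ r2 <= 1 / 2 /\ r2 <= (A * n%:R)^-1 / 2.
  by rewrite /r2 !ge_min !lexx !orbT.
pose psi x := lin nu p x - A * lin nu p x ^+ 2 + B * sqd p x.
have Al x : `|x - p| <= (A * n%:R)^-1 -> A * `|lin nu p x| <= 1.
  move=> xA; have := lin_le p x nui => h.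
  have : A * `|lin nu p x| <= A * (n%:R * `|x - p|) by rewrite ler_wpM2l //; lra.
  have : A * n%:R * `|x - p| <= A * n%:R * (A * n%:R)^-1 by rewrite ler_wpM2l // mulr_ge0 //; lra.
  rewrite divff; first by move=> a b; apply: (le_trans b); rewrite mulrA.
  by rewrite mulf_neq0 //; lra.
have small a : a < r2 -> a < r /\ a <= (A * n%:R)^-1.
  move=> ar; split; first by apply: lt_le_trans ar (le_trans r2r _); rewrite ler_pdivrMr // ler_peMr ?ler1n // ltW.
  by apply: le_trans (ltW ar) (le_trans r2A _); rewrite ler_pdivrMr // ler_peMr ?ler1n // ltW.
have psi_ge x : O x -> `|x - p| < r /\ `|x - p| <= (A * n%:R)^-1 -> sqd p x <= psi x.
  by move=> Ox [xr xA]; apply: barrier_ge_arith; [|exact: sqd_ge0|exact: hO|exact: Al].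
have B0 : 0 <= B := le_trans ler01 B1.
have A0 : 0 <= A := le_trans ler01 A1.
have r21 : r2 <= 1 by apply: le_trans r2h _; rewrite ler_pdivrMr // mul1r ler1n.
pose C := 3 + A + 2 * B.
have psi_nb x i (t : R) : O x -> `|x - p| < r2 -> `|t| <= 1 -> - (C * `|t|) <= psi (x + t *: e_ i).
  move=> Ox xr t1; rewrite /psi lin_shift sqd_shift; apply: barrier_shift_arith => //.
  - have := coord_le_norm (x - p) i; rewrite !mxE => /le_trans; apply.
    exact: le_trans (ltW xr) r21.
  - exact: Al (small _ xr).2.
  - exact: le_trans (sqd_ge0 p x) (psi_ge x Ox (small _ xr)).
have psi_avg h x : avg h psi x = psi x - h ^+ 2 / n%:R.
  have E i : psi (x + h *: e_ i) + psi (x - h *: e_ i) =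
      (2 * psi x + 2 * h ^+ 2 * B) - 2 * A * h ^+ 2 * nu 0 i ^+ 2.
    by rewrite -scaleNr /psi !lin_shift !sqd_shift; ring.
  rewrite /avg; under eq_bigr => i _ do rewrite E.
  by rewrite sumrB sumr_const card_ord -mulr_sumr nu1 -mulr_natr /A; field.
pose T := (2 * M + 1) / r2 ^+ 2.
have T0 : 0 < T by rewrite divr_gt0 ?exprn_gt0 //; lra.
pose C' := (n%:R + B * n%:R).
have n00 : 0 < n%:R :> R := lt_le_trans ltr01 n1.
have C'0 : 0 < C' by rewrite /C' ltr_pwDl // mulr_ge0 // ltW.
have C1 : 0 < C + 1 by move: A0 B0; rewrite /C; move: (A) (B) => a b; clear; lra.
have TC : 0 < 4 * T * (C + 1) by rewrite mulr_gt0 // mulr_gt0.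
have TC' : 0 < 4 * T * C' by rewrite mulr_gt0 // mulr_gt0.
exists (Num.min r2 (e / (4 * T * C'))).
  by rewrite lt_min r20 /= divr_gt0 // mulr_gt0 // mulr_gt0.
near=> j.
have h0 := @hs_gt0 R j.
have hr : hs R j <= r2 by near: j; exact: hs_small.
have hC : hs R j <= e / (4 * T * (C + 1)) by near: j; apply: hs_small; rewrite divr_gt0.
set h := hs R j in h0 hr hC *.
have habs : `|h| = h by rewrite ger0_norm // ltW.
have yr y x : `|y - p| <= `|x - p| + h -> `|x - p| < r2 -> `|y - p| < r2 + r2.
  by move=> yb xr; apply: le_lt_trans yb _; exact: ltr_leD.
have y_r y x : `|y - p| <= `|x - p| + h -> `|x - p| < r2 -> `|y - p| < r.
  by move=> yb xr; apply: lt_le_trans (yr y x yb xr) _; rewrite [r]splitr lerD.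
have y_r1 y x : `|y - p| <= `|x - p| + h -> `|x - p| < r2 -> `|y - p| < r1.
  by move=> yb xr; apply: lt_le_trans (yr y x yb xr) _; rewrite [r1]splitr lerD.
have y_A y x : `|y - p| <= `|x - p| + h -> `|x - p| < r2 -> `|y - p| <= (A * n%:R)^-1.
  by move=> yb xr; apply: le_trans (ltW (yr y x yb xr)) _; rewrite [leRHS]splitr lerD.
pose D := [set x | O x /\ `|x - p| < r2].
pose Psi x := u j x - g p - e / 2 - T * psi x.
have main : forall x, D x -> Psi x <= 0.
  apply: (@disc_comparison R n n0 h (T * h ^+ 2 / n%:R) (2 * M) D Psi).
  - by rewrite divr_gt0 ?ltr0n // mulr_gt0 // exprn_gt0.
  - move=> x [Ox xr]; have b := psi_ge x Ox (small _ xr); have a := sqd_ge0 p x.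
    have : 0 <= T * psi x by rewrite mulr_ge0 ?(ltW T0) // (le_trans a b).
    move: (uM j x) (gM p) (ltW e0); rewrite /Psi !ler_norml; move: (T * psi x) (u j x) (g p) => c' a' b'.
    by clear => /andP[? ?] /andP[? ?] ? ?; lra.
  - move=> x [Ox xr] _.
    have -> : Psi = (fun x => (u j x + (- T) * psi x) + (- g p - e / 2)).
      by apply/funext => y; rewrite /Psi; ring.
    rewrite avgD (avgD h (u j)) avgZ avg_cst // psi_avg -(ua j x Ox).
    by rewrite le_eqVlt; apply/orP; left; apply/eqP; ring.
  - move=> x i [Ox xr] _.
    have nb t : `|t| = h -> D (x + t *: e_ i) \/ Psi (x + t *: e_ i) <= 0.
      move=> th; set y := x + t *: e_ i.
      have yb : `|y - p| <= `|x - p| + h.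
        rewrite /y addrAC; apply: (le_trans (ler_normD _ _)); rewrite lerD2l -th; exact: norm_basis.
      have [Oy|Oy] := pselect (O y).
        have [yp|yp] := ltP `|y - p| r2; first by left.
        right; have hp := psi_ge y Oy (conj (y_r y x yb xr) (y_A y x yb xr)).
        have : T * r2 ^+ 2 <= T * psi y.
          rewrite ler_wpM2l ?(ltW T0) //; apply: le_trans hp; apply: le_trans (sqd_ge_norm p y).
          by rewrite ler_sqr ?nnegrE ?(ltW r20).
        rewrite /T divfK ?expf_neq0 ?lt0r_neq0 // -/T /Psi.
        move: (uM j y) (gM p) (ltW e0); rewrite !ler_norml; move: (T * psi y) (u j y) (g p) => c' a' b'.
        by clear => /andP[? ?] /andP[? ?] ? ?; lra.
      right; rewrite /Psi ug //.
      have t1 : `|t| <= 1 by rewrite th; exact: le_trans hr r21.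
      have := psi_nb x i t Ox xr t1; rewrite -/y th => hp.
      have : T * - (C * h) <= T * psi y by rewrite ler_wpM2l // ltW.
      have : T * (C + 1) * h <= e / 4.
        by move: hC; rewrite ler_pdivlMr // mulrA; move: (T) (C) (h) => a b c; clear; lra.
      have := hg y (y_r1 y x yb xr); rewrite ler_norml => /andP[_].
      have : 0 <= T * h by rewrite mulr_ge0 // ltW.
      by move: (psi y) (g y) (g p) (T) (C) (h) => a b c a' b' c'; clear; lra.
    split; first exact: nb.
    by rewrite -scaleNr; apply: nb; rewrite normrN.
move=> x; rewrite lt_min => /andP[xr xd].
have [Ox|Ox] := pselect (O x); last first.
  have xr1 : `|x - p| < r1.
    by apply: lt_le_trans xr (le_trans r2r1 _); rewrite ler_pdivrMr // ler_peMr ?ler1n // ltW.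
  rewrite ug //; have := hg x xr1; rewrite ler_norml => /andP[_]; move: (ltW e0).
  by move: (g x) (g p) => a b; clear; lra.
have := main x (conj Ox xr); rewrite /Psi.
have : psi x <= C' * `|x - p|.
  have -> : C' * `|x - p| = n%:R * `|x - p| + B * (n%:R * `|x - p|) by rewrite /C'; ring.
  rewrite /psi.
  have a1 : lin nu p x <= n%:R * `|x - p| := le_trans (ler_norm _) (lin_le p x nui).
  have a2 : B * sqd p x <= B * (n%:R * `|x - p|).
    rewrite ler_wpM2l //; apply: (le_trans (sqd_le_norm p x)); rewrite ler_wpM2l // expr2 ler_piMr //.
    exact: le_trans (ltW xr) r21.
  have : 0 <= A * lin nu p x ^+ 2 by rewrite mulr_ge0 ?sqr_ge0.
  move: a1 a2; move: (A * lin nu p x ^+ 2) (B * sqd p x) (B * _) (lin nu p x) (n%:R * _) => a b c a' b'; clear; lra.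
move=> h1; have : T * psi x <= T * (C' * `|x - p|) by rewrite ler_wpM2l // ltW.
move: xd h1 (ltW e0); rewrite ltr_pdivlMr //.
by move: (u j x) (psi x) (T) (C') (g p) `|x - p| => a b c a' b' c'; clear; lra.
Unshelve. all: by end_near. Qed.

(** The boundary estimate of [perron_bdry] holds on a neighbourhood that does not depend on the
    step, so it passes to the limit; applied to [u] and to [- u] it gives continuity at the
    boundary. *)
Theorem dirichlet O (g : V -> R) (M : R) : open O -> (forall p, bdry O p -> touches_from_outside O p) ->
  (forall x, `|g x| <= M) -> (forall p, bdry O p -> {for p, continuous g}) ->
  exists w, [/\ harmonic_on O w, forall x, ~ O x -> w x = g x,
     forall p, bdry O p -> {for p, continuous w} & forall x, `|w x| <= M].
Proof.
move=> oO hO gM gc.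
have [G [GU Goo]] := @ultraFilterLemma nat \oo _.
have ps j := @perron_solution R n n0 (hs R j) M O g gM.
pose u j := sval (cid (ps j)).
have uM j x : `|u j x| <= M by rewrite /u; case: cid => v [].
have ua j x : O x -> u j x = avg (hs R j) (u j) x by move=> Ox; rewrite /u; case: cid => v /= [_ h _]; exact: h.
have ug j x : ~ O x -> u j x = g x by move=> Ox; rewrite /u; case: cid => v /= [_ _ h]; exact: h.
have fu : disc_family O u.
  move=> x Ox; have [d d0 hd] := open_ballP oO Ox; exists d, (M + 1); split=> //.
    by have := le_trans (normr_ge0 _) (gM x); lra.
  near=> j => z zx; split; last by apply: ua; exact: hd.
  by apply: (le_trans (uM j z)); lra.
pose w x := if `[< O x >] then dlim G u x else g x.
have wO x : O x -> w x = dlim G u x by move=> Ox; rewrite /w asboolT.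
have wg x : ~ O x -> w x = g x by move=> Ox; rewrite /w asboolF.
have wM x : `|w x| <= M.
  have [Ox|Ox] := pselect (O x); last by rewrite wg.
  rewrite wO //; apply: (@dlim_bound R n G GU Goo O u x M 1 fu) => //; last by rewrite subrr normr0.
  by near=> j => z _; exact: uM.
exists w; split=> //.
- have := dlim_harmonic n0 GU Goo oO fu; move=> [sm hm]; split.
    by apply: smooth_congr sm => // y Oy; rewrite wO.
  move=> x Ox; rewrite -[RHS](hm x Ox); apply: eq_bigr => i _.
  exact: (@iter_pd_congr R n O w (dlim G u) oO wO).
- move=> p bp; apply: cont_norm => e e0.
  have Op : ~ O p by case: bp.
  have [d1 d10 H1] := perron_bdry (hO p bp) e0 (gc p bp) gM uM ua ug.
  have [d2 d20 H2] : exists2 d : R, 0 < d & \forall j \near \oo, forall x, `|x - p| < d -> - u j x <= - g p + e.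
    apply: (@perron_bdry O p (fun x => - g x) M e (fun j x => - u j x)) => //; first exact: hO.
    - by apply: continuousN; exact: gc.
    - by move=> x; rewrite normrN.
    - by move=> j x; rewrite normrN.
    - move=> j x Ox; rewrite (ua j x Ox) -mulN1r -avgZ; congr (avg _ _ x).
      by apply/funext => y; rewrite mulN1r.
    - by move=> j x Ox; rewrite ug.
  have [d3 d30 H3] := cont_normP (gc p bp) e0.
  exists (Num.min (Num.min d1 d2) d3); first by rewrite !lt_min d10 d20 d30.
  move=> x; rewrite !lt_min -andbA => /and3P[x1 x2 x3]; rewrite (wg p Op).
  have [Ox|Ox] := pselect (O x); last by rewrite (wg x Ox); exact: H3.
  rewrite wO //.
  apply: (@ulim_le R G GU Goo (fun j => `|u j (fl j x) - g p|)).
    by apply: cvg_norm; apply: cvgB; [exact: dlim_cvg fu Ox|exact: cvg_cst].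
  near=> j.
  have K1 : forall x, `|x - p| < d1 -> u j x <= g p + e by near: j.
  have K2 : forall x, `|x - p| < d2 -> - u j x <= - g p + e by near: j.
  have hf : `|fl j x - p| <= `|x - p| + hs R j.
    have -> : fl j x - p = (fl j x - x) + (x - p) by rewrite addrA subrK.
    by apply: (le_trans (ler_normD _ _)); rewrite addrC lerD2l; exact: fl_close.
  have s1 : hs R j <= (d1 - `|x - p|) / 2 by near: j; apply: hs_small; lra.
  have s2 : hs R j <= (d2 - `|x - p|) / 2 by near: j; apply: hs_small; lra.
  have := K1 (fl j x) ltac:(lra); have := K2 (fl j x) ltac:(lra).
  by rewrite ler_norml => a b; apply/andP; split; lra.
Unshelve. all: by end_near. Qed.
End Dirichlet.

(** * Maximum principle and interior gradient estimates *)

Section MaximumPrinciple.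
Variables (R : realType).

Lemma derive_pos_right (g : R -> R) (t0 l : R) : is_derive t0 1 g l -> 0 < l ->
  exists2 r : R, 0 < r & forall t, 0 < t -> t < r -> g t0 < g (t0 + t).
Proof.
move=> [dg <-] l0; move: dg; rewrite /derivable => /cvg_ex[/= m hm].
have E : 'D_1 g t0 = m by apply: cvg_lim hm.
rewrite E in l0; have /cvgrPdist_lt /(_ _ l0) [r /= r0 h] := hm.
exists r => // t t1 tr.
have := h t; rewrite /ball_ /= sub0r normrN (gtr0_norm t1) => /(_ tr (lt0r_neq0 t1)).
rewrite ltr_norml => /andP[_]; rewrite ltrBlDr ltrDl /GRing.scale /= mulr1 [t + t0]addrC.
by rewrite pmulr_rgt0 ?invr_gt0 // subr_gt0.
Qed.

(** A second derivative at 0, meant for restrictions to lines parallel to the axes. Stated for one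
    variable, it adds up directly for differences with mirror images and for polynomials. *)
Definition d2 (g : R -> R) (l : R) := exists2 g1 : R -> R,
  (exists2 r : R, 0 < r & forall t : R, `|t| < r -> is_derive t 1 g (g1 t)) & is_derive (0 : R) 1 g1 l.

Lemma is_derive_comp_real (g phi : R -> R) (t l m : R) : is_derive t 1 phi l ->
  is_derive (phi t) 1 g m -> is_derive t 1 (g \o phi) (m * l).
Proof.
move=> dp dg.
have p1 := @ex_derive _ _ _ _ _ _ _ dp; have g1 := @ex_derive _ _ _ _ _ _ _ dg.
apply: DeriveDef.
  apply/derivable1_diffP; apply: differentiable_comp; exact/derivable1_diffP.
rewrite -derive1E [LHS](@derive1_comp R phi g t p1 g1) !derive1E.
by rewrite (@derive_val _ _ _ _ _ _ _ dg) (@derive_val _ _ _ _ _ _ _ dp).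
Qed.

Lemma is_derive_opp_arg (g : R -> R) (t l : R) : is_derive (- t) 1 g l ->
  is_derive t 1 (fun s => g (- s)) (- l).
Proof.
move=> dg; have dN : is_derive t 1 (fun s : R => - s) (- 1).
  by apply: is_deriveN; exact: is_derive_id.
by rewrite -mulrN1; exact: (is_derive_comp_real dN dg).
Qed.

Lemma d2_max (g : R -> R) (l r : R) : d2 g l -> 0 < r ->
  (forall t, `|t| < r -> g t <= g 0) -> l <= 0.
Proof.
move=> [g1 [r1 r10 dg] dg1] r0 gm; rewrite leNgt; apply/negP => l0.
have dg0 : is_derive (0 : R) 1 g (g1 0) by apply: dg; rewrite normr0.
have g10 : g1 0 = 0.
  apply/eqP; rewrite eq_le; apply/andP; split; rewrite leNgt; apply/negP => h.
    have [r2 r20 H] := derive_pos_right dg0 h.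
    have m0 : 0 < Num.min r r2 / 2 by rewrite divr_gt0 // lt_min r0.
    have ml : Num.min r r2 / 2 < Num.min r r2 by lra.
    have := H _ m0 (lt_le_trans ml _); rewrite ge_min lexx orbT add0r => /(_ isT).
    by rewrite ltNge gm // gtr0_norm // (lt_le_trans ml) // ge_min lexx.
  have dN : is_derive (0 : R) 1 (fun t => g (- t)) (- g1 0) by apply: is_derive_opp_arg; rewrite oppr0.
  have [|r2 r20 H] := derive_pos_right dN; first by rewrite oppr_gt0.
  have m0 : 0 < Num.min r r2 / 2 by rewrite divr_gt0 // lt_min r0.
  have ml : Num.min r r2 / 2 < Num.min r r2 by lra.
  have := H _ m0 (lt_le_trans ml _); rewrite ge_min lexx orbT add0r oppr0 => /(_ isT).
  by rewrite ltNge gm // normrN gtr0_norm // (lt_le_trans ml) // ge_min lexx.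
have [r2 r20 H] := derive_pos_right dg1 l0.
pose m := Num.min r (Num.min r1 r2); pose t := m / 2.
have mp : 0 < m by rewrite !lt_min r0 r10.
have [tr [tr1 tr2]] : t < r /\ t < r1 /\ t < r2.
  have ml : t < m by rewrite /t; lra.
  by split; [|split]; apply: (lt_le_trans ml); rewrite !ge_min lexx ?orbT.
have t0 : 0 < t by rewrite /t; lra.
have [s||c] := @MVT R g g1 0 t t0.
- rewrite in_itv /= => /andP[s0 st]; apply: dg; rewrite gtr0_norm //; exact: lt_trans tr1.
- apply: continuous_in_subspaceT => s; rewrite inE /= in_itv /= => /andP[s0 st].
  by apply: is_derive1_cont (dg s _); rewrite ger0_norm //; exact: le_lt_trans tr1.
rewrite in_itv /= subr0 => /andP[c0 ct] E.
have : 0 < g1 c * t.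
  have := H c c0 (lt_trans ct tr2); rewrite add0r g10 => gc; exact: mulr_gt0.
by rewrite -E subr_gt0 ltNge gm // gtr0_norm.
Qed.

Lemma d2D g h l m : d2 g l -> d2 h m -> d2 (fun t => g t + h t) (l + m).
Proof.
move=> [g1 [r r0 dg] dg1] [h1 [s s0 dh] dh1]; exists (fun t => g1 t + h1 t).
  exists (Num.min r s); first by rewrite lt_min r0.
  by move=> t; rewrite lt_min => /andP[tr ts]; apply: is_deriveD; [exact: dg|exact: dh].
exact: is_deriveD.
Qed.

Lemma d2Z (c : R) g l : d2 g l -> d2 (fun t => c * g t) (c * l).
Proof.
move=> [g1 [r r0 dg] dg1]; exists (fun t => c * g1 t); last exact: is_deriveZ1.
by exists r => // t tr; apply: is_deriveZ1; exact: dg.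
Qed.

Lemma d2N_arg g l : d2 g l -> d2 (fun t => g (- t)) l.
Proof.
move=> [g1 [r r0 dg] dg1]; exists (fun t => - g1 (- t)).
  exists r => // t tr; apply: is_derive_opp_arg; apply: dg; by rewrite normrN.
rewrite -[l]opprK; apply: is_deriveN; apply: is_derive_opp_arg; by rewrite oppr0.
Qed.

Lemma d2_quad (a b c : R) : d2 (fun t => a + b * t + c * t ^+ 2) (2 * c).
Proof.
have dX (t : R) : is_derive t 1 (fun s : R => s ^+ 2) (2 * t).
  apply: is_derive_ext (@is_deriveX R R^o (fun s : R => s) 2 t 1 1 (is_derive_id t 1)) => //.
  by rewrite /GRing.scale /= expr1 mulr1 -mulr_natl.
have dI (t : R) : is_derive t 1 (fun s : R => b * s) (b * 1).
  by apply: is_deriveZ1; exact: is_derive_id.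
exists (fun t => b + 2 * c * t).
  exists 1 => // t _.
  apply: is_derive_ext (is_deriveD (is_deriveD (is_derive_cst a t 1) (dI t)) (is_deriveZ1 c (dX t))) => //.
  by rewrite add0r mulr1; ring.
have dJ : is_derive (0 : R) 1 (fun s : R => 2 * c * s) (2 * c * 1).
  by apply: is_deriveZ1; exact: is_derive_id.
apply: is_derive_ext (is_deriveD (is_derive_cst b (0 : R) (1 : R)) dJ) => //.
by rewrite add0r mulr1.
Qed.

End MaximumPrinciple.

#[local] Opaque pd.

(** * The maximum principle on compact sets and the interior gradient estimate *)

Section InteriorGradient.
Variables (R : realType) (n : nat).
Local Notation V := 'rV[R]_n.
Local Notation e_ := (@basis_vec R n).
Implicit Types (x z : V) (U : set V) (f H : V -> R).

Definition lap f x : R := \sum_(j < n) pd j (pd j f) x.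

Lemma smooth_d2 U f x j : open U -> smooth_on U f -> U x ->
  d2 (fun t => f (x + t *: e_ j)) (pd j (pd j f) x).
Proof.
move=> oU sf Ux; have [r r0 rU] := open_ballP oU Ux.
exists (fun t => pd j f (x + t *: e_ j)).
  exists r => // t tr; apply: is_derive_line; apply: (smooth_derive j sf); apply: rU.
  by rewrite addrC addKr; exact: le_lt_trans (norm_basis _ _) tr.
by apply: is_derive_line; rewrite scale0r addr0; apply: (smooth_derive j (smooth_pd j sf)).
Qed.

(** Only points with [H > 0] have to be interior along the axes and to have a positive Laplacian. In
    applications the boundary of [K] is excluded by showing that [H] is nonpositive there. *)
Lemma max_principle (K : set V) H : compact K -> {within K, continuous H} ->
  (forall x, K x -> 0 < H x -> (exists2 r : R, 0 < r & forall j t, `|t| < r -> K (x + t *: e_ j)) /\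
     exists2 l : 'I_n -> R, (forall j, d2 (fun t => H (x + t *: e_ j)) (l j)) & 0 < \sum_j l j) ->
  forall x, K x -> H x <= 0.
Proof.
move=> cK cH hK x0 Kx0.
have [c] := EVT_max_rV (ex_intro K x0 Kx0) cK cH; rewrite inE => Kc cmax.
apply: (@le_trans _ _ (H c)); first by apply: cmax; rewrite inE.
rewrite leNgt; apply/negP => Hc; have [[r r0 rK] [l dl]] := hK c Kc Hc.
apply/negP; rewrite -leNgt; apply: sumr_le0 => j _.
apply: (d2_max (dl j) r0) => t tr; rewrite scale0r addr0; apply: cmax; rewrite inE; exact: rK.
Qed.

Lemma compact_box (K : set V) (M : R) : closed K -> (forall x, K x -> `|x| <= M) -> compact K.
Proof.
move=> cK bK; apply: bounded_closed_compact => //; exists M; split; first exact: num_real.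
by move=> N MN x Kx; apply: le_trans (bK x Kx) (ltW MN).
Qed.

Lemma closed_le_fun f g : continuous f -> continuous g -> closed [set x : V | f x <= g x].
Proof.
move=> cf cg; rewrite (_ : [set x | _] = (fun x => g x - f x) @^-1` [set t | 0 <= t]).
  apply: closed_comp; last exact: (@closed_ge R).
  by move=> x _; apply: continuousB; [exact: cg|exact: cf].
by apply/seteqP; split => x /=; rewrite subr_ge0.
Qed.

(* Comparison on the half cube of the difference of [f] with its mirror image, as in Gilbarg and Trudinger *)
Lemma interior_gradient U f x i (d M N : R) : open U -> smooth_on U f -> 0 < d -> 0 < M ->
  (forall z, `|z - x| <= d -> U z) -> (forall z, `|z - x| <= d -> `|f z| <= M) ->
  (forall z, `|z - x| <= d -> `|lap f z| <= N) ->
  `|pd i f x| <= 2 * n%:R * M / d + d * N.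
Proof.
move=> oU; wlog suff W : f / (smooth_on U f -> 0 < d -> 0 < M ->
  (forall z, `|z - x| <= d -> U z) -> (forall z, `|z - x| <= d -> `|f z| <= M) ->
  (forall z, `|z - x| <= d -> `|lap f z| <= N) -> pd i f x <= 2 * n%:R * M / d + d * N).
  move=> sf d0 M0 dU fM fN; have Ux : U x by apply: dU; rewrite subrr normr0 ltW.
  rewrite ler_norml W // andbT lerNl.
  have := W (fun z => - f z) (smoothN oU sf) d0 M0 dU; rewrite (pdN i sf Ux); apply.
    by move=> z zd; rewrite normrN; exact: fM.
  move=> z zd; have -> : lap (fun z => - f z) z = - lap f z; last by rewrite normrN; exact: fN.
  rewrite /lap -sumrN; apply: eq_bigr => j _.
  rewrite (@pd_congr R n U _ (fun y => - pd j f y) j z oU _ (dU z zd)).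
    by rewrite (pdN _ (smooth_pd j sf)) //; exact: dU.
  by move=> y Uy; rewrite (pdN _ sf).
move=> sf d0 M0 dU fM fN.
have Ux : U x by apply: dU; rewrite subrr normr0 ltW.
have n0 : (0 < n)%N := leq_ltn_trans (leq0n _) (ltn_ord i).
have nn : 1 <= n%:R :> R by rewrite ler1n.
pose eta z := z 0 i - x 0 i.
pose Rf z : V := z - (2 * eta z) *: e_ i.
pose w (k : 'I_n) : R := if k == i then - n%:R else 1.
pose c := 2 * M / d ^+ 2.
have c0 : 0 < c by rewrite divr_gt0 ?mulr_gt0 // exprn_gt0.
(* The last term has Laplacian [- 2 * N] and absorbs the Laplacians of [f] at [z] and at its mirror
   image; the first term has Laplacian [- 2 * c], which leaves a strict inequality. *)
pose psi z := c * (wq w x z + 2 * n%:R * d * eta z) + N * (2 * d * eta z - eta z ^+ 2).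
pose H z := f z - f (Rf z) - psi z.
pose K := [set z : V | `|z - x| <= d /\ 0 <= eta z].
have N0 : 0 <= N := le_trans (normr_ge0 _) (fN x ltac:(by rewrite subrr normr0 ltW)).
have etaS z t j : eta (z + t *: e_ j) = eta z + (if j == i then t else 0).
  by rewrite /eta !mxE eqxx eq_sym /=; case: eqP => _; rewrite ?mulr1 ?mulr0; ring.
have RfS z t j : Rf (z + t *: e_ j) = Rf z + (if j == i then - t else t) *: e_ j.
  rewrite /Rf etaS; case: eqP => [->|_]; last by rewrite addr0 addrAC.
  by apply/rowP => k; rewrite !mxE; ring.
have Rfn z : `|Rf z - x| <= `|z - x|.
  apply: norm_le_coord => // k; rewrite !mxE eqxx /=.
  have := coord_le_norm (z - x) k; rewrite !mxE.
  have [->|_] := eqVneq k i; last by rewrite mulr0 subr0.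
  by rewrite mulr1 -[X in _ -> X <= _]normrN (_ : - (z 0 i - 2 * eta z - x 0 i) = z 0 i - x 0 i) // /eta; ring.
have cont_coord k : continuous (fun z : V => z 0 k) by move=> z; exact: coord_cont.
have cE : continuous eta.
  by move=> z; apply: continuousB; [exact: cont_coord|exact: cst_continuous].
have seta : smooth_on setT eta.
  by apply: smoothB; [exact: openT|exact: smooth_coord openT|exact: smooth_cst openT].
have swq : smooth_on setT (wq w x).
  apply: smooth_sum => [|k]; first exact: openT.
  apply: smoothZ; first exact: openT.
  have sk : smooth_on setT (fun z : V => z 0 k - x 0 k).
    by apply: smoothB; [exact: openT|exact: smooth_coord openT|exact: smooth_cst openT].
  exact: (smoothM openT sk sk).
have spsi : smooth_on setT psi.
  apply: smoothD; first exact: openT.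
    apply: smoothZ; first exact: openT.
    by apply: smoothD => //; [exact: openT|apply: smoothZ => //; exact: openT].
  apply: smoothZ; first exact: openT.
  apply: smoothB; first exact: openT.
    by apply: smoothZ => //; exact: openT.
  exact: (smoothM openT seta seta).
have contH : {within K, continuous H}.
  apply: continuous_in_subspaceT => z; rewrite inE => -[zd _].
  have c1 : {for z, continuous f} := smooth_cont sf (dU z zd).
  have c2 : {for z, continuous (fun y => f (Rf y))}.
    apply: cont_norm => e e0.
    have [r r0 hr] := cont_normP (smooth_cont sf (dU _ (le_trans (Rfn z) zd))) e0.
    exists r => // y yr; apply: hr; apply: le_lt_trans yr.
    apply: norm_le_coord => // k; rewrite !mxE !eqxx /=.
    have := coord_le_norm (y - z) k; rewrite !mxE.
    have [->|_] := eqVneq k i; last by rewrite !mulr0 !subr0.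
    rewrite !mulr1 -[X in _ -> X <= _]normrN.
    by rewrite (_ : - (y 0 i - 2 * eta y - (z 0 i - 2 * eta z)) = y 0 i - z 0 i) // /eta; ring.
  have c3 : {for z, continuous psi} := smooth_cont spsi I.
  exact: (continuousB (continuousB c1 c2) c3).
have main : forall z, K z -> H z <= 0.
  apply: (@max_principle K H) => //.
    apply: (@compact_box K (`|x| + d)).
      apply: closedI; last by apply: closed_le_fun => //; exact: cst_continuous.
      apply: (@closed_le_fun (fun z => `|z - x|) (fun=> d)); last exact: cst_continuous.
      move=> z; apply: cont_norm => e e0; exists e => // y ye.
      apply: (le_trans (ler_dist_dist _ _)); rewrite opprB addrA subrK; exact: ltW.
    move=> z [zd _]; rewrite -(subrK x z); apply: (le_trans (ler_normD _ _)); lra.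
  move=> z [zd ez] Hz.
  have wq_ge j : j != i -> (z 0 j - x 0 j) ^+ 2 - n%:R * eta z ^+ 2 <= wq w x z.
    move=> ji; rewrite /wq (bigD1 i) //= (bigD1 j) //= /w eqxx (negbTE ji) mul1r -/(eta z).
    rewrite mulNr addrCA lerD2l lerDl; apply: sumr_ge0 => k /andP[/negbTE -> _].
    by rewrite mul1r sqr_ge0.
  have wq_ge0 : - (n%:R * eta z ^+ 2) <= wq w x z.
    rewrite /wq (bigD1 i) //= /w eqxx -/(eta z) mulNr lerDl; apply: sumr_ge0 => j /negbTE ->.
    by rewrite mul1r sqr_ge0.
  have ed : eta z <= d.
    by have := coord_le_norm (z - x) i; rewrite !mxE -/(eta z) => h; apply: le_trans (ler_norm _) (le_trans h zd).
  have ph : f z - f (Rf z) <= 2 * M.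
    have := fM z zd; have := fM (Rf z) (le_trans (Rfn z) zd); rewrite !ler_norml => /andP[? ?] /andP[? ?]; lra.
  have pN : 0 <= N * (2 * d * eta z - eta z ^+ 2).
    rewrite mulr_ge0 // expr2 -mulrBl mulr_ge0 //; lra.
  have big : d ^+ 2 <= wq w x z + 2 * n%:R * d * eta z -> False.
    move=> h; have : c * d ^+ 2 <= c * (wq w x z + 2 * n%:R * d * eta z) by rewrite ler_pM2l.
    rewrite {1}/c divfK ?expf_neq0 ?lt0r_neq0 // => h'; move: Hz; rewrite /H /psi; lra.
  have e0 : 0 < eta z.
    rewrite lt_neqAle ez andbT; apply/eqP => e0; move: Hz.
    have -> : H z = - psi z by rewrite /H /Rf -e0 mulr0 scale0r subr0 subrr sub0r.
    rewrite /psi -e0; move: wq_ge0; rewrite -e0 expr0n /= !mulr0 !subr0 mulr0 !addr0 oppr0 => h.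
    have : 0 <= c * wq w x z by rewrite mulr_ge0 // ltW.
    lra.
  have e1 : eta z < d.
    rewrite lt_neqAle ed andbT; apply/eqP => e1; apply: big.
    rewrite e1 in wq_ge0 *; have : 0 <= (n%:R - 1) * d ^+ 2 by rewrite mulr_ge0 ?subr_ge0 // exprn_ge0 // ltW.
    lra.
  have e2 j : j != i -> `|z 0 j - x 0 j| < d.
    move=> ji; have := coord_le_norm (z - x) j; rewrite !mxE => h.
    rewrite lt_neqAle (le_trans h zd) andbT; apply/eqP => e2; apply: big.
    have := wq_ge j ji; rewrite -[(_ - _) ^+ 2]real_normK ?num_real // e2.
    have : 0 <= n%:R * (eta z * (2 * d - eta z)) by rewrite !mulr_ge0 //; lra.
    lra.
  split.
    exists (Num.min (eta z) (\big[Num.min/d]_j (d - `|z 0 j - x 0 j|))).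
      rewrite lt_min e0 /=; apply: lt_bigmin => // j _; rewrite subr_gt0.
      have [->|ji] := eqVneq j i; last exact: e2.
      by rewrite ger0_norm.
    move=> j t; rewrite lt_min => /andP[t1 t2]; split; last first.
      rewrite etaS; case: eqP => _; last by rewrite addr0.
      by move: t1; rewrite ltr_norml => /andP[]; lra.
    apply: norm_le_coord; first exact: ltW.
    move=> k; rewrite !mxE eqxx /=.
    have hk : `|t| < d - `|z 0 k - x 0 k| by apply: lt_le_trans t2 _; exact: bigmin_le_cond.
    have -> : z 0 k + t * (k == j)%:R - x 0 k = (z 0 k - x 0 k) + t * (k == j)%:R by ring.
    apply: (le_trans (ler_normD _ _)).
    have : `|t * (k == j)%:R| <= `|t| by case: (k == j); rewrite ?mulr1 ?mulr0 ?normr0.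
    lra.
  pose l j := pd j (pd j f) z - pd j (pd j f) (Rf z) - (c * (2 * w j) - (if j == i then 2 * N else 0)).
  exists l.
    move=> j; have D1 := smooth_d2 j oU sf (dU z zd).
    have D2 := smooth_d2 j oU sf (dU _ (le_trans (Rfn z) zd)).
    have D2' : d2 (fun t => f (Rf (z + t *: e_ j))) (pd j (pd j f) (Rf z)).
      rewrite (_ : (fun t => _) = if j == i then (fun t => f (Rf z + (- t) *: e_ j)) else (fun t => f (Rf z + t *: e_ j))).
        by case: ifP => _; [exact: (d2N_arg D2)|exact: D2].
      by apply/funext => t; rewrite RfS; case: ifP.
    have D3 : d2 (fun t => psi (z + t *: e_ j)) (c * (2 * w j) - (if j == i then 2 * N else 0)).
      pose ji : R := if j == i then 1 else 0.
      rewrite (_ : (fun t => _) = (fun t => psi z + (c * (w j * 2 * (z 0 j - x 0 j) + 2 * n%:R * d * ji) + N * (2 * d * ji - 2 * eta z * ji)) * t + (c * w j - N * ji) * t ^+ 2)).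
        have -> : c * (2 * w j) - (if j == i then 2 * N else 0) = 2 * (c * w j - N * ji).
          by rewrite /ji; case: ifP => _; ring.
        exact: d2_quad.
      apply/funext => t; rewrite /psi wq_shift etaS /ji; case: ifP => _; ring.
    have := d2D (d2D D1 (d2Z (-1) D2')) (d2Z (-1) D3).
    have -> : pd j (pd j f) z + -1 * pd j (pd j f) (Rf z) +
        -1 * (c * (2 * w j) - (if j == i then 2 * N else 0)) = l j.
      by rewrite /l; set A := pd j _ z; set B := pd j _ (Rf z); ring.
    by rewrite (_ : (fun t => _) = (fun t => H (z + t *: e_ j))) //; apply/funext => t; rewrite /H; ring.
  have -> : \sum_j l j = lap f z - lap f (Rf z) - \sum_j (c * (2 * w j) - (if j == i then 2 * N else 0)).
    by rewrite /l /lap !sumrB.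
  have -> : \sum_j (c * (2 * w j) - (if j == i then 2 * N else 0)) = - (2 * c) - 2 * N.
    rewrite sumrB -mulr_sumr -mulr_sumr -big_mkcond big_pred1_eq.
    have -> : \sum_j w j = - 1.
      rewrite (bigD1 i) //= /w eqxx (eq_bigr (fun=> 1)); last by move=> j /negbTE ->.
      by rewrite sumr_const cardC1 card_ord -subn1 natrB //; ring.
    ring.
  move: (fN z zd) (fN _ (le_trans (Rfn z) zd)); generalize (lap f z) (lap f (Rf z)) => A B.
  move: c0; clear; move: c => c; clear; rewrite !ler_norml => c0 /andP[? ?] /andP[? ?]; lra.
(* On the axis through [x] the bound is linear in [t], and the odd difference on the left has
   derivative [2 * pd i f x] at 0. *)
have key t : 0 < t -> t < d -> f (x + t *: e_ i) - f (x - t *: e_ i) - t * (4 * n%:R * M / d + 2 * d * N) <= 0.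
  move=> t0 td; pose z := x + t *: e_ i.
  have ez : eta z = t by rewrite /z etaS eqxx /eta subrr add0r.
  have Kz : K z.
    split; last by rewrite ez ltW.
    rewrite /z addrC addKr; apply: (le_trans (norm_basis _ _)); by rewrite gtr0_norm // ltW.
  have RE : Rf z = x - t *: e_ i.
    by rewrite /Rf ez /z; apply/rowP => k; rewrite !mxE; ring.
  have := main z Kz; rewrite /H RE /psi ez.
  have -> : wq w x z = - n%:R * t ^+ 2.
    rewrite /wq (bigD1 i) //= big1 ?addr0.
      by rewrite /w eqxx -/(eta z) ez.
    by move=> j ji; rewrite /z !mxE eqxx (negbTE ji) /= mulr0 addr0 subrr expr0n mulr0.
  have -> : 4 * n%:R * M / d = c * (2 * n%:R * d) by rewrite /c; field; exact: lt0r_neq0.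
  have : 0 <= c * (n%:R * t ^+ 2) by rewrite mulr_ge0 ?(ltW c0) // mulr_ge0 // sqr_ge0.
  have : 0 <= N * t ^+ 2 by rewrite mulr_ge0 // sqr_ge0.
  lra.
have D1 : is_derive (0 : R) 1 (fun t => f (x + t *: e_ i)) (pd i f x).
  by apply: is_derive_line; rewrite scale0r addr0; exact: (smooth_derive i sf).
have D2 : is_derive (0 : R) 1 (fun t => f (x - t *: e_ i)) (- pd i f x).
  have := @is_derive_opp_arg R (fun t => f (x + t *: e_ i)) 0 (pd i f x).
  rewrite oppr0 => /(_ D1); rewrite (_ : (fun s => _) = (fun t => f (x - t *: e_ i))) //.
  by apply/funext => t; rewrite scaleNr.
pose B := 4 * n%:R * M / d + 2 * d * N.
have D3 : is_derive (0 : R) 1 (fun t : R => B * t) (B * 1).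
  by apply: is_deriveZ1; exact: is_derive_id.
have D := is_deriveB (is_deriveB D1 D2) D3.
suff h : pd i f x - - pd i f x - B * 1 <= 0.
  rewrite /B in h; have -> : 2 * n%:R * M / d + d * N = (4 * n%:R * M / d + 2 * d * N) / 2 by field; exact: lt0r_neq0.
  by move: h; generalize (4 * n%:R * M / d + 2 * d * N) (pd i f x) => B' A; lra.
rewrite leNgt; apply/negP => h; have [r r0 Hr] := derive_pos_right D h.
have m0 : 0 < Num.min d r / 2 by rewrite divr_gt0 // lt_min d0.
have ml : Num.min d r / 2 < Num.min d r by lra.
have := Hr _ m0 (lt_le_trans ml _); rewrite ge_min lexx orbT add0r => /(_ isT).
have := key _ m0 (lt_le_trans ml _); rewrite ge_min lexx => /(_ isT).
rewrite /= !fctE /= scale0r subr0 addr0 -/B; lra.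
Qed.
End InteriorGradient.

(** * Boundary charts and barriers *)

Section Chart.
Variables (R : realType) (n : nat).
Local Notation V := 'rV[R]_n.
Local Notation e_ := (@basis_vec R n).
Implicit Types (x z y : V) (f v : V -> R).
Variables (O U : set V) (s : V -> R) (p : V).
Hypotheses (oO : open O) (oU : open U) (sU : smooth_on U s) (Up : U p) (sp0 : s p = 0).
Hypothesis OU : forall x, U x -> O x <-> 0 < s x.
Hypothesis grad_s : exists j, pd j s p != 0.

Ltac goal_lra := clear -oO oU sU Up sp0 OU grad_s; lra.

Definition gradsq x : R := \sum_i pd i s x ^+ 2.

Lemma chart_bounds : exists r L c : R, [/\ 0 < r, 1 <= L, 0 < c & forall x, `|x - p| < r ->
  [/\ U x, `|s x| <= 1, forall i, `|pd i s x| <= L, forall i j, `|pd i (pd j s) x| <= L & c <= gradsq x]].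
Proof.
pose c := gradsq p.
have c0 : 0 < c.
  have [j jp] := grad_s; rewrite /c /gradsq (bigD1 j) //= ltr_pwDl ?exprn_even_gt0 //.
  by apply: sumr_ge0 => i _; rewrite sqr_ge0.
have sg : smooth_on U gradsq.
  apply: smooth_sum => // i; exact: (smoothM oU (smooth_pd i sU) (smooth_pd i sU)).
have c2 : 0 < c / 2 by lra.
have [d1 d10 H1] := cont_normP (smooth_cont sg Up) c2.
have [d2 d20 H2] := cont_normP (smooth_cont sU Up) (@ltr01 R).
have [d3 d30 H3] := open_ballP oU Up.
have [d4 [M4 [d40 M40 H4]]] : exists d M : R, [/\ 0 < d, 0 <= M & forall i, forall x, `|x - p| < d -> `|pd i s x| <= M].
  apply: (@fin_bound R _ (fun i d M => forall x, `|x - p| < d -> `|pd i s x| <= M)).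
    by move=> i d M d' M' h dd MM x xd; apply: le_trans (h x (lt_le_trans xd dd)) MM.
  move=> i; have [d d0 H] := cont_normP (smooth_cont (smooth_pd i sU) Up) (@ltr01 R).
  exists d, (`|pd i s p| + 1); split=> // x /H h.
  rewrite -[pd i s x](subrK (pd i s p)); apply: (le_trans (ler_normD _ _)).
  by rewrite addrC lerD2l.
have [d5 [M5 [d50 M50 H5]]] : exists d M : R, [/\ 0 < d, 0 <= M & forall ij, forall x, `|x - p| < d -> `|pd ij.1 (pd ij.2 s) x| <= M].
  apply: (@fin_bound R _ (fun (ij : 'I_n * 'I_n) d M => forall x, `|x - p| < d -> `|pd ij.1 (pd ij.2 s) x| <= M)).
    by move=> i d M d' M' h dd MM x xd; apply: le_trans (h x (lt_le_trans xd dd)) MM.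
  move=> [i j] /=; have [d d0 H] := cont_normP (smooth_cont (smooth_pd i (smooth_pd j sU)) Up) (@ltr01 R).
  exists d, (`|pd i (pd j s) p| + 1); split=> // x /H h.
  rewrite -[pd i _ x](subrK (pd i (pd j s) p)); apply: (le_trans (ler_normD _ _)).
  by rewrite addrC lerD2l.
exists (Num.min (Num.min d1 d2) (Num.min d3 (Num.min d4 d5))), (1 + M4 + M5), (c / 2); split=> //.
- by rewrite !lt_min d10 d20 d30 d40 d50.
- by rewrite -addrA lerDl addr_ge0.
move=> x; rewrite !lt_min => /andP[/andP[x1 x2] /and3P[x3 x4 x5]]; split.
- exact: H3.
- by have := H2 x x2; rewrite sp0 subr0.
- by move=> i; apply: (le_trans (H4 i x x4)); lra.
- by move=> i j; apply: (le_trans (H5 (i, j) x x5)); lra.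
- by have := H1 x x1; rewrite -/c ler_norml => /andP[h _]; lra.
Qed.

Lemma chart_lip : exists r L : R, [/\ 0 < r, 1 <= L & (forall x y, `|x - p| < r -> `|y - p| < r ->
  `|s x - s y| <= L * `|x - y|) /\ (forall i x y, `|x - p| < r -> `|y - p| < r ->
  `|pd i s x - pd i s y| <= L * `|x - y|)].
Proof.
have [r [L [c [r0 L1 c0 H]]]] := chart_bounds.
have n1 : (0 < n)%N by have [j _] := grad_s; exact: leq_ltn_trans (leq0n _) (ltn_ord j).
have aux f (x y : V) : (forall z, `|z - p| < r -> forall i, is_derive z (e_ i) f (pd i f z)) ->
    (forall z, `|z - p| < r -> forall i, `|pd i f z| <= L) -> `|x - p| < r / 4 -> `|y - p| < r / 4 ->
    `|f x - f y| <= L * n%:R * `|x - y|.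
  move=> df bf xp yp; have {1}-> : x = y + (x - y) by rewrite addrC subrK.
  have cube z : `|z - y| <= `|x - y| -> `|z - p| < r.
    move=> zy; have xy : `|x - y| < r / 2.
      have -> : x - y = (x - p) - (y - p) by rewrite opprB addrA subrK.
      by apply: (le_lt_trans (ler_normB _ _)); lra.
    have -> : z - p = (z - y) + (y - p) by rewrite addrA subrK.
    by apply: (le_lt_trans (ler_normD _ _)); lra.
  apply: (@box_lip R n f (fun i => pd i f)).
  - by lra.
  - by move=> i z /cube zp; exact: df.
  - by move=> i z /cube zp; exact: bf.
exists (r / 4), (L * n%:R); split; first lra.
  by apply: (le_trans L1); rewrite ler_peMr ?ler1n //; lra.
split=> [x y|i x y]; apply: aux => z zr.
- by move=> i; have [Uz _ _ _ _] := H z zr; exact: (smooth_derive i sU).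
- by have [_ _ h _ _] := H z zr.
- by move=> j; have [Uz _ _ _ _] := H z zr; exact: (smooth_derive j (smooth_pd i sU)).
- by move=> j; have [_ _ _ h _] := H z zr.
Qed.

(* Boundary weights [s^(1 - m/2)], where [s] vanishes to first order on the boundary. *)
Definition wt (m : nat) x : R := s x * (Num.sqrt (s x))^-1 ^+ m.
Definition BO (m : nat) f := exists C r : R, [/\ 0 < C, 0 < r & forall x, `|x - p| < r -> O x -> `|f x| <= C * wt m x].

Lemma wt_ge0 m x : 0 < s x -> 0 < wt m x.
Proof. by move=> s0; rewrite mulr_gt0 // exprn_gt0 // invr_gt0 sqrtr_gt0. Qed.

Lemma wt2 x : 0 < s x -> wt 2 x = 1.
Proof. by move=> s0; rewrite /wt exprVn sqr_sqrtr ?ltW // divff // lt0r_neq0. Qed.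

Lemma wtS m x : 0 < s x -> wt m.+2 x = wt m x / s x.
Proof.
move=> s0; have h : (Num.sqrt (s x))^-1 ^+ 2 = (s x)^-1 by rewrite exprVn sqr_sqrtr ?ltW.
by rewrite /wt -addn2 exprD h mulrA.
Qed.

Lemma wt_mono m m' x : 0 < s x -> `|s x| <= 1 -> (m <= m')%N -> wt m x <= wt m' x.
Proof.
move=> s0 s1 mm; rewrite /wt ler_pM2l //; apply: ler_weXn2l => //.
rewrite invf_ge1 ?sqrtr_gt0 // -[leRHS]sqrtr1 ler_wsqrtr //.
by rewrite (ger0_norm (ltW s0)) in s1.
Qed.

(** For use on cubes of radius proportional to [s x], on which [s] changes by a bounded factor. *)
Lemma wt_comparable m x z : 0 < s x -> s x / 4 <= s z -> s z <= 4 * s x -> wt m z <= 4 * 2 ^+ m * wt m x.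
Proof.
move=> s0 h1 h2; have z0 : 0 < s z by lra.
have -> : 4 * 2 ^+ m * wt m x = (4 * s x) * (2 * (Num.sqrt (s x))^-1) ^+ m.
  by rewrite /wt exprMn; ring.
apply: ler_pM (ltW z0) _ h2 _; first by rewrite exprn_ge0 // invr_ge0 sqrtr_ge0.
rewrite lerXn2r ?nnegrE ?mulr_ge0 ?invr_ge0 ?sqrtr_ge0 //.
rewrite -lef_pV2 ?posrE ?invr_gt0 ?mulr_gt0 ?invr_gt0 ?sqrtr_gt0 //.
rewrite invfM !invrK mulrC ler_pdivrMr // mulrC.
have -> : 2 = Num.sqrt 4 :> R by rewrite (_ : 4 = 2 ^+ 2) ?sqrtr_sqr ?ger0_norm //; ring.
by rewrite -sqrtrM // ler_wsqrtr //; lra.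
Qed.

Lemma BO_mono m m' f : (m <= m')%N -> BO m f -> BO m' f.
Proof.
move=> mm [C [r [C0 r0 H]]]; have [r1 [L [c [r10 L1 c0 H1]]]] := chart_bounds.
exists C, (Num.min r r1); split; rewrite ?lt_min ?r0 // => x; rewrite lt_min => /andP[xr xr1] Ox.
have [Ux s1 _ _ _] := H1 x xr1; have sx := (OU Ux).1 Ox.
by apply: (le_trans (H x xr Ox)); rewrite ler_pM2l //; exact: wt_mono.
Qed.

Lemma BO_congr m f v : (exists2 r : R, 0 < r & forall x, `|x - p| < r -> O x -> f x = v x) -> BO m f -> BO m v.
Proof.
move=> [r r0 fv] [C [r' [C0 r'0 H]]]; exists C, (Num.min r r'); split; rewrite ?lt_min ?r0 //.
by move=> x; rewrite lt_min => /andP[xr xr'] Ox; rewrite -fv //; exact: H.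
Qed.

Lemma BO_add m f v : BO m f -> BO m v -> BO m (fun x => f x + v x).
Proof.
move=> [C [r [C0 r0 H]]] [C' [r' [C'0 r'0 H']]]; exists (C + C'), (Num.min r r'); split.
- exact: addr_gt0.
- by rewrite lt_min r0.
move=> x; rewrite lt_min => /andP[xr xr'] Ox; apply: (le_trans (ler_normD _ _)).
by rewrite mulrDl lerD // ?H ?H'.
Qed.

Lemma BO_mul m f v : BO 2 f -> BO m v -> BO m (fun x => f x * v x).
Proof.
move=> [C [r [C0 r0 H]]] [C' [r' [C'0 r'0 H']]]; have [r1 [L [c [r10 L1 c0 H1]]]] := chart_bounds.
exists (C * C'), (Num.min r1 (Num.min r r')); split.
- exact: mulr_gt0.
- by rewrite !lt_min r0 r10.
move=> x; rewrite !lt_min => /and3P[xr1 xr xr'] Ox; have [Ux s1 _ _ _] := H1 x xr1; have sx := (OU Ux).1 Ox.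
by rewrite normrM -mulrA ler_pM // ?H' //; have := H x xr Ox; rewrite wt2 // mulr1.
Qed.

Lemma BO_smooth f : smooth_on U f -> BO 2 f.
Proof.
move=> sf; have [d d0 H] := cont_normP (smooth_cont sf Up) (@ltr01 R).
have [r1 [L [c [r10 L1 c0 H1]]]] := chart_bounds.
exists (`|f p| + 1), (Num.min d r1); split; rewrite ?ltr_pwDr ?lt_min ?d0 // => x.
rewrite lt_min => /andP[xd xr] Ox; have [Ux s1 _ _ _] := H1 x xr; rewrite wt2 ?mulr1; last exact/(OU Ux).
rewrite -[f x](subrK (f p)); apply: (le_trans (ler_normD _ _)).
by rewrite addrC lerD2l; exact: H.
Qed.

Lemma BO0 m : BO m (fun=> 0).
Proof.
have [r1 [L [c [r10 L1 c0 H1]]]] := chart_bounds; exists 1, r1; split=> // x xr Ox.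
have [Ux _ _ _ _] := H1 x xr; rewrite normr0 mul1r ltW // wt_ge0 //; exact/(OU Ux).
Qed.

Lemma openOU : open (O `&` U). Proof. exact: openI. Qed.

(** The interior estimate on the cube of radius [s x / (2 * L)], which stays in [O]. A derivative
    costs a factor [(s x)^-1], that is, two steps of the weight; the Laplacian enters multiplied by
    the radius and may therefore be worse by [(s x) ^- 2]. *)
Lemma BO_grad m f i : smooth_on (O `&` U) f -> BO m f -> BO m.+4 (lap f) -> BO m.+2 (pd i f).
Proof.
move=> sf [C [r [C0 r0 H]]] [C' [r' [C'0 r'0 H']]].
have [r1 [L1 [c [r10 L11 c0 H1]]]] := chart_bounds.
have [r2 [L [r20 L1' [Hl _]]]] := chart_lip.
pose rho := Num.min (Num.min r r') (Num.min r1 r2).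
have rho0 : 0 < rho by rewrite !lt_min r0 r'0 r10.
pose k := (2 * L)^-1; have k0 : 0 < k by rewrite invr_gt0 mulr_gt0 // (lt_le_trans ltr01).
pose B := 2 * n%:R * (C * (4 * 2 ^+ m)) / k + k * (C' * (4 * 2 ^+ m.+4)).
have p2 q : 0 < 4 * 2 ^+ q :> R by rewrite mulr_gt0 ?exprn_gt0.
have a1 := mulr_gt0 C0 (p2 m); have a2 := mulr_gt0 C'0 (p2 m.+4).
have B0 : 0 <= B.
  exact: addr_ge0 (divr_ge0 (mulr_ge0 (mulr_ge0 _ _) (ltW a1)) (ltW k0)) (mulr_ge0 (ltW k0) (ltW a2)).
exists (B + 1), (rho / 2); split; [by rewrite ltr_wpDl|by rewrite divr_gt0|].
move=> x xr Ox.
have [xr1 [xr2 [xr3 xr4]]] : rho <= r /\ rho <= r' /\ rho <= r1 /\ rho <= r2.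
  by rewrite /rho !ge_min !lexx !orbT.
have xrho : `|x - p| < rho by apply: lt_trans xr _; rewrite ltr_pdivrMr // ltr_pMr // ltr1n.
have [Ux s1 _ _ _] := H1 x (lt_le_trans xrho xr3); have sx := (OU Ux).1 Ox.
have near_x z : `|z - x| <= k * s x -> [/\ `|z - p| < rho, s x / 4 <= s z & s z <= 4 * s x].
  move=> zx.
  have sxp : s x <= L * `|x - p|.
    have := Hl x p (lt_le_trans xrho xr4); rewrite subrr normr0 sp0 subr0 => /(_ r20); exact: le_trans (ler_norm _).
  have ks : k * s x <= `|x - p| / 2.
    have -> : `|x - p| / 2 = k * (L * `|x - p|) by rewrite /k; field; rewrite gt_eqF // (lt_le_trans ltr01).
    by rewrite ler_wpM2l // ltW.
  have zp : `|z - p| < rho.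
    have -> : z - p = (z - x) + (x - p) by rewrite addrA subrK.
    apply: (le_lt_trans (ler_normD _ _)); apply: le_lt_trans (lerD (le_trans zx ks) (lexx _)) _.
    by move: xr (ltW rho0); move: (rho) `|x - p| => a b; goal_lra.
  have hz := Hl z x (lt_le_trans zp xr4) (lt_le_trans xrho xr4).
  have : L * `|z - x| <= s x / 2.
    have -> : s x / 2 = L * (k * s x) by rewrite /k; field; rewrite gt_eqF // (lt_le_trans ltr01).
    by rewrite ler_wpM2l // (le_trans ler01).
  move: hz; rewrite ler_norml => /andP[a b] h; split=> //; move: a b h sx.
    by move: (s x) (s z) (L * _) => a' b' c'; goal_lra.
  by move: (s x) (s z) (L * _) => a' b' c'; goal_lra.
have zO z : `|z - x| <= k * s x -> (O `&` U) z.
  move=> zx; have [zp a b] := near_x z zx; have [Uz _ _ _ _] := H1 z (lt_le_trans zp xr3).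
  by split=> //; apply/(OU Uz); apply: lt_le_trans a; rewrite divr_gt0.
have d0 : 0 < k * s x by rewrite mulr_gt0.
have M0 : 0 < C * (4 * 2 ^+ m) * wt m x by exact: mulr_gt0 a1 (wt_ge0 m sx).
have G := @interior_gradient R n (O `&` U) f x i (k * s x) (C * (4 * 2 ^+ m) * wt m x)
   (C' * (4 * 2 ^+ m.+4) * wt m.+4 x) openOU sf d0 M0 zO _ _.
have {}G : `|pd i f x| <= B * wt m.+2 x.
  apply: (le_trans (G _ _)).
  - move=> z zx; have [zp a b] := near_x z zx.
    apply: (le_trans (H z (lt_le_trans zp xr1) (zO z zx).1)); rewrite -mulrA ler_pM2l //.
    exact: wt_comparable.
  - move=> z zx; have [zp a b] := near_x z zx.
    apply: (le_trans (H' z (lt_le_trans zp xr2) (zO z zx).1)); rewrite -mulrA ler_pM2l //.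
    exact: wt_comparable.
  rewrite le_eqVlt; apply/orP; left; apply/eqP; rewrite /B (wtS m.+2) // (wtS m) //.
  by field; rewrite !lt0r_neq0.
apply: (le_trans G); rewrite ler_wpM2r //; last by rewrite lerDl.
by rewrite ltW // wt_ge0.
Qed.
End Chart.

(** * Rules for the Laplacian, comparison of smooth functions on compact sets *)

Section LaplacianRules.
Variables (R : realType) (n : nat).
Local Notation V := 'rV[R]_n.
Local Notation e_ := (@basis_vec R n).
Implicit Types (x z y a : V) (f g : V -> R) (U W K A : set V).

#[local] Transparent pd.
Lemma pd_shift f a j : pd j (fun x => f (x + a)) = (fun x => pd j f (x + a)).
Proof.
apply/funext => x; rewrite /pd /derive.
set g1 := fun h => h^-1 *: _; set g2 := fun h => h^-1 *: _; suff -> : g1 = g2 by [].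
by apply/funext => h; rewrite /g1 /g2 /= addrA.
Qed.
#[local] Opaque pd.

Lemma iter_pd_shift f a js : iter_pd js (fun x => f (x + a)) = (fun x => iter_pd js f (x + a)).
Proof. by elim: js => //= j js ->; exact: pd_shift. Qed.

Lemma lap_shift f a x : lap (fun x => f (x + a)) x = lap f (x + a).
Proof. by apply: eq_bigr => j _; rewrite !pd_shift. Qed.

Lemma derivable_shift f a x v : derivable f (x + a) v -> derivable (fun x => f (x + a)) x v.
Proof.
rewrite /derivable; set g1 := fun h => h^-1 *: _; set g2 := fun h => h^-1 *: _.
by suff -> : g1 = g2 by []; apply/funext => h; rewrite /g1 /g2 /= addrA.
Qed.

Lemma continuous_shift f a x : {for x + a, continuous f} -> {for x, continuous (fun x => f (x + a))}.
Proof.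
move=> cf; apply: cont_norm => e e0; have [d d0 h] := cont_normP cf e0.
by exists d => // y yd; apply: h; rewrite opprD addrACA subrr addr0.
Qed.

Lemma smooth_shift U f a : smooth_on U f -> smooth_on [set x | U (x + a)] (fun x => f (x + a)).
Proof.
move=> sf js x Ux; have [d c] := sf js _ Ux; rewrite iter_pd_shift.
by split=> [j|]; [apply: derivable_shift; exact: d|apply: continuous_shift; exact: c].
Qed.

Lemma open_shift U a : open U -> open [set x | U (x + a)].
Proof.
move=> oU; apply: ballP_open => x Ux; have [r r0 h] := open_ballP oU Ux.
by exists r => // y yr; apply: h; rewrite opprD addrACA subrr addr0.
Qed.

Lemma lapD U f g x : open U -> smooth_on U f -> smooth_on U g -> U x ->
  lap (fun y => f y + g y) x = lap f x + lap g x.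
Proof.
move=> oU sf sg Ux; rewrite /lap -big_split; apply: eq_bigr => j _ /=.
rewrite (@pd_congr R n U _ (fun y => pd j f y + pd j g y) j x oU _ Ux).
  by rewrite (pdD _ (smooth_pd j sf) (smooth_pd j sg)).
by move=> y Uy; rewrite (pdD _ sf sg).
Qed.

Lemma lapZ U (c : R) f x : open U -> smooth_on U f -> U x ->
  lap (fun y => c * f y) x = c * lap f x.
Proof.
move=> oU sf Ux; rewrite /lap mulr_sumr; apply: eq_bigr => j _ /=.
rewrite (@pd_congr R n U _ (fun y => c * pd j f y) j x oU _ Ux).
  by rewrite (pdZ _ _ (smooth_pd j sf)).
by move=> y Uy; rewrite (pdZ _ _ sf).
Qed.

Lemma lapB U f g x : open U -> smooth_on U f -> smooth_on U g -> U x ->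
  lap (fun y => f y - g y) x = lap f x - lap g x.
Proof.
move=> oU sf sg Ux; rewrite -mulN1r -(lapZ (-1) oU sg Ux) -(lapD oU sf (smoothZ (-1) oU sg) Ux).
by congr (lap _ x); apply/funext => y; rewrite mulN1r.
Qed.

Lemma lap_cst (c : R) x : lap (fun _ : V => c) x = 0.
Proof.
rewrite /lap big1 // => j _; rewrite (_ : pd j (fun=> c) = fun=> 0) ?pd_cst //.
by apply/funext => y; rewrite pd_cst.
Qed.

Lemma lap_pd U f i x : open U -> smooth_on U f -> U x -> lap (pd i f) x = pd i (lap f) x.
Proof.
move=> oU sf Ux; rewrite /lap (pd_sum _ _ i oU _ Ux); last first.
  by move=> j; apply: smooth_pd; exact: smooth_pd.
apply: eq_bigr => j _; rewrite (pd_swap i j oU (smooth_pd j sf) Ux).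
by apply: (@pd_congr R n U _ _ j x oU _ Ux) => y Uy; exact: (pd_swap j i oU sf Uy).
Qed.

Lemma lap_comp W f (phi phi1 phi2 : R -> R) x : open W -> smooth_on W f ->
  smooth_on W (fun y => phi1 (f y)) ->
  (forall y, W y -> is_derive (f y) 1 phi (phi1 (f y))) ->
  (forall y, W y -> is_derive (f y) 1 phi1 (phi2 (f y))) -> W x ->
  lap (fun y => phi (f y)) x = phi2 (f x) * \sum_j pd j f x ^+ 2 + phi1 (f x) * lap f x.
Proof.
move=> oW sf s1 d1 d2 Wx; rewrite /lap !mulr_sumr -big_split; apply: eq_bigr => j _ /=.
rewrite (@pd_congr R n W _ (fun y => phi1 (f y) * pd j f y) j x oW _ Wx).
  by rewrite (pdM _ s1 (smooth_pd j sf)) // (pd_comp j sf Wx (d2 x Wx)) expr2; ring.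
by move=> y Wy; rewrite (pd_comp j sf Wy (d1 y Wy)).
Qed.

Lemma smooth_lap U f : open U -> smooth_on U f -> smooth_on U (lap f).
Proof. by move=> oU sf; apply: smooth_sum => // j; do 2 apply: smooth_pd. Qed.

Lemma smooth_sqd U a : open U -> smooth_on U (sqd a).
Proof.
move=> oU; apply: smooth_sum => // k.
have sk : smooth_on U (fun z : V => z 0 k - a 0 k).
  by apply: smoothB => //; [exact: smooth_coord|exact: smooth_cst].
exact: (smoothM oU sk sk).
Qed.

Lemma pd_sqd a x j : pd j (sqd a) x = 2 * (x 0 j - a 0 j).
Proof.
have sc k : smooth_on setT (fun z : V => z 0 k - a 0 k).
  by apply: smoothB; [exact: openT|exact: smooth_coord openT|exact: smooth_cst openT].
have pc k y : pd j (fun z : V => z 0 k - a 0 k) y = (k == j)%:R.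
  by rewrite (pdB j (smooth_coord k openT) (smooth_cst _ openT) I) pd_coord pd_cst subr0.
rewrite /sqd (@pd_sum R n setT _ _ _ (fun k z => (z 0 k - a 0 k) ^+ 2) j x openT _ I); last first.
  by move=> k; exact: (smoothM openT (sc k) (sc k)).
rewrite (bigD1 j) //= big1 ?addr0.
  by rewrite (pdM j (sc j) (sc j) I) /= !pc eqxx mulr1; ring.
by move=> k kj; rewrite (pdM j (sc k) (sc k) I) /= !pc (negbTE kj) !mulr0 addr0.
Qed.

Lemma lap_sqd a x : lap (sqd a) x = 2 * n%:R.
Proof.
rewrite /lap (eq_bigr (fun=> 2)); first by rewrite sumr_const card_ord mulr_natr.
move=> j _; rewrite (_ : pd j (sqd a) = fun y => 2 * (y 0 j - a 0 j)); last first.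
  by apply/funext => y; exact: pd_sqd.
have sc : smooth_on setT (fun z : V => z 0 j - a 0 j).
  by apply: smoothB; [exact: openT|exact: smooth_coord openT|exact: smooth_cst openT].
rewrite (pdZ _ _ sc I) (pdB j (smooth_coord j openT) (smooth_cst _ openT) I) pd_coord pd_cst eqxx.
by rewrite subr0 mulr1.
Qed.

Lemma lap_sqrt W f x : open W -> smooth_on W f -> (forall y, W y -> 0 < f y) -> W x ->
  lap (fun y => Num.sqrt (f y)) x =
  lap f x / (2 * Num.sqrt (f x)) - \sum_j pd j f x ^+ 2 / (4 * f x * Num.sqrt (f x)).
Proof.
move=> oW sf f0 Wx.
have q0 y : W y -> 0 < Num.sqrt (f y) by move=> /f0 fy; rewrite sqrtr_gt0.
have s1 : smooth_on W (fun y => (2 * Num.sqrt (f y))^-1).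
  apply: smooth_inv => //; first by apply: smoothZ => //; exact: smooth_sqrt.
  by move=> y Wy; rewrite mulf_neq0 // lt0r_neq0 // q0.
have d1 y : W y -> is_derive (f y) 1 Num.sqrt (2 * Num.sqrt (f y))^-1.
  by move=> Wy; apply: is_derive1_sqrt; exact: f0.
have d2 y : W y -> is_derive (f y) 1 (fun t => (2 * Num.sqrt t)^-1) (- (4 * f y * Num.sqrt (f y))^-1).
  move=> Wy; have fy := f0 y Wy; have qy := q0 y Wy.
  have dS := is_deriveZ1 2 (@is_derive1_sqrt R _ fy).
  have n2 : 2 * Num.sqrt (f y) != 0 by rewrite mulf_neq0 // lt0r_neq0.
  have dI := @is_derive_invX R (2 * Num.sqrt (f y)) 1 n2.
  apply: is_derive_ext (is_derive_comp_real dS dI) => // .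
  by rewrite -{3}(sqr_sqrtr (ltW fy)); field; exact: lt0r_neq0.
rewrite (@lap_comp W f Num.sqrt (fun t => (2 * Num.sqrt t)^-1) (fun t => - (4 * t * Num.sqrt t)^-1) x oW sf s1 d1 d2 Wx).
by rewrite -mulr_suml mulNr addrC [X in X - _]mulrC [X in _ - X]mulrC.
Qed.

Lemma lap_mul_sqrt W f x : open W -> smooth_on W f -> (forall y, W y -> 0 < f y) -> W x ->
  lap (fun y => f y * Num.sqrt (f y)) x =
  3 / 2 * Num.sqrt (f x) * lap f x + 3 / 4 * (\sum_j pd j f x ^+ 2) / Num.sqrt (f x).
Proof.
move=> oW sf f0 Wx.
have q0 y : W y -> 0 < Num.sqrt (f y) by move=> /f0 fy; rewrite sqrtr_gt0.
have s1 : smooth_on W (fun y => 3 / 2 * Num.sqrt (f y)) by apply: smoothZ => //; exact: smooth_sqrt.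
have d1 y : W y -> is_derive (f y) 1 (fun t => t * Num.sqrt t) (3 / 2 * Num.sqrt (f y)).
  move=> Wy; have fy := f0 y Wy; have qy := q0 y Wy.
  have dM := is_deriveM (@is_derive_id R R^o (f y) 1) (@is_derive1_sqrt R _ fy).
  apply: is_derive_ext dM => //; rewrite /GRing.scale /= mulr1 -{1}(sqr_sqrtr (ltW fy)).
  by field; exact: lt0r_neq0.
have d2 y : W y -> is_derive (f y) 1 (fun t => 3 / 2 * Num.sqrt t) (3 / 4 / Num.sqrt (f y)).
  move=> Wy; have fy := f0 y Wy; have qy := q0 y Wy.
  apply: is_derive_ext (is_deriveZ1 (3 / 2) (@is_derive1_sqrt R _ fy)) => //.
  by field; exact: lt0r_neq0.
rewrite (@lap_comp W f (fun t => t * Num.sqrt t) (fun t => 3 / 2 * Num.sqrt t) (fun t => 3 / 4 / Num.sqrt t) x oW sf s1 d1 d2 Wx).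
by ring.
Qed.

Lemma compare_smooth W K f : open W -> smooth_on W f -> compact K -> K `<=` W ->
  (forall x, K x -> 0 < f x -> (exists2 r : R, 0 < r & forall y, `|y - x| < r -> K y) /\ 0 < lap f x) ->
  forall x, K x -> f x <= 0.
Proof.
move=> oW sf cK KW hK; apply: (max_principle cK).
  by apply: continuous_in_subspaceT => x; rewrite inE => /KW; exact: smooth_cont sf.
move=> x Kx fx; have [[r r0 h] l0] := hK x Kx fx; split.
  exists r => // j t tr; apply: h; rewrite addrC addKr.
  exact: le_lt_trans (norm_basis _ _) tr.
by exists (fun j => pd j (pd j f) x) => // j; exact: smooth_d2 oW sf (KW x Kx).
Qed.

Lemma closed_restrict A f : closed A -> (forall x, A x -> {for x, continuous f}) ->
  closed [set x | A x /\ 0 <= f x].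
Proof.
move=> cA cf x clx.
have Ax : A x by apply: cA; apply: closure_subset clx => y [].
split=> //; rewrite leNgt; apply/negP => fx.
have f2 : 0 < - f x / 2 by lra.
have [d d0 h] := cont_normP (cf x Ax) f2.
have [|y [[Ay fy] yd]] := clx [set y | `|y - x| < d].
  by apply/nbhs_ballP; exists d => // y; rewrite -ball_normE /= distrC.
have := h y yd; rewrite ler_norml => /andP[_]; lra.
Qed.

Lemma closed_cube a (r : R) : closed [set x : V | `|x - a| <= r].
Proof.
apply: (@closed_le_fun R n (fun z => `|z - a|) (fun=> r)); last exact: cst_continuous.
move=> z; apply: cont_norm => e e0; exists e => // y ye.
by apply: (le_trans (ler_dist_dist _ _)); rewrite opprB addrA subrK; exact: ltW.
Qed.

Lemma compact_restrict a (r : R) f : (forall x, `|x - a| <= r -> {for x, continuous f}) ->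
  compact [set x : V | `|x - a| <= r /\ 0 <= f x].
Proof.
move=> cf; apply: (@compact_box R n _ (`|a| + r)).
  by apply: closed_restrict => //; exact: closed_cube.
move=> z [zd _]; rewrite -(subrK a z) addrC; apply: (le_trans (ler_normD _ _)).
by rewrite lerD2l.
Qed.
End LaplacianRules.

(** * Barriers: linear decay at the boundary *)

Section ChartBarriers.
Variables (R : realType) (n : nat).
Local Notation V := 'rV[R]_n.
Local Notation e_ := (@basis_vec R n).
Implicit Types (x z y : V) (f v w : V -> R).
Variables (O U : set V) (s : V -> R) (p : V).
Hypotheses (oO : open O) (oU : open U) (sU : smooth_on U s) (Up : U p) (sp0 : s p = 0).
Hypothesis OU : forall x, U x -> O x <-> 0 < s x.
Hypothesis grad_s : exists j, pd j s p != 0.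
Local Notation BO := (BO O s p).
Local Notation W := (O `&` U).

Let oW : open W := openI oO oU.
Let sW : smooth_on W s.
Proof. by apply: smooth_sub sU => x []. Qed.
Let s_gt0 x : W x -> 0 < s x.
Proof. by move=> [Ox Ux]; apply/(OU Ux). Qed.

Ltac goal_lra := clear -oO oU sU Up sp0 OU grad_s oW sW s_gt0; lra.

(** The constants [L] and [c] come before [d], so that the size of the neighbourhood can be chosen
    in terms of them. *)
Lemma chart_small : exists L c : R, [/\ 1 <= L, 0 < c & forall d : R, 0 < d -> exists r : R, [/\ 0 < r, r <= d,
  (forall x, `|x - p| < r -> [/\ U x, `|s x| <= d, `|s x| <= 1, forall i, `|pd i s x| <= L &
     c <= gradsq s x /\ `|lap s x| <= n%:R * L]) &
  (forall i x y, `|x - p| < r -> `|y - p| < r -> `|pd i s x - pd i s y| <= L * `|x - y|)]].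
Proof.
have [r1 [L1 [c [r10 L11 c0 H1]]]] := chart_bounds oU sU Up sp0 grad_s.
have [r2 [L2 [r20 L21 [Hl Hg]]]] := chart_lip oU sU Up sp0 grad_s.
have L20 : 0 < L2 by lra.
exists (L1 + L2), c; split=> //; first lra.
move=> d d0; exists (Num.min (Num.min r1 r2) (d / L2)); split.
- by rewrite !lt_min r10 r20 /= divr_gt0.
- by rewrite !ge_min ler_pdivrMr // ler_peMr ?orbT // ltW.
- move=> x; rewrite !lt_min => /andP[/andP[x1 x2] x3].
  have [Ux sx gx hx cx] := H1 x x1; split=> //.
  - have := Hl x p x2; rewrite subrr normr0 sp0 subr0 => /(_ r20) /le_trans; apply.
    by move: x3; rewrite ltr_pdivlMr // mulrC => /ltW.
  - by move=> i; apply: (le_trans (gx i)); lra.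
  split=> //; apply: (le_trans (ler_norm_sum _ _ _)).
  rewrite mulr_natl -[n in _ *+ n]card_ord -sumr_const; apply: ler_sum => i _.
  by apply: (le_trans (hx i i)); lra.
move=> i x y; rewrite !lt_min => /andP[/andP[_ x2] _] /andP[/andP[_ y2] _].
by apply: (le_trans (Hg i x y x2 y2)); rewrite ler_wpM2r //; lra.
Qed.

Lemma wt3E x : 0 < s x -> wt s 3 x = (Num.sqrt (s x))^-1.
Proof. by move=> s0; rewrite /wt exprSr mulrA -/(wt s 2 x) wt2 // mul1r. Qed.

Lemma wt4E x : 0 < s x -> wt s 4 x = (s x)^-1.
Proof. by move=> s0; rewrite wtS // wt2 // div1r. Qed.

Lemma wt1E x : 0 < s x -> wt s 1 x = Num.sqrt (s x).
Proof.
move=> s0; rewrite /wt expr1 -{1}(sqr_sqrtr (ltW s0)) expr2 -mulrA divff ?mulr1 //.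
by rewrite sqrtr_eq0 -ltNge.
Qed.

Lemma wt0E x : wt s 0 x = s x.
Proof. by rewrite /wt expr0 mulr1. Qed.

Definition vanishes v := exists2 r : R, 0 < r & forall h : R, 0 < h -> exists2 e : R, 0 < e &
  forall x, `|x - p| < r -> O x -> s x < e -> `|v x| <= h.

Lemma barrier_arith (N m c q r l G T C k : R) : `|l| <= N -> 0 < r -> r <= 1 -> c <= G -> 0 < q ->
  7 / 2 * N + 2 * m <= c / 2 * q -> 0 < T -> 4 * (C + 1) <= T * c -> `|k| <= C * q ->
  0 < k - T * (2 * l - (3 / 2 * r * l + 3 / 4 * G * q) + 2 * m).
Proof.
rewrite !ler_norml => /andP[l1 l2] r0 r1 cG q0 h T0 hT /andP[k1 _].
have a1 : - (3 / 2 * r * l) <= 3 / 2 * N.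
  have : 0 <= r * (N + l) by rewrite mulr_ge0 //; lra.
  have : 0 <= (1 - r) * N by rewrite mulr_ge0 //; lra.
  lra.
have a2 : c * q <= G * q by rewrite ler_wpM2r // ltW.
have a3 : 2 * l - (3 / 2 * r * l + 3 / 4 * G * q) + 2 * m <= - (c / 4 * q) by lra.
have a4 : T * (2 * l - (3 / 2 * r * l + 3 / 4 * G * q) + 2 * m) <= T * - (c / 4 * q).
  by rewrite ler_pM2l.
have a5 : (C + 1) * q <= T * c / 4 * q by rewrite ler_wpM2r ?(ltW q0) //; lra.
lra.
Qed.

Lemma near_gt f x (a : R) : {for x, continuous f} -> a < f x ->
  exists2 r : R, 0 < r & forall y, `|y - x| < r -> a < f y.
Proof.
move=> cf h; have h2 : 0 < (f x - a) / 2 by lra.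
have [d d0 H] := cont_normP cf h2; exists d => // y /H.
by rewrite ler_norml => /andP[]; lra.
Qed.

Lemma barrier_upper v : smooth_on W v -> BO 2 v -> BO 3 (lap v) -> vanishes v ->
  exists T r : R, [/\ 0 < T, 0 < r & forall x, `|x - p| < r -> O x -> v x <= T * s x].
Proof.
move=> sv [C1 [r1 [C10 r10 H1]]] [C2 [r2 [C20 r20 H2]]] [r3 r30 H3].
have [L [c [L1 c0 HS]]] := chart_small.
have [n1 n0] : 1 <= n%:R :> R /\ 0 < n%:R :> R.
  by have [j _] := grad_s; rewrite ler1n ltr0n (leq_ltn_trans (leq0n _) (ltn_ord j)).
pose N := n%:R * L; have N0 : 0 < N by rewrite mulr_gt0 //; lra.
(* For [Num.sqrt (s x) <= d] the bounded terms in the Laplacian of the barrier, at most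
   [7 / 2 * N + 2 * n], are at most half of [c / Num.sqrt (s x)]. *)
pose d := c / (7 * N + 4 * n%:R); have d0 : 0 < d by rewrite divr_gt0 //; lra.
have dd0 : 0 < d ^+ 2 by rewrite exprn_gt0.
have [r4 [r40 _ HX _]] := HS _ dd0.
pose r := Num.min (Num.min r1 r2) (Num.min r3 r4).
have r0 : 0 < r by rewrite !lt_min r10 r20 r30.
have [ra [rb [rc rd]]] : r <= r1 /\ r <= r2 /\ r <= r3 /\ r <= r4 by rewrite /r !ge_min !lexx !orbT.
pose rho := r / 4; have rho0 : 0 < rho by rewrite /rho; lra.
have rr : rho <= r by rewrite /rho; lra.
pose T := (C1 + 1) / rho ^+ 2 + 4 * (C2 + 1) / c.
have t1 : 0 < (C1 + 1) / rho ^+ 2 by rewrite divr_gt0 ?exprn_gt0 // addr_gt0.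
have t2 : 0 < 4 * (C2 + 1) / c by rewrite divr_gt0 // mulr_gt0 // addr_gt0.
have T0 : 0 < T by rewrite /T addr_gt0.
have Tr : C1 + 1 <= T * rho ^+ 2.
  have : (C1 + 1) / rho ^+ 2 * rho ^+ 2 <= T * rho ^+ 2 by rewrite ler_pM2r ?exprn_gt0 // /T lerDl ltW.
  by rewrite divfK // expf_neq0 // lt0r_neq0.
have Tc : 4 * (C2 + 1) <= T * c.
  have : 4 * (C2 + 1) / c * c <= T * c by rewrite ler_pM2r // /T lerDr ltW.
  by rewrite divfK // lt0r_neq0.
have chart x : `|x - p| < r -> O x -> [/\ W x, 0 < s x, Num.sqrt (s x) <= 1, Num.sqrt (s x) <= d & `|lap s x| <= N /\ c <= gradsq s x].
  move=> xr Ox; have [Ux sd s1 _ [cg ls]] := HX x (lt_le_trans xr rd).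
  have sx := (OU Ux).1 Ox; rewrite (ger0_norm (ltW sx)) in sd s1.
  split=> //.
    by rewrite -[leRHS]sqrtr1 ler_wsqrtr.
  by rewrite -[leRHS](ger0_norm (ltW d0)) -sqrtr_sqr ler_wsqrtr.
exists (2 * T), rho; split; [by rewrite mulr_gt0|exact: rho0|].
move=> x0 x0p Ox0; apply/ler_addgt0Pr => h h0.
have [e e0 He] := H3 h h0.
have e2e : e / 2 < e by rewrite ltr_pdivrMr // ltr_pMr // ltr1n.
have [W0 s0 _ _ _] := chart x0 (lt_le_trans x0p rr) Ox0.
have Ts0 : 0 < T * s x0 by rewrite mulr_gt0.
have [se|se] := ltP (s x0) e.
  have := He x0 (lt_le_trans (lt_le_trans x0p rr) rc) Ox0 se; rewrite ler_norml => /andP[_].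
  move: Ts0; clear; lra.
have quarter_sum (a b : V) : `|a| <= rho -> `|b| < rho -> `|a + b| < r.
  move=> ha hb; apply: le_lt_trans (ler_normD a b) _; move: ha hb r0; rewrite /rho.
  by move: `|a| `|b| (r) => a' b' c'; goal_lra.
(* [v] is controlled only inside [O], so the comparison stops at the level [s = e / 2], where
   [v <= h] because [v] vanishes at the boundary; [h] is arbitrary. *)
pose K := [set x : V | `|x - x0| <= rho /\ 0 <= s x - e / 2].
have Kp x : K x -> `|x - p| < r.
  move=> [xx _]; have -> : x - p = (x - x0) + (x0 - p) by rewrite addrA subrK.
  exact: quarter_sum xx x0p.
have KU x : `|x - x0| <= rho -> U x.
  move=> xx; have xp : `|x - p| < r.
    have -> : x - p = (x - x0) + (x0 - p) by rewrite addrA subrK.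
    exact: quarter_sum xx x0p.
  by have [] := HX x (lt_le_trans xp rd).
have KO x : K x -> O x.
  move=> [xx sx]; apply/(OU (KU x xx)); apply: (@lt_le_trans _ _ (e / 2)); first by rewrite divr_gt0.
  by rewrite -subr_ge0.
have cs x : U x -> {for x, continuous s} by exact: smooth_cont.
have cK : compact K.
  apply: compact_restrict => x xx; apply: continuousB; first exact: cs (KU x xx).
  exact: cst_continuous.
pose psi x := 2 * s x - s x * Num.sqrt (s x) + sqd x0 x.
pose H x := (v x - T * psi x) - h.
have sq : smooth_on W (fun x => s x * Num.sqrt (s x)).
  by apply: smoothM => //; apply: smooth_sqrt.
have s2 : smooth_on W (fun x => 2 * s x) by exact: smoothZ.
have sB := smoothB oW s2 sq.
have spsi : smooth_on W psi := smoothD oW sB (smooth_sqd x0 oW).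
have sT := smoothZ T oW spsi.
have sH : smooth_on W H by apply: smoothB => //; [exact: smoothB|exact: smooth_cst].
have psi_ge x : K x -> s x + sqd x0 x <= psi x.
  move=> Kx; have [Wx sx s1 _ _] := chart x (Kp x Kx) (KO x Kx); rewrite /psi.
  have : 0 <= s x * (1 - Num.sqrt (s x)) by rewrite mulr_ge0 ?(ltW sx) // subr_ge0.
  by move: (s x) (Num.sqrt _) (sqd _ _) => a b c'; goal_lra.
have KW : K `<=` W by move=> x Kx; have [] := chart x (Kp x Kx) (KO x Kx).
have Hle := @compare_smooth R n W K H oW sH cK KW.
have main : forall x, K x -> H x <= 0.
  apply: Hle => x Kx Hx.
  have [Wx sx s1 sd [lN cG]] := chart x (Kp x Kx) (KO x Kx).
  have qx := sqd_ge0 x0 x; have px := psi_ge x Kx.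
  have Tp : T * (s x + sqd x0 x) <= T * psi x by rewrite ler_pM2l.
  have Tq : 0 <= T * sqd x0 x by rewrite mulr_ge0 // ltW.
  have Ts : 0 < T * s x by rewrite mulr_gt0.
  have i1 : `|x - x0| < rho.
    rewrite lt_neqAle Kx.1 andbT; apply/eqP => E; move: Hx; rewrite /H.
    have : T * rho ^+ 2 <= T * sqd x0 x by rewrite ler_pM2l // -E; exact: sqd_ge_norm.
    have := H1 x (lt_le_trans (Kp x Kx) ra) (KO x Kx); rewrite wt2 // mulr1 ler_norml => /andP[_].
    move: Tr Tp Ts h0; clear; lra.
  have i2 : e / 2 < s x.
    rewrite lt_neqAle -subr_ge0 Kx.2 andbT; apply/eqP => E; move: Hx; rewrite /H.
    have se' : s x < e by rewrite -E; exact: e2e.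
    have := He x (lt_le_trans (Kp x Kx) rc) (KO x Kx) se'; rewrite ler_norml => /andP[_].
    move: Tp Ts Tq; clear; lra.
  split.
    have [d1 d10 h1] := near_gt (cs x Wx.2) i2.
    exists (Num.min d1 (rho - `|x - x0|)); first by rewrite lt_min d10 subr_gt0.
    move=> y; rewrite lt_min => /andP[y1 y2]; split; last by rewrite subr_ge0 ltW // h1.
    have -> : y - x0 = (y - x) + (x - x0) by rewrite addrA subrK.
    by apply: (le_trans (ler_normD _ _)); rewrite -lerBrDr ltW.
  rewrite /H (lapB oW (smoothB oW sv sT) (smooth_cst h oW) Wx) lap_cst subr0.
  rewrite (lapB oW sv sT Wx) (lapZ T oW spsi Wx) /psi (lapD oW sB (smooth_sqd x0 oW) Wx).
  rewrite (lapB oW s2 sq Wx) (lapZ 2 oW sW Wx) lap_sqd (lap_mul_sqrt oW sW s_gt0 Wx).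
  have q0 : 0 < Num.sqrt (s x) by rewrite sqrtr_gt0.
  apply: (@barrier_arith N _ c _ _ _ _ T C2) => //.
  - by rewrite invr_gt0.
  - have D0 : 0 < 7 * N + 4 * n%:R by rewrite addr_gt0 // mulr_gt0.
    rewrite -ler_pdivrMr ?invr_gt0 // invrK; move: sd; rewrite /d ler_pdivlMr //.
    by move: (Num.sqrt _) (N) (n%:R : R) => a b c'; goal_lra.
  have := H2 x (lt_le_trans (Kp x Kx) rb) (KO x Kx); rewrite wt3E //.
have := main x0; rewrite /K /= subrr normr0 => /(_ (conj (ltW rho0) _)).
rewrite subr_ge0 (le_trans (ltW e2e) se) => /(_ isT).
rewrite /H /psi; have -> : sqd x0 x0 = 0.
  by rewrite /sqd big1 // => i _; rewrite subrr expr0n.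
have : 0 <= T * (s x0 * Num.sqrt (s x0)) by rewrite mulr_ge0 ?(ltW T0) // mulr_ge0 ?sqrtr_ge0 // ltW.
move: Ts0 h0; clear; lra.
Qed.

Lemma lapN f x : smooth_on W f -> W x -> lap (fun y => - f y) x = - lap f x.
Proof.
move=> sf Wx; rewrite -mulN1r -(lapZ (-1) oW sf Wx); congr (lap _ x).
by apply/funext => y; rewrite mulN1r.
Qed.

Lemma chart_ball : exists2 r : R, 0 < r & forall x, `|x - p| < r -> U x.
Proof. exact: open_ballP. Qed.

Lemma BO_opp m f : BO m f -> BO m (fun x => - f x).
Proof. by move=> [C [r [C0 r0 H]]]; exists C, r; split=> // x xr Ox; rewrite normrN; exact: H. Qed.

Lemma BO_barrier v : smooth_on W v -> BO 2 v -> BO 3 (lap v) -> vanishes v -> BO 0 v.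
Proof.
move=> sv bv bl vv; have [T1 [r1 [T10 r10 H1]]] := barrier_upper sv bv bl vv.
have [r3 r30 hU] := chart_ball.
have bl' : BO 3 (lap (fun x => - v x)).
  by apply: (BO_congr _ (BO_opp bl)); exists r3 => // x xr Ox; rewrite lapN //; split=> //; exact: hU.
have vv' : vanishes (fun x => - v x).
  move: vv => [r r0 h]; exists r => // e e0; have [d d0 h'] := h e e0; exists d => // x xr Ox sx.
  by rewrite normrN; exact: h'.
have [T2 [r2 [T20 r20 H2]]] := barrier_upper (smoothN oW sv) (BO_opp bv) bl' vv'.
exists (T1 + T2), (Num.min r3 (Num.min r1 r2)); split; rewrite ?addr_gt0 ?lt_min ?r30 ?r10 //.
move=> x; rewrite !lt_min => /and3P[x3 x1 x2] Ox; rewrite wt0E.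
have sx := s_gt0 (conj Ox (hU x x3)).
have a1 : 0 < T1 * s x by rewrite mulr_gt0.
have a2 : 0 < T2 * s x by rewrite mulr_gt0.
have := H1 x x1 Ox; have := H2 x x2 Ox; rewrite ler_norml => b1 b2; apply/andP; split; lra.
Qed.

Lemma BO1_vanishes v : BO 1 v -> vanishes v.
Proof.
move=> [C [r [C0 r0 H]]]; have [r3 r30 hU] := chart_ball.
exists (Num.min r r3); first by rewrite lt_min r0.
move=> h h0; exists ((h / C) ^+ 2); first by rewrite exprn_gt0 // divr_gt0.
move=> x; rewrite lt_min => /andP[xr x3] Ox sx; have s0 := s_gt0 (conj Ox (hU x x3)).
apply: (le_trans (H x xr Ox)); rewrite wt1E // mulrC -ler_pdivlMr //.
have hc : 0 <= h / C by rewrite ltW // divr_gt0.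
by rewrite -[leRHS](ger0_norm hc) -sqrtr_sqr ler_wsqrtr // ltW.
Qed.
End ChartBarriers.

(** * Boundary regularity *)

Section TangentialDerivative.
Variables (R : realType) (n : nat).
Local Notation V := 'rV[R]_n.
Local Notation e_ := (@basis_vec R n).
Implicit Types (x z y : V) (f w : V -> R).

Lemma half_lt (a : R) : 0 < a -> a / 2 < a.
Proof. by move=> a0; rewrite ltr_pdivrMr // ltr_pMr // ltr1n. Qed.

Lemma concave_sqrt_le0 (l M c G g q : R) : 0 < g -> 0 < q -> `|l| <= M -> c <= G -> 2 * M * g <= c ->
  l / (2 * q) - G / (4 * g * q) <= 0.
Proof.
move=> g0 q0 /ler_normlP[_ lM] cG h.
have -> : l / (2 * q) - G / (4 * g * q) = (2 * g * l - G) / (4 * g * q) by field; rewrite !lt0r_neq0.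
rewrite pmulr_lle0 ?invr_gt0 ?mulr_gt0 //.
have : g * l <= g * M by rewrite ler_pM2l.
lra.
Qed.

Lemma concave_sqrt_le (l N c G g q : R) : 0 < g -> 0 < q -> q <= 1 -> `|l| <= N -> c <= G -> 0 <= c ->
  4 * N * g <= c -> l / (2 * q) - G / (4 * g * q) <= - (c / 8 / g).
Proof.
move=> g0 q0 q1 /ler_normlP[_ lM] cG c0 h.
have gl : g * l <= g * N by rewrite ler_pM2l.
have -> : l / (2 * q) - G / (4 * g * q) = (2 * g * l - G) / (4 * g * q) by field; rewrite !lt0r_neq0.
rewrite ler_pdivrMr ?mulr_gt0 //.
have -> : - (c / 8 / g) * (4 * g * q) = - (c / 2 * q) by field; rewrite !lt0r_neq0.
have : c / 2 * q <= c / 2 by rewrite ler_piMr //; lra.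
lra.
Qed.

Lemma segment_mvt U f x (v : V) (t : R) : open U -> smooth_on U f -> 0 < t ->
  (forall a : R, 0 <= a <= t -> U (x + a *: v)) ->
  exists2 a : R, 0 <= a <= t & f (x + t *: v) - f x = t * \sum_k v 0 k * pd k f (x + a *: v).
Proof.
move=> oU sf t0 hU.
have [a|a at_ E] := @mvt_point R (fun a => f (x + a *: v)) (fun a => \sum_k v 0 k * pd k f (x + a *: v)) 0 t (ltW t0).
  by move=> at_; apply: is_derive_line; apply: smooth_dir oU sf (hU a at_).
by exists a => //; move: E; rewrite scale0r addr0 subr0 => ->; rewrite mulrC.
Qed.

Lemma sum_two (a b : R) i j (g : 'I_n -> R) :
  \sum_k (a *: e_ j - b *: e_ i) 0 k * g k = a * g j - b * g i.
Proof.
have S c l : \sum_k (c * (k == l)%:R) * g k = c * g l.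
  rewrite (bigD1 l) //= eqxx mulr1 big1 ?addr0 // => k /negbTE ->.
  by rewrite mulr0 mul0r.
rewrite -(S a j) -(S b i) -sumrB; apply: eq_bigr => k _.
by rewrite !mxE eqxx /=; ring.
Qed.

Lemma norm_two (a b L : R) i j : `|a| <= L -> `|b| <= L -> `|a *: e_ j - b *: e_ i : V| <= 2 * L.
Proof.
move=> aL bL; apply: (le_trans (ler_normB _ _)).
have := le_trans (norm_basis a j) aL; have := le_trans (norm_basis b i) bL; lra.
Qed.

Lemma two_bound (a b L u1 u2 B : R) : `|a| <= L -> `|b| <= L -> `|u1| <= B -> `|u2| <= B ->
  `|a * u1 - b * u2| <= 2 * L * B.
Proof.
move=> aL bL h1 h2; apply: (le_trans (ler_normB _ _)); rewrite !normrM.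
have -> : 2 * L * B = L * B + L * B by ring.
by rewrite lerD // ler_pM.
Qed.

Lemma quotient_le (D t B T q1 q2 : R) : 0 < t -> `|D| <= t * B -> 0 < T -> B <= T * (q1 + q2) ->
  t^-1 * D - T * (q1 + q2) <= 0.
Proof.
move=> t0 /ler_normlP[_ DB] T0 BT; rewrite subr_le0 mulrC ler_pdivrMr //.
by apply: (le_trans DB); rewrite mulrC ler_pM2r.
Qed.

Lemma quotient_lap (D t B T q1 q2 c si : R) : 0 < t -> `|D| <= t * (B * si) -> 0 < T -> 0 < si ->
  q1 <= 0 -> q2 <= - (c / 8 * si) -> 8 * B + 8 <= T * c -> 0 < t^-1 * D - T * (q1 + q2).
Proof.
move=> t0 /ler_normlP[DB _] T0 s0 h1 h2 hT.
have k1 : - (B * si) <= t^-1 * D.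
  by rewrite -(ler_pM2l t0) mulrA divff ?lt0r_neq0 // mul1r mulrN lerNl.
have k2 : T * (q1 + q2) <= T * - (c / 8 * si) by rewrite ler_pM2l //; lra.
have k3 : (8 * B + 8) * si <= T * c * si by rewrite ler_pM2r.
lra.
Qed.

Lemma div_half (a b C : R) : 0 < a -> 0 < b -> 0 < C -> a / 2 <= b -> C / b <= 2 * C / a.
Proof.
move=> a0 b0 C0 ab; have -> : 2 * C / a = C / (a / 2) by field; rewrite lt0r_neq0.
by rewrite ler_pM2l // lef_pV2 ?posrE // divr_gt0.
Qed.

Lemma cross_sub (a b u1 u2 : R) : a * u1 - b * u2 = a * (u1 - b) - b * (u2 - a).
Proof. by ring. Qed.

Lemma double_le (a b : R) : a <= b -> a + a <= 2 * b.
Proof. lra. Qed.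

Lemma grad_shift_ge (P y : 'I_n -> R) :
  (\sum_k P k ^+ 2) / 2 - 4 * \sum_k y k ^+ 2 <= \sum_k (P k + 2 * y k) ^+ 2.
Proof.
rewrite mulr_suml mulr_sumr -sumrB; apply: ler_sum => k _; rewrite -subr_ge0.
have -> : (P k + 2 * y k) ^+ 2 - (P k ^+ 2 / 2 - 4 * y k ^+ 2) = (P k + 4 * y k) ^+ 2 / 2 by field.
by rewrite divr_ge0 // sqr_ge0.
Qed.

Variables (O U : set V) (s : V -> R) (p : V).
Hypotheses (oO : open O) (oU : open U) (sU : smooth_on U s) (Up : U p) (sp0 : s p = 0).
Hypothesis OU : forall x, U x -> O x <-> 0 < s x.
Hypothesis grad_s : exists j, pd j s p != 0.
Local Notation BO := (BO O s p).
Local Notation W := (O `&` U).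

Let oW : open W := openI oO oU.
Let sW : smooth_on W s.
Proof. by apply: smooth_sub sU => x []. Qed.
Let s_gt0 x : W x -> 0 < s x.
Proof. by move=> [Ox Ux]; apply/(OU Ux). Qed.

Ltac keep := clear -grad_s OU sp0 Up sU oU oO s_gt0 sW oW.
Ltac goal_lra := keep; lra.

(** Derivative of [f] along a field in the plane of the coordinates [i] and [j] that is tangent to
    the level sets of [s]. *)
Definition Zf i j f x : R := pd i s x * pd j f x - pd j s x * pd i f x.

Lemma BO_unif m (F : 'I_n -> V -> R) : (forall k, BO m (F k)) ->
  exists C r : R, [/\ 0 < C, 0 < r & forall k x, `|x - p| < r -> O x -> `|F k x| <= C * wt s m x].
Proof.
move=> H; have [r0 r00 hU] := open_ballP oU Up.
have [r [C [r1 C0 h]]] : exists r C : R, [/\ 0 < r, 0 <= C & forall k, forall x, `|x - p| < Num.min r r0 -> O x -> `|F k x| <= C * wt s m x].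
  apply: (@fin_bound R _ (fun k r C => forall x, `|x - p| < Num.min r r0 -> O x -> `|F k x| <= C * wt s m x)).
    move=> k d M d' M' hh dd MM x; rewrite lt_min => /andP[xd x0] Ox.
    apply: (le_trans (hh x _ Ox)); first by rewrite lt_min (lt_le_trans xd dd).
    by rewrite ler_wpM2r // ltW // wt_ge0 // s_gt0 //; split => //; exact: hU.
  move=> k; have [C [r [C0 r1 h]]] := H k; exists r, C; split=> // x.
  by rewrite lt_min => /andP[xr _]; exact: h.
exists (C + 1), (Num.min r r0); split; [lra|by rewrite lt_min r1|].
move=> k x xr Ox; apply: (le_trans (h k x xr Ox)); rewrite ler_wpM2r //; last lra.
move: xr; rewrite lt_min => /andP[_ x0].
by rewrite ltW // wt_ge0 // s_gt0 //; split => //; exact: hU.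
Qed.

(** [Zf i j w] itself is not yet known to tend to zero at the boundary. So the difference quotient
    of [w] along the fixed vector [tau], tangent to the level set of [s] at [x0], is compared with a
    multiple of [sqrt (s + |x - x0|^2) + sqrt s]. By tangency, a step of length [t] changes [s] only
    by O(t (|x - x0| + t)); where [s] has that size, [w = O(s)] bounds the quotient by O(|x - x0| +
    t). In the interior the Laplacian of [sqrt s] is negative of order [s^(-3/2)], which beats the
    O(1/s) coming from the gradient of [lap w]. At [x0] both roots equal [sqrt (s x0)], and [t]
    tends to 0. *)
Lemma tangential_upper w i j : smooth_on W w -> BO 0 w -> (forall k, BO 2 (pd k w)) ->
  (forall k, BO 4 (pd k (lap w))) ->
  exists T r : R, [/\ 0 < T, 0 < r & forall x, `|x - p| < r -> O x -> Zf i j w x <= T * Num.sqrt (s x)].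
Proof.
move=> sw [C0 [r0 [C00 r00 H0]]] /BO_unif[C1 [r1 [C10 r10 H1]]] /BO_unif[C4 [r4 [C40 r40 H4]]].
have [L [c [L1 c0 HS]]] := chart_small oU sU Up sp0 grad_s.
have n1 : 1 <= n%:R :> R by rewrite ler1n (leq_ltn_trans (leq0n _) (ltn_ord j)).
have L0 : 0 < L by lra.
pose N := n%:R * L; have N0 : 0 < N by rewrite mulr_gt0 //; lra.
pose D := (N + 2 * n%:R) * (n%:R + 1); have D1 : N + 2 * n%:R <= D by rewrite ler_peMr //; lra.
have D2 : n%:R <= D by lra.
pose d := c / (16 * D); have d0 : 0 < d by rewrite divr_gt0 //; lra.
have dD : 16 * D * d = c by rewrite mulrC /d divfK // lt0r_neq0 //; lra.
have [rs [rs0 rsd HX HG]] := HS _ d0.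
pose r := Num.min (Num.min (Num.min r0 r1) (Num.min r4 rs)) 1.
have rp : 0 < r by rewrite !lt_min r00 r10 r40 rs0 /=.
have [ra [rb [rc [rd re]]]] : r <= r0 /\ r <= r1 /\ r <= r4 /\ r <= rs /\ r <= 1.
  by rewrite /r !ge_min !lexx !orbT.
pose rho := r / 8; have rho0 : 0 < rho by rewrite /rho; lra.
have rho1 : n%:R * rho ^+ 2 <= n%:R * d.
  rewrite ler_wpM2l //; apply: (@le_trans _ _ rho); last by rewrite /rho; lra.
  by rewrite expr2 ler_piMr ?(ltW rho0) //; rewrite /rho; lra.
(* Along the segment [s] moves by at most [4 * L ^+ 3 * t * (|x - x0| + t)], see [sdiff], which is
   half of [A * t * (|x - x0| + t)]. Hence for [x] in [K] the segment stays in [O] and [s] changes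
   by at most half of [s x]. *)
pose A := 8 * L ^+ 3.
have L3 : 1 <= L ^+ 3 by rewrite exprn_ege1.
have A1 : 1 <= A by rewrite /A; lra.
have A0 : 0 < A by lra.
pose T := 2 * L * C1 / rho + 5 / 2 * C0 * A + (32 * L * C4 + 8) / c + 1.
have Ta : 0 < 2 * L * C1 / rho by rewrite divr_gt0 // mulr_gt0 //; lra.
have Tb : 0 < 5 / 2 * C0 * A by rewrite mulr_gt0 ?mulr_gt0 //; lra.
have Tc : 0 < (32 * L * C4 + 8) / c by rewrite divr_gt0 // addr_gt0 // !mulr_gt0.
have T0 : 0 < T by rewrite /T; lra.
have T1 : 2 * L * C1 <= T * rho.
  have : 2 * L * C1 / rho * rho <= T * rho by rewrite ler_pM2r // /T; lra.
  by rewrite divfK // lt0r_neq0.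
have T2 : 5 / 2 * C0 * A <= T by rewrite /T; lra.
have T3 : 32 * L * C4 + 8 <= T * c.
  have : (32 * L * C4 + 8) / c * c <= T * c by rewrite ler_pM2r // /T; lra.
  by rewrite divfK // lt0r_neq0.
clearbody T; clear Ta Tb Tc.
have chart x : `|x - p| < r -> O x -> [/\ W x, 0 < s x, s x <= d, s x <= 1 & Num.sqrt (s x) <= 1] /\
    [/\ `|lap s x| <= N & c <= gradsq s x].
  move=> xr Ox; have [Ux sd s1 _ [cg ls]] := HX x (lt_le_trans xr rd).
  have sx := (OU Ux).1 Ox; rewrite (ger0_norm (ltW sx)) in sd s1.
  split=> //; split=> //; rewrite -[leRHS]sqrtr1 ler_wsqrtr //.
exists (2 * T), rho; split; [lra|exact: rho0|].
move=> x0 x0p Ox0.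
have rr : rho < r by rewrite /rho; move: rp; goal_lra.
have x0r : `|x0 - p| < r := lt_trans x0p rr.
have [[Wx0 s0 _ _ _] _] := chart x0 x0r Ox0.
pose a := pd i s x0; pose b := pd j s x0.
have [aL bL] : `|a| <= L /\ `|b| <= L.
  by have [_ _ _ g _] := HX x0 (lt_le_trans x0r rd); split; exact: g.
pose tau : V := a *: e_ j - b *: e_ i.
have tauL : `|tau| <= 2 * L by exact: norm_two.
have dirE f y : smooth_on U f -> \sum_k tau 0 k * pd k f y = a * pd j f y - b * pd i f y.
  by move=> _; exact: sum_two.
(* The first entry keeps the segments near [p]; the last one gives [A * t ^+ 2 <= s x0], which puts
   [x0] itself in [K]. *)
pose t0 := Num.min (rho / (2 * L)) (Num.min 1 (Num.sqrt (s x0 / A))).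
have t00 : 0 < t0.
  by rewrite !lt_min divr_gt0 ?mulr_gt0 //= ltr01 sqrtr_gt0 divr_gt0.
suff key t : 0 < t -> t < t0 -> w (x0 + t *: tau) - w x0 <= t * (2 * T * Num.sqrt (s x0)).
  have D1' : is_derive (0 : R) 1 (fun t => w (x0 + t *: tau)) (Zf i j w x0).
    rewrite (_ : Zf i j w x0 = \sum_k tau 0 k * pd k w x0); last by rewrite sum_two.
    by apply: is_derive_line; rewrite scale0r addr0; exact: smooth_dir oW sw Wx0.
  pose B := 2 * T * Num.sqrt (s x0).
  have D2' : is_derive (0 : R) 1 (fun t : R => B * t) (B * 1).
    by apply: is_deriveZ1; exact: is_derive_id.
  have DD := is_deriveB D1' D2'.
  rewrite leNgt; apply/negP => h; have hB : 0 < Zf i j w x0 - B * 1 by rewrite mulr1 subr_gt0.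
  have [r' r'0 Hr] := derive_pos_right DD hB.
  have m0 : 0 < Num.min t0 r' / 2 by rewrite divr_gt0 // lt_min t00.
  have ml : Num.min t0 r' / 2 < Num.min t0 r' by apply: half_lt; rewrite lt_min t00.
  have := Hr _ m0 (lt_le_trans ml _); rewrite ge_min lexx orbT add0r => /(_ isT).
  have := key _ m0 (lt_le_trans ml _); rewrite ge_min lexx => /(_ isT).
  by rewrite /= !fctE /= scale0r addr0 mulr0 subr0 -/B [_ * B]mulrC lerBlDr ltrBrDr [w x0 + _]addrC leNgt => /negP.
move=> tp; rewrite !lt_min => /and3P[ta tb tc].
have tL : 2 * L * t < rho by move: ta; rewrite ltr_pdivlMr ?mulr_gt0 // mulrC.
have tA : A * t ^+ 2 <= s x0.
  have : t ^+ 2 <= Num.sqrt (s x0 / A) ^+ 2 by rewrite ler_sqr ?nnegrE ?sqrtr_ge0 ?ltW.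
  rewrite sqr_sqrtr ?divr_ge0 ?(ltW s0) ?(ltW A0) //.
  by rewrite ler_pdivlMr 1?mulrC.
pose K := [set x : V | `|x - x0| <= rho /\ 0 <= s x - A * t * (`|x - x0| + t)].
have ball x q : `|x - x0| <= rho -> 0 <= q <= t -> `|x + q *: tau - x0| <= `|x - x0| + 2 * L * t /\ `|x + q *: tau - p| < r.
  move=> xx /andP[q0 qt].
  have qt' : `|q *: tau| <= 2 * L * t.
    rewrite normrZ ger0_norm // mulrC ler_pM //.
  have e1 : `|x + q *: tau - x0| <= `|x - x0| + 2 * L * t.
    by rewrite addrAC; apply: (le_trans (ler_normD _ _)); rewrite lerD2l.
  split => //; have -> : x + q *: tau - p = (x + q *: tau - x0) + (x0 - p) by rewrite addrA subrK.
  apply: (le_lt_trans (ler_normD _ _)); move: e1 xx x0p tL rho0; rewrite /rho; goal_lra.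
have ballx x : `|x - x0| <= rho -> `|x - p| < r.
  by move=> xx; have [|_] := ball x 0 xx; rewrite ?lexx ?(ltW tp) // scale0r addr0.
have sdiff x q : `|x - x0| <= rho -> 0 <= q <= t -> `|s (x + q *: tau) - s x| <= A * t * (`|x - x0| + t) / 2.
  move=> xx /andP[q0 qt].
  have pos : 0 <= A * t * (`|x - x0| + t) by rewrite mulr_ge0 ?addr_ge0 ?mulr_ge0 // ltW.
  move: q0; rewrite le_eqVlt => /orP[/eqP <-|q0].
    by rewrite scale0r addr0 subrr normr0 divr_ge0.
  have hb u : 0 <= u <= q -> U (x + u *: tau).
    move=> /andP[u0 uq]; have [|_ h] := ball x u xx; first by rewrite u0 (le_trans uq).
    by have [] := HX _ (lt_le_trans h rd).
  have [u uq ->] := segment_mvt oU sU q0 hb.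
  have ut : 0 <= u <= t by move: uq => /andP[-> uq]; rewrite (le_trans uq).
  have [h1 h2] := ball x u xx ut; rewrite sum_two.
  set y := x + u *: tau in h1 h2 *.
  have g1 := HG j y x0 (lt_le_trans h2 rd) (lt_le_trans x0r rd).
  have g2 := HG i y x0 (lt_le_trans h2 rd) (lt_le_trans x0r rd).
  have -> : a * pd j s y - b * pd i s y = a * (pd j s y - pd j s x0) - b * (pd i s y - pd i s x0).
    exact: cross_sub.
  rewrite normrM (ger0_norm (ltW q0)).
  have k1 : `|a * (pd j s y - pd j s x0)| <= L * (L * `|y - x0|).
    by rewrite normrM; exact: ler_pM (normr_ge0 _) (normr_ge0 _) aL g1.
  have k2 : `|b * (pd i s y - pd i s x0)| <= L * (L * `|y - x0|).
    by rewrite normrM; exact: ler_pM (normr_ge0 _) (normr_ge0 _) bL g2.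
  have k3 : L * (L * `|y - x0|) <= L * (L * (2 * L * (`|x - x0| + t))).
    do 2 (rewrite ler_wpM2l ?(ltW L0) //); apply: (le_trans h1).
    have : 0 <= (2 * L - 1) * `|x - x0| by rewrite mulr_ge0 //; move: L1; goal_lra.
    by goal_lra.
  apply: (@le_trans _ _ (t * (2 * (L * (L * (2 * L * (`|x - x0| + t))))))).
    apply: ler_pM => //; first exact: ltW.
    apply: (le_trans (ler_normB _ _)); apply: (le_trans (lerD k1 k2)).
    exact: double_le.
  by rewrite le_eqVlt; apply/orP; left; apply/eqP; rewrite /A; keep; field.
have seg x q : K x -> 0 <= q <= t -> [/\ O (x + q *: tau), s x / 2 <= s (x + q *: tau) & s (x + q *: tau) <= 3 / 2 * s x].
  move=> [xx sx] qt; have := sdiff x q xx qt; rewrite ler_norml => /andP[h1 h2].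
  have [_ h] := ball x q xx qt.
  have pos : 0 < A * t * (`|x - x0| + t) by rewrite !mulr_gt0 // ltr_wpDl.
  have : 0 < s (x + q *: tau) by move: h1 sx pos; goal_lra.
  have [Uq _ _ _ _] := HX _ (lt_le_trans h rd); move=> /(OU Uq) Oq.
  by split => //; move: h1 h2 sx; goal_lra.
have segW x : K x -> forall q, 0 <= q <= t -> W (x + q *: tau).
  move=> Kx q qt; have [Oq _ _] := seg x q Kx qt; split => //.
  have [_ h] := ball x q Kx.1 qt; by have [] := HX _ (lt_le_trans h rd).
have z0 : 0 <= (0 : R) <= t by rewrite lexx ltW.
have zt : 0 <= t <= t by rewrite lexx ltW.
have KW x : K x -> W x by move=> Kx; have := segW x Kx 0 z0; rewrite scale0r addr0.
pose W' := W `&` [set x | W (x + t *: tau)].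
have oW' : open W' by apply: openI => //; exact: open_shift.
have W'W f : smooth_on W f -> smooth_on W' f by apply: smooth_sub => x [].
have sSh f : smooth_on W f -> smooth_on W' (fun x => f (x + t *: tau)).
  by move=> sf; apply: smooth_sub (smooth_shift (a := t *: tau) sf) => x [].
pose g x := s x + sqd x0 x.
have sg : smooth_on W' g := smoothD oW' (W'W _ sW) (smooth_sqd x0 oW').
have g0 x : W' x -> 0 < g x.
  by move=> [Wx _]; rewrite /g ltr_pwDl ?s_gt0 // sqd_ge0.
have s0' x : W' x -> 0 < s x by move=> [Wx _]; exact: s_gt0.
have sqg : smooth_on W' (fun x => Num.sqrt (g x)) := smooth_sqrt oW' sg g0.
have sqs : smooth_on W' (fun x => Num.sqrt (s x)) := smooth_sqrt oW' (W'W _ sW) s0'.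
have sdw := smoothB oW' (sSh _ sw) (W'W _ sw).
have s1' := smoothZ t^-1 oW' sdw.
have s2 := smoothD oW' sqg sqs.
have s3 := smoothZ T oW' s2.
pose H x := t^-1 * (w (x + t *: tau) - w x) - T * (Num.sqrt (g x) + Num.sqrt (s x)).
have sH : smooth_on W' H := smoothB oW' s1' s3.
have cK : compact K.
  apply: compact_restrict => x xx; apply: continuousB.
    by apply: (smooth_cont sU); have [] := HX _ (lt_le_trans (ballx x xx) rd).
  apply: continuousM; first exact: cst_continuous.
  apply: continuousD; last exact: cst_continuous.
  apply: cont_norm => e e0; exists e => // y ye.
  by apply: (le_trans (ler_dist_dist _ _)); rewrite opprB addrA subrK; exact: ltW.
have KW' : K `<=` W' by move=> x Kx; split; [exact: KW|exact: (segW x Kx t zt)].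
suff main : forall x, K x -> H x <= 0.
  have := main x0; rewrite /K /= subrr normr0 add0r -mulrA -expr2 subr_ge0.
  move=> /(_ (conj (ltW rho0) tA)); rewrite /H /g.
  have -> : sqd x0 x0 = 0 by rewrite /sqd big1 // => k _; rewrite subrr expr0n.
  rewrite addr0 subr_le0 mulrC ler_pdivrMr // => /le_trans; apply.
  by rewrite le_eqVlt; apply/orP; left; apply/eqP; ring.
apply: (compare_smooth oW' sH cK KW') => x Kx Hx.
have [xx sKx] := Kx; have [[Wx sx sd s1 q1] [lN cG]] := chart x (ballx x xx) (KW x Kx).1.
have qs0 : 0 < Num.sqrt (s x) by rewrite sqrtr_gt0.
have gx0 := g0 x (KW' x Kx); have qg0 : 0 < Num.sqrt (g x) by rewrite sqrtr_gt0.
have qge : `|x - x0| <= Num.sqrt (g x).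
  rewrite -[leLHS](ger0_norm (normr_ge0 _)) -sqrtr_sqr ler_wsqrtr //.
  by apply: (le_trans (sqd_ge_norm x0 x)); rewrite /g lerDr ltW.
have tq : t <= Num.sqrt (s x).
  rewrite -[leLHS](ger0_norm (ltW tp)) -sqrtr_sqr ler_wsqrtr //.
  have t3 : 0 <= A * t * `|x - x0| by rewrite mulr_ge0 // mulr_ge0 // ltW.
  have t2 : t ^+ 2 <= A * t ^+ 2 by rewrite ler_peMl // sqr_ge0.
  by move: sKx; rewrite mulrDr -[A * t * t]mulrA -expr2; move: t2 t3; goal_lra.
have i1 : `|x - x0| < rho.
  rewrite lt_neqAle xx andbT; apply/eqP => E; move: Hx; apply/negP; rewrite -leNgt.
  apply: (@quotient_le _ _ (2 * L * C1)) => //; last first.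
    apply: (le_trans T1); rewrite ler_pM2l //; apply: (@le_trans _ _ (Num.sqrt (g x))).
      by rewrite -E.
    by rewrite lerDl ltW.
  have [q qt ->] := segment_mvt oW sw tp (segW x Kx).
  rewrite normrM (ger0_norm (ltW tp)) ler_pM2l // sum_two.
  have [_ h] := ball x q xx qt; have [Oq _] := segW x Kx q qt; have sq0 := s_gt0 (segW x Kx q qt).
  have bw k : `|pd k w (x + q *: tau)| <= C1.
    by apply: (le_trans (H1 k _ (lt_le_trans h rb) Oq)); rewrite wt2 // mulr1.
  exact: two_bound.
have i2 : A * t * (`|x - x0| + t) < s x.
  rewrite lt_neqAle -subr_ge0 sKx andbT; apply/eqP => E; move: Hx; apply/negP; rewrite -leNgt.
  apply: (@quotient_le _ _ (5 / 2 * C0 * A * (`|x - x0| + t))) => //; last first.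
    by rewrite ler_pM ?lerD ?addr_ge0 ?(ltW tp) // mulr_ge0 ?mulr_ge0 // ltW.
  have [Ot l1 l2] := seg x t Kx zt; have [_ h] := ball x t xx zt.
  have b1 := H0 _ (lt_le_trans h ra) Ot; have b2 := H0 x (lt_le_trans (ballx x xx) ra) Wx.1.
  rewrite wt0E in b1; rewrite wt0E in b2.
  apply: (le_trans (ler_normB _ _)); apply: (le_trans (lerD b1 b2)).
  rewrite -mulrDr; apply: (@le_trans _ _ (C0 * (5 / 2 * s x))).
    by rewrite ler_pM2l //; move: l2; goal_lra.
  by rewrite -E le_eqVlt; apply/orP; left; apply/eqP; field.
split.
  have cc : {for x, continuous (fun y => s y - A * t * (`|y - x0| + t))}.
    apply: continuousB; first exact: smooth_cont sW Wx.
    apply: continuousM; first exact: cst_continuous.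
    apply: continuousD; last exact: cst_continuous.
    apply: cont_norm => e e0; exists e => // y ye.
    by apply: (le_trans (ler_dist_dist _ _)); rewrite opprB addrA subrK; exact: ltW.
  have i3 : 0 < s x - A * t * (`|x - x0| + t) by rewrite subr_gt0.
  have [d1 d10 h1] := near_gt cc i3.
  exists (Num.min d1 (rho - `|x - x0|)); first by rewrite lt_min d10 subr_gt0.
  move=> y; rewrite lt_min => /andP[y1 y2]; split; last by apply: ltW; exact: h1.
  have -> : y - x0 = (y - x) + (x - x0) by rewrite addrA subrK.
  by apply: (le_trans (ler_normD _ _)); rewrite -lerBrDr ltW.
have Wx' := KW' x Kx.
rewrite /H (lapB oW' s1' s3 Wx') (lapZ _ oW' sdw Wx') (lapZ _ oW' s2 Wx').
rewrite (lapB oW' (sSh _ sw) (W'W _ sw) Wx') (lapD oW' sqg sqs Wx') lap_shift.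
rewrite (lap_sqrt oW' sg g0 Wx') (lap_sqrt oW' (W'W _ sW) s0' Wx').
have lg : lap g x = lap s x + 2 * n%:R.
  by rewrite /g (lapD oW' (W'W _ sW) (smooth_sqd x0 oW') Wx') lap_sqd.
have pg k : pd k g x = pd k s x + 2 * (x 0 k - x0 0 k).
  by rewrite /g (pdD k (W'W _ sW) (smooth_sqd x0 oW') Wx') pd_sqd.
have sqx : sqd x0 x <= n%:R * d.
  apply: (le_trans (sqd_le_norm x0 x)); apply: le_trans rho1.
  by rewrite ler_wpM2l // ler_sqr ?nnegrE // ltW.
have Dd : D * d = c / 16 by move: dD; goal_lra.
have nd : n%:R * d <= c / 16 by rewrite -Dd ler_pM2r.
apply: (@quotient_lap _ _ (4 * L * C4) _ _ _ c (s x)^-1) => //.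
- have [q qt ->] := segment_mvt oW (smooth_lap oW sw) tp (segW x Kx).
  rewrite normrM (ger0_norm (ltW tp)) ler_pM2l // sum_two.
  have [_ h] := ball x q xx qt; have [Oq l1 l2] := seg x q Kx qt; have sq0 := s_gt0 (segW x Kx q qt).
  have bw k : `|pd k (lap w) (x + q *: tau)| <= 2 * C4 / s x.
    apply: (le_trans (H4 k _ (lt_le_trans h rc) Oq)); rewrite wt4E //.
    exact: div_half.
  have -> : 4 * L * C4 / s x = 2 * L * (2 * C4 / s x) by ring.
  exact: two_bound.
- by rewrite invr_gt0.
- rewrite -mulr_suml; apply: (@concave_sqrt_le0 _ (N + 2 * n%:R) (c / 4)) => //.
  + by rewrite lg; apply: (le_trans (ler_normD _ _)); rewrite lerD // ger0_norm // mulr_ge0.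
  + rewrite (eq_bigr (fun k => (pd k s x + 2 * (x 0 k - x0 0 k)) ^+ 2)); last by move=> k _; rewrite pg.
    have := grad_shift_ge (fun k => pd k s x) (fun k => x 0 k - x0 0 k).
    rewrite -/(gradsq s x) -/(sqd x0 x); apply: le_trans.
    by move: cG sqx nd c0; goal_lra.
  have gd : g x <= (n%:R + 1) * d by rewrite /g; move: sqx sd; goal_lra.
  have : (N + 2 * n%:R) * g x <= (N + 2 * n%:R) * ((n%:R + 1) * d).
    by rewrite ler_wpM2l //; move: N0 n1; goal_lra.
  by rewrite mulrA -/D Dd; move: c0; goal_lra.
- rewrite -mulr_suml; apply: (@concave_sqrt_le _ N) => //; first exact: ltW.
  have : N * s x <= D * d by rewrite ler_pM ?(ltW N0) ?(ltW sx) //; move: D1 n1; goal_lra.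
  by rewrite Dd; move: c0; goal_lra.
by move: T3; goal_lra.
Qed.
End TangentialDerivative.

(** * Bounds for all derivatives up to the boundary *)

Section BoundaryRegularity.
Variables (R : realType) (n : nat).
Local Notation V := 'rV[R]_n.
Local Notation e_ := (@basis_vec R n).
Implicit Types (x z y : V) (f g w : V -> R).
Variables (O U : set V) (s : V -> R) (p : V).
Hypotheses (oO : open O) (oU : open U) (sU : smooth_on U s) (Up : U p) (sp0 : s p = 0).
Hypothesis OU : forall x, U x -> O x <-> 0 < s x.
Hypothesis grad_U : forall x, U x -> exists j, pd j s x != 0.
Local Notation BO := (BO O s p).
Local Notation W := (O `&` U).
Local Notation Zf := (Zf s).

Let grad_s : exists j, pd j s p != 0 := grad_U Up.
Let oW : open W := openI oO oU.
Let WU : W `<=` U. Proof. by move=> x []. Qed.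

Lemma gradsq_neq0 x : U x -> gradsq s x != 0.
Proof.
move=> /grad_U[j hj]; rewrite gt_eqF // /gradsq (bigD1 j) //= ltr_pwDl ?exprn_even_gt0 //.
by apply: sumr_ge0 => i _; rewrite sqr_ge0.
Qed.

Lemma smooth_gradsq : smooth_on U (gradsq s).
Proof. by apply: smooth_sum => // i; exact: (smoothM oU (smooth_pd i sU) (smooth_pd i sU)). Qed.

Lemma smooth_Zf i j w : smooth_on W w -> smooth_on W (Zf i j w).
Proof.
move=> sw; have sp k : smooth_on W (pd k s) := smooth_sub WU (smooth_pd k sU).
exact: (smoothB oW (smoothM oW (sp i) (smooth_pd j sw)) (smoothM oW (sp j) (smooth_pd i sw))).
Qed.

Lemma tangential_bound w i j : smooth_on W w -> BO 0 w -> (forall k, BO 2 (pd k w)) ->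
  (forall k, BO 4 (pd k (lap w))) -> BO 1 (Zf i j w).
Proof.
move=> sw b0 b2 b4; have T a b := tangential_upper oO oU sU Up sp0 OU grad_s a b sw b0 b2 b4.
have [T1 [r1 [T10 r10 H1]]] := T i j; have [T2 [r2 [T20 r20 H2]]] := T j i.
have [r3 r30 hU] := open_ballP oU Up.
exists (T1 + T2), (Num.min r3 (Num.min r1 r2)); split; rewrite ?addr_gt0 ?lt_min ?r30 ?r10 //.
move=> x; rewrite !lt_min => /and3P[x3 x1 x2] Ox; have sx : 0 < s x by apply/(OU (hU x x3)).
rewrite wt1E //; have := H1 x x1 Ox; have := H2 x x2 Ox.
have -> : Zf j i w x = - Zf i j w x by rewrite /Zf opprB.
move=> h1 h2; rewrite mulrDl; have a1 : 0 <= T1 * Num.sqrt (s x) by rewrite mulr_ge0 ?sqrtr_ge0 // ltW.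
have a2 : 0 <= T2 * Num.sqrt (s x) by rewrite mulr_ge0 ?sqrtr_ge0 // ltW.
rewrite ler_norml -lerNl; apply/andP; split.
  by apply: (le_trans h1); rewrite lerDr.
by apply: (le_trans h2); rewrite lerDl.
Qed.

Lemma product_cancel (a1 a2 b1 b2 u1 u2 h1 h2 : R) :
  a1 * h1 + u1 * a2 - (b1 * h2 + u2 * b2) - (a2 * u1 - b2 * u2) = a1 * h1 - b1 * h2.
Proof. by ring. Qed.

Lemma cross_add (a b u1 u2 : R) : a * a * u2 = a * (a * u2 - b * u1) + b * (a * u1).
Proof. by ring. Qed.

Lemma leibniz2 (a b da db d2a d2b : R) :
  a * d2b + (2 * da * db + d2a * b) = da * db + b * d2a + (a * d2b + db * da).
Proof. by ring. Qed.

(* Modulo first derivatives of [w], the Hessian of [w] is a combination of the derivatives of the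
   tangential derivatives [Zf i j w] and of the Laplacian, with smooth coefficients. *)
Section Class.
Variable P : (V -> R) -> Prop.
Hypothesis Pcongr : forall f g, (forall x, W x -> f x = g x) -> P f -> P g.
Hypothesis Padd : forall f g, P f -> P g -> P (fun x => f x + g x).
Hypothesis Pmul : forall c f, smooth_on U c -> P f -> P (fun x => c x * f x).
Hypothesis P0 : P (fun=> 0).

Lemma class_sum (F : 'I_n -> V -> R) : (forall i, P (F i)) -> P (fun x => \sum_i F i x).
Proof.
move=> H; suff h l : P (fun x => \sum_(i <- l) F i x) by apply: Pcongr (h (index_enum 'I_n)).
elim: l => [|i l IH]; first by apply: Pcongr P0 => x _; rewrite big_nil.
by apply: Pcongr (Padd (H i) IH) => x _; rewrite big_cons.
Qed.

Lemma class_sub f g : P f -> P g -> P (fun x => f x - g x).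
Proof.
move=> Pf Pg; apply: Pcongr (Padd Pf (Pmul (smooth_cst (-1) oU) Pg)) => x _.
by rewrite mulN1r.
Qed.

Lemma class_div f : P (fun x => gradsq s x * f x) -> P f.
Proof.
move=> Pf; have si := smooth_inv oU smooth_gradsq gradsq_neq0.
apply: Pcongr (Pmul si Pf) => x [_ Ux].
by rewrite mulrA mulVf ?mul1r // gradsq_neq0.
Qed.

Variable w : V -> R.
Hypotheses (sw : smooth_on W w) (Pw : forall k, P (pd k w)).

Lemma class_Z_pd a i j : (forall k, P (pd k (Zf a i w))) -> P (Zf a i (pd j w)).
Proof.
move=> PZ.
have c1 := Pmul (smooth_pd j (smooth_pd a sU)) (Pw i).
have c2 := Pmul (smooth_pd j (smooth_pd i sU)) (Pw a).
apply: Pcongr (class_sub (PZ j) (class_sub c1 c2)) => x Wx.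
have sp k : smooth_on W (pd k s) := smooth_sub WU (smooth_pd k sU).
rewrite /Zf (pdB j (smoothM oW (sp a) (smooth_pd i sw)) (smoothM oW (sp i) (smooth_pd a sw)) Wx).
rewrite (pdM j (sp a) (smooth_pd i sw) Wx) (pdM j (sp i) (smooth_pd a sw) Wx).
rewrite (pd_swap j i oW sw Wx) (pd_swap j a oW sw Wx); exact: product_cancel.
Qed.

Definition nd f x : R := \sum_a pd a s x * pd a f x.

Lemma grad_split f i x : gradsq s x * pd i f x = \sum_a pd a s x * Zf a i f x + pd i s x * nd f x.
Proof.
rewrite /gradsq /nd mulr_suml mulr_sumr -big_split; apply: eq_bigr => a _ /=.
by rewrite expr2; exact: cross_add.
Qed.

Lemma hess_class : (forall a i k, P (pd k (Zf a i w))) -> P (lap w) -> forall i j, P (pd i (pd j w)).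
Proof.
move=> PZ PF i j; have ZZ a b c : P (Zf a b (pd c w)) by apply: class_Z_pd.
have Zs b c : P (fun x => \sum_a pd a s x * Zf a b (pd c w) x).
  by apply: class_sum => a; apply: Pmul => //; exact: smooth_pd.
(* The doubly normal second derivative, obtained from [gradsq s * lap w] by subtracting the
   tangential derivatives collected in [Zs]. *)
have NN : P (fun x => \sum_b pd b s x * nd (pd b w) x).
  apply: Pcongr (class_sub (Pmul smooth_gradsq PF) (class_sum (fun c => Zs c c))) => x Wx.
  rewrite /lap mulr_sumr -sumrB; apply: eq_bigr => b _.
  by rewrite grad_split addrC addKr.
have Nj c : P (nd (pd c w)).
  apply: class_div.
  have h1 : P (fun x => \sum_b pd b s x * \sum_a pd a s x * Zf a c (pd b w) x).
    by apply: class_sum => b; apply: Pmul => //; exact: smooth_pd.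
  apply: Pcongr (Padd h1 (Pmul (smooth_pd c sU) NN)) => x Wx.
  rewrite [in RHS]/nd !mulr_sumr -big_split; apply: eq_bigr => b _ /=.
  by rewrite (pd_swap b c oW sw Wx) [RHS]mulrCA grad_split mulrDr [X in _ + X = _]mulrCA.
apply: class_div; apply: Pcongr (Padd (Zs i j) (Pmul (smooth_pd i sU) (Nj j))) => x Wx.
by rewrite grad_split.
Qed.

(** The commutator of the Laplacian with a first-order operator has order two, so third derivatives
    of [w] enter only through the gradient of [lap w]. *)
Lemma lap_Z_class i j : (forall a b, P (pd a (pd b w))) -> (forall k, P (pd k (lap w))) -> P (lap (Zf i j w)).
Proof.
move=> PH PF.
have sp k : smooth_on W (pd k s) := smooth_sub WU (smooth_pd k sU).
have part a b : P (lap (fun x => pd a s x * pd b w x)).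
  have h1 := Pmul (smooth_pd a sU) (PF b).
  have h2 : P (fun x => \sum_k (2 * pd k (pd a s) x) * pd k (pd b w) x).
    by apply: class_sum => k; apply: Pmul => //; apply: smoothZ => //; do 2 apply: smooth_pd.
  have h3 := Pmul (smooth_lap oU (smooth_pd a sU)) (Pw b).
  apply: Pcongr (Padd h1 (Padd h2 h3)) => x Wx.
  rewrite -(lap_pd b oW sw Wx) /lap mulr_sumr mulr_suml.
  rewrite -[X in _ + X = _]big_split /= -[LHS]big_split /=; apply: eq_bigr => k _.
  rewrite [RHS](@pd_congr R n W _ (fun y => pd k (pd a s) y * pd b w y + pd a s y * pd k (pd b w) y) k x oW _ Wx).
    have s1 := smoothM oW (smooth_pd k (sp a)) (smooth_pd b sw).
    have s2 := smoothM oW (sp a) (smooth_pd k (smooth_pd b sw)).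
    rewrite (pdD k s1 s2 Wx) (pdM k (smooth_pd k (sp a)) (smooth_pd b sw) Wx).
    have -> := pdM k (sp a) (smooth_pd k (smooth_pd b sw)) Wx.
    exact: leibniz2.
  by move=> y Wy; rewrite (pdM k (sp a) (smooth_pd b sw) Wy) addrC [X in X + _]mulrC.
apply: Pcongr (class_sub (part i j) (part j i)) => x Wx.
by rewrite /Zf (lapB oW (smoothM oW (sp i) (smooth_pd j sw)) (smoothM oW (sp j) (smooth_pd i sw)) Wx).
Qed.
End Class.

(** Derivatives of order below [k] are bounded near [p]; only those of order exactly [k] may grow
    like [s^(1 - m/2)]. Induction on the order improves the weight at the top order alone. *)
Fixpoint reg (k m : nat) f : Prop :=
  smooth_on W f /\ if k is k'.+1 then BO 2 f /\ forall j, reg k' m (pd j f) else BO m f.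

Lemma reg_smooth k m f : reg k m f -> smooth_on W f.
Proof. by case: k => [|k] []. Qed.

Lemma BO_congrW m f g : (forall x, W x -> f x = g x) -> BO m f -> BO m g.
Proof.
move=> fg; apply: BO_congr; have [r r0 hU] := open_ballP oU Up; exists r => // x xr Ox.
by apply: fg; split => //; exact: hU.
Qed.

Lemma reg_congr k m f g : (forall x, W x -> f x = g x) -> reg k m f -> reg k m g.
Proof.
elim: k f g => [|k IH] f g fg /= [sf h]; (split; first exact: smooth_congr oW fg sf).
  exact: BO_congrW fg h.
case: h => b h; split; first exact: BO_congrW fg b.
by move=> j; apply: IH (h j) => x Wx; exact: (@pd_congr R n W _ _ j x oW fg Wx).
Qed.

Lemma reg_add k m f g : reg k m f -> reg k m g -> reg k m (fun x => f x + g x).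
Proof.
elim: k f g => [|k IH] f g /= [sf h] [sg h']; (split; first exact: smoothD).
  exact: BO_add.
case: h => b h; case: h' => b' h'; split; first exact: BO_add.
move=> j; apply: reg_congr (IH _ _ (h j) (h' j)) => x Wx.
by rewrite (pdD j sf sg Wx).
Qed.

Lemma reg_pred k m m' f : (2 <= m')%N -> reg k.+1 m f -> reg k m' f.
Proof.
move=> m2; elim: k f => [|k IH] f /= [sf [b h]]; split=> //.
  exact: (BO_mono oU sU Up sp0 OU grad_s m2).
by split=> // j; apply: IH; exact: h.
Qed.

Lemma reg_mono k m m' f : (m <= m')%N -> reg k m f -> reg k m' f.
Proof.
move=> mm; elim: k f => [|k IH] f /= [sf h]; split=> //.
  exact: (BO_mono oU sU Up sp0 OU grad_s mm).
by case: h => b h; split=> // j; apply: IH.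
Qed.

Lemma BO_coef m c f : smooth_on U c -> BO m f -> BO m (fun x => c x * f x).
Proof. by move=> sc; apply: (BO_mul oU sU Up sp0 OU grad_s); exact: (BO_smooth oU sU Up sp0 OU grad_s sc). Qed.

Lemma reg_mul k m c f : (2 <= m)%N -> smooth_on U c -> reg k m f -> reg k m (fun x => c x * f x).
Proof.
move=> m2; elim: k c f => [|k IH] c f sc hf; have sf := reg_smooth hf; have scW := smooth_sub WU sc;
  (split; first exact: smoothM).
  by apply: BO_coef => //; case: hf.
have h0 := reg_pred m2 hf; case: hf => _ [b h]; split; first exact: BO_coef.
move=> j; apply: reg_congr (reg_add (IH _ _ (smooth_pd j sc) h0) (IH _ _ sc (h j))) => x Wx.
by rewrite (pdM j scW sf Wx) addrC [f x * _]mulrC.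
Qed.

Lemma reg0 k m : reg k m (fun=> 0).
Proof.
elim: k => [|k IH]; (split; first exact: smooth_cst).
  exact: (BO0 oU sU Up sp0 OU grad_s).
split; first exact: (BO0 oU sU Up sp0 OU grad_s).
by move=> j; apply: reg_congr IH => x Wx; rewrite pd_cst.
Qed.

Lemma reg_pd k m j f : reg k.+1 m f -> reg k m (pd j f).
Proof. by move=> [_ [_]]; exact. Qed.

Lemma reg_grad k w : reg k 2 w -> reg k 4 (lap w) -> reg k.+1 4 w.
Proof.
elim: k w => [|k IH] w hw hF; have sw := reg_smooth hw.
  split=> //; split; first by case: hw.
  move=> j; split; first exact: smooth_pd.
  apply: (BO_grad oO oU sU Up sp0 OU grad_s j sw); first by case: hw.
  by case: hF => _; apply: (BO_mono oU sU Up sp0 OU grad_s).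
split=> //; split; first by case: hw => _ [].
move=> j; apply: IH; first exact: reg_pd.
by apply: reg_congr (reg_pd j hF) => x Wx; rewrite (lap_pd j oW sw Wx).
Qed.

Lemma reg_hess k m w : (2 <= m)%N -> smooth_on W w -> reg k.+1 m w -> (forall a i, reg k.+1 m (Zf a i w)) ->
  reg k m (lap w) -> forall i j, reg k m (pd i (pd j w)).
Proof.
move=> m2 sw hw hZ hF; apply: (hess_class (P := reg k m)) => //.
- exact: reg_congr.
- exact: reg_add.
- by move=> c f; exact: reg_mul.
- exact: reg0.
- by move=> j; exact: reg_pd.
- by move=> a i j; exact: reg_pd.
Qed.

Lemma reg_lapZ k m w i j : (2 <= m)%N -> smooth_on W w -> reg k.+2 m w -> reg k.+1 m (lap w) ->
  reg k m (lap (Zf i j w)).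
Proof.
move=> m2 sw hw hF; apply: (lap_Z_class (P := reg k m)) => //.
- exact: reg_congr.
- exact: reg_add.
- by move=> c f; exact: reg_mul.
- exact: reg0.
- by move=> a; apply: (reg_pred m2 (reg_pd a hw)).
- by move=> a b; apply: reg_pd; exact: reg_pd.
- by move=> a; exact: reg_pd.
Qed.

Lemma reg_intro k m w : smooth_on W w -> BO 2 w -> (forall j, BO 2 (pd j w)) ->
  (forall i j, reg k m (pd i (pd j w))) -> reg k.+2 m w.
Proof.
move=> sw b0 b1 h; split=> //; split=> // j; split; first exact: smooth_pd.
by split=> // i; exact: h.
Qed.

Let mono m m' f : (m <= m')%N -> BO m f -> BO m' f := BO_mono oU sU Up sp0 OU grad_s (m := m) (m' := m') (f := f).
Let grad m f i : smooth_on W f -> BO m f -> BO m.+4 (lap f) -> BO m.+2 (pd i f) :=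
  BO_grad oO oU sU Up sp0 OU grad_s i (m := m) (f := f).

(** The bounds improve by turns. From [w = O(s)] the first derivatives are bounded;
    [tangential_bound] gives [O(s^(1/2))] for [Zf i j w], hence [O(s^(-1/2))] for its gradient, and
    [reg_hess] carries this to all second derivatives. Then [lap (Zf i j w)] is [O(s^(-1/2))] too,
    so [BO_barrier] improves [Zf i j w] to [O(s)]; its gradient becomes bounded, and with it the
    second derivatives. *)
Lemma reg_one w : BO 0 w -> reg 1 4 (lap w) -> smooth_on W w -> reg 2 3 w /\ (reg 1 3 (lap w) -> reg 2 2 w /\ forall i j, BO 0 (Zf i j w)).
Proof.
move=> b0 [_ [b2F hF]] sw.
have b2 : BO 2 w := @mono 0 2 _ isT b0.
have b1 j : BO 2 (pd j w) by apply: grad => //; apply: mono b2F.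
have r24 : reg 2 4 w.
  apply: reg_grad; last by split=> //; exact: smooth_lap.
  by split=> //; split=> // j; split; [exact: smooth_pd|exact: b1].
have Z1 i j : BO 1 (Zf i j w).
  by apply: tangential_bound => // k; case: (hF k).
have r13 m : (2 <= m)%N -> reg 1 m w.
  by move=> m2; split=> //; split=> // j; split; [exact: smooth_pd|exact: mono (b1 j)].
have ZR m i j : (forall k, BO m (pd k (Zf i j w))) -> reg 1 m (Zf i j w).
  have sZ := smooth_Zf i j sw.
  by move=> h; split=> //; split=> [|k]; [exact: mono (Z1 i j)|split; [exact: smooth_pd|]].
have lZ m i j : (2 <= m)%N -> reg 2 m w -> reg 1 m (lap w) -> BO m (lap (Zf i j w)).
  by move=> m2 h1 h2; have [] := @reg_lapZ 0 m w i j m2 sw h1 h2.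
have rF m : (2 <= m)%N -> reg 0 m (lap w).
  by move=> m2; split; [exact: smooth_lap|exact: mono b2F].
have hF' : reg 1 4 (lap w) by split=> //; exact: smooth_lap.
have r23 : reg 2 3 w.
  apply: reg_intro => //; apply: reg_hess => //; [exact: r13| |exact: rF].
  move=> i j; apply: ZR => k; apply: grad; [exact: smooth_Zf|exact: Z1|].
  exact: (@mono 4 5 _ isT (lZ 4%N i j isT r24 hF')).
split=> // h3.
have Z0 i j : BO 0 (Zf i j w).
  apply: (BO_barrier oO oU sU Up sp0 OU grad_s); [exact: smooth_Zf|exact: mono (Z1 i j)|exact: lZ|].
  exact: (BO1_vanishes oU Up OU).
split=> //; apply: reg_intro => //; apply: reg_hess => //; [exact: r13| |exact: rF].
move=> i j; apply: ZR => k; apply: grad; [exact: smooth_Zf|exact: Z0|].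
exact: (@mono 3 4 _ isT (lZ 3%N i j isT r23 h3)).
Qed.

Lemma reg_BO k m w : reg k.+1 m w -> BO 2 w. Proof. by move=> [_ []]. Qed.

(** The tangential derivatives [Zf i j w] are again [O(s)], so the induction hypothesis applies to
    them, and [reg_hess] converts the result into one more derivative of [w]. Controlling
    [lap (Zf i j w)] takes a top-order bound for [w] itself: it starts with weight 4 from
    [reg_grad], and the two halves of the statement lower it to 3 and then to 2. *)
Lemma reg_step k w : BO 0 w -> smooth_on W w ->
  (reg k.+1 4 (lap w) -> reg k.+2 3 w) /\ (reg k.+1 3 (lap w) -> reg k.+2 2 w).
Proof.
elim: k w => [|k IH] w b0 sw.
  split=> h; first by have [] := reg_one b0 h sw.
  have h4 : reg 1 4 (lap w) by exact: (@reg_mono 1 3).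
  by have [_ /(_ h)[]] := reg_one b0 h4 sw.
have sZ i j := smooth_Zf i j sw.
have main m : (2 <= m)%N -> (m <= 3)%N -> (forall w, BO 0 w -> smooth_on W w -> reg k.+1 m.+1 (lap w) -> reg k.+2 m w) ->
    reg k.+2 m.+1 (lap w) -> reg k.+3 m.+1 w -> (forall i j, BO 0 (Zf i j w)) -> reg k.+2 2 w -> reg k.+3 m w.
  move=> m2 m3 IHm hF hw Z0 h2.
  have b1 j : BO 2 (pd j w) by exact: reg_BO (reg_pd j h2).
  apply: reg_intro => //; first exact: reg_BO h2.
  refine (@reg_hess k.+1 m w m2 sw (reg_mono m2 h2) _ (reg_pred m2 hF)).
  by move=> a i; exact: IHm (Z0 a i) (sZ a i) (@reg_lapZ k.+1 m.+1 w a i (leqW m2) sw hw hF).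
have P2 : reg k.+2 4 (lap w) -> [/\ reg k.+2 2 w, reg k.+3 4 w & forall i j, BO 0 (Zf i j w)].
  move=> hF; have h2 : reg k.+2 2 w.
    by apply: (IH w b0 sw).2; exact: reg_pred hF.
  have h24 := reg_grad h2 hF; split=> //.
  have F2 : reg k.+1 2 (lap w) := reg_pred (m' := 2) isT hF.
  have F3 : reg 1 3 (lap w).
    split; first exact: smooth_lap.
    by split; [exact: reg_BO F2|move=> j; split; [apply: smooth_pd; exact: smooth_lap|]];
      apply: mono (reg_BO (reg_pd j hF)).
  by have [_ /(_ F3)[]] := reg_one b0 (reg_mono (k := 1) (m := 3) (m' := 4) isT F3) sw.
have P' : reg k.+2 4 (lap w) -> reg k.+3 3 w.
  move=> hF; have [h2 h4 Z0] := P2 hF; exact: (main 3%N isT isT (fun w' b s => (IH w' b s).1) hF h4 Z0 h2).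
split; first exact: P'.
move=> hF; have hF4 := @reg_mono k.+2 3 4 _ isT hF.
have [h2 h4 Z0] := P2 hF4; exact: (main 2%N isT isT (fun w' b s => (IH w' b s).2) hF (P' hF4) Z0 h2).
Qed.

Lemma reg_iter_pd k m f js : size js = k -> reg k m f -> BO m (iter_pd (rev js) f).
Proof.
elim: k f js => [|k IH] f [|j js] //= sz.
  by move=> [_].
move=> [sf [_ h]]; have := IH (pd j f) js; rewrite rev_cons iter_pd_rcons; apply=> //.
by case: sz.
Qed.

(** The Laplacian is zero and satisfies every [reg], so [reg_step] is available at all orders once
    [BO_barrier] has given [w = O(s)]. *)
Theorem harmonic_boundary_bounds w js : harmonic_on O w -> vanishes O s p w -> BO 2 w -> BO 2 (iter_pd js w).
Proof.
move=> [sw hw] vw bw.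
have swW : smooth_on W w by apply: smooth_sub sw => x [].
have F0 x : W x -> 0 = lap w x by move=> [Ox _]; rewrite -(hw x Ox).
have b0 : BO 0 w.
  apply: (BO_barrier oO oU sU Up sp0 OU grad_s) => //.
  by apply: BO_congrW F0 _; exact: (BO0 oU sU Up sp0 OU grad_s).
have h k : reg k.+2 2 w by apply: (reg_step k b0 swW).2; apply: reg_congr F0 (reg0 _ _).
rewrite -(revK js); case E : (size (rev js)) => [|[|k]].
- by move/size0nil: E => ->.
- by have := @reg_iter_pd 1 2 w (rev js) E (@reg_pred 1 2 2 _ isT (h 0%N)).
exact: (reg_iter_pd E (h k)).
Qed.
End BoundaryRegularity.

(** * Extension to the closure *)

Section Extension.
Variables (R : realType) (n : nat).
Local Notation V := 'rV[R]_n.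
Implicit Types (x z y q : V) (f h w : V -> R) (O W : set V).

Lemma closure_near O x (e : R) : closure O x -> 0 < e -> exists2 y, O y & `|y - x| < e.
Proof.
move=> cx e0; have [y [Oy xy]] := cx _ (nbhsx_ballx x _ e0); exists y => //.
by move: xy; rewrite -ball_normE /= distrC.
Qed.

Lemma near_closure O x : (forall e : R, 0 < e -> exists2 y, O y & `|y - x| < e) -> closure O x.
Proof.
move=> H B /nbhs_ballP[e /= e0 eB]; have [y Oy yx] := H e e0; exists y; split=> //.
by apply: eB; rewrite -ball_normE /= distrC.
Qed.

Lemma within_cont O f : (forall x, closure O x -> forall e : R, 0 < e -> exists2 d : R, 0 < d &
  forall y, closure O y -> `|y - x| < d -> `|f y - f x| <= e) -> {within closure O, continuous f}.
Proof.
move=> H; apply/subspace_continuousP => x Ox; apply/cvgrPdist_le => e e0.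
have [d d0 h] := H x Ox e e0; rewrite near_withinE; apply/nbhs_ballP; exists d => //= y.
by rewrite -ball_normE /= distrC => yx Oy; rewrite distrC; exact: h.
Qed.

Definition osc_small O h q := forall e : R, 0 < e -> exists2 d : R, 0 < d &
  forall x z, O x -> O z -> `|x - q| < d -> `|z - q| < d -> `|h x - h z| <= e.

Definition has_lim O h q (l : R) := forall e : R, 0 < e -> exists2 d : R, 0 < d &
  forall z, O z -> `|z - q| < d -> `|h z - l| <= e.

Lemma osc_lim O h q : closure O q -> osc_small O h q -> exists l, has_lim O h q l.
Proof.
move=> cq os; have PF := within_nbhs_proper cq; pose F := h @ within O (nbhs q).
have cF : cauchy F.
  apply: cauchy_exP => e e0; have e2 : 0 < e / 2 by rewrite divr_gt0.
  have [d d0 H] := os _ e2; have [x Ox xq] := closure_near cq d0.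
  exists (h x); change (nbhs q (fun z => O z -> ball (h x) e (h z))); apply/nbhs_ballP; exists d => //= z.
  rewrite -ball_normE /= distrC => zq Oz; rewrite -ball_normE /=.
  by apply: (le_lt_trans (H x z Ox Oz xq zq)); rewrite ltr_pdivrMr // ltr_pMr // ltr1n.
have cv : cvg F by apply: cauchy_cvg.
exists (lim F) => e e0; move/cvgrPdist_le: cv => /(_ e e0).
rewrite near_withinE => /nbhs_ballP[d /= d0 H]; exists d => // z Oz zq.
by rewrite distrC; apply: H => //; rewrite -ball_normE /= distrC.
Qed.

Lemma continuous_extension O h : (forall q, closure O q -> osc_small O h q) ->
  (forall x, O x -> {for x, continuous h}) ->
  exists g : V -> R, {within closure O, continuous g} /\ forall x, O x -> g x = h x.
Proof.
move=> os ch.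
have [g gl] : exists g : V -> R, forall q, closure O q -> has_lim O h q (g q).
  have H q : exists l, closure O q -> has_lim O h q l.
    have [cq|ncq] := pselect (closure O q); last by exists 0.
    by have [l hl] := osc_lim cq (os q cq); exists l.
  have [g gP] := choice H; by exists g.
exists g; split; last first.
  move=> x Ox; have cx : closure O x := subset_closure Ox.
  apply/eqP; rewrite -subr_eq0 -normr_le0; apply/ler_addgt0Pr => e e0; rewrite add0r.
  by have [d d0 H] := gl x cx e e0; rewrite distrC; apply: H => //; rewrite subrr normr0.
apply: within_cont => x cx e e0; have e2 : 0 < e / 2 by rewrite divr_gt0.
have [d d0 H] := gl x cx _ e2; have d2 : 0 < d / 2 by rewrite divr_gt0.
exists (d / 2) => // y cy yx; have [d' d'0 H'] := gl y cy _ e2.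
have m0 : 0 < Num.min (d / 2) d' by rewrite lt_min d2.
have [z Oz] := closure_near cy m0; rewrite lt_min => /andP[z1 z2].
have h1 := H' z Oz z2; have h2 : `|h z - g x| <= e / 2.
  apply: H => //; have -> : z - x = (z - y) + (y - x) by rewrite addrA subrK.
  by apply: (le_lt_trans (ler_normD _ _)); rewrite [d]splitr ltrD.
have -> : g y - g x = (h z - g x) - (h z - g y) by rewrite opprB [in RHS]addrC addrA subrK.
by apply: (le_trans (ler_normB _ _)); rewrite [e]splitr lerD.
Qed.

Lemma osc_small_cont O h q : {for q, continuous h} -> osc_small O h q.
Proof.
move=> ch e e0; have e2 : 0 < e / 2 by rewrite divr_gt0.
have [d d0 H] := cont_normP ch e2; exists d => // x z _ _ xq zq.
have -> : h x - h z = (h x - h q) - (h z - h q) by rewrite opprB addrA subrK.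
by apply: (le_trans (ler_normB _ _)); rewrite [e]splitr lerD ?H.
Qed.

Lemma smooth_up_intro O u : open O -> smooth_on O u ->
  (forall js q, bdry O q -> osc_small O (iter_pd js u) q) -> {within closure O, continuous u} ->
  smooth_up_to_bdry O u.
Proof.
move=> oO su os cu; split=> //; split=> // js; apply: continuous_extension.
  move=> q cq; have [Oq|nOq] := pselect (O q); last exact: os.
  by apply: osc_small_cont; have [] := su js q Oq.
by move=> x Ox; have [] := su js x Ox.
Qed.

Lemma segment_osc W f x (v : V) (C : R) : open W -> smooth_on W f ->
  (forall a : R, 0 <= a <= 1 -> W (x + a *: v) /\ forall k, `|pd k f (x + a *: v)| <= C) ->
  `|f (x + v) - f x| <= n%:R * `|v| * C.
Proof.
move=> oW sf H; have hU (a : R) : 0 <= a <= 1 -> W (x + a *: v) by move=> /H[].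
have [a a1 E] := segment_mvt oW sf ltr01 hU.
move: E; rewrite scale1r mul1r => ->; apply: (le_trans (ler_norm_sum _ _ _)).
rewrite -mulrA mulr_natl -[n in _ *+ n]card_ord -sumr_const; apply: ler_sum => i _.
by rewrite normrM ler_pM // ?coord_le_norm //; exact: (H a a1).2.
Qed.
End Extension.

Lemma sg_lower (R : realType) (a b : R) : `|a - b| <= `|b| / 2 -> `|b| / 2 <= Num.sg b * a.
Proof.
have [b0|b0|->] := ltgtP b 0.
- by rewrite (ltr0_norm b0) ltr0_sg // ler_norml mulN1r => /andP[]; lra.
- by rewrite (gtr0_norm b0) gtr0_sg // ler_norml mul1r => /andP[]; lra.
- by rewrite normr0 mul0r sgr0 mul0r.
Qed.

(** * From bounded derivatives to small oscillation at a boundary point *)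

Section ChartOscillation.
Variables (R : realType) (n : nat).
Local Notation V := 'rV[R]_n.
Local Notation e_ := (@basis_vec R n).
Implicit Types (x z y : V) (f h w : V -> R).
Variables (O U : set V) (s : V -> R) (p : V).
Hypotheses (oO : open O) (oU : open U) (sU : smooth_on U s) (Up : U p) (sp0 : s p = 0).
Hypothesis OU : forall x, U x -> O x <-> 0 < s x.
Hypothesis grad_s : exists j, pd j s p != 0.
Local Notation W := (O `&` U).

(** [nu] is a coordinate vector along which [s] has nonzero derivative at [p], with the sign that
    makes [s] grow; by continuity the rate stays above half of its value at [p]. *)
Lemma transversal : exists nu : V, exists r c L : R, [/\ `|nu| <= 1, 0 < r, 0 < c, 0 <= L &
  (forall x, `|x - p| < r -> U x) /\
  (forall x (t : R), 0 <= t -> `|x - p| + t < r -> s x + c * t <= s (x + t *: nu)) /\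
  (forall x y, `|x - p| < r -> `|y - p| < r -> `|s x - s y| <= L * `|x - y|)].
Proof.
have [j hj] := grad_s; have [r1 [L [r10 L1 [Hl _]]]] := chart_lip oU sU Up sp0 grad_s.
have [r2 r20 hU] := open_ballP oU Up.
pose sg := Num.sg (pd j s p); pose nu : V := sg *: e_ j.
have sg1 : `|sg| = 1 by rewrite normr_sg hj.
have c0 : 0 < `|pd j s p| by rewrite normr_gt0.
have c2 : 0 < `|pd j s p| / 2 by rewrite divr_gt0.
have [r3 r30 H3] := cont_normP (smooth_cont (smooth_pd j sU) Up) c2.
exists nu, (Num.min r1 (Num.min r2 r3)), (`|pd j s p| / 2), L.
have nu1 : `|nu| <= 1 by rewrite -[leRHS]sg1; exact: norm_basis.
split=> //; [by rewrite !lt_min r10 r20|by apply: le_trans L1|].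
split; first by move=> x; rewrite !lt_min => /and3P[_ x2 _]; exact: hU.
split; last by move=> x y; rewrite !lt_min => /andP[x1 _] /andP[y1 _]; exact: Hl.
move=> x t; rewrite le_eqVlt => /orP[/eqP <- _|t0]; first by rewrite mulr0 addr0 scale0r addr0.
rewrite !lt_min => /and3P[x1 x2 x3].
have near_p (a : R) : 0 <= a <= t -> `|x + a *: nu - p| <= `|x - p| + t.
  move=> /andP[a0 at_]; rewrite addrAC; apply: (le_trans (ler_normD _ _)); rewrite lerD2l.
  by rewrite normrZ ger0_norm // -[t]mulr1 ler_pM.
have hb (a : R) : 0 <= a <= t -> U (x + a *: nu).
  by move=> /near_p h; apply: hU; exact: le_lt_trans h x2.
have [a at_ E] := segment_mvt oU sU t0 hb.
rewrite -lerBrDl E mulrC ler_pM2l // (bigD1 j) //= big1 ?addr0; last first.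
  by move=> k /negbTE kj; rewrite !mxE eqxx kj mulr0 mul0r.
rewrite !mxE !eqxx mulr1; set y := x + _.
exact: sg_lower (H3 y (le_lt_trans (near_p a at_) x3)).
Qed.

(* Two points of [O] at distance less than [d] from [p] are joined by the polygon
   [x, x + d K nu, z + d K nu, z], which stays in [O]. *)
Lemma chart_oscillation f : smooth_on W f -> (forall k, BO O s p 2 (pd k f)) -> osc_small O f p.
Proof.
move=> sf /(BO_unif oU Up OU)[C [r1 [C0 r10 H]]].
have [nu [r2 [c [L [nu1 r20 c0 L0 [hU [hs hL]]]]]]] := transversal.
(* Within distance [d] of [p] the function [s] is at least [- L * d], and moving by [d * K] along
   [nu] gains [c * d * K > L * d]. So the middle leg of the polygon lies in [O]. *)
pose K := L / c + 1; have K0 : 0 < K by rewrite ltr_wpDl // divr_ge0 // ltW.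
have Kc : L < c * K by rewrite /K mulrDr mulrCA divff ?lt0r_neq0 // !mulr1 ltrDl.
move=> e e0; pose M := n%:R * (2 * K + 2) * C.
have M0 : 0 <= M by rewrite !mulr_ge0 ?addr_ge0 ?mulr_ge0 // ltW.
pose d := Num.min (Num.min r1 r2 / (1 + K)) (e / (M + 1)).
have K1 : 0 < 1 + K by rewrite addr_gt0.
have d0 : 0 < d by rewrite !lt_min !divr_gt0 ?lt_min ?r10 ?r20 // ltr_wpDl.
have [dr dr2 de] : [/\ d * (1 + K) <= r1, d * (1 + K) <= r2 & M * d <= e].
  have : d <= Num.min r1 r2 / (1 + K) by rewrite /d ge_min lexx.
  rewrite ler_pdivlMr // le_min => /andP[a1 a2]; split => //.
  apply: (@le_trans _ _ ((M + 1) * d)); first by rewrite ler_wpM2r ?(ltW d0) // lerDl.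
  have : d <= e / (M + 1) by rewrite /d ge_min lexx orbT.
  by rewrite ler_pdivlMr ?ltr_wpDl // mulrC.
have point (y : V) (t : R) : `|y - p| < d -> 0 <= t <= d * K -> 0 < s (y + t *: nu) ->
    W (y + t *: nu) /\ forall k, `|pd k f (y + t *: nu)| <= C.
  move=> yd /andP[t0 tK] sy; have h : `|y + t *: nu - p| < d * (1 + K).
    rewrite addrAC mulrDr mulr1; apply: (le_lt_trans (ler_normD _ _)); apply: ltr_leD => //.
    by rewrite normrZ (ger0_norm t0) -[leRHS]mulr1 ler_pM.
  have Uy := hU _ (lt_le_trans h dr2); have Oy := (OU Uy).2 sy; split=> // k.
  have := H k _ (lt_le_trans h dr) Oy; rewrite wt2 // mulr1; exact.
have shift (y : V) (t : R) : `|y - p| < d -> 0 <= t <= d * K -> s y + c * t <= s (y + t *: nu).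
  move=> yd /andP[t0 tK]; apply: hs => //; apply: lt_le_trans dr2.
  by rewrite mulrDr mulr1; apply: ltr_leD.
have dK : 0 <= d * K by rewrite mulr_ge0 // ltW.
have dlt : d <= d * (1 + K) by rewrite ler_peMr ?(ltW d0) // lerDl ltW.
have leg x : O x -> `|x - p| < d -> `|f (x + (d * K) *: nu) - f x| <= n%:R * (d * K) * C.
  move=> Ox xd; have Ux : U x by apply: hU; apply: (lt_le_trans xd); apply: le_trans dr2.
  have sx := (OU Ux).1 Ox.
  apply: (le_trans (segment_osc (openI oO oU) sf (C := C) _)).
    move=> a /andP[a0 a1]; rewrite scalerA.
    have ak : 0 <= a * (d * K) <= d * K by rewrite mulr_ge0 // ler_piMl.
    by apply: point => //; apply: lt_le_trans (shift x _ xd ak); rewrite ltr_pwDl // mulr_ge0 ?mulr_ge0 // ltW.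
  by rewrite ler_wpM2r ?(ltW C0) // ler_wpM2l // normrZ ger0_norm // ler_piMr.
exists d => // x z Ox Oz xd zd.
have mid : `|f (x + (d * K) *: nu + (z - x)) - f (x + (d * K) *: nu)| <= n%:R * (2 * d) * C.
  apply: (le_trans (segment_osc (openI oO oU) sf (C := C) _)).
    move=> a /andP[a0 a1]; rewrite addrAC.
    have yd : `|x + a *: (z - x) - p| < d.
      have -> : x + a *: (z - x) - p = (1 - a) *: (x - p) + a *: (z - p).
        by apply/rowP => k; rewrite !mxE; ring.
      apply: (le_lt_trans (ler_normD _ _)); rewrite !normrZ (ger0_norm a0) ger0_norm ?subr_ge0 //.
      move: a0; rewrite le_eqVlt => /orP[/eqP <-|a0]; first by rewrite subr0 mul1r mul0r addr0.
      apply: (@lt_le_trans _ _ ((1 - a) * d + a * d)); last by rewrite -mulrDl subrK mul1r.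
      by apply: ler_ltD; [rewrite ler_wpM2l ?subr_ge0 // ltW|rewrite ltr_pM2l].
    have kk : 0 <= d * K <= d * K by rewrite dK lexx.
    apply: point => //; apply: lt_le_trans (shift _ _ yd kk).
    have pp : `|p - p| < r2 by rewrite subrr normr0.
    have := hL _ p (lt_le_trans yd (le_trans dlt dr2)) pp; rewrite sp0 subr0 ler_norml => /andP[h _].
    have h1 : L * `|x + a *: (z - x) - p| <= L * d by rewrite ler_wpM2l // ltW.
    have h2 : L * d < c * (d * K) by rewrite mulrCA mulrC ltr_pM2l.
    by rewrite -ltrBlDr sub0r; apply: (lt_le_trans _ h); rewrite ltrN2; exact: le_lt_trans h1 h2.
  rewrite ler_wpM2r ?(ltW C0) // ler_wpM2l //.
  have -> : z - x = (z - p) - (x - p) by rewrite opprB addrA subrK.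
  by apply: (le_trans (ler_normB _ _)); rewrite mulr_natl mulr2n ltW // ltrD.
have E : x + (d * K) *: nu + (z - x) = z + (d * K) *: nu by rewrite addrC addrA subrK.
rewrite E in mid.
have -> : f x - f z = (f (z + (d * K) *: nu) - f z) - (f (x + (d * K) *: nu) - f x) -
    (f (z + (d * K) *: nu) - f (x + (d * K) *: nu)).
  by move: (f x) (f z) (f _) (f _) => a1 a2 a3 a4; clear; ring.
apply: le_trans de; apply: (le_trans (ler_normB _ _)); apply: (le_trans (lerD (ler_normB _ _) mid)).
apply: (le_trans (lerD (lerD (leg z Oz zd) (leg x Ox xd)) (lexx _))).
by rewrite le_eqVlt; apply/orP; left; apply/eqP; rewrite /M; ring.
Qed.

(** Near [p] the set where [|w| >= h] is compact and lies inside [O], so [s] has a positive minimum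
    on it; below that minimum [|w|] is at most [h]. *)
Lemma zero_boundary_vanishes w (r : R) : 0 < r ->
  (forall x, `|x - p| < r -> {for x, continuous w}) -> (forall x, ~ O x -> w x = 0) -> vanishes O s p w.
Proof.
move=> r0 cw w0; have [r1 r10 hU] := open_ballP oU Up.
pose r2 := Num.min r r1 / 2; have m0 : 0 < Num.min r r1 by rewrite lt_min r0.
have r20 : 0 < r2 by rewrite divr_gt0.
have r2m : r2 < Num.min r r1 by rewrite /r2 ltr_pdivrMr // ltr_pMr // ltr1n.
have near x : `|x - p| <= r2 -> `|x - p| < r /\ U x.
  by move=> /le_lt_trans /(_ r2m); rewrite lt_min => /andP[-> /hU].
exists r2 => // h h0; pose K := [set x : V | `|x - p| <= r2 /\ 0 <= `|w x| - h].
have KO x : K x -> O x.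
  move=> [xr wx]; apply: contrapT => nO; move: wx; rewrite (w0 x nO) normr0 sub0r oppr_ge0.
  by rewrite leNgt h0.
have cK : compact K.
  apply: compact_restrict => x /near[xr _]; apply: continuousB; last exact: cst_continuous.
  apply: continuous_comp; first exact: cw; exact: norm_continuous.
have [K0|/set0P/negP/negPn/eqP KE] := pselect (K !=set0); last first.
  exists 1 => // x xr Ox _; rewrite leNgt; apply/negP => hw.
  suff : set0 x by []; by rewrite -KE; split; [exact: ltW|rewrite subr_ge0 ltW].
have cs : {within K, continuous s}.
  apply: continuous_in_subspaceT => x; rewrite inE => -[/near[_ Ux] _]; exact: smooth_cont sU Ux.
have [m] := compact_EVT_min K0 cK cs; rewrite inE => Km hm.
exists (s m); first by apply/(OU (near _ Km.1).2); exact: KO.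
move=> x xr Ox; apply: contraTT; rewrite -ltNge -leNgt => hw; apply: hm; rewrite inE.
by split; [exact: ltW|rewrite subr_ge0 ltW].
Qed.

Lemma bounded_BO2 w (r M : R) : 0 < r -> (forall x, `|x - p| < r -> `|w x| <= M) -> BO O s p 2 w.
Proof.
move=> r0 H; have [r1 r10 hU] := open_ballP oU Up.
have M0 : 0 <= M by apply: le_trans (H p _); rewrite ?subrr ?normr0.
exists (M + 1), (Num.min r r1); split; rewrite ?lt_min ?r0 ?ltr_wpDl //.
move=> x; rewrite lt_min => /andP[xr x1] Ox; rewrite wt2 ?mulr1; last exact/(OU (hU x x1)).
by apply: (le_trans (H x xr)); rewrite lerDl.
Qed.
End ChartOscillation.

(** * Enlarging the domain across the boundary *)

Section Bump.
Variables (R : realType).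

(** [flat 0] is the usual flat function exp(-1/t); the exponent [k] is there because linear
    combinations of the family are closed under differentiation. *)
Definition flat (k : nat) (t : R) : R := if 0 < t then t^-1 ^+ k * expR (- t^-1) else 0.

(** Raise [x / m <= exp (x / m)] to the power [m]. *)
Lemma exp_dominates m (x : R) : 0 <= x -> x ^+ m * expR (- x) <= m%:R ^+ m.
Proof.
case: m => [|m] x0; first by rewrite !expr0 mul1r expR_le1 oppr_le0.
have m0 : 0 < m.+1%:R :> R by rewrite ltr0n.
have h : (x / m.+1%:R) ^+ m.+1 <= expR x.
  have -> : expR x = expR (x / m.+1%:R) ^+ m.+1 by rewrite -expRM_natl mulrC divfK // lt0r_neq0.
  apply: lerXn2r; rewrite ?nnegrE ?expR_ge0 ?divr_ge0 ?(ltW m0) //.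
  by apply: le_trans (expR_ge1Dx _); rewrite lerDr.
have e0 := expR_gt0 x.
rewrite expRN -ler_pdivlMr ?invr_gt0 // invrK.
by move: h; rewrite expr_div_n ler_pdivrMr ?exprn_gt0 // mulrC.
Qed.

Lemma flat_bound k (t : R) : `|flat k t| <= k.+1%:R ^+ k.+1 * `|t|.
Proof.
rewrite /flat; case: ifPn => [t0|_]; last by rewrite normr0 mulr_ge0 // exprn_ge0.
have ti : 0 < t^-1 by rewrite invr_gt0.
rewrite (gtr0_norm t0) ger0_norm; last by rewrite mulr_ge0 ?expR_ge0 // exprn_ge0 // ltW.
have := exp_dominates k.+1 (ltW ti); rewrite exprSr -mulrA mulrCA => h.
by rewrite -ler_pdivrMr // mulrC.
Qed.

Lemma flat_derive k (t : R) : is_derive t 1 (flat k) (flat k.+2 t - k%:R * flat k.+1 t).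
Proof.
have [t0|t0|<-] := ltgtP 0 t.
- have D1 := is_derive_invX k (lt0r_neq0 t0).
  have D0 := is_derive_invX 1 (lt0r_neq0 t0).
  have De : is_derive t 1 (fun s : R => expR (- s^-1)) (expR (- t^-1) * (t^-1 ^+ 2)).
    have D : is_derive t 1 (fun s : R => - s^-1) (t^-1 ^+ 2).
      by apply: is_derive_ext (is_deriveN D0) => //=; rewrite mulN1r opprK.
    exact: is_derive_comp_real D (is_derive_expR (- t^-1)).
  have D := is_deriveM D1 De.
  apply: (@near_eq_is_derive _ _ _ ((fun s : R => s^-1 ^+ k) * (fun s : R => expR (- s^-1)))).
    have H : \forall s \near t, 0 < s by apply: (open_gt (y := 0)).
    by apply: filterS H => s s0; rewrite /flat s0.
  apply: is_derive_ext D => //; rewrite /flat t0 !exprS /GRing.scale /=; ring.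
- apply: (@near_eq_is_derive _ _ _ (cst 0)).
    have H : \forall s \near t, s < 0 by apply: (open_lt (y := 0)).
    by apply: filterS H => s s0; rewrite /flat ltNge (ltW s0).
  rewrite /flat ltNge (ltW t0) /= mulr0 subr0; exact: is_derive_cst.
rewrite /flat ltxx mulr0 subr0.
have C : (fun h : R => h^-1 *: (flat k (h *: 1 + 0) - flat k 0)) @ 0^' --> (0 : R).
  apply/cvgrPdist_le => e e0; rewrite near_withinE; pose c : R := k.+2%:R ^+ k.+2.
  have c0 : 0 < c by rewrite exprn_gt0.
  apply/nbhs_ballP; exists (e / c) => /=; first by rewrite divr_gt0.
  move=> h; rewrite -ball_normE /= sub0r normrN ltr_pdivlMr // => hc hn.
  have -> : h^-1 *: (flat k (h *: 1 + 0) - flat k 0) = flat k.+1 h.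
    rewrite addr0 [h *: 1]mulr1 /flat ltxx subr0; case: ifP => _; last by rewrite scaler0.
    by rewrite /GRing.scale /= exprS mulrA.
  rewrite sub0r normrN; apply: (le_trans (flat_bound _ _)); rewrite mulrC; exact: ltW.
by apply: DeriveDef; [exact: cvgP C|exact: cvg_lim C].
Qed.

Inductive flat_comb : (R -> R) -> Prop :=
| flat_comb_base k : flat_comb (flat k)
| flat_comb_add f g : flat_comb f -> flat_comb g -> flat_comb (fun t => f t + g t)
| flat_comb_scale c f : flat_comb f -> flat_comb (fun t => c * f t).

Lemma flat_comb_derive f : flat_comb f -> exists2 f', flat_comb f' & forall t : R, is_derive t 1 f (f' t).
Proof.
elim=> {f} [k|f g _ [f' cf df] _ [g' cg dg]|c f _ [f' cf df]].
- exists (fun t => flat k.+2 t + - k%:R * flat k.+1 t).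
    by apply: flat_comb_add; [|apply: flat_comb_scale]; exact: flat_comb_base.
  by move=> t; rewrite mulNr; exact: flat_derive.
- exists (fun t => f' t + g' t); first exact: flat_comb_add.
  by move=> t; exact: is_deriveD.
exists (fun t => c * f' t); first exact: flat_comb_scale.
by move=> t; exact: is_deriveZ1.
Qed.

Lemma smooth_flat n (U : set 'rV[R]_n) f : open U -> smooth_on U f -> smooth_on U (fun x => flat 0 (f x)).
Proof.
move=> oU sf; apply: (smooth_comp oU sf (C := flat_comb)); first exact: flat_comb_base.
by move=> psi /flat_comb_derive[psi' c d]; exists psi' => // x _; exact: d.
Qed.

Lemma flat_gt0 (t : R) : (0 < flat 0 t) = (0 < t).
Proof. by rewrite /flat; case: (ltP 0 t) => _; rewrite ?ltxx // expr0 mul1r expR_gt0. Qed.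

Lemma flat_eq0 (t : R) : t <= 0 -> flat 0 t = 0.
Proof. by rewrite /flat ltNge => ->. Qed.

Lemma flat_ge0 (t : R) : 0 <= flat 0 t.
Proof. by rewrite /flat; case: ifP => // _; rewrite expr0 mul1r expR_ge0. Qed.
End Bump.

(** * Defining functions at boundary points and the exterior ball condition *)

Section Enlarge.
Variables (R : realType) (n : nat).
Local Notation V := 'rV[R]_n.
Implicit Types (x z y q : V) (O U : set V) (s : V -> R).

Definition chart_at O q := exists U s, [/\ open U, U q, smooth_on U s,
  forall x, U x -> O x <-> 0 < s x & forall x, U x -> exists j, pd j s x != 0].

Definition charted O := forall q, bdry O q -> chart_at O q.

Lemma bdry_chart0 O U s q : bdry O q -> open U -> U q -> smooth_on U s ->
  (forall x, U x -> O x <-> 0 < s x) -> s q = 0.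
Proof.
move=> [cq nO] oU Uq sU OU; apply/eqP; rewrite eq_le leNgt; apply/andP; split.
  by apply/negP => /(OU q Uq).
rewrite leNgt; apply/negP => sq; have sq' : 0 < - s q by rewrite oppr_gt0.
have [d d0 H] := near_gt (smooth_cont (smoothN oU sU) Uq) sq'.
have [r r0 hU] := open_ballP oU Uq.
have m0 : 0 < Num.min d r by rewrite lt_min d0.
have [y Oy] := closure_near cq m0; rewrite lt_min => /andP[yd yr].
have := H y yd; rewrite oppr_gt0; apply/negP; rewrite -leNgt ltW //.
by apply/(OU y (hU y yr)).
Qed.

Lemma smooth_taylor U s q : open U -> U q -> smooth_on U s -> (exists j, pd j s q != 0) ->
  exists r K : R, [/\ 0 < r, 0 <= K & forall x, `|x - q| < r ->
    s x <= s q + \sum_k pd k s q * (x 0 k - q 0 k) + K * sqd q x].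
Proof.
move=> oU Uq sU gs.
have [r1 [L [r10 L1 [_ Hg]]]] : exists r L : R, [/\ 0 < r, 1 <= L & (forall x y, True) /\ (forall i x y, `|x - q| < r -> `|y - q| < r ->
  `|pd i s x - pd i s y| <= L * `|x - y|)].
  (* [chart_lip] is stated for functions that vanish at the base point; subtracting [s q] leaves the
     derivatives as they are. *)
  have s0 : smooth_on U (fun x => s x - s q) by apply: smoothB => //; exact: smooth_cst.
  have pE i x : U x -> pd i (fun x => s x - s q) x = pd i s x.
    by move=> Ux; rewrite (pdB i sU (smooth_cst (s q) oU) Ux) pd_cst subr0.
  have [r2 r20 hU] := open_ballP oU Uq.
  have [||r [L [r0 L1 [_ H]]]] := chart_lip oU s0 Uq; [by rewrite subrr| |].
    by have [j hj] := gs; exists j; rewrite pE.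
  exists (Num.min r r2), L; split; rewrite ?lt_min ?r0 //; split=> // i x y.
  rewrite !lt_min => /andP[xr x2] /andP[yr y2]; have := H i x y xr yr.
  by rewrite !pE //; apply: hU.
have [r2 r20 hU] := open_ballP oU Uq.
exists (Num.min r1 r2), (n%:R * L); split; rewrite ?lt_min ?r10 ?mulr_ge0 //; first lra.
move=> x; rewrite lt_min => /andP[x1 x2].
have near_q (a : R) : 0 <= a <= 1 -> `|q + a *: (x - q) - q| <= `|x - q|.
  move=> /andP[a0 a1]; rewrite addrAC subrr add0r normrZ ger0_norm // ler_piMl //.
have hb (a : R) : 0 <= a <= 1 -> U (q + a *: (x - q)).
  by move=> /near_q h; apply: hU; exact: le_lt_trans h x2.
have [a a1 E] := segment_mvt oU sU ltr01 hb.
move: E; rewrite scale1r addrCA subrr addr0 mul1r => E.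
rewrite -[s x](subrK (s q)) E addrC -addrA lerD2l -lerBlDl -sumrB /=.
apply: (le_trans (ler_norm _)); apply: (le_trans (ler_norm_sum _ _ _)).
have -> : n%:R * L * sqd q x = \sum_(k < n) L * sqd q x.
  by rewrite sumr_const card_ord -mulrA mulr_natl.
apply: ler_sum => k _; rewrite !mxE.
have -> : (x 0 k - q 0 k) * pd k s (q + a *: (x - q)) - pd k s q * (x 0 k - q 0 k) =
  (pd k s (q + a *: (x - q)) - pd k s q) * (x 0 k - q 0 k) by ring.
have qq : `|q - q| < r1 by rewrite subrr normr0.
have h1 := Hg k (q + a *: (x - q)) q (le_lt_trans (near_q a a1) x1) qq.
rewrite normrM; apply: (@le_trans _ _ (L * `|x - q| * `|x - q|)).
  apply: ler_pM => //.
    by apply: (le_trans h1); rewrite ler_wpM2l ?near_q //; lra.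
  by have := coord_le_norm (x - q) k; rewrite !mxE.
by rewrite -mulrA -expr2 ler_wpM2l ?sqd_ge_norm //; lra.
Qed.

(** The second-order Taylor bound of the defining function at its zero [q], divided by the length of
    its gradient, is the required inequality. *)
Lemma chart_touches O q : bdry O q -> chart_at O q -> touches_from_outside O q.
Proof.
move=> bq [U [s [oU Uq sU OU gU]]]; have sq0 := bdry_chart0 bq oU Uq sU OU.
have [r [K [r0 K0 H]]] := smooth_taylor oU Uq sU (gU q Uq).
have G0 : 0 < gradsq s q.
  have [j hj] := gU q Uq; rewrite /gradsq (bigD1 j) //= ltr_pwDl ?exprn_even_gt0 //.
  by apply: sumr_ge0 => i _; rewrite sqr_ge0.
pose g := Num.sqrt (gradsq s q); have g0 : 0 < g by rewrite sqrtr_gt0.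
have [r2 r20 hU] := open_ballP oU Uq.
exists (\row_k (g^-1 * pd k s q)), (g^-1 * K), (Num.min r r2); split.
- rewrite (eq_bigr (fun k => g^-1 ^+ 2 * pd k s q ^+ 2)); last by move=> k _; rewrite !mxE exprMn.
  by rewrite -mulr_sumr -/(gradsq s q) -[gradsq s q]sqr_sqrtr ?(ltW G0) // -/g -exprMn mulVf ?expr1n ?lt0r_neq0.
- by rewrite mulr_ge0 // invr_ge0 ltW.
- by rewrite lt_min r0.
move=> x Ox; rewrite lt_min => /andP[xr x2]; have sx := (OU x (hU x x2)).1 Ox.
have -> : lin (\row_k (g^-1 * pd k s q)) q x = g^-1 * \sum_k pd k s q * (x 0 k - q 0 k).
  by rewrite /lin mulr_sumr; apply: eq_bigr => k _; rewrite !mxE mulrA.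
rewrite -mulrA -mulrN ler_wpM2l ?invr_ge0 ?(ltW g0) //.
by have := H x xr; rewrite sq0; move: sx; lra.
Qed.

Lemma chart_local O O' W q : open W -> W q -> (forall x, W x -> O x <-> O' x) -> chart_at O q -> chart_at O' q.
Proof.
move=> oW Wq OO [U [s [oU Uq sU OU gU]]]; exists (W `&` U), s; split=> //.
- exact: openI.
- by apply: smooth_sub sU => x [].
- by move=> x [Wx Ux]; rewrite -(OO x Wx); exact: OU.
by move=> x [_ Ux]; exact: gU.
Qed.

Lemma smooth_boundary_charted O : smooth_boundary O -> charted O.
Proof.
move=> sb q /sb[U [rho [oU Uq sU E gU]]]; exists U, (fun x => - rho x); split=> //.
- exact: smoothN.
- move=> x Ux; rewrite oppr_gt0; have := f_equal (fun A : set V => A x) E; rewrite /= => e.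
  split=> [Ox|rx]; first by have : (U `&` O) x by []; rewrite /setI /= in e *; rewrite e => -[].
  by have : U x /\ rho x < 0 by []; rewrite -e => -[].
move=> x Ux; have [j hj] := gU x Ux; exists j.
by rewrite (pdN j sU Ux) oppr_eq0.
Qed.
End Enlarge.

(** * Harmonic functions with a pole *)

Section PoleSolutions.
Variables (R : realType) (n : nat).
Hypothesis n0 : (0 < n)%N.
Local Notation V := 'rV[R]_n.
Implicit Types (x z y q p : V) (O U G K : set V) (f h u w P : V -> R).

Lemma compact_bound K f : compact K -> (forall x, K x -> {for x, continuous f}) ->
  exists2 M : R, 0 <= M & forall x, K x -> `|f x| <= M.
Proof.
move=> cK cf; have [K0|nK] := pselect (K !=set0); last first.
  by exists 0 => // x Kx; case: nK; exists x.
have ca : {within K, continuous (fun x => `|f x|)}.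
  apply: continuous_in_subspaceT => x; rewrite inE => Kx.
  by apply: continuous_comp; [exact: cf|exact: norm_continuous].
have [m] := compact_EVT_max K0 cK ca; rewrite inE => Km hm.
by exists `|f m| => // x Kx; apply: hm; rewrite inE.
Qed.

Lemma compact_ball q (r : R) : compact [set x : V | `|x - q| <= r].
Proof.
have -> : [set x : V | `|x - q| <= r] = [set x : V | `|x - q| <= r /\ 0 <= (0 : R)].
  by apply/seteqP; split => x //= [].
by apply: compact_restrict => x _; exact: cst_continuous.
Qed.

(** Adding a small multiple of a bump to the defining function [s] pushes the boundary outwards near
    [p]. The multiple [e] is small against the gradient of [s], so the new function [t] still
    defines a smooth boundary; it agrees with [s] outside the ball of radius [r / 2], where the old
    charts are kept, and the whole change stays away from [G]. *)
Lemma enlarge_domain O G p (B : R) : open O -> (forall x, O x -> `|x| <= B) -> charted O -> bdry O p ->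
  closed G -> G `<=` bdry O -> ~ G p ->
  exists O', [/\ open O', exists B', forall x, O' x -> `|x| <= B', O `<=` O', O' p &
    (forall x, G x -> ~ O' x) /\ charted O'].
Proof.
move=> oO bO cO bp cG GO nG; have [U [s [oU Up sU OU gU]]] := cO p bp.
have sp0 := bdry_chart0 bp oU Up sU OU; have [j hj] := gU p Up.
have c0 : 0 < `|pd j s p| / 2 by rewrite divr_gt0 ?normr_gt0.
have [r1 r10 hU] := open_ballP oU Up.
have [r2 r20 H2] := cont_normP (smooth_cont (smooth_pd j sU) Up) c0.
have oG : open (~` G) by rewrite openC.
have [r3 r30 hG] := open_ballP oG nG.
pose r := Num.min r1 (Num.min r2 r3); have r0 : 0 < r by rewrite !lt_min r10 r20.
have [ra rb rc] : [/\ r <= r1, r <= r2 & r <= r3] by rewrite /r !ge_min !lexx !orbT.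
pose D := [set x : V | `|x - p| < r].
have oD : open D.
  apply: ballP_open => x xr; exists (r - `|x - p|); first by rewrite subr_gt0.
  move=> y yx; rewrite /D /=; have -> : y - p = (y - x) + (x - p) by rewrite addrA subrK.
  by apply: (le_lt_trans (ler_normD _ _)); rewrite -ltrBrDr.
have DU : D `<=` U by move=> x /= xr; apply: hU; exact: lt_le_trans xr ra.
pose dl := (r / 2) ^+ 2; have dl0 : 0 < dl by rewrite exprn_gt0 // divr_gt0.
pose b x := flat 0 (dl - sqd p x).
have b0 x : 0 <= b x := flat_ge0 _.
have sb W : open W -> smooth_on W b.
  by move=> oW; apply: smooth_flat => //; apply: smoothB => //; [exact: smooth_cst|exact: smooth_sqd].
have [M M0 HM] : exists2 M : R, 0 <= M & forall x, `|x - p| <= r -> `|pd j b x| <= M.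
  apply: (@compact_bound [set x : V | `|x - p| <= r]); first exact: compact_ball.
  by move=> x _; apply: (smooth_cont (smooth_pd j (sb _ openT))).
pose e := `|pd j s p| / 2 / (M + 1) / 2; have M1 : 0 < M + 1 by rewrite ltr_wpDl.
have e0 : 0 < e by rewrite !divr_gt0 // normr_gt0.
have eM : e * M < `|pd j s p| / 2.
  apply: (@lt_le_trans _ _ (e * (M + 1))); first by rewrite ltr_pM2l // ltrDl.
  by rewrite /e mulrAC divfK ?lt0r_neq0 // ler_pdivrMr // ler_peMr ?ler1n // ltW.
pose t x := s x + e * b x.
have st : smooth_on D t by apply: smoothD => //; [exact: smooth_sub sU|apply: smoothZ => //; exact: sb].
have gt x : D x -> pd j t x != 0.
  move=> Dx; rewrite /t (pdD j (smooth_sub DU sU) (smoothZ e oD (sb _ oD)) Dx) (pdZ e j (sb _ oD) Dx).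
  rewrite -normr_gt0; have h1 := H2 x (lt_le_trans Dx rb); have h2 := HM x (ltW Dx).
  have h3 : `|e * pd j b x| <= e * M by rewrite normrM (gtr0_norm e0) ler_pM2l.
  have h4 := lerB_normD (pd j s x) (e * pd j b x).
  have h5 : `|pd j s p| - `|pd j s x| <= `|pd j s x - pd j s p| by rewrite distrC lerB_dist.
  by apply: lt_le_trans h4; rewrite subr_gt0; apply: (le_lt_trans h3); apply: (lt_le_trans eM); lra.
pose O' := O `|` [set x | D x /\ 0 < t x].
have OD x : D x -> O' x <-> 0 < t x.
  move=> Dx; split=> [[Ox|[]]//|tx]; last by right.
  have sx := (OU x (DU x Dx)).1 Ox; apply: (lt_le_trans sx).
  by rewrite /t lerDl mulr_ge0 // ltW.
have far x : dl < sqd p x -> O x <-> O' x.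
  move=> dx; split=> [Ox|[//|[Dx]]]; first by left.
  by rewrite /t /b flat_eq0 ?mulr0 ?addr0 ?subr_le0 ?(ltW dx) // => sx; apply/(OU x (DU x Dx)).
have oF : open [set x : V | dl < sqd p x].
  apply: ballP_open => x /= dx.
  exact: near_gt (smooth_cont (smooth_sqd p openT) (I : setT x)) dx.
have Dp : D p by rewrite /D /= subrr normr0.
have farr x : r <= `|x - p| -> dl < sqd p x.
  move=> h; apply: lt_le_trans (sqd_ge_norm p x); rewrite /dl ltr_pXn2r ?nnegrE ?divr_ge0 ?(ltW r0) //.
  by apply: lt_le_trans h; rewrite ltr_pdivrMr // ltr_pMr // ltr1n.
exists O'; split.
- apply: openU => //; apply: ballP_open => x [Dx tx].
  have [d1 d10 h1] := near_gt (smooth_cont st Dx) tx; have [d2 d20 h2] := open_ballP oD Dx.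
  exists (Num.min d1 d2); first by rewrite lt_min d10.
  by move=> y; rewrite lt_min => /andP[/h1 ? /h2].
- exists (`|B| + (r + `|p|)) => x [Ox|[Dx _]].
    by apply: (le_trans (bO x Ox)); apply: (le_trans (ler_norm _)); rewrite lerDl addr_ge0 // ltW.
  rewrite -[x](subrK p); apply: (le_trans (ler_normD _ _)).
  by rewrite ler_wpDl // lerD2r (ltW Dx).
- by move=> x Ox; left.
- right; split=> //; rewrite /t sp0 add0r mulr_gt0 // /b flat_gt0 subr_gt0.
  by rewrite /sqd big1 // => k _; rewrite subrr expr0n.
split=> [x Gx|q bq].
  case=> [Ox|[Dx _]]; first by have [_] := GO x Gx.
  by apply: (hG x) => //; exact: lt_le_trans Dx rc.
have [Dq|nD] := pselect (D q); first by exists D, t; split=> // x Dx; exists j; exact: gt.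
have Fq : dl < sqd p q by apply: farr; rewrite leNgt; apply/negP.
apply: (chart_local oF Fq far); apply: cO; split; last by move=> Oq; case: bq => _; case; left.
apply: near_closure => d d0; have [d' d'0 h] := open_ballP oF Fq.
have m0 : 0 < Num.min d d' by rewrite lt_min d0.
have [y Oy] := closure_near bq.1 m0; rewrite lt_min => /andP[y1 y2]; exists y => //.
by apply/(far y (h y y2)).
Qed.

(** [transversal] for [- s] leads out of [O] at a positive rate, and a neighbourhood on which [s] is
    negative misses [O]. *)
Lemma exterior_point O p (e : R) : bdry O p -> chart_at O p -> 0 < e -> exists2 y, `|y - p| < e & ~ closure O y.
Proof.
move=> bp [U [s [oU Up sU OU gU]]] e0; have sp0 := bdry_chart0 bp oU Up sU OU.
have sN : smooth_on U (fun x => - s x) by exact: smoothN.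
have gN : exists j, pd j (fun x => - s x) p != 0.
  by have [j hj] := gU p Up; exists j; rewrite (pdN j sU Up) oppr_eq0.
have sNp : - s p = 0 by rewrite sp0 oppr0.
have [nu [r [c [L [nu1 r0 c0 L0 [hU [hs _]]]]]]] := transversal oU sN Up sNp gN.
pose t := Num.min e r / 2; have m0 : 0 < Num.min e r by rewrite lt_min e0.
have t0 : 0 < t by rewrite divr_gt0.
have tm : t < Num.min e r by rewrite ltr_pdivrMr // ltr_pMr // ltr1n.
have te : `|p + t *: nu - p| < Num.min e r.
  rewrite addrAC subrr add0r normrZ (gtr0_norm t0); apply: le_lt_trans tm.
  by rewrite ler_piMr // ltW.
exists (p + t *: nu); first by move: te; rewrite lt_min => /andP[].
move=> cy; set y := p + t *: nu in cy te.
have yr : `|y - p| < r by move: te; rewrite lt_min => /andP[].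
have ys : 0 < - s y.
  have : - s p + c * t <= - s y.
    apply: hs; first exact: ltW.
    by rewrite subrr normr0 add0r; move: tm; rewrite lt_min => /andP[].
  by rewrite sp0 oppr0 add0r; apply: lt_le_trans; rewrite mulr_gt0.
have [d1 d10 h1] := near_gt (smooth_cont sN (hU y yr)) ys.
have [d2 d20 h2] := open_ballP oU (hU y yr).
have mm : 0 < Num.min d1 d2 by rewrite lt_min d10.
have [z Oz] := closure_near cy mm; rewrite lt_min => /andP[z1 z2].
have := h1 z z1; rewrite oppr_gt0; apply/negP; rewrite -leNgt ltW //.
by apply/(OU z (h2 z z2)).
Qed.

(** Only upper limits at the boundary are assumed, so the comparison takes place on the set where
    [h >= M + e / 2], which is compact inside [O]. The multiple of [sqd x] added to [h] makes the
    Laplacian positive and is at most [e / 2] on [O]. *)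
Lemma harmonic_max O h (B M : R) : open O -> (forall x, O x -> `|x| <= B) -> harmonic_on O h ->
  (forall p, bdry O p -> forall e : R, 0 < e -> exists2 d : R, 0 < d & forall x, O x -> `|x - p| < d -> h x <= M + e) ->
  forall x, O x -> h x <= M.
Proof.
move=> oO bO [sh hh] hb x Ox; apply/ler_addgt0Pr => e e0.
have B0 : 0 <= B := le_trans (normr_ge0 x) (bO x Ox).
pose e2 := e / 2; have e20 : 0 < e2 by rewrite divr_gt0.
pose e4 := e2 / 2; have e40 : 0 < e4 by rewrite divr_gt0.
pose K := [set z | O z /\ M + e2 <= h z].
have cK : compact K.
  apply: (@compact_box R n K B); last by move=> z [Oz _]; exact: bO.
  have sub : closure K `<=` K.
    move=> z cz; have cOz : closure O z by apply: closure_subset cz => y [].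
    have [Oz|nOz] := pselect (O z).
      split=> //; rewrite leNgt; apply/negP => hz.
      have hz' : - (M + e2) < - h z by rewrite ltrN2.
      have [d d0 H] := near_gt (smooth_cont (smoothN oO sh) Oz) hz'.
      by have [y [Oy hy] yz] := closure_near cz d0; have := H y yz; rewrite ltrN2 ltNge hy.
    have [d d0 H] := hb z (conj cOz nOz) e4 e40; have [y [Oy hy] yz] := closure_near cz d0.
    have := le_trans hy (H y Oy yz); rewrite lerD2l leNgt /e4 ltr_pdivrMr // ltr_pMr // ltr1n //.
  by rewrite (_ : K = closure K); [exact: closed_closure|apply/seteqP; split => //; exact: subset_closure].
pose D := n%:R * (2 * B) ^+ 2 + 1; have D0 : 0 < D by rewrite ltr_wpDl // mulr_ge0 // exprn_ge0 // mulr_ge0.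
have sD z : O z -> sqd x z <= D.
  move=> Oz; apply: (le_trans (sqd_le_norm x z)); rewrite /D ler_wpDr // ler_wpM2l //.
  rewrite ler_sqr ?nnegrE ?mulr_ge0 //; apply: (le_trans (ler_normB _ _)).
  by rewrite mulr_natl mulr2n lerD // bO.
pose eta := e2 / D; have eta0 : 0 < eta by rewrite divr_gt0.
pose f z := h z - (M + e) + eta * sqd x z.
have sm := smoothB oO sh (smooth_cst (M + e) oO).
have sq := smoothZ eta oO (smooth_sqd x oO).
have sf : smooth_on O f := smoothD oO sm sq.
have KO : K `<=` O by move=> z [].
have main : forall z, K z -> f z <= 0.
  apply: (compare_smooth oO sf cK KO) => z [Oz hz] fz; split.
    have hz' : M + e2 < h z.
      have : eta * sqd x z <= e2 by rewrite /eta mulrAC ler_pdivrMr // ler_pM2l // sD.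
      by move: fz; rewrite /f /e2; lra.
    have [d d0 H] := near_gt (smooth_cont sh Oz) hz'; have [d' d'0 H'] := open_ballP oO Oz.
    exists (Num.min d d'); first by rewrite lt_min d0.
    by move=> y; rewrite lt_min => /andP[/H/ltW ? /H'].
  rewrite /f (lapD oO sm sq Oz) (lapB oO sh (smooth_cst _ oO) Oz) lap_cst (lapZ _ oO (smooth_sqd x oO) Oz).
  rewrite lap_sqd; have -> : lap h z = 0 := hh z Oz.
  by rewrite subr0 add0r mulr_gt0 // mulr_gt0 ?ltr0n.
have [Kx|nK] := pselect (K x).
  have := main x Kx; rewrite /f; have := mulr_ge0 (ltW eta0) (sqd_ge0 x x); lra.
have : h x < M + e2 by rewrite ltNge; apply/negP => hx; apply: nK.
by rewrite /e2; lra.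
Qed.

Lemma harmonicN O h : open O -> harmonic_on O h -> harmonic_on O (fun x => - h x).
Proof.
move=> oO [sh hh]; split; first exact: smoothN.
move=> x Ox; change (lap (fun x => - h x) x = 0).
have E := lapZ (-1) oO sh Ox; have h0 : lap h x = 0 := hh x Ox.
move: E; rewrite h0 mulr0 => <-; rewrite (_ : (fun x => - h x) = (fun y => -1 * h y)) //.
by apply/funext => y; rewrite mulN1r.
Qed.

Lemma harmonicB O h u : open O -> harmonic_on O h -> harmonic_on O u -> harmonic_on O (fun x => h x - u x).
Proof.
move=> oO [sh hh] [su hu]; split; first exact: smoothB.
move=> x Ox; have := lapB oO sh su Ox; have -> : lap h x = 0 := hh x Ox; have -> : lap u x = 0 := hu x Ox.
by rewrite subr0.
Qed.

Lemma harmonic_sub W O h : W `<=` O -> harmonic_on O h -> harmonic_on W h.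
Proof. by move=> WO [sh hh]; split; [exact: smooth_sub sh|move=> x /WO; exact: hh]. Qed.

Lemma harmonic_congr O h u : open O -> (forall x, O x -> h x = u x) -> harmonic_on O h -> harmonic_on O u.
Proof.
move=> oO hu [sh hh]; split; first exact: smooth_congr oO hu sh.
move=> x Ox; rewrite -[RHS](hh x Ox); apply: eq_bigr => j _.
by rewrite (iter_pd_congr oO hu).
Qed.

Lemma harmonic_bound O h (b : V -> R) (B M : R) : open O -> (forall x, O x -> `|x| <= B) -> harmonic_on O h ->
  (forall p, bdry O p -> has_lim O h p (b p)) -> (forall p, bdry O p -> `|b p| <= M) ->
  forall x, O x -> `|h x| <= M.
Proof.
move=> oO bO hh hl bM x Ox; rewrite ler_norml lerNl; apply/andP; split.
  apply: (harmonic_max oO bO (harmonicN oO hh)) => // p bp e e0; have [d d0 H] := hl p bp e e0.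
  exists d => // z Oz zp; have := H z Oz zp; have := bM p bp; rewrite !ler_norml => /andP[h1 _] /andP[h2 _]; lra.
apply: (harmonic_max oO bO hh) => // p bp e e0; have [d d0 H] := hl p bp e e0.
by exists d => // z Oz zp; have := H z Oz zp; have := bM p bp; rewrite !ler_norml => /andP[_ h1] /andP[_ h2]; lra.
Qed.

(* [w] is the harmonic function with the boundary values of [P]; that [P - w] tends to zero at the
   boundary is the continuity of [u]. *)
Definition pole_sol O y P u w := [/\ harmonic_on O w, forall x, ~ (O x /\ x <> y) -> u x = 0,
  forall x, x <> y -> {for x, continuous u} & forall x, O x -> x <> y -> u x = P x - w x].

Lemma open_neq y : open [set x : V | x <> y].
Proof.
apply: ballP_open => x /= xy; exists `|x - y|.
  by rewrite normr_gt0 subr_eq0; apply/eqP.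
by move=> z zx zy; move: zx; rewrite zy distrC ltxx.
Qed.

Lemma pole_sol_exists O y P (B : R) : open O -> (forall x, O x -> `|x| <= B) -> charted O -> O y ->
  harmonic_on [set x | x <> y] P -> exists u w, pole_sol O y P u w.
Proof.
move=> oO bO cO Oy [sU _]; have cU x : x <> y -> {for x, continuous P} by move=> xy; exact: (smooth_cont sU (xy : [set x | x <> y] x)).
have cB : compact (bdry O).
  apply: (@compact_box R n _ B).
    by apply: closedI; [exact: closed_closure|exact: open_closedC].
  move=> z [cz _]; apply/ler_addgt0Pr => e e0; have [x Ox xz] := closure_near cz e0.
  rewrite -[z](subrK x); apply: (le_trans (ler_normD _ _)); rewrite addrC.
  by rewrite lerD ?bO // distrC ltW.
have neq p : bdry O p -> p <> y by move=> [_ nO] py; apply: nO; rewrite py.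
have [M M0 HM] := compact_bound cB (fun p bp => cU p (neq p bp)).
(* [dirichlet] takes bounded data on the whole space, while [P] may blow up at [y]; the truncation
   leaves [P] unchanged near the boundary of [O]. *)
pose g x := Num.max (- (M + 1)) (Num.min (M + 1) (P x)).
have M1 : - (M + 1) <= M + 1 by lra.
have gM x : `|g x| <= M + 1.
  by rewrite ler_norml /g le_max lexx /= ge_max M1 ge_min lexx.
have gU x : `|P x| <= M + 1 -> g x = P x.
  by rewrite ler_norml => /andP[h1 h2]; rewrite /g (min_idPr h2) (max_idPr h1).
have near_b p : bdry O p -> exists2 d : R, 0 < d & forall x, `|x - p| < d -> g x = P x.
  move=> bp; have [d d0 H] := cont_normP (cU p (neq p bp)) (@ltr01 R); exists d => // x /H h.
  apply: gU; rewrite -[P x](subrK (P p)); apply: (le_trans (ler_normD _ _)).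
  by rewrite addrC lerD // HM.
have cg p : bdry O p -> {for p, continuous g}.
  move=> bp; apply: cont_norm => e e0; have [d d0 H] := near_b p bp.
  have [d' d'0 H'] := cont_normP (cU p (neq p bp)) e0; exists (Num.min d d'); first by rewrite lt_min d0.
  by move=> x; rewrite lt_min => /andP[x1 x2]; rewrite !H ?subrr ?normr0 //; exact: H'.
have [w [hw wg cw wM]] := dirichlet n0 oO (fun p bp => chart_touches bp (cO p bp)) gM cg.
pose u x := if `[< O x /\ x <> y >] then P x - w x else 0.
have uE x : O x -> x <> y -> u x = P x - w x by move=> Ox xy; rewrite /u asboolT.
have u0 x : ~ (O x /\ x <> y) -> u x = 0 by move=> h; rewrite /u asboolF.
exists u, w; split=> // x xy; have [Ox|nO] := pselect (O x).
  have oN : open (O `&` [set x | x <> y]) by apply: openI => //; exact: open_neq.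
  apply: (continuous_congr oN (f := fun x => P x - w x)); last first.
  - by apply: continuousB; [exact: cU|exact: smooth_cont hw.1 Ox].
  - by split.
  - by move=> z [Oz zy]; rewrite uE.
have [cx|ncx] := pselect (closure O x).
  have bx : bdry O x by []; apply: cont_norm => e e0; rewrite (u0 x) ?subr0; last by case.
  have e2 : 0 < e / 2 by rewrite divr_gt0.
  have [d1 d10 H1] := cont_normP (cU x xy) e2; have [d2 d20 H2] := cont_normP (cw x bx) e2.
  have [d3 d30 H3] := near_b x bx; have wx : w x = P x by rewrite wg // H3 // subrr normr0.
  exists (Num.min d1 d2); first by rewrite lt_min d10.
  move=> z; rewrite lt_min => /andP[z1 z2]; rewrite /u subr0; case: asboolP => [_|_]; last by rewrite normr0 ltW.
  have -> : P z - w z = (P z - P x) - (w z - w x) by rewrite wx opprB addrA subrK.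
  by apply: (le_trans (ler_normB _ _)); rewrite [e]splitr lerD ?H1 ?H2.
have oC : open (~` closure O) by rewrite openC; exact: closed_closure.
apply: (continuous_congr oC (f := fun=> 0)) => //; last exact: cst_continuous.
by move=> z nz; rewrite u0 // => -[Oz _]; apply: nz; exact: subset_closure.
Qed.

Lemma pole_sol_lim O y P u w p : O y -> harmonic_on [set x | x <> y] P -> pole_sol O y P u w ->
  bdry O p -> has_lim O w p (P p).
Proof.
move=> Oy [sU _] [hw u0 cu uE] bp e e0; have py : p <> y by move=> py; apply: bp.2; rewrite py.
have e2 : 0 < e / 2 by rewrite divr_gt0.
have [d1 d10 H1] := cont_normP (smooth_cont sU (py : [set x | x <> y] p)) e2.
have [d2 d20 H2] := cont_normP (cu p py) e2.
have [d3 d30 H3] := open_ballP (@open_neq y) py.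
exists (Num.min d1 (Num.min d2 d3)); first by rewrite !lt_min d10 d20.
move=> z Oz; rewrite !lt_min => /and3P[z1 z2 z3].
have up : u p = 0 by apply: u0 => -[Op _]; apply: bp.2.
have := H2 z z2; rewrite up subr0 (uE z Oz (H3 z z3)) => h.
have -> : w z - P p = (P z - P p) - (P z - w z) by ring.
by apply: (le_trans (ler_normB _ _)); rewrite [e]splitr lerD ?H1.
Qed.

Lemma has_limB O h u p (a b : R) : has_lim O h p a -> has_lim O u p b -> has_lim O (fun x => h x - u x) p (a - b).
Proof.
move=> Hh Hu e e0; have e2 : 0 < e / 2 by rewrite divr_gt0.
have [d1 d10 H1] := Hh _ e2; have [d2 d20 H2] := Hu _ e2.
exists (Num.min d1 d2); first by rewrite lt_min d10.
move=> z Oz; rewrite lt_min => /andP[z1 z2].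
have -> : h z - u z - (a - b) = (h z - a) - (u z - b) by ring.
by apply: (le_trans (ler_normB _ _)); rewrite [e]splitr lerD ?H1 ?H2.
Qed.

Lemma pole_sol_bound O y P u w (B M : R) : open O -> (forall x, O x -> `|x| <= B) -> O y ->
  harmonic_on [set x | x <> y] P -> pole_sol O y P u w -> (forall p, bdry O p -> `|P p| <= M) ->
  forall x, O x -> `|w x| <= M.
Proof.
move=> oO bO Oy hU sol UM; have [hw _ _ _] := sol.
apply: (harmonic_bound oO bO hw (b := P)) => // p bp; exact: pole_sol_lim sol bp.
Qed.

(** The two poles may differ: [w] and [w'] are harmonic in all of [O], so only the boundary values
    of [P] and [P'] count. *)
Lemma pole_sol_close O y y' P P' u u' w w' (B e : R) : open O -> (forall x, O x -> `|x| <= B) -> O y -> O y' ->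
  harmonic_on [set x | x <> y] P -> harmonic_on [set x | x <> y'] P' ->
  pole_sol O y P u w -> pole_sol O y' P' u' w' -> (forall p, bdry O p -> `|P p - P' p| <= e) ->
  forall x, O x -> `|w x - w' x| <= e.
Proof.
move=> oO bO Oy Oy' hU hU' sol sol' Ue; have [hw _ _ _] := sol; have [hw' _ _ _] := sol'.
apply: (harmonic_bound oO bO (harmonicB oO hw hw') (b := fun x => P x - P' x)) => // p bp.
by apply: has_limB; [exact: pole_sol_lim sol bp|exact: pole_sol_lim sol' bp].
Qed.

(** A point of the closure of [D] that lies in [O] is an interior point for the harmonic function
    [u]. Any other is on the boundary of [O], where [u] is continuous and zero; removing [y] from
    [O] does not change the charts there, and the boundary bounds on the next derivatives give small
    oscillation of each derivative. *)
Lemma pole_sol_smooth O y P u w D : open O -> charted O -> harmonic_on [set x | x <> y] P ->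
  pole_sol O y P u w -> open D -> D `<=` O -> ~ closure D y ->
  smooth_up_to_bdry D u /\ harmonic_on D u.
Proof.
move=> oO cO hU [hw u0 cu uE] oD DO nDy.
pose Oy := O `&` [set x | x <> y]; have oOy : open Oy by apply: openI => //; exact: open_neq.
have hu : harmonic_on Oy u.
  apply: (harmonic_congr oOy (h := fun x => P x - w x)); first by move=> x [Ox xy]; rewrite uE.
  apply: harmonicB => //; [apply: harmonic_sub hU|apply: harmonic_sub hw] => x [] //.
have DOy : D `<=` Oy.
  by move=> x Dx; split; [exact: DO|move=> xy; apply: nDy; rewrite -xy; exact: subset_closure].
have neqD x : closure D x -> x <> y by move=> cx xy; apply: nDy; rewrite -xy.
split; last exact: harmonic_sub hu.
apply: smooth_up_intro => //; first exact: (harmonic_sub DOy hu).1; last first.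
  by apply: within_cont => x cx e e0; have [d d0 H] := cont_normP (cu x (neqD x cx)) e0; exists d => // z _; exact: H.
move=> js q [cq nDq]; have qy := neqD q cq.
suff : osc_small Oy (iter_pd js u) q.
  by move=> H e e0; have [d d0 h] := H e e0; exists d => // x z /DOy Ox /DOy Oz; exact: h.
have [Oq|nOq] := pselect (O q).
  by apply: osc_small_cont; have [] := hu.1 js q (conj Oq qy).
have bq : bdry O q by split=> //; apply: closure_subset cq.
have [U1 [s [oU1 Uq sU1 OU gU]]] := cO q bq; have sq0 := bdry_chart0 bq oU1 Uq sU1 OU.
pose W := U1 `&` [set x | x <> y]; have oW : open W by apply: openI => //; exact: open_neq.
have Wq : W q by [].
have sW : smooth_on W s by apply: smooth_sub sU1 => x [].
have OW x : W x -> Oy x <-> 0 < s x.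
  by move=> [Ux xy]; split=> [[Ox _]|sx]; [exact/(OU x Ux)|split=> //; exact/(OU x Ux)].
have gW x : W x -> exists j, pd j s x != 0 by move=> [Ux _]; exact: gU.
have [r r0 hr] := open_ballP oW Wq.
have vn : vanishes Oy s q u.
  apply: (zero_boundary_vanishes oW sW Wq OW r0); first by move=> x /hr[_]; exact: cu.
  by move=> x nx; apply: u0.
have [d d0 H] := cont_normP (cu q qy) (@ltr01 R).
have b2 : BO Oy s q 2 u.
  apply: (bounded_BO2 oW Wq OW (M := `|u q| + 1) d0) => x /H h.
  rewrite -[u x](subrK (u q)); apply: (le_trans (ler_normD _ _)); by rewrite addrC lerD2l.
have bd ks := harmonic_boundary_bounds oOy oW sW Wq sq0 OW gW ks hu vn b2.
have si : smooth_on (Oy `&` W) (iter_pd js u).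
  by apply: smooth_iter; apply: smooth_sub hu.1 => x [].
apply: (chart_oscillation oOy oW sW Wq sq0 OW (gW q Wq) si) => k.
exact: (bd (k :: js)).
Qed.
End PoleSolutions.

(** * Moving the pole *)

Section Continuation.
Variables (R : realType) (n : nat).
Hypothesis n0 : (0 < n)%N.
Local Notation V := 'rV[R]_n.
Local Notation e_ := (@basis_vec R n).
Implicit Types (x z y q p : V) (O W : set V) (f h u w P Q : V -> R).

Lemma harmonic_pd W f i : open W -> harmonic_on W f -> harmonic_on W (pd i f).
Proof.
move=> oW [sf hf]; split; first exact: smooth_pd.
move=> x Wx; change (lap (pd i f) x = 0); rewrite (lap_pd i oW sf Wx).
rewrite (@pd_congr R n W (lap f) (fun=> 0) i x oW _ Wx); first exact: pd_cst.
by move=> z Wz; exact: hf.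
Qed.

Lemma harmonic_iter W f i k : open W -> harmonic_on W f -> harmonic_on W (iter_pd (nseq k i) f).
Proof. by move=> oW hf; elim: k => [|k IH]; [exact: hf|exact: (harmonic_pd i oW IH)]. Qed.

Lemma harmonicZ W (c : R) f : open W -> harmonic_on W f -> harmonic_on W (fun x => c * f x).
Proof.
move=> oW [sf hf]; split; first exact: smoothZ.
move=> x Wx; change (lap (fun x => c * f x) x = 0); rewrite (lapZ c oW sf Wx).
by have -> : lap f x = 0 := hf x Wx; rewrite mulr0.
Qed.

Lemma harmonic_sum W (F : nat -> V -> R) k : open W -> (forall k, harmonic_on W (F k)) ->
  harmonic_on W (fun x => \sum_(j < k) F j x).
Proof.
move=> oW hF; elim: k => [|k IH].
  apply: (harmonic_congr oW (h := fun x => 0 * F 0%N x)); last exact: harmonicZ.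
  by move=> x _; rewrite big_ord0 mul0r.
apply: (harmonic_congr oW (h := fun x => \sum_(j < k) F j x - (-1) * F k x)).
  by move=> x _; rewrite big_ord_recr /= mulN1r opprK.
exact: (harmonicB oW IH (harmonicZ (-1) oW (hF k))).
Qed.

(** The gradient estimate is applied [K] times with radius [r / K], which uses up the radius [r]
    exactly. The growth [K ^+ K] is comparable to [K!] up to a geometric factor, so Taylor series
    converge on a ball. *)
Lemma iter_gradient W f i x (r M : R) K : open W -> harmonic_on W f -> 0 < r -> 0 < M ->
  (forall z, `|z - x| <= r -> W z /\ `|f z| <= M) ->
  `|iter_pd (nseq K i) f x| <= (2 * n%:R * K%:R / r) ^+ K * M.
Proof.
move=> oW hf r0 M0 H; case: K => [|K].
  by rewrite expr0 mul1r; apply: (H x _).2; rewrite subrr normr0 ltW.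
have K0 : 0 < K.+1%:R :> R by rewrite ltr0n.
pose d := r / K.+1%:R; have d0 : 0 < d by rewrite divr_gt0.
pose c := 2 * n%:R * K.+1%:R / r.
have c0 : 0 < c by rewrite !mulr_gt0 ?invr_gt0 ?ltr0n.
have cd : c = 2 * n%:R / d by rewrite /c /d invfM invrK; field; rewrite lt0r_neq0.
suff main m : (m <= K.+1)%N -> forall z, `|z - x| <= r - m%:R * d -> `|iter_pd (nseq m i) f z| <= c ^+ m * M.
  by apply: main => //; rewrite subrr normr0 /d mulrC divfK ?subrr // lt0r_neq0.
elim: m => [_ z|m IH mK z zx].
  by rewrite mul0r subr0 expr0 mul1r => /H[].
have near z' : `|z' - z| <= d -> `|z' - x| <= r - m%:R * d.
  move=> zz; have -> : z' - x = (z' - z) + (z - x) by rewrite addrA subrK.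
  apply: (le_trans (ler_normD _ _)); apply: (le_trans (lerD zz zx)).
  by rewrite -natr1 mulrDl mul1r; lra.
have inW z' : `|z' - z| <= d -> W z'.
  move=> /near h; apply: (H z' _).1; apply: (le_trans h).
  by rewrite gerBl mulr_ge0 // ltW.
have hm := harmonic_iter i m oW hf.
have M1 : 0 < c ^+ m * M by rewrite mulr_gt0 // exprn_gt0.
have := @interior_gradient R n W _ z i d _ 0 oW hm.1 d0 M1 inW.
have -> : c ^+ m.+1 * M = 2 * n%:R * (c ^+ m * M) / d + d * 0.
  by rewrite mulr0 addr0 exprS {1}cd; ring.
apply.
  by move=> z' zz; apply: IH; [exact: ltnW|exact: near].
by move=> z' /inW zz; have -> : lap (iter_pd (nseq m i) f) z' = 0 := hm.2 z' zz; rewrite normr0.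
Qed.

(** The left side is a single term of the series of exp(K+1), and exp(1) <= 4 because exp(-1/2) >=
    1/2. *)
Lemma pow_le_fact K : K.+1%:R ^+ K.+1 / K.+1`!%:R <= 4 ^+ K.+1 :> R.
Proof.
have h := expR_ge1Dxn K (ler0n R K.+1).
apply: (@le_trans _ _ (expR K.+1%:R)).
  by apply: le_trans h; rewrite lerDr.
rewrite -[K.+1%:R]mulr1 expRM_natl lerXn2r ?nnegrE ?expR_ge0 //.
have h1 : 2^-1 <= expR (- 2^-1) :> R by have := expR_ge1Dx (- 2^-1 : R); lra.
have -> : expR 1 = expR (2^-1 : R) ^+ 2 by rewrite -expRM_natl divff.
have -> : 4 = 2 ^+ 2 :> R by ring.
rewrite -[X in expR X]opprK expRN.
rewrite lerXn2r ?nnegrE ?invr_ge0 ?expR_ge0 //.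
by rewrite -[leRHS]invrK lef_pV2 ?posrE ?expR_gt0 // invr_gt0.
Qed.

(** As a function of its centre [a], the Taylor polynomial evaluated at [t] has a telescoping
    derivative, of which only [(t - a)^K / K! * D K.+1 a] remains; the mean value estimate is
    applied to it. *)
Lemma taylor_bound (D : nat -> R -> R) (t B : R) K :
  (forall k (a : R), Num.min 0 t <= a <= Num.max 0 t -> is_derive a 1 (D k) (D k.+1 a)) ->
  (forall a : R, Num.min 0 t <= a <= Num.max 0 t -> `|D K.+1 a| <= B) ->
  `|D 0%N t - \sum_(k < K.+1) t ^+ k / k`!%:R * D k 0| <= `|t| ^+ K / K`!%:R * B * `|t|.
Proof.
move=> dD bD; pose T k (a : R) := (t - a) ^+ k / k`!%:R.
have dT k (a : R) : is_derive a 1 (T k.+1) (- T k a).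
  have d1 : is_derive a 1 (fun a : R => t - a) (-1).
    apply: is_derive_ext (is_deriveB (is_derive_cst t a 1) (is_derive_id a 1)) => //.
    by rewrite sub0r.
  have d2 := is_deriveZ1 k.+1`!%:R^-1 (is_deriveX k.+1 d1).
  apply: is_derive_ext d2 => [s|]; first by rewrite /T exprfctE mulrC.
  rewrite /T factS natrM /GRing.scale /=; field.
  by rewrite pnatr_eq0 -lt0n fact_gt0 nat1r pnatr_eq0.
pose F m (a : R) := \sum_(k < m) T k a * D k a.
have dF m (a : R) : Num.min 0 t <= a <= Num.max 0 t -> is_derive a 1 (F m.+1) (T m a * D m.+1 a).
  move=> ha; elim: m => [|m IH].
    apply: is_derive_ext (dD 0%N a ha) => [s|].
      by rewrite /F big_ord_recl big_ord0 /T expr0 fact0 divr1 mul1r addr0.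
    by rewrite /T expr0 fact0 divr1 mul1r.
  apply: is_derive_ext (is_deriveD IH (is_deriveM (dT m a) (dD m.+1 a ha))) => [s|].
    by rewrite /F [in RHS]big_ord_recr.
  by rewrite /GRing.scale /=; ring.
have E : `|F K.+1 t - F K.+1 0 - 0 * (t - 0)| <= `|t| ^+ K / K`!%:R * B * `|t - 0|.
  refine (@mvt_bound R (F K.+1) (fun a => T K a * D K.+1 a) 0 t 0 _ (fun a ha => dF K a ha) (fun a ha => _)).
  rewrite subr0 normrM ler_pM ?bD //.
  rewrite /T normrM normrX normfV [`|K`!%:R|]ger0_norm // ler_pM2r ?invr_gt0 ?ltr0n ?fact_gt0 //.
  apply: lerXn2r; rewrite ?nnegrE //; move: ha; case/orP: (le_total 0 t) => t0.
    by rewrite (min_idPl t0) (max_idPr t0) => /andP[a0 at_]; rewrite !ger0_norm ?subr_ge0 // gerBl.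
  rewrite (min_idPr t0) (max_idPl t0) => /andP[a0 at_].
  by rewrite (ler0_norm t0) ler0_norm ?subr_le0 // opprB gerDr.
move: E; rewrite mul0r !subr0; congr (`|_ - _| <= _).
  rewrite /F big_ord_recl big1 => [|k _]; first by rewrite /T expr0 fact0 divr1 mul1r addr0.
  by rewrite /T subrr expr0n mul0r mul0r.
by rewrite /F; apply: eq_bigr => k _; rewrite /T subr0.
Qed.

Lemma geometric_small (M e : R) : 0 < e -> exists K, K.+1%:R * (4^-1) ^+ K.+1 * M <= e.
Proof.
move=> e0; case/orP: (le_total M 0) => M0.
  exists 0%N; apply: le_trans (ltW e0); rewrite mulr_ge0_le0 // mulr_ge0 // exprn_ge0 // invr_ge0.
pose K := Num.trunc (M / e); exists K.
have h : M / e < K.+1%:R by rewrite /K truncnS_gt // divr_ge0 // ltW.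
have p1 : K.+1%:R <= 2 ^+ K.+1 :> R by rewrite -natrX ler_nat ltnW // ltn_expl.
have p2 : 0 < 2 ^+ K.+1 :> R by rewrite exprn_gt0.
have -> : (4^-1 : R) ^+ K.+1 = (2 ^+ K.+1)^-1 * (2 ^+ K.+1)^-1.
  by rewrite -invfM -exprMn exprVn; congr (_ ^+ _)^-1; ring.
rewrite mulrA -mulrA; apply: (@le_trans _ _ (1 * ((2 ^+ K.+1)^-1 * M))).
  by rewrite ler_wpM2r ?mulr_ge0 ?invr_ge0 ?(ltW p2) // ler_pdivrMr // mul1r.
rewrite mul1r mulrC ler_pdivrMr // -ler_pdivrMl // mulrC.
exact: le_trans (ltW h) p1.
Qed.

Lemma harmonic_shift W f a : open W -> harmonic_on W f -> harmonic_on [set x | W (x + a)] (fun x => f (x + a)).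
Proof.
move=> oW [sf hf]; split; first exact: smooth_shift.
move=> x Wx; change (lap (fun x => f (x + a)) x = 0); rewrite lap_shift; exact: hf Wx.
Qed.

(** The Taylor polynomial in [s] of the translate of [P] is made of derivatives of [P], which keep
    the pole at [y]. On cubes of radius [rho / 4] the derivatives grow like [(8 n K / rho)^K]; the
    constant 128 makes [|s| * 8 n / rho] at most 1/16, and with the factor 4 of [pow_le_fact] the
    ratio is 1/4. *)
Lemma pole_approx y P i (s B rho e : R) : harmonic_on [set x | x <> y] P -> 0 < rho -> 0 <= B ->
  `|s| * (128 * n%:R) <= rho -> 0 < e ->
  exists2 P', harmonic_on [set x | x <> y] P' &
    forall x, `|x| <= B -> rho <= `|x - y| -> `|P (x + s *: e_ i) - P' x| <= e.
Proof.
move=> hP rho0 B0 hs e0; have oN := @open_neq R n y.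
have nR : 1 <= n%:R :> R by rewrite ler1n.
have s64 : `|s| <= rho / 128.
  rewrite ler_pdivlMr //; apply: le_trans hs; rewrite ler_wpM2l //.
  by rewrite ler_peMr.
pose Kc := [set x : V | `|x - 0| <= B + rho /\ 0 <= `|x - y| - rho / 4].
have cK : compact Kc.
  apply: compact_restrict => x _; apply: continuousB; last exact: cst_continuous.
  apply: cont_norm => d d0; exists d => // z zd.
  by apply: (le_trans (ler_dist_dist _ _)); rewrite opprB addrA subrK; exact: ltW.
have [M M0 HM] : exists2 M : R, 0 <= M & forall x, Kc x -> `|P x| <= M.
  apply: compact_bound cK _ => x [_ h]; apply: smooth_cont hP.1 _ => xy.
  by move: h; rewrite xy subrr normr0 sub0r oppr_ge0 leNgt divr_gt0.
have M1 : 0 < M + 1 by rewrite ltr_wpDl.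
have [K HK] := geometric_small (M + 1) e0.
exists (fun x => \sum_(k < K.+1) (s ^+ k / k`!%:R) * iter_pd (nseq k i) P x).
  apply: (harmonic_sum (F := fun k x => (s ^+ k / k`!%:R) * iter_pd (nseq k i) P x) K.+1 oN) => k.
  exact: harmonicZ _ oN (harmonic_iter i k oN hP).
move=> x xB xy; pose D k (a : R) := iter_pd (nseq k i) P (x + a *: e_ i).
have seg (a : R) : Num.min 0 s <= a <= Num.max 0 s -> `|a| <= `|s|.
  case/orP: (le_total 0 s) => s0.
    by rewrite (min_idPl s0) (max_idPr s0) => /andP[a0 at_]; rewrite !ger0_norm.
  by rewrite (min_idPr s0) (max_idPl s0) => /andP[a0 at_]; rewrite !ler0_norm // lerN2.
have ball (a : R) z : `|a| <= `|s| -> `|z - (x + a *: e_ i)| <= rho / 4 -> z <> y /\ `|P z| <= M + 1.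
  move=> as_ za; have ae : `|a *: e_ i| <= rho / 128.
    by apply: (le_trans (norm_basis a i)); exact: le_trans s64.
  have zy : rho / 4 <= `|z - y|.
    have : `|x - y| <= `|z - y| + `|z - (x + a *: e_ i)| + `|a *: e_ i|.
      have {1}-> : x - y = (z - y) - (z - (x + a *: e_ i)) - a *: e_ i.
        by apply/rowP => k; rewrite !mxE; ring.
      by apply: (le_trans (ler_normB _ _)); rewrite lerD2r; exact: ler_normB.
    lra.
  split; first by move=> E; move: zy; rewrite E subrr normr0 leNgt divr_gt0.
  apply: (le_trans (HM z _)); last by rewrite lerDl.
  split; last by rewrite subr_ge0.
  rewrite subr0; have -> : z = (z - (x + a *: e_ i)) + a *: e_ i + x.
    by apply/rowP => k; rewrite !mxE; ring.
  apply: (le_trans (ler_normD _ _)); rewrite addrC lerD //; apply: (le_trans (ler_normD _ _)); lra.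
have self (a : R) : `|a| <= `|s| -> x + a *: e_ i <> y.
  by move=> ha; have [|//] := ball a (x + a *: e_ i) ha; rewrite subrr normr0 divr_ge0 // ltW.
have r40 : 0 < rho / 4 by rewrite divr_gt0.
have := @taylor_bound D s ((2 * n%:R * K.+1%:R / (rho / 4)) ^+ K.+1 * (M + 1)) K _ _.
rewrite /D /= scale0r addr0 => H; apply: (le_trans (H _ _)).
- move=> k a /seg ha; apply: is_derive_line.
  exact: (smooth_derive i (smooth_iter _ hP.1) (self a ha : [set x | x <> y] _)).
- move=> a /seg ha; exact: (@iter_gradient _ P i _ _ _ K.+1 oN hP r40 M1 (fun z => ball a z ha)).
apply: le_trans HK.
have -> : `|s| ^+ K / K`!%:R * ((2 * n%:R * K.+1%:R / (rho / 4)) ^+ K.+1 * (M + 1)) * `|s| =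
  K.+1%:R * (`|s| * (8 * n%:R) / rho) ^+ K.+1 * (K.+1%:R ^+ K.+1 / K.+1`!%:R) * (M + 1).
  have -> : 2 * n%:R * K.+1%:R / (rho / 4) = (8 * n%:R / rho) * K.+1%:R by field; rewrite lt0r_neq0.
  rewrite -[_ / rho]mulrA.
  rewrite !exprMn.
  rewrite factS natrM [`|s| ^+ K.+1]exprS; field.
  by rewrite pnatr_eq0 -lt0n fact_gt0 nat1r pnatr_eq0.
rewrite ler_wpM2r ?(ltW M1) // -mulrA ler_wpM2l //.
have q1 : 0 <= `|s| * (8 * n%:R) / rho by rewrite divr_ge0 ?mulr_ge0 // ltW.
have q2 : `|s| * (8 * n%:R) / rho <= 16^-1.
  by rewrite ler_pdivrMr //; move: hs; lra.
apply: (@le_trans _ _ (16^-1 ^+ K.+1 * 4 ^+ K.+1)).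
  apply: ler_pM; [exact: exprn_ge0|by rewrite divr_ge0 ?exprn_ge0| |exact: pow_le_fact].
  by apply: lerXn2r => //; rewrite nnegrE invr_ge0.
by rewrite -exprMn (_ : 16^-1 * 4 = 4^-1 :> R) //; field.
Qed.

(** [pole_approx] moves the pole of [Q] back to [y] with an error of [e / 2] outside the cube of
    radius [rho]. The boundary of [O] is out there, so the maximum principle gives the same error
    for the corrections [w] and [w']. *)
Lemma pole_shift O y Q u' w' i (t B rho e : R) : open O -> (forall x, O x -> `|x| <= B) -> charted O ->
  0 < rho -> (forall x, `|x - y| < rho -> O x) -> `|t| * (128 * n%:R) <= rho ->
  harmonic_on [set x | x <> y + t *: e_ i] Q -> pole_sol O (y + t *: e_ i) Q u' w' -> 0 < e ->
  exists P u w, [/\ harmonic_on [set x | x <> y] P, pole_sol O y P u w &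
    forall x, O x -> x <> y + t *: e_ i -> rho <= `|x - y| -> `|u x - u' x| <= e].
Proof.
move=> oO bO cO rho0 yO ht hQ sol' e0.
have Oy : O y by apply: yO; rewrite subrr normr0.
have nR : 1 <= n%:R :> R by rewrite ler1n.
have t1 : `|t| < rho.
  have [->|t0] := eqVneq t 0; first by rewrite normr0.
  by apply: lt_le_trans ht; rewrite ltr_pMr ?normr_gt0 //; lra.
have Oy' : O (y + t *: e_ i).
  apply: yO; rewrite addrAC subrr add0r; exact: le_lt_trans (norm_basis t i) t1.
have B0 : 0 <= B := le_trans (normr_ge0 y) (bO y Oy).
pose P0 x := Q (x + t *: e_ i).
have hP0 : harmonic_on [set x | x <> y] P0.
  apply: harmonic_sub (harmonic_shift (t *: e_ i) (@open_neq R n (y + t *: e_ i)) hQ).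
  by move=> x /= xy /addIr.
have e2 : 0 < e / 2 by rewrite divr_gt0.
have ht' : `|- t| * (128 * n%:R) <= rho by rewrite normrN.
have [P hP PE] := pole_approx i hP0 rho0 B0 ht' e2.
have PQ x : `|x| <= B -> rho <= `|x - y| -> `|Q x - P x| <= e / 2.
  by move=> xB xy; have := PE x xB xy; rewrite /P0 scaleNr subrK.
have [u [w sol]] := pole_sol_exists n0 oO bO cO Oy hP; exists P, u, w; split=> //.
have bB p : bdry O p -> `|p| <= B /\ rho <= `|p - y|.
  move=> [cp nOp]; split; last by rewrite leNgt; apply/negP => /yO.
  apply/ler_addgt0Pr => d d0; have [x Ox xp] := closure_near cp d0.
  rewrite -[p](subrK x); apply: (le_trans (ler_normD _ _)); rewrite addrC.
  by rewrite lerD ?bO // distrC ltW.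
have ww x : O x -> `|w x - w' x| <= e / 2.
  move=> Ox; apply: (pole_sol_close n0 oO bO Oy Oy' hP hQ sol sol' _ Ox) => p /bB[pB py].
  by rewrite distrC; exact: PQ.
move=> x Ox xy' xy; have [_ _ _ uE] := sol; have [_ _ _ uE'] := sol'.
have xny : x <> y by move=> E; move: xy; rewrite E subrr normr0 leNgt rho0.
rewrite uE // uE' //.
have -> : P x - w x - (Q x - w' x) = - ((Q x - P x) + (w x - w' x)) by ring.
by rewrite normrN [e]splitr; apply: (le_trans (ler_normD _ _)); rewrite lerD ?PQ ?ww ?bO.
Qed.
End Continuation.

(** * Lebesgue measure on the Borel sets *)

Section BorelMeasure.
Variable R : realType.
Implicit Types n : nat.

Definition BV n := g_sigma_algebraType (@open 'rV[R]_n).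

Definition box n (a b : 'rV[R]_n) : set 'rV[R]_n := [set x | forall i, a 0 i <= x 0 i < b 0 i].

Definition rbox n (ab : 'rV[rat]_n * 'rV[rat]_n) : set 'rV[R]_n :=
  box (map_mx ratr ab.1) (map_mx ratr ab.2).

(** The boxes are numbered by [unpickle]; numbers that code no box, and boxes that leave [U], give
    the empty set, so that an open set is a union over all of [nat]. *)
Definition rbox_in n (U : set 'rV[R]_n) (m : nat) : set 'rV[R]_n :=
  if (unpickle m : option ('rV[rat]_n * 'rV[rat]_n)) is Some ab
  then [set x | rbox ab x /\ rbox ab `<=` U] else set0.

Lemma open_rboxes n (U : set 'rV[R]_n) : open U -> U = \bigcup_m rbox_in U m.
Proof.
move=> oU; apply/seteqP; split => x.
  move=> Ux; have [r r0 hU] := open_ballP oU Ux.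
  have r20 : 0 < r / 2 by rewrite divr_gt0.
  have r2 : r / 2 < r by rewrite ltr_pdivrMr // ltr_pMr // ltr1n.
  have pick i : exists ab : rat * rat, [/\ x 0 i - r / 2 < ratr ab.1, ratr ab.1 <= x 0 i, x 0 i < ratr ab.2 & ratr ab.2 < x 0 i + r / 2].
    have [a] := @rat_in_itvoo R (x 0 i - r / 2) (x 0 i) ltac:(by rewrite gtrBl).
    have [b] := @rat_in_itvoo R (x 0 i) (x 0 i + r / 2) ltac:(by rewrite ltrDl).
    by rewrite !in_itv /= => /andP[b1 b2] /andP[a1 a2]; exists (a, b); split=> //; exact: ltW.
  have [f Hf] := choice pick.
  pose ab := (\row_i (f i).1, \row_i (f i).2) : 'rV[rat]_n * 'rV[rat]_n.
  exists (pickle ab) => //; rewrite /rbox_in pickleK; split.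
    by move=> i; rewrite !mxE; have [_ -> -> _] := Hf i.
  move=> y hy; apply: hU; apply: le_lt_trans r2; apply: norm_le_coord => [|i]; first exact: ltW.
  have := hy i; rewrite !mxE; have [h1 _ _ h4] := Hf i => /andP[h2 h3].
  by rewrite ltW // ltr_distl (lt_le_trans h1 h2) (lt_trans h3 h4).
by move=> [m _]; rewrite /rbox_in; case: unpickle => // ab [xab]; exact.
Qed.

Lemma measurable_coord d (T : measurableType d) n (f : T -> BV n) :
  (forall i, measurable_fun setT (fun t => (f t : 'rV[R]_n) 0 i)) -> measurable_fun setT f.
Proof.
move=> mf; apply: (measurability _ (erefl : @measurable _ (BV n) = <<s @open 'rV[R]_n >>)) => _ [U oU <-]; rewrite setTI (open_rboxes oU) preimage_bigcup.
apply: bigcupT_measurable => m; rewrite /rbox_in; case: unpickle => [ab|]; last first.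
  by rewrite preimage_set0; exact: measurable0.
have [h|h] := pselect (rbox ab `<=` U); last first.
  rewrite (_ : _ @^-1` _ = set0); first exact: measurable0.
  by apply/seteqP; split => // x [].
rewrite (_ : _ @^-1` _ = \bigcap_(i in [set: 'I_n]) (fun t => (f t : 'rV[R]_n) 0 i) @^-1` `[ratr (ab.1 0 i), ratr (ab.2 0 i)[).
  apply: fin_bigcap_measurable => // i _.
  by rewrite -[X in measurable X]setTI; apply: mf => //; exact: measurable_itv.
apply/seteqP; split => x; first by move=> [hx _] i _ /=; rewrite in_itv /=; have := hx i; rewrite !mxE.
by move=> hx; split=> // i; have := hx i I; rewrite /= in_itv /= !mxE.
Qed.

Lemma measurable_open n (U : set 'rV[R]_n) : open U -> measurable (U : set (BV n)).
Proof. by move=> oU; apply: sub_sigma_algebra. Qed.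

Lemma measurable_cont n (f : 'rV[R]_n -> R) : continuous f -> measurable_fun setT (f : BV n -> R).
Proof.
move=> cf; apply: (measurability _ (RGenOpens.measurableE R)) => _ [U [a [b ->]] <-].
rewrite setTI; apply: measurable_open; apply: open_comp; last exact: interval_open.
by move=> x _; exact: cf.
Qed.

Definition vpair n (t : measurableTypeR R * BV n) : BV n.+1 := vcons t.1 (t.2 : 'rV[R]_n).

Lemma measurable_vpair n : measurable_fun setT (@vpair n).
Proof.
apply: measurable_coord => i; rewrite /vpair /vcons.
case: (unliftP ord0 i) => [j|] ->.
  rewrite (_ : (fun t => _) = (fun y : BV n => (y : 'rV[R]_n) 0 j) \o snd).
    apply: measurableT_comp; last exact: measurable_snd.
    by apply: measurable_cont => x; exact: coord_cont.
  by apply/funext => t; rewrite mxE liftK.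
rewrite (_ : (fun t => _) = fst); first exact: measurable_fst.
by apply/funext => t; rewrite mxE unlift_none.
Qed.

Definition cball n (B : R) : set (BV n) := [set x : 'rV[R]_n | `|x| <= B].

Section Integrable.
Variables (n : nat) (mu : {measure set (BV n) -> \bar R}).
Hypothesis mu_fin : forall B : R, (mu (@cball n B) < +oo)%E.

Lemma measurable_ball (B : R) : measurable (@cball n B).
Proof.
rewrite -[X in measurable X]setCK; apply: measurableC; apply: measurable_open.
rewrite openC (_ : (@cball n B) = [set x : 'rV[R]_n | `|x - 0| <= B]); first exact: closed_cube.
by apply/funext => x; rewrite /cball /= subr0.
Qed.

Lemma bounded_support_integrable (g : BV n -> R) (M B : R) : measurable_fun setT g ->
  (forall x, `|g x| <= M) -> (forall x, B < `|x : 'rV[R]_n| -> g x = 0) -> mu.-integrable setT (EFin \o g).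
Proof.
move=> mg gM g0; pose A := (@cball n B).
have iA : mu.-integrable A (EFin \o g).
  apply: measurable_bounded_integrable; [exact: measurable_ball|exact: mu_fin|exact: measurable_funTS|].
  by exists M; split; [exact: num_real|move=> N MN x _; exact: le_trans (gM x) (ltW MN)].
move/(integrable_mkcond _ (measurable_ball B)): iA; congr (integrable _ _ _).
apply/funext => x; rewrite /patch; case: ifPn => // /negP xA; rewrite /= g0 //.
by rewrite ltNge; apply/negP => h; apply: xA; rewrite inE.
Qed.
End Integrable.

Section SigmaFinitePack.
Context d (T : measurableType d) (m : {measure set T -> \bar R}) (sf : sigma_finite setT m).
(** A fresh constant on which the sigma-finite structure can be declared when sigma-finiteness is
    only the hypothesis [sf]. *)
Definition sigma_finite_copy : set T -> \bar R := m.
HB.instance Definition _ := Measure.on sigma_finite_copy.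
HB.instance Definition _ := Measure_isSigmaFinite.Build _ _ _ sigma_finite_copy sf.
Lemma sigma_finite_pack : exists m2 : {sigma_finite_measure set T -> \bar R}, m2 = m :> (set T -> \bar R).
Proof. by exists sigma_finite_copy. Qed.
End SigmaFinitePack.

(** By induction on the dimension, [mu] is the image under [vcons] of the product with the
    one-dimensional Lebesgue measure, starting from the Dirac mass in dimension 0. Tonelli
    identifies [eint]. For [iint], Fubini is used on bounded functions of bounded support, whose
    sections are integrable, so that the [fine] in each [Rintegral] loses nothing. *)
Lemma lebesgue_rV n : exists mu : {sigma_finite_measure set (BV n) -> \bar R},
 [/\ forall g : BV n -> \bar R, measurable_fun [set: BV n] g -> (forall x, 0 <= g x)%E -> eint g = (\int[mu]_x g x)%E,
     forall B : R, (mu (@cball n B) < +oo)%E &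
     forall (g : BV n -> R) (M B : R), measurable_fun [set: BV n] g -> (forall x, `|g x| <= M) ->
       (forall x : 'rV[R]_n, B < `|x| -> g x = 0) -> iint g = fine (\int[mu]_x (g x)%:E)%E].
Proof.
elim: n => [|n [mu [He Hf Hi]]].
  exists \d_(0 : BV 0); split.
  - move=> g mg g0; rewrite integral_dirac //; rewrite /dirac /= indicT mul1e //.
  - by move=> B; rewrite (le_lt_trans (probability_le1 _ _)) ?ltry //; exact: measurable_ball.
  - move=> g M B mg gM g0; rewrite integral_dirac //; last exact/measurable_EFinP.
    by rewrite diracT mul1e.
pose leb : {sigma_finite_measure set (measurableTypeR R) -> \bar R} := @lebesgue_measure R.
pose nu : {measure set (measurableTypeR R * BV n) -> \bar R} := (leb \x mu)%E.
have mv := @measurable_vpair n.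
pose m1 : {measure set (BV n.+1) -> \bar R} :=
  measure_function_pushforward__canonical__measure_function_Measure nu mv.
have m1fin (B : R) : (m1 (@cball n.+1 B) < +oo)%E.
  have mI : measurable (`[- B, B] : set (measurableTypeR R)) by exact: measurable_itv.
  apply: (@le_lt_trans _ _ (nu (`[- B, B] `*` @cball n B))).
    have sub : @vpair n @^-1` @cball n.+1 B `<=` `[- B, B] `*` @cball n B.
      move=> [a y] /= h; split => /=.
        rewrite in_itv /= -ler_norml; apply: le_trans h.
        by have := coord_le_norm (vpair (a, y)) ord0; rewrite /vpair /vcons mxE unlift_none.
      apply: norm_le_coord => [|i]; first by apply: le_trans h.
      apply: le_trans h; have := coord_le_norm (vpair (a, y)) (lift ord0 i).
      by rewrite /vpair /vcons mxE liftK.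
    have mA : measurable (@vpair n @^-1` @cball n.+1 B).
      by rewrite -[X in measurable X]setTI; exact: (mv measurableT _ (measurable_ball B)).
    have mB : measurable ((`[- B, B] : set (measurableTypeR R)) `*` @cball n B).
      by apply: measurableX => //; exact: measurable_ball.
    by apply: (@le_measure _ _ _ nu _ _ _ _ sub); rewrite inE.
  have -> : nu (`[- B, B] `*` @cball n B) = (leb `[(- B)%R, B]%classic * mu (@cball n B))%E.
    exact: (product_measure1E leb mu mI (measurable_ball B)).
  apply: lte_mul_pinfty => //.
  by rewrite /leb /= lebesgue_measure_itv /=; case: ifP.
have sf : sigma_finite setT m1.
  exists (fun k => @cball n.+1 k%:R).
    apply/seteqP; split => // x _; exists (Num.trunc `|x : 'rV[R]_n.+1|).+1 => //=.
    by rewrite /cball /= ltW // truncnS_gt.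
  by move=> k; split; [exact: measurable_ball|exact: m1fin].
have [m2 m2E] := sigma_finite_pack sf.
have section_meas d (T : measurableType d) (g : BV n.+1 -> T) (a : R) : measurable_fun [set: BV n.+1] g ->
    measurable_fun [set: BV n] (fun y : BV n => g (vpair (a, y))).
  by move=> mg; apply: (measurable_fun_pair2 (f := g \o @vpair n)); exact: measurableT_comp.
exists m2; rewrite m2E; split=> //.
- move=> g mg g0; rewrite /= (ge0_integral_pushforward mv) //.
  have mgv : measurable_fun setT (g \o @vpair n) := measurableT_comp mg mv.
  rewrite preimage_setT (fubini_tonelli1 (m1 := leb) (m2 := mu) _ mgv); last by move=> x; exact: g0.
  by apply: eq_integral => a _; rewrite /fubini_F /=; apply: He => //; exact: section_meas.
move=> g M B mg gM g0.
have ig := bounded_support_integrable m1fin mg gM g0.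
have mgE : measurable_fun [set: BV n.+1] (EFin \o g) by exact/measurable_EFinP.
have inu : nu.-integrable setT ((EFin \o g) \o @vpair n).
  apply/integrableP; split; first exact: measurableT_comp.
  have mabs : measurable_fun setT (abse \o (EFin \o g)) by apply: measurableT_comp.
  by have /integrableP[_] := ig; rewrite /= (ge0_integral_pushforward mv).
rewrite /= (integral_pushforward mv) // preimage_setT.
rewrite -(integral12_prod_meas1 inu) /Rintegral; congr fine; apply: eq_integral => a _.
have s0 (y : 'rV[R]_n) : B < `|y| -> g (vpair (a, y)) = 0.
  move=> By; apply: g0; apply: (lt_le_trans By); apply: norm_le_coord => // i.
  have := coord_le_norm (vpair (a, y)) (lift ord0 i).
  by rewrite /vpair /vcons mxE liftK.
have is_ := bounded_support_integrable Hf (section_meas _ _ g a mg) (fun y => gM _) s0.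
rewrite (Hi _ M B (section_meas _ _ g a mg)) //.
by rewrite fineK //; exact: integrable_fin_num is_.
Qed.
End BorelMeasure.

(** * Kelvin transforms of exponentials *)

Section HarmonicExponentials.
Variables (R : realType) (n : nat).
Local Notation V := 'rV[R]_n.
Implicit Types (x z y : V) (W : set V) (f g : V -> R).

Lemma leibniz_lap (a b da db d2a d2b : R) :
  da * db + b * d2a + (a * d2b + db * da) = a * d2b + 2 * (da * db) + b * d2a.
Proof. by ring. Qed.

Lemma lapM W f g x : open W -> smooth_on W f -> smooth_on W g -> W x ->
  lap (fun x => f x * g x) x = f x * lap g x + 2 * \sum_j pd j f x * pd j g x + g x * lap f x.
Proof.
move=> oW sf sg Wx; rewrite /lap !mulr_sumr -[X in X + _]big_split -[RHS]big_split /=.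
apply: eq_bigr => j _.
rewrite (@pd_congr R n W _ (fun y => pd j f y * g y + f y * pd j g y) j x oW _ Wx).
  have s1 := smoothM oW (smooth_pd j sf) sg; have s2 := smoothM oW sf (smooth_pd j sg).
  rewrite (pdD j s1 s2 Wx) (pdM j (smooth_pd j sf) sg Wx) (pdM j sf (smooth_pd j sg) Wx).
  exact: leibniz_lap.
by move=> y Wy; rewrite (pdM j sf sg Wy) addrC [g y * _]mulrC.
Qed.

Section ExpCos.
Variables (W : set V) (P Q : V -> R).
Hypotheses (oW : open W) (sP : smooth_on W P) (sQ : smooth_on W Q).
Hypothesis PQ1 : forall x, W x -> lap P x + \sum_j pd j P x ^+ 2 = \sum_j pd j Q x ^+ 2.
Hypothesis PQ2 : forall x, W x -> lap Q x + 2 * \sum_j pd j P x * pd j Q x = 0.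

Let ec x := expR (P x) * cos (Q x).
Let es x := expR (P x) * sin (Q x).
Let sE : smooth_on W (fun x => expR (P x)) := smooth_exp oW sP.
Let sC : smooth_on W ec := smoothM oW sE (smooth_cos oW sQ).
Let sS : smooth_on W es := smoothM oW sE (smooth_sin oW sQ).

Let pd_ec j x : W x -> pd j ec x = pd j P x * ec x - pd j Q x * es x.
Proof.
move=> Wx; rewrite /ec (pdM j sE (smooth_cos oW sQ) Wx).
rewrite (pd_comp j sP Wx (is_derive_expR _)) (pd_comp j sQ Wx (is_derive_cos _)) /es.
by ring.
Qed.

Let pd_es j x : W x -> pd j es x = pd j P x * es x + pd j Q x * ec x.
Proof.
move=> Wx; rewrite /es (pdM j sE (smooth_sin oW sQ) Wx).
rewrite (pd_comp j sP Wx (is_derive_expR _)) (pd_comp j sQ Wx (is_derive_sin _)) /ec.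
by ring.
Qed.

Lemma second_ec (C S p q pp qq : R) :
  p * (p * C - q * S) + C * pp - (q * (p * S + q * C) + S * qq) =
  C * (pp + p ^+ 2 - q ^+ 2) - S * (qq + 2 * (p * q)).
Proof. by ring. Qed.

Lemma second_es (C S p q pp qq : R) :
  p * (p * S + q * C) + S * pp + (q * (p * C - q * S) + C * qq) =
  S * (pp + p ^+ 2 - q ^+ 2) + C * (qq + 2 * (p * q)).
Proof. by ring. Qed.

Let sums x : W x -> \sum_j (pd j (pd j P) x + pd j P x ^+ 2 - pd j Q x ^+ 2) = 0 /\
  \sum_j (pd j (pd j Q) x + 2 * (pd j P x * pd j Q x)) = 0.
Proof.
move=> Wx; split; first by rewrite sumrB big_split /= -/(lap P x) PQ1 // subrr.
by rewrite big_split /= -/(lap Q x) -mulr_sumr PQ2.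
Qed.

(** With phi = P + iQ, the hypotheses [PQ1] and [PQ2] are the real and imaginary parts of lap phi +
    grad phi . grad phi = 0, which is the harmonicity of exp phi. *)
Lemma exp_cos_harmonic : harmonic_on W (fun x => expR (P x) * cos (Q x)) /\
  harmonic_on W (fun x => expR (P x) * sin (Q x)).
Proof.
split; (split; [by []|move=> x Wx]).
  change (lap ec x = 0); have [h1 h2] := sums Wx.
  transitivity (ec x * (\sum_j (pd j (pd j P) x + pd j P x ^+ 2 - pd j Q x ^+ 2)) - es x * (\sum_j (pd j (pd j Q) x + 2 * (pd j P x * pd j Q x)))); last by rewrite h1 h2 !mulr0 subrr.
  rewrite !mulr_sumr -sumrB; apply: eq_bigr => j _.
  rewrite (@pd_congr R n W _ (fun y => pd j P y * ec y - pd j Q y * es y) j x oW _ Wx); last by move=> y; exact: pd_ec.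
  have s1 := smoothM oW (smooth_pd j sP) sC; have s2 := smoothM oW (smooth_pd j sQ) sS.
  rewrite (pdB j s1 s2 Wx) (pdM j (smooth_pd j sP) sC Wx) (pdM j (smooth_pd j sQ) sS Wx).
  rewrite (pd_ec j Wx) (pd_es j Wx); exact: second_ec.
change (lap es x = 0); have [h1 h2] := sums Wx.
transitivity (es x * (\sum_j (pd j (pd j P) x + pd j P x ^+ 2 - pd j Q x ^+ 2)) + ec x * (\sum_j (pd j (pd j Q) x + 2 * (pd j P x * pd j Q x)))); last by rewrite h1 h2 !mulr0 addr0.
rewrite !mulr_sumr -big_split; apply: eq_bigr => j _.
rewrite (@pd_congr R n W _ (fun y => pd j P y * es y + pd j Q y * ec y) j x oW _ Wx); last by move=> y; exact: pd_es.
have s1 := smoothM oW (smooth_pd j sP) sS; have s2 := smoothM oW (smooth_pd j sQ) sC.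
rewrite (pdD j s1 s2 Wx) (pdM j (smooth_pd j sP) sS Wx) (pdM j (smooth_pd j sQ) sC Wx).
rewrite (pd_ec j Wx) (pd_es j Wx); exact: second_es.
Qed.
End ExpCos.

Section Kelvin.
Variable y : V.
Local Notation W := [set x : V | x <> y].
Local Notation rho := (sqd y).
Let oW : open W := @open_neq R n y.
Let srho : smooth_on W rho := smooth_sqd y oW.

Lemma sqd_gt0 x : x <> y -> 0 < rho x.
Proof.
move=> xy; apply: lt_le_trans (sqd_ge_norm y x); rewrite exprn_gt0 // normr_gt0 subr_eq0.
exact/eqP.
Qed.
Let rho0 x : W x -> rho x != 0. Proof. by move=> /sqd_gt0/lt0r_neq0. Qed.

Lemma smooth_lin a U : open U -> smooth_on U (lin a y).
Proof.
move=> oU; apply: smooth_sum => // k; apply: smoothZ => //.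
by apply: smoothB => //; [exact: smooth_coord|exact: smooth_cst].
Qed.

Lemma pd_lin a j x : pd j (lin a y) x = a 0 j.
Proof.
have sc k : smooth_on setT (fun z : V => z 0 k - y 0 k).
  by apply: smoothB; [exact: openT|exact: smooth_coord openT|exact: smooth_cst openT].
rewrite /lin (@pd_sum R n setT _ _ _ (fun k z => a 0 k * (z 0 k - y 0 k)) j x openT _ I); last first.
  by move=> k; apply: smoothZ => //; exact: openT.
rewrite (bigD1 j) //= big1 ?addr0 => [|k kj]; rewrite (pdZ _ _ (sc _) I) (pdB j (smooth_coord _ openT) (smooth_cst _ openT) I) pd_coord pd_cst subr0.
  by rewrite eqxx mulr1.
by rewrite (negbTE kj) mulr0.
Qed.

Lemma lap_lin a x : lap (lin a y) x = 0.
Proof.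
rewrite /lap big1 // => j _; rewrite (_ : pd j (lin a y) = fun=> a 0 j) ?pd_cst //.
by apply/funext => z; exact: pd_lin.
Qed.

Let ir x := (rho x)^-1.
Let sir : smooth_on W ir. Proof. exact: smooth_inv oW srho rho0. Qed.
Let sln : smooth_on W (fun x => ln (rho x)). Proof. by apply: smooth_ln => // x; exact: sqd_gt0. Qed.

Let grad_rho x : \sum_j pd j rho x ^+ 2 = 4 * rho x.
Proof. by rewrite /sqd mulr_sumr; apply: eq_bigr => j _; rewrite pd_sqd exprMn; congr (_ * _); ring. Qed.

Lemma is_derive_inv1 (t : R) : t != 0 -> is_derive t 1 (fun s => s^-1) (- t^-1 ^+ 2).
Proof.
move=> t0; apply: is_derive_ext (is_derive_invX 1 t0) => [s|]; first by rewrite expr1.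
by rewrite mulN1r.
Qed.

Let pd_ir j x : W x -> pd j ir x = - 2 * (x 0 j - y 0 j) * ir x ^+ 2.
Proof. by move=> Wx; rewrite /ir (pd_comp j srho Wx (is_derive_inv1 (rho0 Wx))) pd_sqd; ring. Qed.

Let lap_ir x : W x -> lap ir x = (8 - 2 * n%:R) * ir x ^+ 2.
Proof.
move=> Wx; rewrite /ir.
have d2 z : W z -> is_derive (rho z) 1 (fun t : R => - t^-1 ^+ 2) (2 * (rho z)^-1 ^+ 3).
  move=> Wz; apply: is_derive_ext (is_deriveN (is_derive_invX 2 (rho0 Wz))) => //.
  by rewrite mulNr opprK.
have s1 : smooth_on W (fun z => - (rho z)^-1 ^+ 2).
  apply: smoothN => //; exact: (smoothM oW sir sir).
have E := lap_comp (phi := fun t => t^-1) (phi1 := fun t => - t^-1 ^+ 2) (phi2 := fun t => 2 * t^-1 ^+ 3) oW srho s1 (fun z Wz => is_derive_inv1 (rho0 Wz)) d2 Wx.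
rewrite E grad_rho lap_sqd; field; exact: rho0.
Qed.

Let pd_ln j x : W x -> pd j (fun x => ln (rho x)) x = 2 * (x 0 j - y 0 j) * ir x.
Proof. by move=> Wx; rewrite (pd_comp j srho Wx (is_derive1_ln (sqd_gt0 Wx))) pd_sqd /ir mulrC. Qed.

Let lap_ln x : W x -> lap (fun x => ln (rho x)) x = (2 * n%:R - 4) * ir x.
Proof.
move=> Wx; rewrite /ir.
have E := lap_comp (phi := @ln R) (phi1 := fun t => t^-1) (phi2 := fun t => - t^-1 ^+ 2) oW srho sir (fun z Wz => is_derive1_ln (sqd_gt0 Wz)) (fun z Wz => is_derive_inv1 (rho0 Wz)) Wx.
rewrite E grad_rho lap_sqd; field; exact: rho0.
Qed.

Variables (a b : V) (A : R).
Hypotheses (aA : \sum_j a 0 j ^+ 2 = A) (bA : \sum_j b 0 j ^+ 2 = A) (ab0 : \sum_j a 0 j * b 0 j = 0).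

(* [exp (kelvin_re x + i kelvin_im x)] is the Kelvin transform about [y] of [exp ((a + i b).x)]. *)
Definition kelvin_re x := lin a y x * (rho x)^-1 - (n%:R / 2 - 1) * ln (rho x).
Definition kelvin_im x := lin b y x * (rho x)^-1.

Let sKr : smooth_on W kelvin_re.
Proof.
apply: smoothB => //; last exact: smoothZ.
by apply: smoothM => //; exact: smooth_lin.
Qed.
Let sKi : smooth_on W kelvin_im.
Proof. by apply: smoothM => //; exact: smooth_lin. Qed.

Let m : R := n%:R / 2 - 1.
Let Y x j := x 0 j - y 0 j.

Let pd_lr c j x : W x -> pd j (fun x => lin c y x * ir x) x = c 0 j * ir x - Y x j * (2 * lin c y x * ir x ^+ 2).
Proof.
by move=> Wx; rewrite (pdM j (smooth_lin c oW) sir Wx) pd_lin (pd_ir j Wx) /Y; ring.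
Qed.

Let lap_lr c x : W x -> lap (fun x => lin c y x * ir x) x = (4 - 2 * n%:R) * (lin c y x * ir x ^+ 2).
Proof.
move=> Wx; rewrite (lapM oW (smooth_lin c oW) sir Wx) lap_lin lap_ir // mulr0 addr0.
have -> : \sum_j pd j (lin c y) x * pd j ir x = - 2 * ir x ^+ 2 * lin c y x.
  rewrite /lin mulr_sumr; apply: eq_bigr => j _; rewrite -/(lin c y) pd_lin (pd_ir j Wx).
  by ring.
by ring.
Qed.

Let dotY (c : V) x : \sum_j c 0 j * Y x j = lin c y x. Proof. by []. Qed.

Let sum_sq (c : V) (r d : R) x : \sum_j (c 0 j * r - Y x j * d) ^+ 2 =
  (\sum_j c 0 j ^+ 2) * r ^+ 2 - 2 * r * d * lin c y x + rho x * d ^+ 2.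
Proof.
rewrite -dotY /sqd mulr_suml mulr_suml mulr_sumr -sumrB -big_split; apply: eq_bigr => j _ /=.
by rewrite /Y; ring.
Qed.

Let sum_mul (r d e : R) x : \sum_j (a 0 j * r - Y x j * d) * (b 0 j * r - Y x j * e) =
  - (r * e) * lin a y x - (r * d) * lin b y x + rho x * (d * e).
Proof.
transitivity (r ^+ 2 * (\sum_j a 0 j * b 0 j) + (- (r * e) * lin a y x - (r * d) * lin b y x + rho x * (d * e))); last first.
  by rewrite ab0 mulr0 add0r.
rewrite -!dotY /sqd mulr_suml !mulr_sumr -sumrB -!big_split; apply: eq_bigr => j _ /=.
by rewrite /Y; ring.
Qed.

Lemma kelvin_harmonic : harmonic_on W (fun x => expR (kelvin_re x) * cos (kelvin_im x)) /\
  harmonic_on W (fun x => expR (kelvin_re x) * sin (kelvin_im x)).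
Proof.
have sl : smooth_on W (fun x => lin a y x * ir x) by apply: smoothM => //; exact: smooth_lin.
have pdR j x : W x -> pd j kelvin_re x = a 0 j * ir x - Y x j * (2 * lin a y x * ir x ^+ 2 + 2 * m * ir x).
  move=> Wx; rewrite /kelvin_re (pdB j sl (smoothZ _ oW sln) Wx) (pdZ _ j sln Wx) (pd_lr a j Wx) (pd_ln j Wx).
  by rewrite -/m /Y; ring.
have pdI j x : W x -> pd j kelvin_im x = b 0 j * ir x - Y x j * (2 * lin b y x * ir x ^+ 2) by exact: pd_lr.
have rr x : W x -> rho x * ir x = 1 by move=> Wx; rewrite /ir divff // rho0.
apply: exp_cos_harmonic => // x Wx; have r1 := rr x Wx.
  rewrite (eq_bigr (fun j => (a 0 j * ir x - Y x j * (2 * lin a y x * ir x ^+ 2 + 2 * m * ir x)) ^+ 2)); last by move=> j _; rewrite pdR.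
  rewrite [in RHS](eq_bigr (fun j => (b 0 j * ir x - Y x j * (2 * lin b y x * ir x ^+ 2)) ^+ 2)); last by move=> j _; rewrite pdI.
  rewrite !sum_sq aA bA /kelvin_re (lapB oW sl (smoothZ _ oW sln) Wx) (lapZ _ oW sln Wx) lap_lr // lap_ln // -/m.
  move: (lin a y x) (lin b y x) (ir x) (rho x) r1 => La Lb r q r1.
  have -> : n%:R = 2 * m + 2 :> R by rewrite /m; field.
  have E1 d : q * d ^+ 2 = q * d * d by ring.
  rewrite !E1; have -> : q * (2 * La * r ^+ 2 + 2 * m * r) = 2 * La * r + 2 * m.
    transitivity ((q * r) * (2 * La * r + 2 * m)); [ring|by rewrite r1 mul1r].
  have -> : q * (2 * Lb * r ^+ 2) = 2 * Lb * r.
    transitivity ((q * r) * (2 * Lb * r)); [ring|by rewrite r1 mul1r].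
  by ring.
rewrite (eq_bigr (fun j => (a 0 j * ir x - Y x j * (2 * lin a y x * ir x ^+ 2 + 2 * m * ir x)) * (b 0 j * ir x - Y x j * (2 * lin b y x * ir x ^+ 2)))); last by move=> j _; rewrite pdR ?pdI.
rewrite sum_mul lap_lr //.
move: (lin a y x) (lin b y x) (ir x) (rho x) r1 => La Lb r q r1.
have -> : n%:R = 2 * m + 2 :> R by rewrite /m; field.
have -> : q * ((2 * La * r ^+ 2 + 2 * m * r) * (2 * Lb * r ^+ 2)) = (q * r) * ((2 * La * r + 2 * m) * (2 * Lb * r ^+ 2)) by ring.
by rewrite r1; ring.
Qed.
End Kelvin.
End HarmonicExponentials.

(** * Vanishing from bounds on the Laplace transform *)

Section LaplaceVanishing.
Context d (T : measurableType d) (R : realType) (mu : {measure set T -> \bar R}).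
Implicit Types (h f g phi : T -> R).

Definition intble h := mu.-integrable setT (EFin \o h).
Definition J h : R := \int[mu]_x h x.

Lemma intble_mul h phi (M : R) : intble h -> measurable_fun setT phi -> (forall x, `|phi x| <= M) ->
  intble (fun x => h x * phi x).
Proof.
move=> ih mp bp; have M0 x : 0 <= M := le_trans (normr_ge0 _) (bp x).
have mh : measurable_fun setT h by apply/measurable_EFinP; exact: measurable_int ih.
apply: (@le_integrable _ _ _ mu setT measurableT _ (fun x => (M%:E * (EFin \o h) x)%E)).
- by apply/measurable_EFinP; exact: measurable_funM.
- move=> x _; rewrite /= lee_fin !normrM [leRHS]mulrC ler_wpM2l //.
  exact: le_trans (bp x) (ler_norm _).
exact: (integrableZl measurableT).
Qed.

Lemma intble_scale h (c : R) : intble h -> intble (fun x => c * h x).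
Proof.
move=> ih; have := integrableZl measurableT c ih.
by apply: eq_integrable.
Qed.

Lemma intble_meas h : intble h -> measurable_fun setT h.
Proof. by move=> ih; apply/measurable_EFinP; exact: measurable_int ih. Qed.

Lemma intble_sub h g : intble h -> intble g -> intble (fun x => h x - g x).
Proof.
move=> ih ig; have := integrableB measurableT ih ig.
by apply: eq_integrable.
Qed.

Lemma J_sub h g : intble h -> intble g -> J (fun x => h x - g x) = J h - J g.
Proof. by move=> ih ig; rewrite /J -RintegralB. Qed.

Lemma J_scale h (c : R) : intble h -> J (fun x => c * h x) = c * J h.
Proof. by move=> ih; rewrite /J RintegralZl. Qed.

Lemma eq_J h g : h =1 g -> J h = J g.
Proof. by move=> hg; congr J; apply/funext. Qed.

Lemma J_bound h g : intble h -> intble g -> (forall x, `|h x| <= g x) -> `|J h| <= J g.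
Proof.
move=> ih ig hg; apply: (le_trans (le_normr_Rintegral measurableT ih)).
apply: le_Rintegral => //.
apply: (@le_integrable _ _ _ mu setT measurableT _ (EFin \o g)) => //.
  by apply/measurable_EFinP; apply: measurableT_comp => //; exact: intble_meas.
by move=> x _; rewrite /= lee_fin normr_id; apply: le_trans (hg x) (ler_norm _).
Qed.

Lemma J_dominated h (phi_ : nat -> T -> R) phi (M : R) : intble h -> (forall N, measurable_fun setT (phi_ N)) ->
  measurable_fun setT phi -> (forall N x, `|phi_ N x| <= M) ->
  (forall x (e : R), 0 < e -> exists N0, forall N, (N0 <= N)%N -> `|phi_ N x - phi x| <= e) ->
  forall e : R, 0 < e -> exists N0, forall N, (N0 <= N)%N ->
    `|J (fun x => h x * phi_ N x) - J (fun x => h x * phi x)| <= e.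
Proof.
move=> ih mp_ mp bp cp e e0.
have mh := intble_meas ih.
have iN N : intble (fun x => h x * phi_ N x) by apply: (@intble_mul _ _ M).
have h1 : forall N, measurable_fun setT (fun x => (h x * phi_ N x)%:E).
  by move=> N; apply/measurable_EFinP; exact: measurable_funM.
have h2 : measurable_fun setT (fun x => (h x * phi x)%:E).
  by apply/measurable_EFinP; exact: measurable_funM.
have h3 : {ae mu, forall x, setT x -> (fun N => (h x * phi_ N x)%:E) @ \oo --> (h x * phi x)%:E}.
  apply/aeW => x _; apply: cvg_EFin; first exact: nearW.
  apply: cvgMr; apply/cvgrPdist_le => e' e'0.
  have [N0 HN] := cp x e' e'0; near=> N; rewrite distrC; apply: HN.
  by near: N; exact: nbhs_infty_ge.
have h4 : mu.-integrable setT (fun x => `|((`|M|)%:E * (h x)%:E)|%E).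
  exact: integrable_abse (integrableZl measurableT _ ih).
have h5 : {ae mu, forall x N, setT x -> (`|(h x * phi_ N x)%:E| <= `|((`|M|)%:E * (h x)%:E)|)%E}.
  apply/aeW => x N _; rewrite /= lee_fin !normrM normr_id mulrC ler_wpM2r //.
  exact: le_trans (bp N x) (ler_norm _).
have [ip _ cv] := dominated_convergence measurableT h1 h2 h3 h4 h5.
have fp := integrable_fin_num measurableT ip.
move: cv; rewrite -(fineK fp) => /fine_cvg /cvgrPdist_le /(_ e e0) [N0 _ HN].
by exists N0 => N hN; rewrite distrC; exact: HN.
Unshelve. all: by end_near.
Qed.

Lemma J_ae0 h : intble h -> (forall A, measurable A -> J (fun x => h x * \1_A x) = 0) ->
  ae_eq mu setT (EFin \o h) (cst 0%E).
Proof.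
move=> ih H; apply: integral_ae_eq => // A _ mA.
rewrite integral0 integral_mkcond.
have iA : intble (fun x => h x * \1_A x).
  by apply: (@intble_mul _ _ 1) => // x; rewrite indicE; case: (_ \in _); rewrite ?normr1 ?normr0.
transitivity (\int[mu]_x (h x * \1_A x)%:E)%E.
  by apply: eq_integral => x _; rewrite patchE indicE; case: (_ \in _); rewrite ?mulr1 ?mulr0.
have fA := integrable_fin_num measurableT iA.
by rewrite -(fineK fA); congr (_%:E); exact: (H A mA).
Qed.

Lemma exp_small (N : nat) (s : R) : (0 < N)%N -> 0 < s -> N%:R * expR (- (N%:R * s)) <= 4 / (N%:R * s ^+ 2).
Proof.
move=> N0 s0; have n0 : 0 < N%:R :> R by rewrite ltr0n.
have ns : 0 <= N%:R * s by rewrite mulr_ge0 // ltW.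
have := exp_dominates 2 ns; rewrite -natrX => h.
have p : 0 < N%:R * s ^+ 2 by rewrite mulr_gt0 // exprn_gt0.
rewrite ler_pdivlMr //; move: h; rewrite exprMn; set E := expR _; move=> h.
by have -> : N%:R * E * (N%:R * s ^+ 2) = N%:R ^+ 2 * s ^+ 2 * E by ring.
Qed.

Lemma small_seq (C e : R) : 0 < e -> exists N0, forall N, (N0 < N)%N -> C / N%:R <= e.
Proof.
move=> e0; exists (Num.trunc (`|C| / e)) => N hN.
have h : `|C| / e < N%:R.
  apply: lt_le_trans (truncnS_gt _) _.
  by rewrite ler_nat.
have N0 : 0 < N%:R :> R by rewrite ltr0n (leq_ltn_trans _ hN).
rewrite ler_pdivrMr //; apply: (le_trans (ler_norm C)).
by move: h; rewrite ltr_pdivrMr // mulrC => /ltW.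
Qed.

Lemma exp_sub1 (t : R) : 0 <= t -> t <= 2^-1 -> expR t - 1 <= 2 * t.
Proof.
move=> t0 t1; have h := expR_ge1Dx (- t); have p : 0 < 1 - t by lra.
have : expR t <= (1 - t)^-1.
  by rewrite -[expR t]invrK -expRN lef_pV2 ?posrE ?expR_gt0.
move=> h2; have : (1 - t)^-1 <= 1 + 2 * t.
  rewrite -[leLHS]mul1r ler_pdivrMr //.
  have : 0 <= t * (1 - 2 * t) by rewrite mulr_ge0 //; lra.
  lra.
lra.
Qed.

Lemma one_minus_pow (a : R) m : 0 <= a -> a <= 1 -> 1 - (1 - a) ^+ m <= m%:R * a.
Proof.
move=> a0 a1; elim: m => [|m IH]; first by rewrite expr0 subrr mul0r.
have h : (1 - a) ^+ m <= 1 by apply: exprn_ile1; lra.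
have : a * (1 - a) ^+ m <= a by rewrite -[leRHS]mulr1 ler_wpM2l.
rewrite exprS -natr1; move: IH; set E := _ ^+ m; lra.
Qed.

(* With [u] the [N]-th power of [exp tau / T0] for [T0 = K e^c], the polynomials [1 - (1 - u)^(N K^N)] in
   [exp tau] tend to the indicator of [tau >= c], and their coefficients are small enough for the
   assumed bounds. *)
Lemma threshold_vanish h (tau : T -> R) (b c r C0 : R) : intble h -> measurable_fun setT tau ->
  (forall x, tau x <= b) -> r < c -> 0 <= C0 ->
  (forall k, (0 < k)%N -> `|J (fun x => h x * expR (k%:R * tau x))| <= C0 * expR (r * k%:R)) ->
  J (fun x => h x * \1_[set x | c <= tau x] x) = 0.
Proof.
move=> ih mt tb rc C00 H.
(* [ln K >= b - c] places the reference level [t0 = c + ln K] above the bound [b] of [tau], so that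
   [u] takes values in [0, 1]. *)
pose K := (Num.trunc (expR (b - c))).+2.
have K0 : 0 < K%:R :> R by rewrite ltr0n.
have Kb : b - c <= ln K%:R.
  rewrite -[leLHS]expRK ler_ln ?posrE ?expR_gt0 //.
  apply: le_trans (ltW (truncnS_gt _)) _.
  by rewrite ler_nat.
pose t0 := c + ln K%:R.
pose u N x := expR (N%:R * (tau x - t0)).
have u0 N x : 0 <= u N x by exact: expR_ge0.
have u1 N x : u N x <= 1.
  rewrite /u -[leRHS]expR0 ler_expR mulr_ge0_le0 // /t0; have := tb x; lra.
pose Q N := expR (N%:R * (r - t0)).
have mu_ N : measurable_fun setT (u N).
  by apply: measurableT_comp => //; apply: measurable_funM => //; apply: measurable_funB.
have mpow N k : measurable_fun setT (fun x => u N x ^+ k) by exact: measurable_funX.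
have m1u N k : measurable_fun setT (fun x => (1 - u N x) ^+ k).
  by apply: measurable_funX; exact: measurable_funB.
have b01 (a : R) k : 0 <= a -> a <= 1 -> `|a ^+ k| <= 1.
  by move=> a0 a1; rewrite ger0_norm ?exprn_ge0 // exprn_ile1.
have c01 N x : 0 <= 1 - u N x /\ 1 - u N x <= 1.
  by have := u0 N x; have := u1 N x; split; lra.
have iuk N k m : intble (fun x => h x * (u N x ^+ k * (1 - u N x) ^+ m)).
  apply: (@intble_mul _ _ 1) => //; first exact: measurable_funM.
  move=> x; rewrite normrM -[leRHS]mulr1; have [a1 a2] := c01 N x.
  by apply: ler_pM => //; exact: b01.
(* The hypothesis at the integer [N * k] bounds the integral of [u ^+ k] by [Q ^+ k]; each factor
   [1 - u] is a difference of two such terms and costs a factor [1 + Q]. *)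
have step N k m : (0 < N)%N -> (0 < k)%N ->
    `|J (fun x => h x * (u N x ^+ k * (1 - u N x) ^+ m))| <= C0 * Q N ^+ k * (1 + Q N) ^+ m.
  move=> N0; elim: m k => [|m IH] k k0.
    rewrite expr0 mulr1.
    have E x : h x * (u N x ^+ k * (1 - u N x) ^+ 0) = expR (- ((N * k)%:R * t0)) * (h x * expR ((N * k)%:R * tau x)).
      rewrite expr0 mulr1 /u -expRM_natl [RHS]mulrCA -expRD natrM; congr (h x * expR _); ring.
    have ih' : intble (fun x => h x * expR ((N * k)%:R * tau x)).
      apply: (@intble_mul _ _ (expR ((N * k)%:R * b))) => //.
        by apply: measurableT_comp => //; exact: measurable_funM.
      by move=> x; rewrite ger0_norm ?expR_ge0 // ler_expR ler_wpM2l.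
    rewrite (eq_J E) J_scale // normrM ger0_norm ?expR_ge0 //.
    have Nk : (0 < N * k)%N by rewrite muln_gt0 N0.
    apply: (@le_trans _ _ (expR (- ((N * k)%:R * t0)) * (C0 * expR (r * (N * k)%:R)))).
      by rewrite ler_wpM2l ?expR_ge0 // H.
    rewrite le_eqVlt; apply/orP; left; apply/eqP.
    rewrite /Q -expRM_natl mulrCA -expRD natrM; congr (C0 * expR _); ring.
  have E x : h x * (u N x ^+ k * (1 - u N x) ^+ m.+1) =
      h x * (u N x ^+ k * (1 - u N x) ^+ m) - h x * (u N x ^+ k.+1 * (1 - u N x) ^+ m).
    by rewrite !exprS; ring.
  rewrite (eq_J E) J_sub //; apply: (le_trans (ler_normB _ _)).
  apply: (le_trans (lerD (IH k k0) (IH k.+1 isT))).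
  by rewrite le_eqVlt; apply/orP; left; apply/eqP; rewrite !exprS; ring.
pose p N m x := 1 - (1 - u N x) ^+ m.
have p01 N m x : `|p N m x| <= 1.
  have [a1 a2] := c01 N x; have := b01 _ m a1 a2; rewrite ger0_norm ?exprn_ge0 // /p => h1.
  by have := exprn_ge0 m a1 => h2; rewrite ger0_norm; lra.
have mp N m : measurable_fun setT (p N m) by apply: measurable_funB.
have ip N m : intble (fun x => h x * p N m x) by apply: (@intble_mul _ _ 1).
have pbound N m : (0 < N)%N -> `|J (fun x => h x * p N m x)| <= C0 * ((1 + Q N) ^+ m - 1).
  move=> N0; elim: m => [|m IH].
    rewrite expr0 subrr mulr0 (eq_J (g := fun x => 0 * h x)) ?J_scale ?mul0r ?normr0 //.
    by move=> x; rewrite /p expr0 subrr mulr0 mul0r.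
  have E x : h x * p N m.+1 x = h x * p N m x - (- 1) * (h x * (u N x ^+ 1 * (1 - u N x) ^+ m)).
    by rewrite /p !exprS expr0; ring.
  have iN : intble (fun x => - 1 * (h x * (u N x ^+ 1 * (1 - u N x) ^+ m))) by exact: intble_scale.
  rewrite (eq_J E) J_sub // J_scale // mulN1r opprK; apply: (le_trans (ler_normD _ _)).
  apply: (le_trans (lerD IH (step N 1%N m N0 isT))).
  by rewrite le_eqVlt; apply/orP; left; apply/eqP; rewrite !exprS expr0; ring.
(* [M N * u N] equals [N * expR (N * (tau - c))]: it tends to 0 where [tau < c] and is at least [N]
   where [tau >= c]. With [r] in place of [tau] it is [M N * Q N], which tends to 0 and controls the
   integral. *)
pose M N := (N * K ^ N)%N.
have MQ N (s : R) : (M N)%:R * expR (N%:R * (s - t0)) = N%:R * expR (- (N%:R * (c - s))).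
  have KN : (K ^ N)%:R = expR (N%:R * ln K%:R) :> R.
    by rewrite expRM_natl lnK ?posrE // natrX.
  rewrite /M natrM KN -mulrA -expRD; congr (_ * expR _); rewrite /t0; ring.
have cr : 0 < c - r by rewrite subr_gt0.
apply/eqP; rewrite -normr_le0; apply/ler_addgt0Pr => e e0; rewrite add0r.
have e2 : 0 < e / 2 by rewrite divr_gt0.
have mI : measurable [set x | c <= tau x].
  rewrite (_ : [set x | _] = setT `&` tau @^-1` `[c, +oo[); first exact: (mt measurableT _ (measurable_itv _)).
  by apply/seteqP; split => x; rewrite /= in_itv /= andbT // => -[].
have mind : measurable_fun setT (\1_[set x | c <= tau x] : T -> R) by exact: measurable_indic.
have pw x (d0 : R) : 0 < d0 -> exists N0, forall N, (N0 <= N)%N ->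
    `|p N (M N) x - \1_[set x | c <= tau x] x| <= d0.
  move=> d00; have [cx|xc] := leP c (tau x).
    have [N3 HN3] := small_seq 1 d00; exists N3.+1 => N hN.
    have N0 : 0 < N%:R :> R by rewrite ltr0n; exact: leq_ltn_trans hN.
    have [a1 a2] := c01 N x; have q0 := exprn_ge0 (M N) a1.
    rewrite indicE mem_set // /p addrAC subrr sub0r normrN ger0_norm //.
    apply: le_trans (HN3 N hN); rewrite mul1r.
    have q1 : (1 - u N x) ^+ M N <= expR (- N%:R).
      apply: (@le_trans _ _ (expR (- ((M N)%:R * u N x)))).
        rewrite -mulrN expRM_natl lerXn2r ?nnegrE ?expR_ge0 //; exact: expR_ge1Dx.
      rewrite ler_expR lerN2 /u MQ; apply: ler_peMr; first exact: ltW.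
      rewrite -[leLHS]expR0 ler_expR.
      by rewrite -mulrN opprB; apply: mulr_ge0; [exact: ltW | rewrite subr_ge0].
    apply: le_trans q1 _; rewrite expRN lef_pV2 ?posrE ?expR_gt0 //.
    by apply: le_trans (expR_ge1Dx _); rewrite lerDr.
  have cx : 0 < c - tau x by rewrite subr_gt0.
  have [N3 HN3] := small_seq (4 / (c - tau x) ^+ 2) d00; exists N3.+1 => N hN.
  have N0 : (0 < N)%N by exact: leq_ltn_trans hN.
  have [a1 a2] := c01 N x; have q0 := exprn_ge0 (M N) a1.
  rewrite indicE memNset ?subr0; last by rewrite /= leNgt xc.
  apply: le_trans (HN3 N hN).
  have q1 : 0 <= p N (M N) x by rewrite /p subr_ge0 exprn_ile1.
  rewrite ger0_norm //; apply: (@le_trans _ _ ((M N)%:R * u N x)).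
    by rewrite /p; exact: one_minus_pow.
  rewrite /u MQ; apply: le_trans (exp_small N0 cx) _.
  by rewrite le_eqVlt; apply/orP; left; apply/eqP; rewrite invfM mulrA mulrAC.
have [N0 HN] := @J_dominated h (fun N => p N (M N)) _ 1 ih (fun N => mp _ _) mind (fun N => p01 _ _) pw _ e2.
have [N1 HN1] := small_seq (2 * C0 * (4 / (c - r) ^+ 2)) e2.
have [N2 HN2] := @small_seq (4 / (c - r) ^+ 2) 2^-1 ltac:(by rewrite invr_gt0).
pose N := (N0 + N1 + N2).+1.
have NN0 : (N0 <= N)%N by rewrite leqW // -addnA leq_addr.
have NN1 : (N1 < N)%N by rewrite ltnS addnAC leq_addl.
have NN2 : (N2 < N)%N by rewrite ltnS leq_addl.
have := HN N NN0; set J1 := J _; set J2 := J _ => h12.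
have N_gt0 : (0 < N)%N by [].
have tQ : (M N)%:R * Q N <= 4 / (c - r) ^+ 2 / N%:R.
  by rewrite MQ; apply: le_trans (exp_small _ _) _ => //; rewrite -mulrA -invfM [_ ^+ 2 * _]mulrC.
have h1 : `|J1| <= e / 2.
  apply: le_trans (pbound N (M N) N_gt0) _.
  have q1 : (1 + Q N) ^+ M N <= expR ((M N)%:R * Q N).
    by rewrite expRM_natl lerXn2r ?nnegrE ?addr_ge0 ?expR_ge0 // expR_ge1Dx.
  have q2 : expR ((M N)%:R * Q N) - 1 <= 2 * ((M N)%:R * Q N).
    apply: exp_sub1; first by rewrite mulr_ge0 ?expR_ge0.
    by apply: le_trans tQ _; exact: HN2.
  have q3 : (1 + Q N) ^+ M N - 1 <= 2 * (4 / (c - r) ^+ 2 / N%:R).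
    by apply: le_trans (lerB q1 (lexx 1)) _; apply: le_trans q2 _; rewrite ler_wpM2l.
  apply: (@le_trans _ _ (C0 * (2 * (4 / (c - r) ^+ 2 / N%:R)))); first by rewrite ler_wpM2l.
  apply: le_trans (HN1 N NN1).
  by rewrite le_eqVlt; apply/orP; left; apply/eqP; ring.
have -> : J2 = J1 - (J1 - J2) by ring.
by apply: (le_trans (ler_normB _ _)); rewrite [e]splitr lerD.
Qed.

Lemma J_indic_lambda h n (X : T -> BV R n) : intble h -> measurable_fun setT X ->
  J h = 0 -> lambda_system setT [set A : set (BV R n) | measurable A /\ J (fun x => h x * \1_A (X x)) = 0].
Proof.
move=> ih mX J0.
have mA A : measurable (A : set (BV R n)) -> measurable_fun setT (fun x => \1_A (X x) : R).
  by move=> mA; apply: (measurableT_comp (f := (\1_A : BV R n -> R))) mX => //; exact: measurable_indic.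
have bA (A : set (BV R n)) x : `|\1_A (X x) : R| <= 1.
  by rewrite indicE; case: (_ \in _); rewrite ?normr1 ?normr0.
have iA A : measurable (A : set (BV R n)) -> intble (fun x => h x * \1_A (X x)).
  by move=> hA; apply: (@intble_mul _ _ 1) => //; exact: mA.
split.
- by move=> A _.
- split; first exact: measurableT.
  by rewrite -[RHS]J0; apply: eq_J => x; rewrite indicT mulr1.
- move=> A B BA [hA A0] [hB B0]; split; first exact: measurableD.
  rewrite (eq_J (g := fun x => h x * \1_A (X x) - h x * \1_B (X x))).
    by rewrite J_sub ?A0 ?B0 ?subr0 //; exact: iA.
  move=> x; rewrite -mulrBr; congr (_ * _); rewrite !indicE.
  have [xB|xB] := pselect (B (X x)).
    by rewrite memNset ?mem_set ?subrr //; [exact: BA | case].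
  rewrite (memNset xB) subr0; have [xA|xA] := pselect (A (X x)).
    by rewrite !mem_set.
  by rewrite !memNset // => -[].
move=> F ndF HF; have mU : measurable (\bigcup_i F i : set (BV R n)).
  by apply: bigcupT_measurable => i; case: (HF i).
split=> //; apply/eqP; rewrite -normr_le0; apply/ler_addgt0Pr => e e0; rewrite add0r.
have pw x (d0 : R) : 0 < d0 -> exists N0, forall N, (N0 <= N)%N ->
    `|\1_(F N) (X x) - \1_(\bigcup_i F i) (X x)| <= d0.
  move=> d00; have [[k _ Fk]|nF] := pselect ((\bigcup_i F i) (X x)).
    exists k => N kN; rewrite !indicE !mem_set ?subrr ?normr0 ?ltW //.
      by exists k.
    by have /subsetPset := ndF _ _ kN; exact.
  exists 0%N => N _; rewrite !indicE !memNset ?subrr ?normr0 ?ltW // => h1.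
  by apply: nF; exists N.
have [N0 HN] := J_dominated ih (fun N => mA _ (proj1 (HF N))) (mA _ mU) (fun N => bA (F N)) pw e0.
by have := HN N0 (leqnn _); rewrite (proj2 (HF N0)) sub0r normrN.
Qed.

Definition dotp n (xi : 'I_n -> R) (v : 'rV[R]_n) : R := \sum_i xi i * v 0 i.
Definition enorm n (xi : 'I_n -> R) : R := Num.sqrt (\sum_i xi i ^+ 2).

Lemma enorm_ge0 n (xi : 'I_n -> R) : 0 <= enorm xi.
Proof. exact: sqrtr_ge0. Qed.

Lemma sum_sqr_ge0 n (xi : 'I_n -> R) : 0 <= \sum_i xi i ^+ 2.
Proof. by apply: sumr_ge0 => i _; exact: sqr_ge0. Qed.

Lemma enorm_sqr n (xi : 'I_n -> R) : enorm xi ^+ 2 = \sum_i xi i ^+ 2.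
Proof. by rewrite sqr_sqrtr // sum_sqr_ge0. Qed.

Lemma cauchy_schwarz n (a b : 'I_n -> R) : \sum_i a i * b i <= enorm a * enorm b.
Proof.
set S := \sum_i _.
have key : S ^+ 2 <= (enorm a * enorm b) ^+ 2.
  rewrite exprMn !enorm_sqr; set A := \sum_i a i ^+ 2; set B := \sum_i b i ^+ 2.
  have A0 : 0 <= A := sum_sqr_ge0 a; have B0 : 0 <= B := sum_sqr_ge0 b.
  have : 0 <= \sum_i (B * a i - S * b i) ^+ 2 by exact: sum_sqr_ge0.
  rewrite (eq_bigr (fun i => B ^+ 2 * a i ^+ 2 - 2 * B * S * (a i * b i) + S ^+ 2 * b i ^+ 2)); last by move=> i _; ring.
  rewrite big_split sumrB -!mulr_sumr /= -/A -/B -/S => h.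
  have {}h : 0 <= B * (A * B - S ^+ 2) by move: h; move: (A) (B) (S) => a' b' s'; lra.
  move: B0; rewrite le_eqVlt => /orP[/eqP B0|B0]; last by move: h; rewrite pmulr_rge0 // subr_ge0.
  have b0 i : b i = 0.
    have /eqP := esym B0; rewrite psumr_eq0; last by move=> j _; exact: sqr_ge0.
    by move=> /allP /(_ i (mem_index_enum _)); rewrite sqrf_eq0 => /eqP.
  by rewrite /S big1 ?expr0n -?B0 ?mulr0 // => i _; rewrite b0 mulr0.
apply: (le_trans (ler_norm S)); rewrite -sqrtr_sqr -[leRHS]ger0_norm ?mulr_ge0 ?enorm_ge0 //.
by rewrite -[leRHS]sqrtr_sqr ler_sqrt // sqr_ge0.
Qed.

Lemma enormD n (a b : 'I_n -> R) : enorm (fun i => a i + b i) <= enorm a + enorm b.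
Proof.
rewrite -[leRHS]ger0_norm ?addr_ge0 ?enorm_ge0 // -[leRHS]sqrtr_sqr ler_sqrt ?sqr_ge0 //.
rewrite (eq_bigr (fun i => a i ^+ 2 + 2 * (a i * b i) + b i ^+ 2)); last by move=> i _; ring.
rewrite !big_split -mulr_sumr /= -!enorm_sqr; have := cauchy_schwarz a b.
by move: (enorm a) (enorm b) => x y; set S := \sum_i _; lra.
Qed.

Lemma enormZ n (k : R) (a : 'I_n -> R) : 0 <= k -> enorm (fun i => k * a i) = k * enorm a.
Proof.
move=> k0; rewrite /enorm (eq_bigr (fun i => k ^+ 2 * a i ^+ 2)); last by move=> i _; ring.
by rewrite -mulr_sumr sqrtrM ?sqr_ge0 // sqrtr_sqr ger0_norm.
Qed.

(** [threshold_vanish] in the direction [om], with the factor [expR (dotp xi (X x))] carried along,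
    shows that the restriction [phi] of [g] to the half-space has zero Laplace transform at every
    [xi]. Thresholds in the coordinates, one after the other, then annihilate the integrals of [phi]
    over all finite intersections of coordinate half-spaces, and these generate the Borel sets. *)
Lemma laplace_vanish n (g : T -> R) (X : T -> BV R n) (B0 C r1 : R) (om : 'I_n -> R) (c : R) (A : set (BV R n)) :
  intble g -> (forall i, measurable_fun setT (fun x => (X x : 'rV[R]_n) 0 i)) ->
  (forall x i, `|(X x : 'rV[R]_n) 0 i| <= B0) -> 0 <= r1 ->
  (forall xi, `|J (fun x => g x * expR (dotp xi (X x)))| <= C * expR (r1 * enorm xi)) ->
  enorm om <= 1 -> r1 < c -> measurable A ->
  J (fun x => g x * \1_[set x | c <= dotp om (X x)] x * \1_A (X x)) = 0.
Proof.
move=> ig mXi bX r10 H om1 r1c mA.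
have mX : measurable_fun setT X by exact: measurable_coord.
have mdot xi : measurable_fun setT (fun x => dotp xi (X x)).
  by apply: measurable_sum => i; exact: measurable_funM.
have bdot xi x : dotp xi (X x) <= \sum_i `|xi i| * B0.
  apply: ler_sum => i _; apply: le_trans (ler_norm _) _; rewrite normrM.
  by rewrite ler_wpM2l.
have mge xi (c0 : R) : measurable [set x | c0 <= dotp xi (X x)].
  rewrite (_ : [set x | _] = setT `&` (fun x => dotp xi (X x)) @^-1` `[c0, +oo[).
    exact: (mdot xi measurableT _ (measurable_itv _)).
  by apply/seteqP; split => x; rewrite /= in_itv /= andbT // => -[].
have iexp h xi : intble h -> intble (fun x => h x * expR (dotp xi (X x))).
  move=> ih; apply: (@intble_mul _ _ (expR (\sum_i `|xi i| * B0))) => //.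
    by apply: measurableT_comp => //; exact: mdot.
  by move=> x; rewrite ger0_norm ?expR_ge0 // ler_expR.
have b1 (D : set T) x : `|\1_D x : R| <= 1.
  by rewrite indicE; case: (_ \in _); rewrite ?normr1 ?normr0.
have iind h (D : set T) : measurable D -> intble h -> intble (fun x => h x * \1_D x).
  by move=> mD ih; apply: (@intble_mul _ _ 1) => //; exact: measurable_indic.
pose phi x := g x * \1_[set x | c <= dotp om (X x)] x.
have iphi : intble phi by exact: iind.
have dD xi (k : R) eta v : expR (dotp xi v) * expR (k * dotp eta v) = expR (dotp (fun i => xi i + k * eta i) v) :> R.
  rewrite -expRD; congr expR; rewrite /dotp mulr_sumr -big_split; apply: eq_bigr => i _ /=; ring.
have base xi : J (fun x => phi x * expR (dotp xi (X x))) = 0.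
  rewrite (eq_J (g := fun x => (g x * expR (dotp xi (X x))) * \1_[set x | c <= dotp om (X x)] x)); last first.
    by move=> x; rewrite /phi mulrAC.
  apply: (@threshold_vanish _ _ (\sum_i `|om i| * B0) c r1 (`|C| * expR (r1 * enorm xi))) => //.
  - exact: iexp.
  move=> k k0; rewrite (eq_J (g := fun x => g x * expR (dotp (fun i => xi i + k%:R * om i) (X x)))); last first.
    by move=> x; rewrite -mulrA dD.
  apply: le_trans (H _) _; rewrite -mulrA -expRD.
  apply: le_trans (ler_wpM2r (expR_ge0 _) (ler_norm C)) _; rewrite ler_wpM2l //.
  rewrite ler_expR -mulrDr ler_wpM2l //; apply: le_trans (enormD _ _) _.
  by rewrite lerD2l enormZ // -[leRHS]mulr1 ler_wpM2l.
pose cset (L : seq ('I_n * R)) := [set v : BV R n | forall ic, ic \in L -> ic.2 <= (v : 'rV[R]_n) 0 ic.1].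
have mcset L : measurable (cset L).
  elim: L => [|[i c0] L IH]; first by rewrite (_ : cset _ = setT) //; apply/seteqP; split.
  rewrite (_ : cset _ = [set v : BV R n | c0 <= (v : 'rV[R]_n) 0 i] `&` cset L); last first.
    apply/seteqP; split => v.
      by move=> h; split=> [|ic hic]; [apply: (h (i, c0)); rewrite mem_head|apply: h; rewrite inE hic orbT].
    by move=> [h1 h2] ic; rewrite inE => /orP[/eqP ->|/h2].
  apply: measurableI => //; have mc : measurable_fun setT (fun v : BV R n => (v : 'rV[R]_n) 0 i).
    by apply: measurable_cont => v; exact: coord_cont.
  rewrite (_ : [set v | _] = setT `&` (fun v : BV R n => (v : 'rV[R]_n) 0 i) @^-1` `[c0, +oo[).
    exact: (mc measurableT _ (measurable_itv _)).
  by apply/seteqP; split => x; rewrite /= in_itv /= andbT // => -[].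
have lists L xi : J (fun x => phi x * \1_(cset L) (X x) * expR (dotp xi (X x))) = 0.
  elim: L xi => [|[i c0] L IH] xi.
    rewrite -[RHS](base xi); apply: eq_J => x; congr (_ * _).
    by rewrite indicE mem_set ?mulr1.
  pose ei j : R := (j == i)%:R.
  have dei v : dotp ei v = v 0 i.
    by rewrite /dotp (bigD1 i) //= /ei eqxx mul1r big1 ?addr0 // => j /negbTE ->; rewrite mul0r.
  rewrite (eq_J (g := fun x => (phi x * \1_(cset L) (X x) * expR (dotp xi (X x))) * \1_[set x | c0 <= dotp ei (X x)] x)).
    (* By [IH] the integrals to be bounded are zero, so the constant is 0 and any rate below [c0]
       serves. *)
    apply: (@threshold_vanish _ _ (\sum_i `|ei i| * B0) c0 (c0 - 1) 0) => //.
    - apply: iexp; apply: (@intble_mul _ _ 1) => //.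
      by apply: (measurableT_comp (f := (\1_(cset L) : BV R n -> R))) mX => //; exact: measurable_indic.
    - by move=> x; exact: (b1 (X @^-1` cset L) x).
    - by rewrite ltrBlDr ltrDl.
    move=> k k0; rewrite (eq_J (g := fun x => phi x * \1_(cset L) (X x) * expR (dotp (fun i => xi i + k%:R * ei i) (X x)))).
      by rewrite IH normr0 mul0r.
    by move=> x; rewrite -mulrA dD.
  move=> x; rewrite [RHS]mulrAC -(mulrA (phi x) (\1_(cset L) (X x))); congr (_ * _ * _); rewrite !indicE -natrM mulnb; congr (_%:R).
  congr nat_of_bool; apply/idP/andP => [|[]]; rewrite !inE /= dei => h.
    by split; [move=> ic hic; apply: h; rewrite inE hic orbT | apply: (h (i, c0)); rewrite mem_head].
  by move=> h2 ic; rewrite inE => /orP[/eqP ->|/h].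
have J0 : J phi = 0.
  rewrite -[RHS](lists [::] (fun=> 0)); apply: eq_J => x.
  by rewrite indicE mem_set // /dotp big1 ?expR0 ?mulr1 // => i _; rewrite mul0r.
have LS := J_indic_lambda iphi mX J0.
pose G := [set A | exists L, A = cset L].
have GI : setI_closed G.
  move=> _ _ [L1 ->] [L2 ->]; exists (L1 ++ L2); apply/seteqP; split => v.
    by move=> [h1 h2] ic; rewrite mem_cat => /orP[/h1|/h2].
  by move=> h; split=> ic hic; apply: h; rewrite mem_cat hic ?orbT.
have GH : G `<=` [set A : set (BV R n) | measurable A /\ J (fun x => phi x * \1_A (X x)) = 0].
  move=> _ [L ->]; split; first exact: mcset.
  rewrite -[RHS](lists L (fun=> 0)); apply: eq_J => x.
  by rewrite /dotp [X in expR X]big1 ?expR0 ?mulr1 // => i _; rewrite mul0r.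
have sG := lambda_system_subset GI LS GH (fun _ _ => @subsetT _ _).
(* The sets of [G] make every coordinate measurable, so by [measurable_coord] the sigma-algebra they
   generate contains all Borel sets. *)
have mid : measurable_fun setT (fun v : g_sigma_algebraType G => (v : 'rV[R]_n) : BV R n).
  apply: measurable_coord => i; apply: (measurability _ (RGenCInfty.measurableE R)) => _ [_ [c0 ->] <-].
  rewrite setTI; apply: sub_sigma_algebra; exists [:: (i, c0)]; apply/seteqP; split => v.
    by rewrite /= in_itv /= andbT => h ic; rewrite inE => /eqP ->.
  by rewrite /= in_itv /= andbT => /(_ (i, c0)); apply; rewrite inE.
have := mid measurableT A mA; rewrite setTI => hA.
by have [] := sG _ hA.
Qed.
End LaplaceVanishing.

(** * Vanishing on a ball around the pole *)

Section KelvinLocalization.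
Variables (R : realType) (n : nat) (mu : {measure set (BV R n) -> \bar R}).
Hypothesis n2 : (2 <= n)%N.
Hypothesis mu_fin : forall B : R, (mu (@cball R n B) < +oo)%E.
Notation V := 'rV[R]_n.
Implicit Types (x y z a b : V) (f u v w P : V -> R).

Let n_gt0 : (0 < n)%N := ltnW n2.

Definition null (A : set V) := mu.-negligible (A : set (BV R n)).
Definition loc0 f x := exists2 r : R, 0 < r & null [set z | `|z - x| < r /\ f z != 0].

Lemma nullS (A B : set V) : A `<=` B -> null B -> null A.
Proof. by move=> AB; exact: negligibleS. Qed.

(** Countability of the rational boxes: each point of [U] lies in one of them on which [f] is zero
    outside a null set, and there are only countably many. *)
Lemma null_loc f (U : set V) : (forall x, U x -> loc0 f x) -> null [set z | U z /\ f z != 0].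
Proof.
move=> H.
pose A (m : nat) := [set z : V | exists ab : 'rV[rat]_n * 'rV[rat]_n,
  [/\ unpickle m = Some ab, rbox ab z, f z != 0 & null [set z | rbox ab z /\ f z != 0]]].
have nA m : null (A m).
  case E : (unpickle m : option ('rV[rat]_n * 'rV[rat]_n)) => [ab|]; last first.
    by apply: (nullS (B := set0)); [move=> z [ab []]; rewrite E|exact: negligible_set0].
  have [h|h] := pselect (null [set z | @rbox R n ab z /\ f z != 0]).
    by apply: (nullS _ h) => z [ab' []]; rewrite E => -[<-].
  by apply: (nullS (B := set0)); [move=> z [ab' []]; rewrite E => -[<-]|exact: negligible_set0].
apply: (nullS (B := \bigcup_m A m)); last exact: negligible_bigcup.
move=> z [Uz fz]; have [r r0 hr] := H z Uz.
have oB : open [set t : V | `|t - z| < r].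
  apply: ballP_open => t /= tz; exists (r - `|t - z|); first by rewrite subr_gt0.
  move=> s st; rewrite -[s](subrK t) -addrA; apply: (le_lt_trans (ler_normD _ _)).
  by rewrite -ltrBrDr.
have : [set t : V | `|t - z| < r] z by rewrite /= subrr normr0.
rewrite {1}(open_rboxes oB) => -[m _]; rewrite /rbox_in.
case E : (unpickle m : option ('rV[rat]_n * 'rV[rat]_n)) => [ab|//] [zab abr].
exists m => //; exists ab; split => //; apply: (nullS _ hr) => t [/abr tr ft]; exact: (conj tr ft).
Qed.

Lemma J_null f g : measurable_fun setT (f : BV R n -> R) -> measurable_fun setT (g : BV R n -> R) ->
  null [set x | f x <> g x] -> J mu f = J mu g.
Proof.
move=> mf mg h; rewrite /J /Rintegral; congr fine; apply: ae_eq_integral => //.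
- exact/measurable_EFinP.
- exact/measurable_EFinP.
apply: (negligibleS _ h) => x /= hx fg; apply: hx => _ /=; by rewrite fg.
Qed.

Lemma measurable_off_point y u : (forall x, x <> y -> {for x, continuous u}) ->
  measurable_fun setT (u : BV R n -> R).
Proof.
move=> cu; have my : measurable ([set x | x <> y] : set (BV R n)) by apply: measurable_open; exact: open_neq.
apply: (measurability _ (RGenOpens.measurableE R)) => _ [U [a [b ->]] <-]; rewrite setTI.
set W := u @^-1` _.
have -> : W = (W `&` [set x | x <> y]) `|` (W `&` ~` [set x | x <> y]).
  by rewrite -setIUr setUv setIT.
apply: measurableU.
  apply: measurable_open; apply: ballP_open => x [Wx xy].
  have [r1 r10 h1] := open_ballP (@open_neq R n y) xy.
  have oI : open `]a, b[%classic by exact: interval_open.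
  have /nbhs_normP[r2 r20 h2] := cu x xy _ (open_nbhs_nbhs (conj oI Wx)).
  exists (Num.min r1 r2); first by rewrite lt_min r10.
  move=> z; rewrite lt_min => /andP[z1 z2]; split; last exact: h1.
  by apply: h2; rewrite /= distrC.
have [Wy|nWy] := pselect (W y).
  rewrite (_ : W `&` _ = ~` [set x | x <> y]); first exact: measurableC.
  apply/seteqP; split => x /=; first by case.
  by move=> h; split => //; have -> : x = y by apply: contrapT.
rewrite (_ : W `&` _ = set0); first exact: measurable0.
apply/seteqP; split => // x [Wx] /= h; apply: nWy; rewrite (_ : y = x) //.
by apply: esym; apply: contrapT.
Qed.

(** A quarter turn in the plane of two coordinates, one of them with [a 0 i != 0], is orthogonal to
    [a]; [q] rescales it to the length of [a]. The second coordinate exists because [n] is at least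
    2. *)
Lemma orthogonal_partner a : exists b, \sum_i b 0 i ^+ 2 = \sum_i a 0 i ^+ 2 /\ \sum_i a 0 i * b 0 i = 0.
Proof.
have [[i ai]|h] := pselect (exists i, a 0 i != 0); last first.
  exists 0; split; first by apply: eq_bigr => i _; rewrite mxE; have [->|ai] := eqVneq (a 0 i) 0; [|case: h; exists i].
  by apply: big1 => i _; rewrite mxE mulr0.
have [j ji] : exists j : 'I_n, j != i.
  have [i0|i0] := eqVneq (val i) 0%N; [exists (Ordinal n2)|exists (Ordinal n_gt0)].
    by apply/eqP => /(congr1 val) /=; rewrite i0.
  by apply/eqP => h; move: i0; rewrite -h eqxx.
pose s := a 0 i ^+ 2 + a 0 j ^+ 2; pose A := \sum_i a 0 i ^+ 2.
have s0 : 0 < s by rewrite ltr_pwDl ?sqr_ge0 // lt0r sqrf_eq0 ai sqr_ge0.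
have A0 : 0 <= A by apply: sumr_ge0 => k _; exact: sqr_ge0.
pose q := Num.sqrt (A / s).
pose b := \row_k (if k == i then q * a 0 j else if k == j then - (q * a 0 i) else 0) : V.
have bi : b 0 i = q * a 0 j by rewrite mxE eqxx.
have bj : b 0 j = - (q * a 0 i) by rewrite mxE (negbTE ji) eqxx.
have bk k : k != i -> k != j -> b 0 k = 0 by move=> /negbTE h1 /negbTE h2; rewrite mxE h1 h2.
exists b; split.
  rewrite (bigD1 i) //= (bigD1 j) //= big1 ?addr0; last by move=> k /andP[h1 h2]; rewrite bk ?expr0n.
  rewrite bi bj; have q2 : q ^+ 2 = A / s by rewrite sqr_sqrtr // divr_ge0 // ltW.
  have -> : (q * a 0 j) ^+ 2 + (- (q * a 0 i)) ^+ 2 = q ^+ 2 * s by rewrite /s; ring.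
  by rewrite q2 divfK // gt_eqF.
rewrite (bigD1 i) //= (bigD1 j) //= big1 ?addr0; last by move=> k /andP[h1 h2]; rewrite bk ?mulr0.
by rewrite bi bj; ring.
Qed.

Lemma lin_le_enorm a y x : lin a y x <= enorm (fun i => a 0 i) * Num.sqrt (sqd y x).
Proof. exact: (cauchy_schwarz (fun i => a 0 i) (fun i => x 0 i - y 0 i)). Qed.

Lemma le_sqrt (e s : R) : 0 <= e -> e ^+ 2 <= s -> e <= Num.sqrt s.
Proof. by move=> e0 h; rewrite -(ger0_norm e0) -sqrtr_sqr ler_wsqrtr. Qed.

Lemma kelvin_re_le y a x (e : R) : 0 < e -> e ^+ 2 <= sqd y x ->
  kelvin_re y a x <= enorm (fun i => a 0 i) / e - (n%:R / 2 - 1) * ln (e ^+ 2).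
Proof.
move=> e0 h; have e20 : 0 < e ^+ 2 by rewrite exprn_gt0.
have s0 : 0 < sqd y x by exact: lt_le_trans h.
have r0 : 0 < Num.sqrt (sqd y x) by rewrite sqrtr_gt0.
apply: lerB.
  have := lin_le_enorm a y x; have := enorm_ge0 (fun i => a 0 i); move: (lin a y x) (enorm _) => L N N0 LN.
  apply: (@le_trans _ _ (N * Num.sqrt (sqd y x) * (sqd y x)^-1)); first by rewrite ler_wpM2r // invr_ge0 ltW.
  rewrite -mulrA ler_wpM2l // -{2}(sqr_sqrtr (ltW s0)) expr2 invfM mulrA divff ?mul1r ?gt_eqF //.
  by rewrite lef_pV2 ?posrE // le_sqrt // ltW.
rewrite ler_wpM2l ?ler_ln ?posrE //.
by rewrite subr_ge0 ler_pdivlMr // mul1r ler_nat.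
Qed.

(** Inversion in the unit sphere about [y], in coordinates centred at [y]. The value 0 inside the
    ball of radius [d] keeps it bounded; the functions integrated against it vanish there. *)
Definition kelvin_pt y (d : R) (x : BV R n) : BV R n :=
  if d ^+ 2 <= sqd y x then (sqd y x)^-1 *: ((x : V) - y) else 0.

Lemma sqd_cont y x : {for x, continuous (sqd y)}.
Proof. exact: (smooth_cont (smooth_sqd y (@openT V))). Qed.

Lemma measurable_sqd y : measurable_fun setT (sqd y : BV R n -> R).
Proof. by apply: measurable_cont => x; exact: sqd_cont. Qed.

Lemma measurable_far y (d : R) : measurable ([set x | d ^+ 2 <= sqd y x] : set (BV R n)).
Proof.
rewrite (_ : [set x | _] = setT `&` (sqd y : BV R n -> R) @^-1` `[d ^+ 2, +oo[).
  exact: (measurable_sqd y measurableT (measurable_itv _)).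
by apply/seteqP; split => x; rewrite /= in_itv /= andbT // => -[].
Qed.

Lemma closed_far y (d : R) : closed [set x | d ^+ 2 <= sqd y x].
Proof.
rewrite (_ : mkset _ = ~` [set x | - d ^+ 2 < - sqd y x]); last first.
  by apply/seteqP; split => x; rewrite /= ltrN2 leNgt => /negP.
apply: open_closedC; apply: ballP_open => x /= h.
by have [r r0 hr] := near_gt (f := fun x => - sqd y x) (continuousN (@sqd_cont y x)) h; exists r.
Qed.

Lemma expR_lnV (s : R) : 0 < s -> expR (- ln s) = s^-1.
Proof. by move=> s0; rewrite expRN lnK. Qed.

Lemma kelvin_ptE y (d : R) x i : 0 < d ->
  (kelvin_pt y d x : V) 0 i = \1_[set x | d ^+ 2 <= sqd y x] x * (expR (- ln (sqd y x)) * (x 0 i - y 0 i)).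
Proof.
move=> d0; rewrite /kelvin_pt indicE; case: ifP => h.
  by rewrite mem_set // mul1r expR_lnV ?mxE ?mxE //; apply: lt_le_trans h; rewrite exprn_gt0.
by rewrite memNset ?mul0r ?mxE //= h.
Qed.

Lemma measurable_kelvin_pt y (d : R) i : 0 < d -> measurable_fun setT (fun x : BV R n => (kelvin_pt y d x : V) 0 i).
Proof.
move=> d0; rewrite (_ : (fun x => _) = fun x : BV R n => \1_[set x | d ^+ 2 <= sqd y x] x * (expR (- ln (sqd y x)) * ((x : V) 0 i - y 0 i))); last first.
  by apply/funext => x; exact: kelvin_ptE.
apply: measurable_funM; first by apply: measurable_indic; exact: measurable_far.
apply: measurable_funM.
  apply: measurableT_comp => //; apply: measurableT_comp => //.
  by apply: measurableT_comp; [exact: measurable_ln|exact: measurable_sqd].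
by apply: measurable_funB => //; apply: measurable_cont => x; exact: coord_cont.
Qed.

Lemma kelvin_pt_bound y (d : R) x i : 0 < d -> `|(kelvin_pt y d x : V) 0 i| <= d^-1.
Proof.
move=> d0; rewrite /kelvin_pt; case: ifP => [h|_]; last by rewrite mxE normr0 invr_ge0 ltW.
have s0 : 0 < sqd y x by apply: lt_le_trans h; rewrite exprn_gt0.
have r0 : 0 < Num.sqrt (sqd y x) by rewrite sqrtr_gt0.
have dr : d <= Num.sqrt (sqd y x) by rewrite le_sqrt // ltW.
have h2 : `|x 0 i - y 0 i| <= Num.sqrt (sqd y x).
  rewrite -sqrtr_sqr ler_sqrt ?(ltW s0) // /sqd (bigD1 i) //= lerDl.
  by apply: sumr_ge0 => j _; exact: sqr_ge0.
rewrite !mxE normrM ger0_norm ?invr_ge0 ?(ltW s0) //.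
apply: (@le_trans _ _ ((sqd y x)^-1 * Num.sqrt (sqd y x))); first by rewrite ler_wpM2l // invr_ge0 ltW.
by rewrite -{1}(sqr_sqrtr (ltW s0)) expr2 invfM -mulrA mulVf ?gt_eqF // mulr1 lef_pV2 ?posrE.
Qed.

(** Left inverse of [kelvin_pt] away from the pole. For positive [t], [expR (- ln t)] is [t^-1] in a
    form whose measurability is immediate. *)
Definition inversion y (v : BV R n) : BV R n := y + expR (- ln (sqd 0 v)) *: (v : V).

Lemma measurable_inversion y : measurable_fun setT (inversion y).
Proof.
apply: measurable_coord => i.
rewrite (_ : (fun t => _) = fun v : BV R n => y 0 i + expR (- ln (sqd 0 v)) * (v : V) 0 i); last first.
  by apply/funext => v; rewrite !mxE.
apply: measurable_funD => //; apply: measurable_funM.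
  apply: measurableT_comp => //; apply: measurableT_comp => //.
  by apply: measurableT_comp; [exact: measurable_ln|exact: measurable_sqd].
by apply: measurable_cont => x; exact: coord_cont.
Qed.

Lemma sqd_kelvin_pt y (d : R) x : 0 < d -> d ^+ 2 <= sqd y x -> sqd 0 (kelvin_pt y d x) = (sqd y x)^-1.
Proof.
move=> d0 h; have s0 : 0 < sqd y x by apply: lt_le_trans h; rewrite exprn_gt0.
rewrite /kelvin_pt h [LHS](eq_bigr (fun i => (sqd y x)^-1 ^+ 2 * (x 0 i - y 0 i) ^+ 2)).
  by rewrite -mulr_sumr -/(sqd y x) expr2 -mulrA mulVf ?mulr1 // gt_eqF.
by move=> i _; rewrite !mxE subr0 exprMn.
Qed.

Lemma inversion_kelvin_pt y (d : R) x : 0 < d -> d ^+ 2 <= sqd y x -> inversion y (kelvin_pt y d x) = x.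
Proof.
move=> d0 h; have s0 : 0 < sqd y x by apply: lt_le_trans h; rewrite exprn_gt0.
rewrite /inversion sqd_kelvin_pt // expR_lnV ?invr_gt0 // invrK /kelvin_pt h scalerA divff ?gt_eqF // scale1r.
by rewrite addrC subrK.
Qed.

Lemma pole_far_bound (O D : set V) y P u w (B : R) : (forall x, O x -> `|x| <= B) -> closed D -> ~ D y ->
  pole_sol O y P u w -> exists2 K : R, 0 <= K & forall x, D x -> `|u x| <= K.
Proof.
move=> bO cD nDy [_ u0 cu _].
have cK : compact ([set x : V | `|x - 0| <= B] `&` D).
  apply: (@compact_box R n _ B); first by apply: closedI => //; exact: closed_cube.
  by move=> x [/=]; rewrite subr0.
have off x : D x -> x <> y by move=> Dx xy; apply: nDy; rewrite -xy.
have [K K0 hK] := compact_bound cK (fun x h => cu x (off x (proj2 h))).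
exists K => // x Dx; have [Ox|nOx] := pselect (O x); first by apply: hK; split; rewrite //= subr0 bO.
by rewrite u0 ?normr0 // => -[].
Qed.

Lemma J_far f (D : set V) (phi : V -> R) : measurable (D : set (BV R n)) ->
  measurable_fun setT (f : BV R n -> R) -> measurable_fun setT (phi : BV R n -> R) ->
  null [set x | ~ D x /\ f x != 0] -> J mu (fun x => f x * \1_D x * phi x) = J mu (fun x => f x * phi x).
Proof.
move=> mD mf mphi h; apply: J_null.
- by do 2 apply: measurable_funM => //; exact: measurable_indic.
- exact: measurable_funM.
apply: (nullS _ h) => x /= hx; split.
  by move=> Dx; apply: hx; rewrite indicE mem_set // mulr1.
by apply/eqP => fx; apply: hx; rewrite fx !mul0r.
Qed.

Lemma intble_far f (D : set V) (phi : V -> R) (M B K : R) : measurable (D : set (BV R n)) ->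
  measurable_fun setT (f : BV R n -> R) -> (forall x, `|f x| <= M) -> (forall x, B < `|x| -> f x = 0) ->
  measurable_fun setT (phi : BV R n -> R) -> (forall x, D x -> `|phi x| <= K) ->
  intble mu (fun x => f x * \1_D x * phi x).
Proof.
move=> mD mf fM fB mphi hK.
have if1 : intble mu f by exact: (bounded_support_integrable mu_fin mf fM fB).
rewrite (_ : (fun x => _) = fun x => f x * (\1_D x * phi x)); last by apply/funext => x; rewrite mulrA.
apply: (@intble_mul _ _ _ mu f (fun x => \1_D x * phi x) `|K|) => //.
  by apply: measurable_funM => //; exact: measurable_indic.
move=> x; rewrite indicE; have [Dx|nDx] := pselect (D x).
  by rewrite mem_set // mul1r; apply: le_trans (hK x Dx) (ler_norm _).
by rewrite memNset // mul0r normr0.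
Qed.

Section Step.
Variables (O : set V) (y : V) (f : V -> R) (M B delta d : R).
Hypotheses (oO : open O) (cO : charted O) (bO : forall x, O x -> `|x| <= B) (Oy : O y).
Hypotheses (mf : measurable_fun setT (f : BV R n -> R)) (fM : forall x, `|f x| <= M).
Hypothesis f0 : forall x, ~ O x -> f x = 0.
Hypotheses (delta0 : 0 < delta) (hdelta : forall x, `|x - y| < delta -> O x).
Hypotheses (d0 : 0 < d) (dd : d <= delta).
Hypothesis near0 : null [set x | sqd y x < d ^+ 2 /\ f x != 0].
Hypothesis orth : forall P u w P' u' w',
  harmonic_on [set x | x <> y] P -> pole_sol O y P u w ->
  harmonic_on [set x | x <> y] P' -> pole_sol O y P' u' w' -> J mu (fun x => f x * u x * u' x) = 0.

Let D := [set x : V | d ^+ 2 <= sqd y x].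
Let f2 x := f x * \1_D x.
Let mD : measurable (D : set (BV R n)) := measurable_far y d.

Let mf2 : measurable_fun setT (f2 : BV R n -> R).
Proof. by apply: measurable_funM => //; exact: measurable_indic. Qed.

Let f2M x : `|f2 x| <= M.
Proof.
rewrite /f2 normrM -[leRHS]mulr1; apply: ler_pM => //.
by rewrite indicE; case: (_ \in _); rewrite ?normr1 ?normr0.
Qed.

Let f2E x : D x -> f2 x = f x.
Proof. by move=> Dx; rewrite /f2 indicE mem_set // mulr1. Qed.

Let f2N x : ~ D x -> f2 x = 0.
Proof. by move=> Dx; rewrite /f2 indicE memNset // mulr0. Qed.

Let if2 : intble mu (f2 : BV R n -> R).
Proof.
apply: (bounded_support_integrable mu_fin mf2 f2M (B := B)) => x hx.
by rewrite /f2 f0 ?mul0r // => /bO; rewrite leNgt hx.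
Qed.

Let Dy x : D x -> x <> y.
Proof.
move=> h xy; move: h; rewrite /D /= xy leNgt (_ : sqd y y = 0) ?exprn_gt0 //.
by rewrite /sqd big1 // => i _; rewrite subrr expr0n.
Qed.

(** [e1] and [e2] are the logarithms of the factor |x - y|^(2 - n) of the Kelvin transform at the
    distances [delta] and [d]. *)
Let e1 := - ((n%:R / 2 - 1) * ln (delta ^+ 2)).
Let e2 := - ((n%:R / 2 - 1) * ln (d ^+ 2)).

Let nDy : ~ D y. Proof. by move=> /Dy. Qed.

Let cD : closed D. Proof. exact: closed_far. Qed.

Let pole_bound a (W := expR (enorm (fun i => a 0 i) / delta + e1)) P u w :
  (forall x, `|P x| <= expR (kelvin_re y a x)) ->
  harmonic_on [set x | x <> y] P -> pole_sol O y P u w -> forall x, O x -> `|w x| <= W.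
Proof.
move=> hP hP2 sol; apply: (pole_sol_bound n_gt0 oO bO Oy hP2 sol) => p [_ nOp].
apply: le_trans (hP p) _; rewrite ler_expR; apply: kelvin_re_le => //.
apply: le_trans (sqd_ge_norm y p); rewrite ler_sqr ?nnegrE ?(ltW delta0) //.
by rewrite leNgt; apply/negP => /hdelta.
Qed.

Lemma f2_orth P u w P' u' w' :
  harmonic_on [set x | x <> y] P -> pole_sol O y P u w ->
  harmonic_on [set x | x <> y] P' -> pole_sol O y P' u' w' -> J mu (fun x => f2 x * u x * u' x) = 0.
Proof.
move=> hP sol hP' sol'; rewrite -(orth hP sol hP' sol').
have [_ _ cu _] := sol; have [_ _ cu' _] := sol'.
have mu1 := measurable_off_point cu; have mu2 := measurable_off_point cu'.
rewrite (eq_J mu (g := fun x => f2 x * (u x * u' x))); last by move=> x; rewrite mulrA.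
rewrite (eq_J mu (h := fun x => f x * u x * u' x) (g := fun x => f x * (u x * u' x))); last by move=> x; rewrite mulrA.
apply: J_far => //; first exact: measurable_funM.
by apply: (nullS _ near0) => x [/negP nDx fx]; split=> //; rewrite ltNge.
Qed.

Let kre_bound a x : D x -> expR (kelvin_re y a x) <= expR (enorm (fun i => a 0 i) / d + e2).
Proof. by move=> Dx; rewrite ler_expR; exact: kelvin_re_le. Qed.

Let c1 := J mu (fun x => `|f2 x|).

Let if2_mul (phi : V -> R) (K : R) : measurable_fun setT (phi : BV R n -> R) ->
  (forall x, D x -> `|phi x| <= K) -> intble mu (fun x => f2 x * phi x).
Proof.
move=> mphi hK; apply: (intble_far (M := M) (B := B) (K := K)) => // x hx.
by rewrite f0 // => /bO; rewrite leNgt hx.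
Qed.

Let square_bound (p1 p2 v1 v2 e W : R) : `|p1| <= e -> `|p2| <= e -> `|v1| <= W -> `|v2| <= W ->
  `|p1 ^+ 2 + p2 ^+ 2 - ((p1 - v1) ^+ 2 + (p2 - v2) ^+ 2)| <= 4 * (e * W) + 2 * W ^+ 2.
Proof.
move=> h1 h2 k1 k2.
have m1 : `|p1 * v1| <= e * W by rewrite normrM ler_pM.
have m2 : `|p2 * v2| <= e * W by rewrite normrM ler_pM.
have m3 : `|v1 * v1| <= W * W by rewrite normrM ler_pM.
have m4 : `|v2 * v2| <= W * W by rewrite normrM ler_pM.
have -> : p1 ^+ 2 + p2 ^+ 2 - ((p1 - v1) ^+ 2 + (p2 - v2) ^+ 2) =
  2 * (p1 * v1) + 2 * (p2 * v2) - v1 * v1 - v2 * v2 by ring.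
rewrite [W ^+ 2]expr2; move: m1 m2 m3 m4; rewrite !ler_norml.
move: (p1 * v1) (p2 * v2) (v1 * v1) (v2 * v2) (e * W) (W * W) => A1 A2 A3 A4 A5 A6.
move=> /andP[? ?] /andP[? ?] /andP[? ?] /andP[? ?]; apply/andP; split; lra.
Qed.

(* The squares of the two pole solutions sum to [exp (2 kelvin_re)] up to terms of the order of
   [exp kelvin_re] times the boundary values. *)
Lemma kelvin_bound a :
  `|J mu (fun x => f2 x * expR (kelvin_re y a x) ^+ 2)| <=
  (4 * expR (e1 + e2) + 2 * expR (2 * e1)) * c1 * expR ((d^-1 + delta^-1) * enorm (fun i => a 0 i)).
Proof.
have [b [bA ab]] := orthogonal_partner a.
pose E x := expR (kelvin_re y a x); pose N := enorm (fun i => a 0 i).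
pose P1 x := E x * cos (kelvin_im y b x); pose P2 x := E x * sin (kelvin_im y b x).
have [h1 h2] : harmonic_on [set x | x <> y] P1 /\ harmonic_on [set x | x <> y] P2.
  exact: (@kelvin_harmonic R n y a b _ erefl bA ab).
have P1E x : `|P1 x| <= E x.
  by rewrite /P1 normrM ger0_norm ?expR_ge0 // -[leRHS]mulr1 ler_wpM2l ?expR_ge0 // ler_norml cos_geN1 cos_le1.
have P2E x : `|P2 x| <= E x.
  by rewrite /P2 normrM ger0_norm ?expR_ge0 // -[leRHS]mulr1 ler_wpM2l ?expR_ge0 // ler_norml sin_geN1 sin_le1.
have PE x : E x ^+ 2 = P1 x ^+ 2 + P2 x ^+ 2.
  by rewrite /P1 /P2 !exprMn -mulrDr cos2Dsin2 mulr1.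
have [u1 [w1 s1]] := pole_sol_exists n_gt0 oO bO cO Oy h1.
have [u2 [w2 s2]] := pole_sol_exists n_gt0 oO bO cO Oy h2.
have W1 := pole_bound P1E h1 s1; have W2 := pole_bound P2E h2 s2.
have [K1 K10 hK1] := pole_far_bound bO cD nDy s1; have [K2 K20 hK2] := pole_far_bound bO cD nDy s2.
have [_ _ cu1 uE1] := s1; have [_ _ cu2 uE2] := s2.
have mu1 := measurable_off_point cu1; have mu2 := measurable_off_point cu2.
have mP1 : measurable_fun setT (P1 : BV R n -> R).
  by apply: (@measurable_off_point y) => x xy; exact: (smooth_cont (proj1 h1) (xy : [set x | x <> y] x)).
have mP2 : measurable_fun setT (P2 : BV R n -> R).
  by apply: (@measurable_off_point y) => x xy; exact: (smooth_cont (proj1 h2) (xy : [set x | x <> y] x)).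
have iu1 : intble mu (fun x => f2 x * u1 x * u1 x).
  rewrite (_ : (fun x => _) = fun x => f2 x * (u1 x * u1 x)); last by apply/funext => x; rewrite mulrA.
  apply: (if2_mul (phi := fun x => u1 x * u1 x) (K := K1 * K1)); first exact: measurable_funM.
  by move=> x Dx; rewrite normrM ler_pM // hK1.
have iu2 : intble mu (fun x => f2 x * u2 x * u2 x).
  rewrite (_ : (fun x => _) = fun x => f2 x * (u2 x * u2 x)); last by apply/funext => x; rewrite mulrA.
  apply: (if2_mul (phi := fun x => u2 x * u2 x) (K := K2 * K2)); first exact: measurable_funM.
  by move=> x Dx; rewrite normrM ler_pM // hK2.
pose Ed := expR (N / d + e2); pose W := expR (N / delta + e1).
have iE : intble mu (fun x => f2 x * (P1 x ^+ 2 + P2 x ^+ 2)).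
  apply: (if2_mul (phi := fun x => P1 x ^+ 2 + P2 x ^+ 2) (K := Ed ^+ 2)).
    by apply: measurable_funD; exact: measurable_funX.
  move=> x Dx; rewrite -PE ger0_norm ?sqr_ge0 // ler_sqr ?nnegrE ?expR_ge0 //; exact: kre_bound.
have ic : intble mu (fun x => `|f2 x|).
  apply: (bounded_support_integrable mu_fin (M := M) (B := B)).
  - exact: measurableT_comp.
  - by move=> x; rewrite normr_id.
  - by move=> x hx; rewrite /f2 f0 ?mul0r ?normr0 // => /bO; rewrite leNgt hx.
rewrite (eq_J mu (g := fun x => f2 x * (P1 x ^+ 2 + P2 x ^+ 2))); last by move=> x; rewrite -PE.
have J1 := f2_orth h1 s1 h1 s1; have J2 := f2_orth h2 s2 h2 s2.
rewrite -[J mu _]subr0 -J1 -J_sub // -[J mu _]subr0 -J2 -J_sub //; last exact: intble_sub.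
pose C := 4 * (Ed * W) + 2 * W ^+ 2.
have C0 : 0 <= C by rewrite addr_ge0 ?mulr_ge0 ?sqr_ge0 ?expR_ge0.
apply: (@le_trans _ _ (J mu (fun x => C * `|f2 x|))).
  apply: J_bound.
  - by apply: intble_sub => //; exact: intble_sub.
  - exact: intble_scale.
  move=> x; have [Dx|nDx] := pselect (D x); last by rewrite f2N // !mul0r !subr0 normr0 mulr0.
  have [Ox|nOx] := pselect (O x); last by rewrite /f2 f0 // !mul0r !subr0 normr0 mulr0.
  rewrite (_ : _ - _ = f2 x * (P1 x ^+ 2 + P2 x ^+ 2 - (u1 x ^+ 2 + u2 x ^+ 2))); last by ring.
  rewrite normrM mulrC ler_wpM2r // (uE1 x Ox (Dy Dx)) (uE2 x Ox (Dy Dx)).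
  apply: square_bound; [|by apply: le_trans (P2E x) _; exact: kre_bound|exact: W1|exact: W2].
  by apply: le_trans (P1E x) _; exact: kre_bound.
rewrite J_scale // -/c1 mulrAC ler_wpM2r //.
  by apply: le_trans (normr_ge0 (J mu f2)) _; exact: J_bound.
have N0 : 0 <= N := enorm_ge0 _.
(* The mixed terms have exponent [N / d + N / delta] and the squares of [w] have [2 * N / delta];
   the former is the larger one, since [d <= delta]. *)
have dV : delta^-1 <= d^-1 by rewrite lef_pV2 ?posrE.
set F := expR ((d^-1 + _) * _).
have -> : (4 * expR (e1 + e2) + 2 * expR (2 * e1)) * F = 4 * (expR (e1 + e2) * F) + 2 * (expR (2 * e1) * F) by ring.
apply: lerD; rewrite ler_wpM2l // /F /Ed /W -?expRM_natl -!expRD ler_expR -/N.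
  by rewrite le_eqVlt; apply/orP; left; apply/eqP; ring.
have : N * delta^-1 <= N * d^-1 by rewrite ler_wpM2l.
by move: (d^-1) (delta^-1) (e1) => p q e; lra.
Qed.

(** The power |x - y|^(4 - 2n) that remains beside the exponential when the Kelvin transforms are
    squared. *)
Let G x := expR (- (n%:R - 2) * ln (sqd y x)).
Let g x := f2 x * G x.

Let mG : measurable_fun setT (G : BV R n -> R).
Proof.
apply: measurableT_comp => //; apply: measurable_funM => //.
by apply: measurableT_comp; [exact: measurable_ln|exact: measurable_sqd].
Qed.

Let ig : intble mu g.
Proof.
apply: (if2_mul (phi := G) (K := expR (- (n%:R - 2) * ln (d ^+ 2)))) => // x Dx.
rewrite ger0_norm ?expR_ge0 // ler_expR !mulNr lerN2 ler_wpM2l ?subr_ge0 ?ler_nat //.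
by rewrite ler_ln ?posrE ?exprn_gt0 //; apply: lt_le_trans Dx; rewrite exprn_gt0.
Qed.

Let g_exp (xi : 'I_n -> R) (a := \row_i (2^-1 * xi i) : V) x :
  f2 x * expR (kelvin_re y a x) ^+ 2 = g x * expR (dotp xi (kelvin_pt y d x)).
Proof.
have [Dx|nDx] := pselect (D x); last by rewrite /g f2N // !mul0r.
rewrite /g -[RHS]mulrA; congr (_ * _); rewrite /G -expRD -expRM_natl; congr expR.
rewrite /kelvin_pt (Dx : d ^+ 2 <= sqd y x) /kelvin_re.
have -> : dotp xi ((sqd y x)^-1 *: (x - y)) = 2 * (lin a y x * (sqd y x)^-1).
  rewrite /dotp /lin mulr_suml mulr_sumr; apply: eq_bigr => i _; rewrite !mxE.
  by move: (xi i) (_^-1) (x 0 i) (y 0 i) => p q r s; field.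
by move: (lin a y x / sqd y x) (ln _) => p q; field.
Qed.

(** In [g_exp] the Laplace variable [xi] corresponds to [a = xi / 2], which halves the rate of
    [kelvin_bound]. *)
Let r1 := (d^-1 + delta^-1) / 2.

(** With [om] the unit vector from [y] towards [x0], the half-space where [dotp om] is at least
    [c > r1] contains the inverted points near [x0]. [laplace_vanish] annihilates [g] there; an
    arbitrary Borel set near [x0] is recovered as a preimage under [kelvin_pt] by means of
    [inversion]. *)
Lemma kelvin_vanish x0 : x0 <> y -> r1 < (Num.sqrt (sqd y x0))^-1 -> loc0 f x0.
Proof.
move=> x0y hr; have s0 : 0 < sqd y x0 by exact: sqd_gt0.
have [far|close] := leP (d ^+ 2) (sqd y x0); last first.
  have close' : - d ^+ 2 < - sqd y x0 by rewrite ltrN2.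
  have [r r0 hr2] := near_gt (f := fun x => - sqd y x) (continuousN (@sqd_cont y x0)) close'.
  by exists r => //; apply: (nullS _ near0) => z [/hr2]; rewrite ltrN2.
pose s := Num.sqrt (sqd y x0); have sp : 0 < s by rewrite sqrtr_gt0.
have ss : s ^+ 2 = sqd y x0 by rewrite sqr_sqrtr // ltW.
pose om i := s^-1 * (x0 0 i - y 0 i).
have om1 : enorm om = 1.
  rewrite (@enormZ _ _ s^-1 (fun i => x0 0 i - y 0 i)) ?invr_ge0 ?(ltW sp) //.
  by rewrite /enorm -/(sqd y x0) -/s mulVf // gt_eqF.
pose phi x := (sqd y x)^-1 * lin (\row_i om i) y x.
have phi0 : phi x0 = s^-1.
  rewrite /phi (_ : lin _ y x0 = s^-1 * sqd y x0); last first.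
    by rewrite /lin /sqd mulr_sumr; apply: eq_bigr => i _; rewrite mxE /om; ring.
  by rewrite mulrCA mulVf ?mulr1 // gt_eqF.
have cphi : {for x0, continuous phi}.
  apply: continuousM; last exact: (smooth_cont (smooth_lin _ _ (@openT V))).
  by apply: continuousV; [rewrite gt_eqF|exact: sqd_cont].
pose c := (r1 + s^-1) / 2; have r1c : r1 < c by rewrite /c midf_lt.
have cs : c < phi x0 by rewrite phi0 /c midf_lt.
have [r r0 hphi] := near_gt cphi cs.
have dphi x : D x -> dotp om (kelvin_pt y d x) = phi x.
  move=> Dx; rewrite /kelvin_pt (Dx : d ^+ 2 <= sqd y x) /dotp /phi /lin mulr_sumr.
  by apply: eq_bigr => i _; rewrite !mxE; ring.
pose h x := g x * \1_[set x | c <= dotp om (kelvin_pt y d x)] x.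
have mk i := @measurable_kelvin_pt y d i d0.
have r1_ge0 : 0 <= r1 by rewrite /r1 divr_ge0 // addr_ge0 // invr_ge0 ltW.
have Hlap xi : `|J mu (fun x => g x * expR (dotp xi (kelvin_pt y d x)))| <=
    (4 * expR (e1 + e2) + 2 * expR (2 * e1)) * c1 * expR (r1 * enorm xi).
  pose a := \row_i (2^-1 * xi i) : V; have := kelvin_bound a.
  rewrite (eq_J mu (g_exp xi)); move/le_trans; apply.
  rewrite (_ : enorm (fun i => a 0 i) = 2^-1 * enorm xi); first by rewrite mulrA.
  rewrite -enormZ; last by rewrite invr_ge0.
  by congr enorm; apply/funext => i; rewrite mxE.
have om1' : enorm om <= 1 by rewrite om1.
have V0 A : measurable (A : set (BV R n)) -> J mu (fun x => h x * \1_A x) = 0.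
  move=> mA; have mA' : measurable (inversion y @^-1` A : set (BV R n)).
    by rewrite -[X in measurable X]setTI; exact: measurable_inversion.
  rewrite -[RHS](laplace_vanish ig mk (fun x i => kelvin_pt_bound y x i d0) r1_ge0 Hlap om1' r1c mA').
  apply: eq_J => x; rewrite /h; have [Dx|nDx] := pselect (D x); last by rewrite /g f2N // !mul0r.
  congr (_ * _); rewrite !indicE; congr (nat_of_bool _)%:R.
  by apply/idP/idP; rewrite !inE /= inversion_kelvin_pt.
have mh : measurable [set x : BV R n | c <= dotp om (kelvin_pt y d x)].
  have mdot : measurable_fun setT (fun x : BV R n => dotp om (kelvin_pt y d x)).
    by apply: measurable_sum => i; exact: measurable_funM.
  rewrite (_ : [set x | _] = setT `&` (fun x : BV R n => dotp om (kelvin_pt y d x)) @^-1` `[c, +oo[).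
    exact: (mdot measurableT _ (measurable_itv _)).
  by apply/seteqP; split => x; rewrite /= in_itv /= andbT // => -[].
have ih : intble mu h.
  apply: (@intble_mul _ _ _ mu g (\1_[set x | c <= dotp om (kelvin_pt y d x)]) 1) => //.
  by move=> x; rewrite indicE; case: (_ \in _); rewrite ?normr1 ?normr0.
have nh := J_ae0 ih V0.
exists r => //; apply: (nullS _ (negligibleU near0 nh)) => x [xr fx].
have [Dx|nDx] := pselect (D x); last by left; split=> //; rewrite ltNge; apply/negP.
right => /= /(_ I) [] /eqP; rewrite /h indicE mem_set /=; last by rewrite dphi // ltW // hphi.
by rewrite mulr1 /g f2E // mulf_eq0 (negbTE fx) /= expR_eq0.
Qed.
End Step.

Lemma loc0_near f y (d : R) x : null [set z | sqd y z < d ^+ 2 /\ f z != 0] -> sqd y x < d ^+ 2 -> loc0 f x.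
Proof.
move=> h xd; have xd' : - d ^+ 2 < - sqd y x by rewrite ltrN2.
have [r r0 hr2] := near_gt (f := fun x => - sqd y x) (continuousN (@sqd_cont y x)) xd'.
by exists r => //; apply: (nullS _ h) => z [/hr2]; rewrite ltrN2.
Qed.

(* [kelvin_vanish] improves the radius [d] of vanishing to the harmonic mean of [d] and [delta]. *)
Lemma kelvin_ball (O : set V) y f (M B delta : R) : open O -> charted O -> (forall x, O x -> `|x| <= B) -> O y ->
  measurable_fun setT (f : BV R n -> R) -> (forall x, `|f x| <= M) -> (forall x, ~ O x -> f x = 0) ->
  0 < delta -> (forall x, `|x - y| < delta -> O x) -> loc0 f y ->
  (forall P u w P' u' w',
    harmonic_on [set x | x <> y] P -> pole_sol O y P u w ->
    harmonic_on [set x | x <> y] P' -> pole_sol O y P' u' w' -> J mu (fun x => f x * u x * u' x) = 0) ->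
  forall x, sqd y x < delta ^+ 2 -> loc0 f x.
Proof.
move=> oO cO bO Oy mf fM f0 delta0 hdelta [r r0 hr] orth.
pose S := [set d : R | [/\ 0 < d, d <= delta & null [set x | sqd y x < d ^+ 2 /\ f x != 0]]].
have Smin : S (Num.min r delta).
  split; [by rewrite lt_min r0|by rewrite ge_min lexx orbT|].
  apply: (nullS _ hr) => x [xs fx]; split=> //.
  have m0 : 0 < Num.min r delta by rewrite lt_min r0.
  have : `|x - y| < Num.min r delta.
    by rewrite -ltr_sqr ?nnegrE ?(ltW m0) //; apply: le_lt_trans (sqd_ge_norm y x) _.
  by rewrite lt_min => /andP[].
have hS : has_sup S.
  by split; [exists (Num.min r delta)|exists delta => d []].
pose s := sup S.
have s0 : 0 < s by apply: lt_le_trans (ub_le_sup (proj2 hS) Smin); rewrite lt_min r0.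
have sd : s <= delta by apply: ge_sup; [exact: (proj1 hS)|move=> d []].
(* The supremum is an admissible radius, because a locally null set is null. Were it below [delta],
   [kelvin_vanish] would produce the larger admissible radius [r1^-1]. *)
have Ss : null [set x | sqd y x < s ^+ 2 /\ f x != 0].
  apply: null_loc => x /= xs.
  have : Num.sqrt (sqd y x) < s.
    by rewrite -(ltr_sqr (sqrtr_ge0 _)) ?nnegrE ?(ltW s0) // sqr_sqrtr // sqd_ge0.
  move=> /(sup_gt (proj1 hS)) [d [d0 _ dn] xd]; apply: (loc0_near dn).
  by rewrite -(sqr_sqrtr (sqd_ge0 y x)) ltr_sqr ?nnegrE ?sqrtr_ge0 // ltW.
move=> x xd; apply: (@loc0_near f y delta) => //; move: sd; rewrite le_eqVlt => /orP[/eqP <- //|sd].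
pose r1 := (s^-1 + delta^-1) / 2; exfalso.
have sV : delta^-1 < s^-1 by rewrite ltf_pV2 ?posrE.
have dV : 0 < delta^-1 by rewrite invr_gt0.
have r10 : 0 < r1 by rewrite /r1; move: dV sV; clear; lra.
have h1 : s < r1^-1 by rewrite -[ltLHS]invrK ltf_pV2 ?posrE ?invr_gt0 // /r1; move: dV sV; clear; lra.
have h2 : r1^-1 <= delta by rewrite -[leRHS]invrK lef_pV2 ?posrE // /r1; move: dV sV; clear; lra.
suff : S r1^-1 by move=> /(ub_le_sup (proj2 hS)); rewrite leNgt h1.
split=> //; first by rewrite invr_gt0.
apply: null_loc => z /= zr; have [->|zy] := eqVneq z y; first by exists r.
move/eqP in zy.
have z0 : 0 < Num.sqrt (sqd y z) by rewrite sqrtr_gt0; exact: sqd_gt0.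
apply: (kelvin_vanish oO cO bO Oy mf fM f0 delta0 hdelta s0 (ltW sd) Ss orth zy).
rewrite -[ltLHS]invrK ltf_pV2 ?posrE ?invr_gt0 //.
by rewrite -(ltr_sqr (sqrtr_ge0 _)) ?nnegrE ?invr_ge0 ?(ltW r10) // sqr_sqrtr // sqd_ge0.
Qed.
End KelvinLocalization.

(** * Propagation along the domain *)

Section Propagation.
Variables (R : realType) (n : nat) (mu : {measure set (BV R n) -> \bar R}).
Hypothesis n2 : (2 <= n)%N.
Hypothesis mu_fin : forall B : R, (mu (@cball R n B) < +oo)%E.
Notation V := 'rV[R]_n.
Notation e_ := (basis_vec R).
Variables (O : set V) (f : V -> R) (M B : R).
Hypotheses (oO : open O) (cO : charted O) (bO : forall x, O x -> `|x| <= B).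
Hypotheses (mf : measurable_fun setT (f : BV R n -> R)) (fM : forall x, `|f x| <= M).
Hypothesis f0 : forall x, ~ O x -> f x = 0.

Let n_gt0 : (0 < n)%N := ltnW n2.

Definition orth (y : V) := forall P u w P' u' w' : V -> R,
  harmonic_on [set x | x <> y] P -> pole_sol O y P u w ->
  harmonic_on [set x | x <> y] P' -> pole_sol O y P' u' w' -> J mu (fun x => f x * u x * u' x) = 0.

(** The two properties support each other: orthogonality enlarges the region where [f] vanishes by
    [kelvin_ball], and vanishing near the pole keeps the products integrable when the pole moves. *)
Definition dead (y : V) := [/\ O y, loc0 mu f y & orth y].

Lemma le0_small (X L : R) : 0 <= L -> (forall e, 0 < e -> e <= 1 -> X <= e * L) -> X <= 0.
Proof.
move=> L0 H; apply/ler_addgt0Pr => e e0; rewrite add0r.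
have L1 : 0 < L + 1 by rewrite ltr_wpDl.
pose d := Num.min 1 (e / (L + 1)).
have d0 : 0 < d by rewrite lt_min ltr01 divr_gt0.
apply: le_trans (H d d0 _) _; first by rewrite ge_min lexx.
apply: (@le_trans _ _ (e / (L + 1) * L)); first by rewrite ler_wpM2r // ge_min lexx orbT.
by rewrite mulrAC ler_pdivrMr // ler_wpM2l ?(ltW e0) // lerDl.
Qed.

Lemma product_close (a b a' b' K1 K2 e : R) : `|a'| <= K1 -> `|b'| <= K2 -> `|a - a'| <= e -> `|b - b'| <= e ->
  e <= 1 -> `|a' * b' - a * b| <= e * (K1 + K2 + 1).
Proof.
move=> h1 h2 h3 h4 e1; have e0 : 0 <= e := le_trans (normr_ge0 _) h3.
have -> : a' * b' - a * b = - (a' * (b - b') + (a - a') * b' + (a - a') * (b - b')) by ring.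
rewrite normrN.
have m1 : `|a' * (b - b')| <= K1 * e by rewrite normrM ler_pM.
have m2 : `|(a - a') * b'| <= e * K2 by rewrite normrM ler_pM.
have m3 : `|(a - a') * (b - b')| <= e * 1 by rewrite normrM ler_pM // (le_trans h4).
apply: (le_trans (ler_normD _ _)); apply: (le_trans (lerD (ler_normD _ _) (lexx _))).
by apply: (le_trans (lerD (lerD m1 m2) m3)); rewrite le_eqVlt; apply/orP; left; apply/eqP; ring.
Qed.

(** By [kelvin_ball], [f] vanishes on the Euclidean ball of radius [delta] about [y], which contains
    the cube of radius [delta / n]. Outside this cube [pole_shift] approximates solutions with the
    new pole by solutions with the old one to any precision, so the integrals with the new pole are
    limits of zeros. *)
Lemma orth_shift y i (t delta : R) : 0 < delta -> (forall x, `|x - y| < delta -> O x) ->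
  `|t| * (128 * n%:R) <= delta / n%:R -> dead y -> dead (y + t *: e_ i).
Proof.
move=> d0 hd ht [Oy ly oy].
have nR : 1 <= n%:R :> R by rewrite ler1n.
have nR0 : 0 < n%:R :> R by rewrite ltr0n.
have rho0 : 0 < delta / n%:R by rewrite divr_gt0.
have rhod : delta / n%:R <= delta by rewrite ler_pdivrMr // ler_peMr // ltW.
have td : `|t| < delta.
  apply: lt_le_trans rhod; have [->|tn] := eqVneq t 0; first by rewrite normr0.
  apply: lt_le_trans ht; rewrite ltr_pMr ?normr_gt0 //.
  by apply: (@lt_le_trans _ _ 128); [rewrite ltr1n|rewrite ler_peMr].
pose D := [set x : V | delta ^+ 2 <= sqd y x].
have ball := kelvin_ball n2 mu_fin oO cO bO Oy mf fM f0 d0 hd ly oy.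
have near0 : null mu [set x | ~ D x /\ f x != 0].
  apply: (nullS _ (null_loc ball)) => x [/negP nDx fx]; split=> //=.
  by rewrite ltNge.
have sy' : sqd y (y + t *: e_ i) < delta ^+ 2.
  rewrite sqd_shift subrr mulr0 add0r (_ : sqd y y = 0) ?add0r; last first.
    by rewrite /sqd big1 // => k _; rewrite subrr expr0n.
  by rewrite -real_normK ?num_real // ltr_sqr ?nnegrE // ltW.
have nDy' : ~ D (y + t *: e_ i) by rewrite /D /= leNgt sy'.
have Oy' : O (y + t *: e_ i).
  apply: hd; rewrite -ltr_sqr ?nnegrE ?(ltW d0) //; exact: le_lt_trans (sqd_ge_norm _ _) sy'.
have far x : D x -> delta / n%:R <= `|x - y|.
  move=> Dx; rewrite leNgt; apply/negP => xr.
  suff : sqd y x < delta ^+ 2 by rewrite ltNge (Dx : delta ^+ 2 <= _).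
  apply: le_lt_trans (sqd_le_norm y x) _.
  apply: (@lt_le_trans _ _ (n%:R * (delta / n%:R) ^+ 2)).
    by rewrite ltr_pM2l // ltr_sqr ?nnegrE // ltW.
  rewrite (_ : n%:R * _ = delta * (delta / n%:R)); last by field; rewrite gt_eqF.
  by rewrite expr2 ler_wpM2l // ltW.
split=> //; first exact: ball.
move=> Q1 u1' w1' Q2 u2' w2' hQ1 s1 hQ2 s2.
have mD : measurable (D : set (BV R n)) := measurable_far y delta.
have cD : closed D by exact: closed_far.
have [K1 K10 hK1] := pole_far_bound bO cD nDy' s1.
have [K2 K20 hK2] := pole_far_bound bO cD nDy' s2.
have fB x : B < `|x| -> f x = 0 by move=> xB; rewrite f0 // => /bO; rewrite leNgt xB.
have mpole y0 P u w : pole_sol O y0 P u w -> measurable_fun setT (u : BV R n -> R).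
  by move=> [_ _ cu _]; exact: measurable_off_point cu.
have m1 := mpole _ _ _ _ s1; have m2 := mpole _ _ _ _ s2.
have if1 : intble mu f by exact: (bounded_support_integrable mu_fin mf fM fB).
have iabs : intble mu (fun x => `|f x|).
  apply: (bounded_support_integrable mu_fin (M := M) (B := B)).
  - exact: measurableT_comp.
  - by move=> x; rewrite normr_id.
  - by move=> x /fB ->; rewrite normr0.
apply/eqP; rewrite -normr_le0.
apply: (@le0_small _ ((K1 + K2 + 1) * J mu (fun x => `|f x|))).
  apply: mulr_ge0; first by rewrite !addr_ge0.
  by apply: le_trans (normr_ge0 (J mu f)) _; exact: J_bound.
move=> e e0 e1.
have [P1 [u1 [w1 [hP1 S1 c1]]]] := pole_shift n_gt0 oO bO cO rho0 (fun x h => hd x (lt_le_trans h rhod)) ht hQ1 s1 e0.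
have [P2 [u2 [w2 [hP2 S2 c2]]]] := pole_shift n_gt0 oO bO cO rho0 (fun x h => hd x (lt_le_trans h rhod)) ht hQ2 s2 e0.
have m1' := mpole _ _ _ _ S1; have m2' := mpole _ _ _ _ S2.
have nDy : ~ D y.
  by rewrite /D /= (_ : sqd y y = 0) ?leNgt ?exprn_gt0 // /sqd big1 // => k _; rewrite subrr expr0n.
have [L1 L10 hL1] := pole_far_bound bO cD nDy S1.
have [L2 L20 hL2] := pole_far_bound bO cD nDy S2.
have E a b : (fun x => f x * a x * b x) =1 (fun x => f x * (a x * b x)) by move=> x; rewrite mulrA.
have J0 := oy _ _ _ _ _ _ hP1 S1 hP2 S2; rewrite (eq_J mu (E u1 u2)) in J0.
rewrite (eq_J mu (E u1' u2')).
have mm := measurable_funM m1 m2; have mm' := measurable_funM m1' m2'.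
rewrite -(J_far mD mf mm' near0) in J0; rewrite -(J_far mD mf mm near0) -[J mu _]subr0 -J0.
have i1 : intble mu (fun x => f x * \1_D x * (u1' x * u2' x)).
  by apply: (intble_far mu_fin mD mf fM fB mm (K := K1 * K2)) => x Dx; rewrite normrM ler_pM // ?hK1 ?hK2.
have i2 : intble mu (fun x => f x * \1_D x * (u1 x * u2 x)).
  by apply: (intble_far mu_fin mD mf fM fB mm' (K := L1 * L2)) => x Dx; rewrite normrM ler_pM // ?hL1 ?hL2.
rewrite -J_sub // mulrA -J_scale //; apply: J_bound; [exact: intble_sub|exact: intble_scale|].
move=> x; rewrite -mulrBr normrM; have [Ox|nOx] := pselect (O x); last by rewrite f0 // mul0r !normr0 mul0r mulr0.
have [Dx|nDx] := pselect (D x); last first.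
  by rewrite indicE memNset // mulr0 normr0 mul0r !mulr_ge0 ?(ltW e0) // !addr_ge0.
rewrite indicE mem_set // mulr1 mulrC ler_wpM2r //.
have xy' : x <> y + t *: e_ i by move=> xy'; apply: nDy'; rewrite -xy'.
by apply: product_close e1; [exact: hK1|exact: hK2|apply: c1 => //; exact: far|apply: c2 => //; exact: far].
Qed.

(** The square is [2 * (128 * n) * n]: the factor [128 * n] and the division by [n] come from
    [orth_shift], the factor 2 from working with [delta / 2] in [dead_ball]. *)
Definition dead_ratio : R := ((16 * n%:R) ^+ 2)^-1.

Lemma dead_ratio_gt0 : 0 < dead_ratio.
Proof. by rewrite invr_gt0 exprn_gt0 // mulr_gt0 // ltr0n. Qed.

Lemma dead_ball y (delta : R) : 0 < delta -> (forall x, `|x - y| < delta -> O x) -> dead y ->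
  forall z, `|z - y| < delta * dead_ratio -> dead z.
Proof.
move=> d0 hd dy z zy.
have nR : 1 <= n%:R :> R by rewrite ler1n.
have nR0 : 0 < n%:R :> R by rewrite ltr0n.
have q0 := dead_ratio_gt0.
have q1 : dead_ratio <= 2^-1.
  have h2 : 2 <= 16 * n%:R :> R by apply: (@le_trans _ _ 16); [rewrite ler_nat|rewrite ler_peMr].
  have h3 : 2 <= (16 * n%:R) ^+ 2 :> R by rewrite expr2; move: h2; move: (_ * _) => a; nra.
  by rewrite lef_pV2 ?posrE //; exact: lt_le_trans h3.
(* [orth_shift] moves along one axis, so the pole goes from [y] to [z] one coordinate at a time.
   Each intermediate point is within [delta / 2] of [y] and keeps a cube of radius [delta / 2]
   inside [O]. *)
pose p (k : nat) : V := \row_j (if (j < k)%N then z 0 j else y 0 j).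
have py k : `|p k - y| < delta / 2.
  apply: (@le_lt_trans _ _ `|z - y|); last first.
    by apply: lt_le_trans zy _; rewrite ler_wpM2l // ltW.
  apply: norm_le_coord => // j; rewrite !mxE; case: ifP => _; last by rewrite subrr normr0.
  by have := coord_le_norm (z - y) j; rewrite !mxE.
have pS (i : 'I_n) : p i.+1 = p i + (z 0 i - y 0 i) *: e_ i.
  apply/rowP => j; rewrite !mxE eqxx /=; have [->|ji] := eqVneq j i.
    by rewrite ltnS leqnn ltnn mulr1 addrC subrK.
  by rewrite mulr0 addr0 ltnS leq_eqVlt val_eqE (negbTE ji).
have d20 : 0 < delta / 2 by rewrite divr_gt0.
have step k : (k <= n)%N -> dead (p k).
  elim: k => [|k IH] kn; first by rewrite (_ : p 0%N = y) //; apply/rowP => j; rewrite !mxE.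
  rewrite -[k]/(nat_of_ord (Ordinal kn)) pS; apply: (@orth_shift _ _ _ (delta / 2)) => //.
  - move=> x xp; apply: hd; rewrite -[x](subrK (p k)) -addrA; apply: le_lt_trans (ler_normD _ _) _.
    by rewrite [delta]splitr ltrD.
  - have := coord_le_norm (z - y) (Ordinal kn); rewrite !mxE => h.
    apply: (@le_trans _ _ (delta * dead_ratio * (128 * n%:R))).
      by rewrite ler_wpM2r ?mulr_ge0 // (le_trans h) // ltW.
    rewrite /dead_ratio le_eqVlt; apply/orP; left; apply/eqP; field.
    by rewrite gt_eqF.
  - exact: IH (ltnW kn).
rewrite (_ : z = p n); first exact: step.
by apply/rowP => j; rewrite !mxE ltn_ord.
Qed.

(** The radius in [dead_ball] depends on the room around [y] in [O] and not on how far [f] is known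
    to vanish. So it is bounded below near each point of [O], and the good poles form a set that is
    relatively closed as well as open. *)
Lemma dead_connected (W : set V) : open W -> connected W -> W `<=` O -> (exists2 y, W y & dead y) ->
  W `<=` dead.
Proof.
move=> oW cW WO [y0 Wy0 dy0].
have q0 := dead_ratio_gt0.
have odead : open dead.
  apply: ballP_open => y dy; have [Oy _ _] := dy; have [r r0 hr] := open_ballP oO Oy.
  exists (r * dead_ratio); first by rewrite mulr_gt0.
  by move=> z; exact: dead_ball.
suff E : W `&` dead = W by rewrite -E => x [].
apply: cW.
- by exists y0.
- by exists dead.
exists (closure dead); first exact: closed_closure.
apply/seteqP; split => x [Wx hx]; split => //; first exact: subset_closure.
have [r r0 hr] := open_ballP oO (WO x Wx); have r20 : 0 < r / 2 by rewrite divr_gt0.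
have m0 : 0 < Num.min (r / 2) (r / 2 * dead_ratio) by rewrite lt_min r20 mulr_gt0.
have [y dy] := closure_near hx m0; rewrite lt_min => /andP[y1 y2].
apply: (dead_ball r20 _ dy); last by rewrite distrC.
move=> z zy; apply: hr; rewrite -[z](subrK y) -addrA; apply: le_lt_trans (ler_normD _ _) _.
by rewrite [r]splitr ltrD.
Qed.
End Propagation.

(** * The real-valued case, and the theorem *)

Section Real.
Variables (R : realType) (n : nat) (mu : {measure set (BV R n) -> \bar R}).
Hypothesis n2 : (2 <= n)%N.
Hypothesis mu_fin : forall B : R, (mu (@cball R n B) < +oo)%E.
Hypothesis iintE : forall (h : BV R n -> R) (M B : R), measurable_fun [set: BV R n] h ->
  (forall x, `|h x| <= M) -> (forall x : 'rV[R]_n, B < `|x| -> h x = 0) -> iint h = fine (\int[mu]_x (h x)%:E)%E.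
Notation V := 'rV[R]_n.

Lemma borel_fun_measurable (g : V -> R) : borel_fun g -> measurable_fun setT (g : BV R n -> R).
Proof.
move=> bg; apply: (measurability _ (RGenOpens.measurableE R)) => _ [U [a [b ->]] <-].
by rewrite setTI; apply: bg; exact: interval_open.
Qed.

Lemma real_products_dense (Omega Gamma : set V) (g : V -> R) (M B : R) :
  open Omega -> connected Omega -> (forall x, Omega x -> `|x| <= B) -> smooth_boundary Omega ->
  closed Gamma -> Gamma `<=` bdry Omega -> Gamma <> bdry Omega ->
  borel_fun g -> (forall x, Omega x -> `|g x| <= M) ->
  (forall u v, smooth_up_to_bdry Omega u -> harmonic_on Omega u -> (forall x, Gamma x -> u x = 0) ->
     smooth_up_to_bdry Omega v -> harmonic_on Omega v -> (forall x, Gamma x -> v x = 0) ->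
     iint (fun x => if `[< Omega x >] then g x * u x * v x else 0) = 0) ->
  null mu [set x | Omega x /\ g x != 0].
Proof.
move=> oO cO bO sO clG GO nG bg gM H; have chO := smooth_boundary_charted sO.
have [p0 bp0 nGp0] : exists2 p, bdry Omega p & ~ Gamma p.
  apply: contrapT => h; apply: nG; apply/seteqP; split=> // p bp.
  by apply: contrapT => nGp; apply: h; exists p.
have [D [oO' [B' bO'] OO' Op0 [GO' chO']]] := enlarge_domain oO bO chO bp0 clG GO nGp0.
pose f x := g x * \1_Omega x.
have fE x : Omega x -> f x = g x by move=> Ox; rewrite /f indicE mem_set // mulr1.
have fN x : ~ Omega x -> f x = 0 by move=> Ox; rewrite /f indicE memNset // mulr0.
have mO : measurable (Omega : set (BV R n)) := measurable_open oO.
have mf : measurable_fun setT (f : BV R n -> R).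
  by apply: measurable_funM; [exact: borel_fun_measurable|exact: measurable_indic].
have fM x : `|f x| <= `|M|.
  have [Ox|nOx] := pselect (Omega x); last by rewrite fN // normr0.
  by rewrite fE // (le_trans (gM x Ox)) // ler_norm.
have f0 x : ~ D x -> f x = 0 by move=> nOx; apply: fN => /OO'.
have [r r0 hr] := open_ballP oO' Op0; have r20 : 0 < r / 2 by rewrite divr_gt0.
have q0 := dead_ratio_gt0 R n2.
have m0 : 0 < Num.min (r / 2) (r / 2 * dead_ratio R n) by rewrite lt_min r20 mulr_gt0.
(* The first pole: outside the closure of [Omega], and so close to [p0] that [dead_ball] about [y]
   reaches [p0]. *)
have [y yp nyO] := exterior_point bp0 (chO p0 bp0) m0.
move: yp; rewrite lt_min => /andP[y1 y2].
have Oy : D y by apply: hr; apply: lt_trans y1 _; rewrite ltr_pdivrMr // ltr_pMr // ltr1n.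
(* Near [y] the function [f] is zero by its definition. Orthogonality is the hypothesis [H], because
   the pole solutions are smooth up to the boundary of [Omega] and are zero on [Gamma], which lies
   outside [D]. *)
have dy : dead mu D f y.
  split=> //.
    have oC : open (~` closure Omega) by rewrite openC; exact: closed_closure.
    have [s s0 hs] := open_ballP oC (nyO : (~` closure Omega) y); exists s => //.
    apply: (nullS (B := set0)); last exact: negligible_set0.
    by move=> z [/hs nz]; rewrite fN ?eqxx // => /subset_closure.
  move=> P u w P' u' w' hP s1 hP' s2.
  have [su hu] := pole_sol_smooth oO' chO' hP s1 oO OO' nyO.
  have [su' hu'] := pole_sol_smooth oO' chO' hP' s2 oO OO' nyO.
  have [_ u0 cu _] := s1; have [_ u0' cu' _] := s2.
  have [K1 K10 hK1] := pole_far_bound bO' (@closed_closure _ Omega) nyO s1.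
  have [K2 K20 hK2] := pole_far_bound bO' (@closed_closure _ Omega) nyO s2.
  rewrite -[RHS](H u u' su hu _ su' hu' _); last 2 first.
  - by move=> x /GO' nOx; apply: u0 => -[].
  - by move=> x /GO' nOx; apply: u0' => -[].
  rewrite (_ : (fun x => if _ then _ else _) = fun x => f x * u x * u' x); last first.
    apply/funext => x; case: asboolP => Ox; first by rewrite fE.
    by rewrite fN // !mul0r.
  rewrite (@iintE _ (`|M| * K1 * K2) B) //.
  - exact: measurable_funM (measurable_funM mf (measurable_off_point cu)) (measurable_off_point cu').
  - move=> x; have [Ox|nOx] := pselect (Omega x); last by rewrite fN // !mul0r normr0 !mulr_ge0.
    have cx := subset_closure Ox; rewrite normrM; apply: ler_pM => //; last exact: hK2.
    by rewrite normrM; apply: ler_pM => //; exact: hK1.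
  - by move=> x xB; rewrite fN ?mul0r // => /bO; rewrite leNgt xB.
have dp0 : dead mu D f p0.
  apply: (dead_ball n2 mu_fin oO' chO' bO' mf fM f0 r20 _ dy); last by rewrite distrC.
  move=> x xy; apply: hr; rewrite -[x](subrK y) -addrA; apply: le_lt_trans (ler_normD _ _) _.
  by rewrite [r]splitr ltrD.
(* From the boundary point [p0] one more step enters [Omega], whose connectedness does the rest. *)
have [x1 Ox1 dx1] : exists2 x, Omega x & dead mu D f x.
  have rq : 0 < r * dead_ratio R n by rewrite mulr_gt0.
  have [x Ox xp] := closure_near (proj1 bp0) rq; exists x => //.
  by apply: (dead_ball n2 mu_fin oO' chO' bO' mf fM f0 r0 hr dp0).
have all_dead := dead_connected n2 mu_fin oO' chO' bO' mf fM f0 oO cO OO' (ex_intro2 _ _ x1 Ox1 dx1).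
apply: (nullS _ (null_loc (f := f) (U := Omega) _)); last by move=> x /all_dead [].
by move=> x [Ox gx]; split=> //; rewrite fE.
Qed.
End Real.

Lemma complexified_H_Gamma (R : realType) n (Omega Gamma : set 'rV[R]_n) (u : 'rV[R]_n -> R) : open Omega ->
  smooth_up_to_bdry Omega u -> harmonic_on Omega u -> (forall x, Gamma x -> u x = 0) ->
  H_Gamma Omega Gamma (fun x => (u x)%:C%C).
Proof.
move=> oO su hu u0.
have s0 : smooth_on setT (fun _ : 'rV[R]_n => 0 : R) by apply: smooth_cst; exact: openT.
have h0 : harmonic_on Omega (fun _ : 'rV[R]_n => 0 : R).
  by split; [exact: smooth_cst|move=> x Ox; exact: lap_cst].
split; first exact: su.
split; last by split; [exact: hu|split; [exact: h0|move=> x /u0 ->]].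
split; first exact: (proj1 h0).
split; first by apply: continuous_subspaceT => x; exact: cst_continuous.
move=> js; exists (iter_pd js (fun _ => 0)); split => //.
by apply: continuous_subspaceT => x; have [] := s0 js x I.
Qed.

Theorem theorem1p1 (R : realType) (n : nat) (Omega Gamma : set 'rV[R]_n)
  (f : 'rV[R]_n -> R[i]) :
  (2 <= n)%N ->
  open Omega -> connected Omega -> bounded_set Omega ->
  smooth_boundary Omega ->
  closed Gamma -> Gamma `<=` bdry Omega -> Gamma <> bdry Omega ->
  Linfty Omega f ->
  (forall u v, H_Gamma Omega Gamma u -> H_Gamma Omega Gamma v ->
     cint Omega (fun x => f x * u x * v x) = 0) ->
  leb_n [set x | Omega x /\ f x != 0] = 0%E.
Proof.
move=> n2 oO cO [B0 [_ bO0]] sO clG GO nG [bre [bim [M fM]]] H.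
pose B := B0 + 1; have bO x : Omega x -> `|x| <= B by apply: (bO0 B); rewrite ltrDl.
have [mu [eintE mu_fin iintE]] := lebesgue_rV R n.
(* For real-valued [u] and [v] the real and imaginary parts of the integral separate, so the real
   result applies to [ReF f] and to [ImF f] in turn. *)
have Hre : null mu [set x | Omega x /\ ReF f x != 0].
  apply: (real_products_dense n2 mu_fin iintE oO cO bO sO clG GO nG bre (fun x h => proj1 (fM x h))).
  move=> u v su hu u0 sv hv v0.
  have := H _ _ (complexified_H_Gamma oO su hu u0) (complexified_H_Gamma oO sv hv v0).
  move/(congr1 (@complex.Re R)) => /= E; rewrite -[RHS]E; congr iint; apply/funext => x.
  by case: asboolP => // Ox; rewrite /ReF; case: (f x) => a b /=; ring.
have Him : null mu [set x | Omega x /\ ImF f x != 0].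
  apply: (real_products_dense n2 mu_fin iintE oO cO bO sO clG GO nG bim (fun x h => proj2 (fM x h))).
  move=> u v su hu u0 sv hv v0.
  have := H _ _ (complexified_H_Gamma oO su hu u0) (complexified_H_Gamma oO sv hv v0).
  move/(congr1 (@complex.Im R)) => /= E; rewrite -[RHS]E; congr iint; apply/funext => x.
  by case: asboolP => // Ox; rewrite /ImF; case: (f x) => a b /=; ring.
set A := [set x | _].
have AE : A = [set x | Omega x /\ ReF f x != 0] `|` [set x | Omega x /\ ImF f x != 0].
  apply/seteqP; split => x; rewrite /A /= /ReF /ImF; case: (f x) => a b /=.
    by move=> [Ox]; rewrite eq_complex /= negb_and => /orP[h|h]; [left|right].
  by case=> -[Ox h]; split=> //; rewrite eq_complex /= negb_and h ?orbT.
have ms (g : 'rV[R]_n -> R) : borel_fun g -> measurable ([set x | Omega x /\ g x != 0] : set (BV R n)).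
  move=> bg; rewrite (_ : [set x | _] = Omega `&` (setT `&` (g : BV R n -> R) @^-1` (~` [set 0]))).
    apply: measurableI; first exact: measurable_open.
    by apply: borel_fun_measurable => //; apply: measurableC.
  by apply/seteqP; split => x /= [Ox]; [move=> /eqP|case=> _ /eqP].
have mA : measurable (A : set (BV R n)) by rewrite AE; apply: measurableU; exact: ms.
have nA : null mu A by rewrite AE; exact: negligibleU.
rewrite /leb_n eintE; first by rewrite integral_indic // setIT; apply/negligibleP.
- by apply/measurable_EFinP; exact: measurable_indic.
- by move=> x; rewrite lee_fin indicE.
Qed.
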